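(* Assume we are given read-only random access to a string $S$ of length $m$ and streaming access to a string $T$ of length $n\ge m$, both over an integer alphabet of size $\sigma$. For all $\tau\in[\sqrt m\log m(\log\log m)^3\mathinner{.\,.} O(m/\log^2 m)]$, there is an algorithm that reports all $T$-maximal common substrings of $S$ and $T$ using $O(\tau)$ space and $O(nm/\tau\cdot\log\log\sigma)$ time.
   Context: A fragment $T[t\mathinner{.\,.} t']$ is a $T$-maximal common substring of $S$ and $T$ if it occurs in $S$ and neither $T[t-1\mathinner{.\,.} t']$ (when $t>1$) nor $T[t\mathinner{.\,.} t'+1]$ (when $t'<n$) occurs in $S$. Streaming access means the letters of $T$ arrive one by one and can only be read in that order; the space bound counts all space used except for the read-only string $S$. The alphabet size is polynomially bounded in the input length; word RAM model. *)

(* Defs.v *)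
From Stdlib Require Import Reals List Arith.
Import ListNotations.

(* Letters are natural numbers; positions in fragments are 1-based. *)
Definition fragment (T : list nat) (i j : nat) : list nat :=
  firstn (j - i + 1) (skipn (i - 1) T).

Definition occurs (u s : list nat) : Prop :=
  exists x y : list nat, s = x ++ u ++ y.

Definition maximal_common_substring (s T : list nat) (i j : nat) : Prop :=
  1 <= i /\ i <= j /\ j <= length T /\
  occurs (fragment T i j) s /\
  (1 < i -> ~ occurs (fragment T (i - 1) j) s) /\
  (j < length T -> ~ occurs (fragment T i (j + 1)) s).

(* Word RAM with a read-only string, a one-way input stream and a write-only
   output.  All operations are unit-cost, on [w]-bit words.  Operands are always [< 2 ^ w], and
   results are reduced modulo [2 ^ w] when they are stored. *)
Inductive binop : Type :=
  | OAdd | OSub | OMul | ODiv | OMod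
  | OAnd | OOr | OXor | OShl | OShr
  | OLt | OEq.

Definition eval_binop (w : nat) (o : binop) (x y : nat) : nat :=
  match o with
  | OAdd => x + y
  | OSub => x + (2 ^ w - y)
  | OMul => x * y
  | ODiv => x / y
  | OMod => x mod y
  | OAnd => Nat.land x y
  | OOr => Nat.lor x y
  | OXor => Nat.lxor x y
  | OShl => Nat.shiftl x y
  | OShr => Nat.shiftr x y
  | OLt => if x <? y then 1 else 0
  | OEq => if x =? y then 1 else 0
  end.

(* Operands [d], [a], [b] are addresses of memory cells M[d], M[a], M[b]. *)
Inductive instr : Type :=
  | IConst (d v : nat)                 (* M[d] := v *)
  | IOp (o : binop) (d a b : nat)      (* M[d] := M[a] o M[b] *)
  | ILoad (d a : nat)                  (* M[d] := M[M[a]] *)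
  | IStore (a b : nat)                 (* M[M[a]] := M[b] *)
  | IRead (d a : nat)                  (* M[d] := letter of the read-only string
                                          at 0-based position M[a] *)
  | INext (d : nat)                    (* M[d] := next letter of the stream *)
  | IReport (a b : nat)                (* output the pair (M[a], M[b]) *)
  | IJz (a l : nat)                    (* if M[a] = 0, go to instruction l *)
  | IHalt.

Definition program : Type := list instr.

(* The whole read/write storage is [mem], a list of fixed length. *)
Record config : Type := Config {
  pc : nat;
  mem : list nat;
  stream : list nat;
  reports : list (nat * nat)   (* most recent first *)
}.

Definition write (w a v : nat) (M : list nat) : option (list nat) :=
  if a <? length M
  then Some (firstn a M ++ (v mod 2 ^ w) :: skipn (a + 1) M)
  else None.

Definition bind {A B : Type} (x : option A) (f : A -> option B) : option B :=
  match x with Some a => f a | None => None end.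

Definition assign (w a v : nat) (c : config) : option config :=
  bind (write w a v (mem c)) (fun M =>
    Some (Config (pc c + 1) M (stream c) (reports c))).

(* [None] means that there is no next configuration.  This happens at [IHalt],
   but also on an access outside of the memory or of the string [s], and on
   reading past the end of the stream; only the former counts as termination
   in [runs] below. *)
Definition exec (w : nat) (s : list nat) (i : instr) (c : config)
    : option config :=
  let get a := nth_error (mem c) a in
  match i with
  | IConst d v => assign w d v c
  | IOp o d a b =>
      bind (get a) (fun x => bind (get b) (fun y =>
        assign w d (eval_binop w o x y) c))
  | ILoad d a =>
      bind (get a) (fun p => bind (get p) (fun x => assign w d x c))
  | IStore a b =>
      bind (get a) (fun p => bind (get b) (fun x => assign w p x c))
  | IRead d a =>
      bind (get a) (fun p => bind (nth_error s p) (fun x => assign w d x c))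
  | INext d =>
      match stream c with
      | [] => None
      | x :: r => assign w d x (Config (pc c) (mem c) r (reports c))
      end
  | IReport a b =>
      bind (get a) (fun x => bind (get b) (fun y =>
        Some (Config (pc c + 1) (mem c) (stream c) ((x, y) :: reports c))))
  | IJz a l =>
      bind (get a) (fun x =>
        Some (Config (if x =? 0 then l else pc c + 1)
                     (mem c) (stream c) (reports c)))
  | IHalt => None
  end.

Definition step (P : program) (w : nat) (s : list nat) (c : config)
    : option config :=
  bind (nth_error P (pc c)) (fun i => exec w s i c).

Fixpoint steps (P : program) (w : nat) (s : list nat) (t : nat) (c : config)
    : option config :=
  match t with
  | 0 => Some c
  | Datatypes.S t' => bind (step P w s c) (steps P w s t')
  end.

(* The parameters [args] occupy the first cells, the other cells are zero. *)
Definition init (w space : nat) (args T : list nat) : config :=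
  Config 0
    (map (fun v => v mod 2 ^ w) args ++ repeat 0 (space - length args)) T [].

(* On word size [w], with random access to [s] and streaming access to [T],
   [P] halts after [time] steps having reported the pairs [out], and all
   addresses that it accesses are below [space].  Bounding the addresses,
   rather than the number of distinct cells touched, prevents a sparse use of
   a large address space from passing for a small space usage. *)
Definition runs (P : program) (w : nat) (s T args : list nat)
    (space time : nat) (out : list (nat * nat)) : Prop :=
  length args <= space /\
  exists c : config,
    steps P w s time (init w space args T) = Some c /\
    nth_error P (pc c) = Some IHalt /\
    rev (reports c) = out.

Definition lg (x : R) : R := (ln x / ln 2)%R.

(* The logarithm inside an asymptotic bound, where it must not vanish or be
   undefined at small arguments. *)
Definition lg1 (x : R) : R := Rmax 1 (lg x).

(* Main.v *)
(* Let [g = tau] and let [ms j] be the length of the longest suffix of the prefix of [T] of length [j]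
   that occurs in [S].  The pair [(j - ms j + 1, j)] is to be reported iff [1 <= ms j] and either
   [j = n] or [ms (j + 1) <= ms j].  The stream is cut into blocks of [g] letters, and each block is
   processed in time [O(m)] up to a factor [O(log log sigma)].

   Matches that start at most [g] letters before the block lie in a window of [2 * g] letters of [T], and in
   one of the overlapping chunks of length [4 * g] that cover [S].  The window is compared with each chunk
   through a common suffix array, built in linear time by the difference cover algorithm, and longest
   common prefixes of neighbours.  Letters are first sorted by their residues modulo
   some [p = O(m^2 log sigma)] that separates the letters of [S], in radix [g + 1]: as [m <= 4 * g^2] this
   takes [O(1)] or [O(log log sigma)] passes.

   The other matches contain the [g] letters [Y] before the block.  If the period of [Y] exceeds [g / 2], it
   has [O(m / g)] occurrences in [S], all of which are extended letter by letter.  Otherwise the occurrences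
   form [O(m / g)] arithmetic progressions, and a match that ends in the run of [Y] has the length of the
   shorter of the two runs in [S] and in [T], unless these have the same length.  One representative per
   progression is kept during the run, and the occurrences whose run in [S] is as long as that in [T]
   are kept one by one. *)

Require Import Defs.
From Stdlib Require Import Reals List Arith Lia Bool FinFun Lra.
Import ListNotations.

(** The bound leaves O(m) time per block, hence O(m / g) per letter, which is the length that the
    lists of long matches may have. They fit in O(g) cells because the lower bound on [tau] gives
    [m <= 4 * g ^ 2]. Two occurrences at distance at most [g / 2] force a period of the [g] letters,
    whence the threshold; a periodic set of occurrences may have more than [m / g] elements and has
    to be compressed. Letters are compared by sorting, without a dictionary. The residues separate
    the letters of [S] only, and a letter of [T] is compared in full with the one candidate of its
    residue class. The modulus is searched for only when [sigma] exceeds a fixed power of [m]: then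
    [m ^ 8 < 2 * n] and exhaustive search is linear in [n]. Its existence rests on the growth of
    lcm(1..P). The algorithm is written in a structured language with a total semantics and a clock.
    A compiler to the word RAM, proved correct once, costs a constant factor, so that the
    algorithmic arguments deal neither with addresses nor with jumps. *)

Inductive aop := AAdd | ASub | AMul | ADiv | AMod.

(* Besides constants and operations: variable [x], cell [e] of array [k], letter [e] of the read-only string. *)
Inductive expr :=
  | EV (x : nat) | EC (v : nat) | EO (o : aop) (a b : expr)
  | EA (k : nat) (e : expr) | ES (e : expr).

Inductive bexp :=
  | BLt (a b : expr) | BEq (a b : expr) | BAnd (p q : bexp) | BNot (p : bexp).

(** A loop runs a number of times fixed on entry, so every command terminates and its semantics is a
    function. A while loop becomes a bounded repetition of a conditional; the number of rounds then
    comes from an amortised argument. *)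
Inductive cmd :=
  | CSkip | CSet (x : nat) (e : expr) | CSto (k : nat) (i e : expr)
  | CNext (x : nat) | COut (a b : expr)
  | CIf (b : bexp) (c1 c2 : cmd) | CRep (e : expr) (c : cmd) | CSeq (c1 c2 : cmd).

Record state := St {
  sc : nat -> nat; ar : nat -> nat -> nat;
  inp : nat; outp : list (nat * nat); tk : nat }.

Definition tick (s : state) : state :=
  St (sc s) (ar s) (inp s) (outp s) (tk s + 1).
Definition setsc (x v : nat) (s : state) : state :=
  St (fun y => if y =? x then v else sc s y) (ar s) (inp s) (outp s) (tk s).
Definition setar (k i v : nat) (s : state) : state :=
  St (sc s) (fun k' i' => if k' =? k then if i' =? i then v else ar s k i' else ar s k' i')
     (inp s) (outp s) (tk s).

Fixpoint iter {A} (n : nat) (f : A -> A) (x : A) : A :=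
  match n with 0 => x | S n' => f (iter n' f x) end.

(** Redirecting bad indices to 0 keeps the semantics total. Conjunctions are compiled without short
    circuit: an access guarded by a range test is evaluated even when the test fails, and must then
    be harmless. *)
Definition clip (b i : nat) : nat := if i <? b then i else 0.

(* Memory layout: variables, loop counters, temporaries, then [NA] interleaved arrays. *)
Definition VN := 80.
Definition HN := 10.
Definition T0 := VN + HN.
Definition V0 := T0 + 20.
Definition NA := 32.

Declare Scope expr_scope.
Declare Scope cmd_scope.
Delimit Scope expr_scope with e.
Delimit Scope cmd_scope with c.
Bind Scope expr_scope with expr.
Bind Scope expr_scope with bexp.
Bind Scope cmd_scope with cmd.
Arguments EV x%_nat.
Arguments EC v%_nat.
Arguments EA k%_nat e%_e.
Arguments ES e%_e.
Arguments CSet x%_nat e%_e.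
Arguments CSto k%_nat i%_e e%_e.
Arguments CIf b%_e c1%_c c2%_c.
Arguments CRep e%_e c%_c.

Notation "! x" := (EV x) (at level 2, x at level 1, format "! x") : expr_scope.
Notation "# x" := (EC x) (at level 2, x at level 1, format "# x") : expr_scope.
Notation "a + b" := (EO AAdd a b) : expr_scope.
Notation "a - b" := (EO ASub a b) : expr_scope.
Notation "a * b" := (EO AMul a b) : expr_scope.
Notation "a / b" := (EO ADiv a b) : expr_scope.
Notation "a %% b" := (EO AMod a b) (at level 40) : expr_scope.
Notation "k .[ e ]" := (EA k e) (at level 1, format "k .[ e ]") : expr_scope.
Notation "a <? b" := (BLt a b) (at level 70) : expr_scope.
Notation "a =? b" := (BEq a b) (at level 70) : expr_scope.
Notation "a && b" := (BAnd a b) : expr_scope.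
Notation "~~ a" := (BNot a) (at level 35, right associativity) : expr_scope.
Notation "x ::= e" := (CSet x e) (at level 75) : cmd_scope.
Notation "a ;; b" := (CSeq a b) (at level 81, right associativity) : cmd_scope.

Definition incr (x : nat) : cmd := CSet x (!x + #1)%e.
Definition For (x : nat) (e : expr) (c : cmd) : cmd := (x ::= #0 ;; CRep e (c ;; incr x))%c.

(** Write sets are computed from the syntax, so that frame conditions are proved by [eq_refl]. *)
Fixpoint writes (p : cmd -> bool) (c : cmd) : bool :=
  match c with
  | CIf _ c1 c2 | CSeq c1 c2 => writes p c1 || writes p c2
  | CRep _ c => writes p c
  | _ => p c
  end.
Definition wS (x : nat) : cmd -> bool :=
  writes (fun c => match c with CSet y _ => x =? y | CNext y => (x =? y) || (x =? 1) | _ => false end).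
Definition wA (k : nat) : cmd -> bool := writes (fun c => match c with CSto k' _ _ => k =? k' | _ => false end).
Definition wI : cmd -> bool := writes (fun c => match c with CNext _ => true | _ => false end).
Definition wO : cmd -> bool := writes (fun c => match c with COut _ _ => true | _ => false end).

(** Variables 0 to 3 are the arguments of the program; reading letters turns variable 1 from [n]
    into the number of letters left. Variable 4, which has no name here, holds the length of the
    arrays. *)
Notation vm := 0 (only parsing). Notation vrem := 1 (only parsing). Notation vsg := 2 (only parsing).
Notation vg := 3 (only parsing). Notation vn := 5 (only parsing). Notation vpm := 6 (only parsing).
Notation vt := 7 (only parsing). Notation vbeta := 8 (only parsing). Notation pl := 9 (only parsing).
Notation pk := 10 (only parsing). Notation i1 := 11 (only parsing). Notation x1 := 12 (only parsing).
Notation o1 := 13 (only parsing). Notation vN := 14 (only parsing). Notation va := 15 (only parsing).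
Notation vb := 16 (only parsing). Notation vnm := 17 (only parsing). Notation vcv := 18 (only parsing).
Notation v1 := 19 (only parsing). Notation i2 := 20 (only parsing). Notation vh := 21 (only parsing).
Notation voff := 22 (only parsing). Notation vL := 23 (only parsing). Notation vn1 := 24 (only parsing).
Notation vL2 := 25 (only parsing). Notation vno := 26 (only parsing). Notation vc0 := 27 (only parsing).
Notation vc1 := 28 (only parsing). Notation vc2 := 29 (only parsing). Notation x2 := 31 (only parsing).
Notation q2 := 32 (only parsing). Notation vk2 := 33 (only parsing). Notation a1 := 34 (only parsing).
Notation b1 := 35 (only parsing). Notation vii := 37 (only parsing). Notation vjj := 38 (only parsing).
Notation vtake := 39 (only parsing). Notation vlast := 40 (only parsing). Notation vkh := 41 (only parsing).
Notation vki := 42 (only parsing). Notation vs := 43 (only parsing). Notation vhl := 44 (only parsing).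
Notation vbl := 45 (only parsing). Notation vB := 46 (only parsing). Notation vD := 47 (only parsing).
Notation vkk := 48 (only parsing). Notation vfi := 49 (only parsing). Notation vp := 50 (only parsing).
Notation ve2 := 51 (only parsing). Notation vper := 52 (only parsing). Notation vrun := 53 (only parsing).
Notation ve := 54 (only parsing). Notation vnE := 55 (only parsing). Notation vnG := 56 (only parsing).
Notation vnE2 := 57 (only parsing). Notation vnG2 := 58 (only parsing). Notation vlq := 59 (only parsing).
Notation vll := 60 (only parsing). Notation vqq := 61 (only parsing). Notation vdd := 62 (only parsing).
Notation i3 := 63 (only parsing). Notation vms := 64 (only parsing). Notation vnms := 65 (only parsing).
Notation vc := 66 (only parsing). Notation i4 := 67 (only parsing). Notation vcap := 68 (only parsing).
Notation i5 := 69 (only parsing). Notation i6 := 70 (only parsing). Notation vpw := 71 (only parsing).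
Notation vfound := 72 (only parsing). Notation vok := 73 (only parsing). Notation vbits := 75 (only parsing).
 Notation aPA := 0 (only parsing). Notation aKEY := 1 (only parsing).
Notation aCNT := 2 (only parsing). Notation aPB := 3 (only parsing). Notation aX := 4 (only parsing).
Notation aRV := 5 (only parsing). Notation aLV := 6 (only parsing). Notation aOF := 7 (only parsing).
Notation aLN := 8 (only parsing). Notation aRK := 9 (only parsing). Notation aSS := 10 (only parsing).
Notation aSR := 11 (only parsing). Notation aNB := 12 (only parsing). Notation aSA := 13 (only parsing).
Notation aSH := 14 (only parsing). Notation aBUF := 15 (only parsing). Notation aFL := 16 (only parsing).
Notation aEQ := 17 (only parsing). Notation aEL := 18 (only parsing). Notation aGQ := 19 (only parsing).
Notation aGL := 20 (only parsing). Notation aEQ2 := 21 (only parsing). Notation aEL2 := 22 (only parsing).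
Notation aGQ2 := 23 (only parsing). Notation aGL2 := 24 (only parsing).

(** * Lexicographic order of suffixes *)

Fixpoint count (p : nat -> bool) (n : nat) : nat :=
  match n with 0 => 0 | S n' => count p n' + (if p n' then 1 else 0) end.

Lemma count_mono p n n' : n <= n' -> count p n <= count p n'.
Proof. induction 1; simpl; lia. Qed.

Lemma count_lt p n i : i < n -> p i = true -> count p i < count p n.
Proof.
  intros H Hp. pose proof (count_mono p (S i) n H) as H1. simpl in H1. rewrite Hp in H1. lia.
Qed.

Lemma count_split key c n :
  count (fun i => key i <? S c) n = count (fun i => key i <? c) n + count (fun i => key i =? c) n.
Proof.
  induction n; simpl; auto.
  destruct (Nat.ltb_spec (key n) (S c)), (Nat.ltb_spec (key n) c), (Nat.eqb_spec (key n) c); lia.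
Qed.

Lemma count_key_mono key c c' n :
  c <= c' -> count (fun i => key i <? c) n <= count (fun i => key i <? c') n.
Proof.
  induction n; simpl; auto. destruct (Nat.ltb_spec (key n) c), (Nat.ltb_spec (key n) c'); lia.
Qed.

Lemma count_zero p n : (forall i, i < n -> p i = false) -> count p n = 0.
Proof. induction n; intros H; simpl; auto. rewrite IHn, H by auto. reflexivity. Qed.

Lemma count_le p n : count p n <= n.
Proof. induction n; simpl; auto. destruct (p n); lia. Qed.

Lemma count_le_sum key c n :
  count (fun i => key i <? c) n + count (fun i => key i =? c) n <= n.
Proof. rewrite <- count_split. apply count_le. Qed.

Lemma inj_surj (f : nat -> nat) n :
  (forall i, i < n -> f i < n) -> (forall i j, i < n -> j < n -> f i = f j -> i = j) ->
  forall y, y < n -> exists x, x < n /\ f x = y.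
Proof.
  intros H1 H2 y Hy. assert (HB : bFun n f) by exact H1.
  assert (HI : bInjective n f) by (intros a b Ha Hb E; apply H2; auto).
  apply bInjective_bSurjective in HI; [|exact HB]. eauto.
Qed.

Definition eqn (f : nat -> nat) (i j h : nat) : Prop := forall x, x < h -> f (i + x) = f (j + x).
Definition lexlt (f : nat -> nat) (i j : nat) : Prop :=
  exists l, eqn f i j l /\ f (i + l) < f (j + l).

Lemma first_diff (g h : nat -> nat) n :
  (exists l, l < n /\ g l <> h l /\ forall x, x < l -> g x = h x) \/ (forall x, x < n -> g x = h x).
Proof.
  induction n as [|n [H|H]].
  - right. lia.
  - left. destruct H as (l & H1 & H2). exists l. split; [lia|assumption].
  - destruct (Nat.eq_dec (g n) (h n)) as [E|E].
    + right. intros x Hx. destruct (Nat.eq_dec x n) as [->|]; auto. apply H. lia.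
    + left. exists n. auto.
Qed.

Lemma lexlt_trans f i j k : lexlt f i j -> lexlt f j k -> lexlt f i k.
Proof.
  intros (l & E1 & L1) (l' & E2 & L2). destruct (Nat.lt_trichotomy l l') as [H|[H|H]].
  - exists l. split; [intros x Hx; rewrite E1, E2 by lia; reflexivity|]. rewrite <- E2 by lia. assumption.
  - subst l'. exists l. split; [intros x Hx; rewrite E1, E2 by lia; reflexivity|]. lia.
  - exists l'. split; [intros x Hx; rewrite E1, E2 by lia; reflexivity|]. rewrite E1 by lia. assumption.
Qed.

Lemma lexlt_irrefl f i : ~ lexlt f i i.
Proof. intros (l & _ & H). lia. Qed.

Lemma lexlt_asym f i j : lexlt f i j -> ~ lexlt f j i.
Proof. intros H H1. apply (lexlt_irrefl f i). eapply lexlt_trans; eauto. Qed.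

Lemma lexlt_head f i j : f i < f j -> lexlt f i j.
Proof.
  exists 0. split; [intros x Hx; lia|]. rewrite !Nat.add_0_r. assumption.
Qed.

Lemma lexlt_cons f i j : f i = f j -> lexlt f (i + 1) (j + 1) -> lexlt f i j.
Proof.
  intros E (l & E1 & L1). exists (l + 1). split.
  - intros [|x] Hx; [now rewrite !Nat.add_0_r|].
    replace (i + S x) with (i + 1 + x) by lia. replace (j + S x) with (j + 1 + x) by lia. apply E1. lia.
  - replace (i + (l + 1)) with (i + 1 + l) by lia. replace (j + (l + 1)) with (j + 1 + l) by lia. assumption.
Qed.

Lemma lexlt_tail f i j : f i = f j -> lexlt f i j -> lexlt f (i + 1) (j + 1).
Proof.
  intros E (l & E1 & L1). destruct l as [|l].
  - rewrite !Nat.add_0_r in L1. lia.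
  - exists l. split.
    + intros x Hx. replace (i + 1 + x) with (i + S x) by lia.
      replace (j + 1 + x) with (j + S x) by lia. apply E1. lia.
    + replace (i + 1 + l) with (i + S l) by lia. replace (j + 1 + l) with (j + S l) by lia. assumption.
Qed.

Lemma lexlt_ge f i j : lexlt f i j -> f i <= f j.
Proof.
  intros (l & E1 & L1). destruct l as [|l].
  - rewrite !Nat.add_0_r in L1. lia.
  - specialize (E1 0). rewrite !Nat.add_0_r in E1. lia.
Qed.

(** The suffixes that share a given prefix form an interval of the order. Hence the longest common
    prefix of a suffix with a set of marked suffixes is attained at the nearest marked one above or
    below it. *)
Lemma eqn_between f a b c h :
  lexlt f a b -> lexlt f b c -> eqn f a c h -> eqn f a b h /\ eqn f b c h.
Proof.
  intros (l & E1 & L1) (l' & E2 & L2) E. assert (H : h <= l).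
  { destruct (Nat.le_gt_cases h l) as [|C]; auto. destruct (Nat.le_gt_cases l l') as [D|D].
    - destruct (Nat.eq_dec l l') as [->|].
      + pose proof (E l' C). lia.
      + pose proof (E l C). pose proof (E2 l ltac:(lia)). lia.
    - pose proof (E l' ltac:(lia)). pose proof (E1 l' D). lia. }
  split; intros x Hx.
  - apply E1. lia.
  - rewrite <- E1 by lia. apply E. assumption.
Qed.

(** Strings are infinite words padded by zeros: the end acts as a letter smaller than all others,
    and no length enters the comparison of suffixes. *)
Definition str (f : nat -> nat) (N : nat) : Prop :=
  (forall i, i < N -> 0 < f i) /\ (forall i, N <= i -> f i = 0).

(** Two distinct suffixes reach the padding at different offsets, where a zero meets a positive
    letter. *)
Lemma lexlt_total f N i j : str f N -> i <> j -> i <= N -> j <= N -> lexlt f i j \/ lexlt f j i.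
Proof.
  intros [Hp H0] Hij Hi Hj. destruct (first_diff (fun x => f (i + x)) (fun x => f (j + x)) (N + 1))
    as [(l & _ & Hd & He)|He].
  - destruct (Nat.lt_trichotomy (f (i + l)) (f (j + l))) as [C|[C|C]]; [left|lia|right];
      exists l; split; auto. intros x Hx. symmetry. apply He. assumption.
  - destruct (Nat.lt_trichotomy i j) as [C|[C|C]]; [|lia|].
    + specialize (He (N - j) ltac:(lia)).
      rewrite (H0 (j + (N - j))) in He by lia. pose proof (Hp (i + (N - j)) ltac:(lia)). lia.
    + specialize (He (N - i) ltac:(lia)).
      rewrite (H0 (i + (N - i))) in He by lia. pose proof (Hp (j + (N - i)) ltac:(lia)). lia.
Qed.

Lemma lexlt_lt f N i j : str f N -> i < N -> j < N -> i <> j -> ~ lexlt f j i -> lexlt f i j.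
Proof.
  intros HS Hi Hj Hij H. destruct (lexlt_total f N i j HS Hij) as [|]; auto; try lia. contradiction.
Qed.

(** * Reduction of suffix sorting to the positions not divisible by 3 *)

Definition tlt (f : nat -> nat) (i j : nat) : Prop :=
  f i < f j \/ f i = f j /\
    (f (i + 1) < f (j + 1) \/ f (i + 1) = f (j + 1) /\ f (i + 2) < f (j + 2)).

(* Indices of the reduced string: first the positions congruent to 1 modulo 3 (including
   position [N] when it is one of them, so that the first half ends with a 0), then those
   congruent to 2. *)
Definition spos (n1 x : nat) : nat := if x <? n1 then 3 * x + 1 else 3 * (x - n1) + 2.

Lemma mod3 p : p mod 3 = 0 \/ p mod 3 = 1 \/ p mod 3 = 2.
Proof. pose proof (Nat.mod_upper_bound p 3). lia. Qed.

Lemma mod3_add p d : (p + d) mod 3 = (p mod 3 + d) mod 3.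
Proof. now rewrite Nat.Div0.add_mod_idemp_l. Qed.

Section Reduction.
Variables (f f' : nat -> nat) (N : nat).
Hypothesis Hf : str f N.
Let n1 := (N + 2) / 3.
Let L2 := n1 + N / 3.
Let pos := spos n1.
Hypothesis Hf' : str f' L2.
Hypothesis Hname : forall x y, x < L2 -> y < L2 -> (f' x < f' y <-> tlt f (pos x) (pos y)).

Lemma div3 : exists a r, N = 3 * a + r /\ r < 3 /\ N / 3 = a /\ n1 = a + (if r =? 0 then 0 else 1).
Proof.
  exists (N / 3), (N mod 3). pose proof (Nat.div_mod_eq N 3).
  pose proof (Nat.mod_upper_bound N 3 ltac:(lia)). repeat split; auto. destruct (Nat.eqb_spec (N mod 3) 0).
  - symmetry. apply Nat.div_unique with 2; lia.
  - symmetry. apply Nat.div_unique with (N mod 3 - 1); lia.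
Qed.

Lemma spos_le x : x < L2 -> pos x <= N.
Proof.
  unfold L2, pos, spos. destruct div3 as (a & r & E & Hr & E1 & E2). destruct (Nat.eqb_spec r 0);
    match goal with |- context [?u <? ?v] => destruct (Nat.ltb_spec u v) end; lia.
Qed.

(** A step in the reduced string is a jump by three positions. The walk stays within its half; only
    if [N] is 2 modulo 3 can the second half be left exactly at [N], which is then not sampled. *)
Lemma spos_shift x q : x < L2 -> pos x + 3 * q <= N ->
  (x + q < L2 /\ pos (x + q) = pos x + 3 * q) \/ (x + q = L2 /\ pos x + 3 * q = N).
Proof.
  unfold L2, pos, spos. destruct div3 as (a & r & E & Hr & E1 & E2). destruct (Nat.eqb_spec r 0);
    repeat match goal with |- context [?u <? ?v] => destruct (Nat.ltb_spec u v) end;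
    repeat match type of H1 with context [?u <? ?v] => destruct (Nat.ltb_spec u v) end;
    lia.
Qed.

Lemma spos_shift_lt x q : x < L2 -> pos x + 3 * q < N ->
  x + q < L2 /\ pos (x + q) = pos x + 3 * q.
Proof.
  unfold L2, pos, spos. destruct div3 as (a & r & E & Hr & E1 & E2). destruct (Nat.eqb_spec r 0);
    repeat match goal with |- context [?u <? ?v] => destruct (Nat.ltb_spec u v) end;
    repeat match type of H1 with context [?u <? ?v] => destruct (Nat.ltb_spec u v) end;
    lia.
Qed.

Lemma spos_inj x y : x < L2 -> y < L2 -> pos x = pos y -> x = y.
Proof.
  unfold pos, spos. destruct (Nat.ltb_spec x n1), (Nat.ltb_spec y n1); lia.
Qed.

(** The first difference, at offset [l], lies in triple number [l / 3]. The earlier triples are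
    equal and so are their names; the names of the triples at [l / 3] decide, or [x] has come to the
    end of the reduced string, where the padding 0 is below every name. *)
Lemma reduce_dir x y : x < L2 -> y < L2 -> lexlt f (pos x) (pos y) -> lexlt f' x y.
Proof.
  intros Hx Hy (l & E & Lt). set (i := pos x) in *. set (j := pos y) in *. pose proof (spos_le x Hx) as Bi.
  destruct Hf as [Hp H0]. destruct Hf' as [Hp' H0']. assert (J : j + l < N).
  { destruct (Nat.lt_ge_cases (j + l) N); auto. rewrite (H0 (j + l)) in Lt by assumption. lia. }
  assert (I : i + l <= N).
  { destruct (Nat.le_gt_cases (i + l) N) as [|C]; auto.
    specialize (E (N - i) ltac:(lia)). rewrite (H0 (i + (N - i))) in E by lia.
    pose proof (Hp (j + (N - i)) ltac:(lia)). lia. }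
  set (q := l / 3). assert (Hq : 3 * q <= l < 3 * q + 3).
  { pose proof (Nat.div_mod_eq l 3). pose proof (Nat.mod_upper_bound l 3). lia. }
  assert (Eq : forall x', x' < q -> f' (x + x') = f' (y + x')).
  { intros x' Hx'. destruct (spos_shift_lt x x' Hx) as [A1 A2]; [fold i; lia|].
    destruct (spos_shift_lt y x' Hy) as [B1 B2]; [fold j; lia|]. fold i in A2. fold j in B2.
    assert (T : forall d, d < 3 -> f (i + 3 * x' + d) = f (j + 3 * x' + d)).
    { intros d Hd. rewrite <- !Nat.add_assoc. apply E. lia. }
    pose proof (T 0 ltac:(lia)) as T0. pose proof (T 1 ltac:(lia)) as T1.
    pose proof (T 2 ltac:(lia)) as T2. rewrite !Nat.add_0_r in T0.
    pose proof (Hname _ _ A1 B1) as N1. pose proof (Hname _ _ B1 A1) as N2.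
    rewrite A2, B2 in N1, N2. unfold tlt in N1, N2. lia. }
  destruct (spos_shift_lt y q Hy) as [B1 B2]; [fold j; lia|]. exists q. split; [exact Eq|].
  destruct (spos_shift x q Hx) as [[A1 A2]|[A1 A2]]; [fold i; lia| |].
  - apply Hname; auto. rewrite A2, B2.
    assert (T : forall d, d < l - 3 * q -> f (i + 3 * q + d) = f (j + 3 * q + d)).
    { intros d Hd. rewrite <- !Nat.add_assoc. apply E. lia. }
    assert (T3 : f (i + 3 * q + (l - 3 * q)) < f (j + 3 * q + (l - 3 * q))).
    { rewrite <- !Nat.add_assoc. replace (3 * q + (l - 3 * q)) with l by lia. assumption. }
    destruct (l - 3 * q) as [|[|[|r]]] eqn:ER; [| | |lia].
    + rewrite !Nat.add_0_r in T3. left. assumption.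
    + right. pose proof (T 0 ltac:(lia)) as U. rewrite !Nat.add_0_r in U. split; [assumption|left; assumption].
    + right. pose proof (T 0 ltac:(lia)) as U. rewrite !Nat.add_0_r in U. split; [assumption|].
      right. split; [apply T; lia|assumption].
  - rewrite H0' by lia. apply Hp'. assumption.
Qed.

Lemma reduce_iff x y : x < L2 -> y < L2 -> (lexlt f' x y <-> lexlt f (pos x) (pos y)).
Proof.
  intros Hx Hy. split; [|apply reduce_dir; assumption]. intros H. destruct (Nat.eq_dec (pos x) (pos y)) as [E|E].
  - apply spos_inj in E; auto. subst. exfalso. eapply lexlt_irrefl; eauto.
  - destruct (lexlt_total f N (pos x) (pos y)) as [|C]; auto using spos_le.
    exfalso. apply reduce_dir in C; auto. eapply lexlt_asym; eauto.
Qed.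

(* [sr] is the rank of a sampled suffix, extended by 0 beyond the end of the string. *)
Variable sr : nat -> nat.
Hypothesis Hsr : forall p q, p mod 3 <> 0 -> q mod 3 <> 0 -> p < N \/ q < N ->
  (sr p < sr q <-> lexlt f p q).

(** Stripping one letter from both suffixes (two in [cmp2]) leaves two sampled suffixes, whose order
    is known from [sr]. *)
Lemma cmp1 i j : i mod 3 = 1 -> j mod 3 = 0 -> i < N -> j < N ->
  (f i < f j \/ f i = f j /\ sr (i + 1) < sr (j + 1) <-> lexlt f i j).
Proof.
  intros Mi Mj Hi Hj. assert (H1 : (i + 1) mod 3 = 2) by (rewrite mod3_add, Mi; reflexivity).
  assert (H2 : (j + 1) mod 3 = 1) by (rewrite mod3_add, Mj; reflexivity).
  assert (Hij : i <> j) by (intros ->; lia).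
  assert (HS : sr (i + 1) < sr (j + 1) <-> lexlt f (i + 1) (j + 1)) by (apply Hsr; lia). rewrite HS. split.
  - intros [H|[H H']]; [now apply lexlt_head|now apply lexlt_cons].
  - intros H. pose proof (lexlt_ge _ _ _ H). destruct (Nat.eq_dec (f i) (f j)) as [E|E]; [|lia].
    right. split; [assumption|]. now apply lexlt_tail.
Qed.

Lemma cmp2 i j : i mod 3 = 2 -> j mod 3 = 0 -> i < N -> j < N ->
  (f i < f j \/ f i = f j /\ (f (i + 1) < f (j + 1) \/ f (i + 1) = f (j + 1) /\
     sr (i + 2) < sr (j + 2)) <-> lexlt f i j).
Proof.
  intros Mi Mj Hi Hj. assert (H1 : (i + 2) mod 3 = 1) by (rewrite mod3_add, Mi; reflexivity).
  assert (H2 : (j + 2) mod 3 = 2) by (rewrite mod3_add, Mj; reflexivity).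
  assert (Hij : i <> j) by (intros ->; lia).
  assert (HS : f (i + 1) = f (j + 1) -> (sr (i + 2) < sr (j + 2) <-> lexlt f (i + 2) (j + 2))).
  { intros E. apply Hsr; try lia. destruct Hf as [Hp H0].
    destruct (Nat.lt_ge_cases (i + 1) N) as [C1|C1], (Nat.lt_ge_cases (j + 1) N) as [D1|D1];
      try lia.
    - pose proof (Hp _ C1). rewrite (H0 (j + 1)) in E by lia. lia.
    - pose proof (Hp _ D1). rewrite (H0 (i + 1)) in E by lia. lia. }
  assert (A1 : forall k, k + 2 = k + 1 + 1) by (intros; lia). split.
  - intros [H|[H [H'|[H' H'']]]]; [now apply lexlt_head| |].
    + apply lexlt_cons; auto. now apply lexlt_head.
    + apply HS in H''; auto. apply lexlt_cons; auto. apply lexlt_cons; auto. rewrite <- !A1. assumption.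
  - intros H. pose proof (lexlt_ge _ _ _ H). destruct (Nat.eq_dec (f i) (f j)) as [E|E]; [|lia].
    right. split; [assumption|]. apply lexlt_tail in H; auto.
    pose proof (lexlt_ge _ _ _ H). destruct (Nat.eq_dec (f (i + 1)) (f (j + 1))) as [E'|E']; [|lia].
    right. split; [assumption|]. apply HS; auto. rewrite !A1. now apply lexlt_tail.
Qed.

Lemma cmp0 i j : i mod 3 = 0 -> j mod 3 = 0 -> i < N -> j < N -> i <> j ->
  (f i < f j \/ f i = f j /\ sr (i + 1) < sr (j + 1) <-> lexlt f i j).
Proof.
  intros Mi Mj Hi Hj Hij. assert (H1 : (i + 1) mod 3 = 1) by (rewrite mod3_add, Mi; reflexivity).
  assert (H2 : (j + 1) mod 3 = 1) by (rewrite mod3_add, Mj; reflexivity).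
  assert (HS : sr (i + 1) < sr (j + 1) <-> lexlt f (i + 1) (j + 1)) by (apply Hsr; lia). rewrite HS. split.
  - intros [H|[H H']]; [now apply lexlt_head|now apply lexlt_cons].
  - intros H. pose proof (lexlt_ge _ _ _ H). destruct (Nat.eq_dec (f i) (f j)) as [E|E]; [|lia].
    right. split; [assumption|]. now apply lexlt_tail.
Qed.
End Reduction.

(** * Levels of the recursion and ranks of suffixes *)

Definition red (N : nat) : nat := (N + 2) / 3 + N / 3.

(** The third bound charges the time of a level to the decrease in length, which makes the total
    linear. The last one keeps the offset plus twelve times the length from growing when a level of
    [N] letters and three zeros is stored before the next. *)
Lemma red_bounds N : 2 <= N -> 1 <= red N /\ red N < N /\ N <= 4 * (N - red N) /\
  N + 3 + 12 * red N <= 12 * N.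
Proof.
  unfold red. destruct (div3 N) as (a & r & E & Hr & E1 & E2). destruct (Nat.eqb_spec r 0); lia.
Qed.

Definition teq (f : nat -> nat) i j := f i = f j /\ f (i + 1) = f (j + 1) /\ f (i + 2) = f (j + 2).

(** The recursion of the suffix sorting is unrolled: the strings of all levels lie one after the
    other in [aLV], level [k] at offset [aOF] with length [aLN]. *)
Definition lv (s : state) (k i : nat) : nat :=
  if i <? ar s aLN k then ar s aLV (ar s aOF k + i) else 0.

Definition level_ok (s : state) (k : nat) : Prop :=
  (forall i, i < ar s aLN k -> 1 <= ar s aLV (ar s aOF k + i) <= ar s aLN k + 3) /\
  (forall i, i < 3 -> ar s aLV (ar s aOF k + ar s aLN k + i) = 0).

Lemma level_str s k : level_ok s k -> str (lv s k) (ar s aLN k).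
Proof.
  intros [H1 H2]. split; intros i Hi; unfold lv; destruct (Nat.ltb_spec i (ar s aLN k)); try lia.
  pose proof (H1 i H). lia.
Qed.

Lemma level_raw s k i : level_ok s k -> i < ar s aLN k + 3 -> ar s aLV (ar s aOF k + i) = lv s k i.
Proof.
  intros [H1 H2] Hi. unfold lv. destruct (Nat.ltb_spec i (ar s aLN k)); [reflexivity|].
  replace (ar s aOF k + i) with (ar s aOF k + ar s aLN k + (i - ar s aLN k)) by lia. apply H2. lia.
Qed.

Definition names_ok (f f' : nat -> nat) (N : nat) : Prop :=
  forall x y, x < red N -> y < red N ->
    (f' x < f' y <-> tlt f (spos ((N + 2) / 3) x) (spos ((N + 2) / 3) y)).

Definition BOr (p q : bexp) : bexp := BNot (BAnd (BNot p) (BNot q)).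

Lemma inj_card (f : nat -> nat) a b :
  (forall i, i < a -> f i < b) -> (forall i j, i < a -> j < a -> f i = f j -> i = j) -> a <= b.
Proof.
  intros H1 H2. rewrite <- (length_seq a 0), <- (length_seq b 0), <- (length_map f). apply NoDup_incl_length.
  - apply NoDup_map_NoDup_ForallPairs; [|apply seq_NoDup].
    intros x y Hx Hy E. apply in_seq in Hx, Hy. apply H2; auto; lia.
  - intros y Hy. apply in_map_iff in Hy as (x & <- & Hx). apply in_seq in Hx. apply in_seq. specialize (H1 x). lia.
Qed.

Lemma surj_card (f : nat -> nat) a b :
  (forall y, y < b -> exists x, x < a /\ f x = y) -> b <= a.
Proof.
  intros H. rewrite <- (length_seq b 0), <- (length_seq a 0), <- (length_map f (seq 0 a)).
  apply NoDup_incl_length; [apply seq_NoDup|].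
  intros y Hy. apply in_seq in Hy. destruct (H y) as (x & Hx & E); [lia|].
  apply in_map_iff. exists x. split; [assumption|]. apply in_seq. lia.
Qed.

(** As the order is total, the two clauses make [rk] a bijection onto the range from 1 to [N] (see
    [ranks_inj] and [ranks_surj]). *)
Definition ranks (f : nat -> nat) (N : nat) (rk : nat -> nat) : Prop :=
  (forall i, i < N -> 1 <= rk i <= N) /\
  (forall i j, i < N -> j < N -> lexlt f i j -> rk i < rk j).

Lemma ranks_inj f N rk i j : str f N -> ranks f N rk -> i < N -> j < N -> rk i = rk j -> i = j.
Proof.
  intros HS [H1 H2] Hi Hj E. destruct (Nat.eq_dec i j) as [|D]; auto.
  destruct (lexlt_total f N i j HS D) as [L|L]; try lia; apply H2 in L; auto; lia.
Qed.

Lemma ranks_iff f N rk i j : str f N -> ranks f N rk -> i < N -> j < N ->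
  (rk i < rk j <-> lexlt f i j).
Proof.
  intros HS HR Hi Hj. split; [|apply HR; assumption]. destruct (Nat.eq_dec i j) as [->|D]; [lia|].
  destruct (lexlt_total f N i j HS D) as [L|L]; try lia; auto. apply HR in L; auto. lia.
Qed.

Lemma ranks_surj f N rk r : str f N -> ranks f N rk -> 1 <= r <= N -> exists i, i < N /\ rk i = r.
Proof.
  intros HS HR Hr. destruct (inj_surj (fun i => rk i - 1) N) with (y := r - 1) as (x & Hx & E).
  - intros i Hi. destruct HR as [H1 _]. specialize (H1 i Hi). lia.
  - intros i j Hi Hj E. eapply ranks_inj; eauto.
    destruct HR as [H1 _]. pose proof (H1 i Hi). pose proof (H1 j Hj). lia.
  - lia.
  - exists x. destruct HR as [H1 _]. pose proof (H1 x Hx). lia.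
Qed.

(** Ranks of sampled suffixes come from the reduced string, and 0 stands beyond its end. The one
    delicate position is [N] itself, sampled if it is 1 modulo 3: its suffix is pure padding and
    ranks below all others, as a 0 would. *)
Lemma sample_rank f f' N rk sr :
  2 <= N -> str f N -> str f' (red N) -> names_ok f f' N -> ranks f' (red N) rk ->
  let n1 := (N + 2) / 3 in
  (forall x, x < red N -> sr (spos n1 x) = rk x) ->
  (forall p, (forall x, x < red N -> p <> spos n1 x) -> sr p = 0) ->
  forall p q, p mod 3 <> 0 -> q mod 3 <> 0 -> p < N \/ q < N -> (sr p < sr q <-> lexlt f p q).
Proof.
  intros H2 HS HS' HN HR n1 Hs1 Hs0.
  assert (HX : forall p, p mod 3 <> 0 -> p < N -> exists x, x < red N /\ p = spos n1 x).
  { intros p Mp Hp. unfold red, n1. destruct (div3 N) as (a & r & E & Hr & E1 & E2). rewrite E1, E2.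
    pose proof (Nat.div_mod_eq p 3). pose proof (Nat.mod_upper_bound p 3 ltac:(lia)).
    assert (D : p mod 3 = 1 \/ p mod 3 = 2) by lia. destruct D as [D|D]; destruct (Nat.eqb_spec r 0).
    - exists (p / 3). unfold spos. destruct (Nat.ltb_spec (p / 3) (a + 0)); lia.
    - exists (p / 3). unfold spos. destruct (Nat.ltb_spec (p / 3) (a + 1)); lia.
    - exists (a + 0 + p / 3). unfold spos. destruct (Nat.ltb_spec (a + 0 + p / 3) (a + 0)); [lia|]. lia.
    - exists (a + 1 + p / 3). unfold spos. destruct (Nat.ltb_spec (a + 1 + p / 3) (a + 1)); [lia|]. lia. }
  assert (HI : forall x y, x < red N -> y < red N ->
     (rk x < rk y <-> lexlt f (spos n1 x) (spos n1 y))).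
  { intros x y Hx Hy. rewrite (ranks_iff f' (red N) rk x y HS' HR Hx Hy). apply (reduce_iff f f' N HS HS'); auto. }
  assert (HZ : forall p q, p < N -> N <= q -> lexlt f q p /\ ~ lexlt f p q).
  { intros p q Hp Hq. destruct HS as [P Z].
    assert (lexlt f q p) by (apply lexlt_head; rewrite (Z q Hq); apply P; assumption).
    split; [assumption|]. apply lexlt_asym. assumption. }
  (* A position beyond the end with a positive rank can only be the sampled position [N]. *)
  assert (HD : forall q, N <= q -> forall x, x < red N -> spos n1 x < N -> sr q < rk x).
  { intros q Hq x Hx HxN. destruct HR as [R1 R2]. destruct (Nat.lt_ge_cases 0 (sr q)) as [C|C].
    - assert (exists y, y < red N /\ q = spos n1 y) as (y & Hy & ->).
      { destruct (Nat.eq_dec q N) as [->|].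
        - (* the only sampled position that is not smaller than N *)
          destruct (Nat.eq_dec (N mod 3) 1) as [M1|M1].
          + exists (N / 3). unfold red, n1, spos. destruct (div3 N) as (a & r & E & Hr & E1 & E2). rewrite E1, E2.
            assert (r = 1) by (rewrite E in M1; rewrite Nat.mul_comm, Nat.add_comm, Nat.Div0.mod_add in M1;
              rewrite Nat.mod_small in M1; lia).
            subst r. cbn [Nat.eqb]. destruct (Nat.ltb_spec a (a + 1)); lia.
          + rewrite Hs0 in C; [lia|]. intros y Hy E. unfold spos in E. destruct (Nat.ltb_spec y n1).
            * rewrite E in M1. rewrite Nat.add_comm, Nat.mul_comm, Nat.Div0.mod_add in M1. cbn in M1. lia.
            * unfold red in Hy. destruct (div3 N) as (a & r & E0 & Hr & E1 & E2). destruct (Nat.eqb_spec r 0); lia.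
        - rewrite Hs0 in C; [lia|]. intros y Hy E. pose proof (spos_le N y Hy). unfold n1 in E. lia. }
      rewrite Hs1 by assumption. apply HI; auto. apply HZ; auto.
    - specialize (R1 x Hx). lia. }
  intros p q Mp Mq Hpq. destruct (Nat.lt_ge_cases p N) as [Hp|Hp], (Nat.lt_ge_cases q N) as [Hq|Hq]; try lia.
  - destruct (HX p Mp Hp) as (x & Hx & ->). destruct (HX q Mq Hq) as (y & Hy & ->).
    rewrite !Hs1 by assumption. apply HI; assumption.
  - destruct (HZ p q Hp Hq) as [_ HN']. split; [|contradiction].
    destruct (HX p Mp Hp) as (x & Hx & ->). rewrite Hs1 by assumption. pose proof (HD q Hq x Hx Hp). lia.
  - destruct (HZ q p Hq Hp) as [HL _]. split; [auto|]. intros _.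
    destruct (HX q Mq Hq) as (y & Hy & ->). rewrite (Hs1 y) by assumption. apply HD; assumption.
Qed.

Lemma lexlt_ext f g i j : (forall z, f z = g z) -> lexlt f i j -> lexlt g i j.
Proof.
  intros E (l & El & Ll). exists l. split; [intros x Hx; rewrite <- !E; apply El; assumption|].
  rewrite <- !E. assumption.
Qed.

Lemma names_ok_ext f f' g g' N :
  (forall z, f z = g z) -> (forall z, f' z = g' z) -> names_ok f f' N -> names_ok g g' N.
Proof.
  intros E E' H x y Hx Hy. rewrite <- !E', (H x y Hx Hy). unfold tlt. rewrite !E. reflexivity.
Qed.

Lemma ranks_ext f g N rk rk' :
  (forall z, f z = g z) -> (forall z, rk z = rk' z) -> ranks f N rk -> ranks g N rk'.
Proof.
  intros E E' [H1 H2]. split.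
  - intros i Hi. rewrite <- E'. auto.
  - intros i j Hi Hj L. rewrite <- !E'. apply H2; auto. apply (lexlt_ext g f); auto.
Qed.

(** * Periods and common suffixes *)

(** The longest common suffix of the prefixes of lengths [q] and [j]. Matches are indexed by their
    ends throughout, since the stream extends them to the right. *)
Fixpoint lcs (f g : nat -> nat) (q j : nat) : nat :=
  match q, j with
  | S q', S j' => if f q' =? g j' then S (lcs f g q' j') else 0
  | _, _ => 0
  end.

Lemma lcs_spec f g q : forall j h,
  h <= lcs f g q j <-> h <= q /\ h <= j /\ forall x, x < h -> f (q - 1 - x) = g (j - 1 - x).
Proof.
  induction q as [|q IH]; intros j h.
  - simpl. split; [intros; repeat split; intros; lia|]. lia.
  - destruct j as [|j].
    + simpl. split; [intros; repeat split; intros; lia|]. lia.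
    + cbn [lcs]. destruct h as [|h].
      * repeat split; intros; lia.
      * destruct (Nat.eqb_spec (f q) (g j)) as [E|E].
        -- rewrite <- Nat.succ_le_mono, IH. split.
           ++ intros (H1 & H2 & H3). do 2 (split; [lia|]). intros x Hx. destruct x as [|x].
              ** replace (S q - 1 - 0) with q by lia. replace (S j - 1 - 0) with j by lia. assumption.
              ** replace (S q - 1 - S x) with (q - 1 - x) by lia.
                 replace (S j - 1 - S x) with (j - 1 - x) by lia. apply H3. lia.
           ++ intros (H1 & H2 & H3). do 2 (split; [lia|]). intros x Hx. specialize (H3 (S x) ltac:(lia)).
              replace (S q - 1 - S x) with (q - 1 - x) in H3 by lia.
              replace (S j - 1 - S x) with (j - 1 - x) in H3 by lia. assumption.
        -- split; [lia|]. intros (_ & _ & H3). exfalso. apply E. specialize (H3 0 ltac:(lia)).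
           replace (S q - 1 - 0) with q in H3 by lia. replace (S j - 1 - 0) with j in H3 by lia. assumption.
Qed.

Lemma lcs_le f g q j : lcs f g q j <= q /\ lcs f g q j <= j.
Proof. destruct (proj1 (lcs_spec f g q j (lcs f g q j)) (le_n _)) as (A & B & _). auto. Qed.

Lemma lcs_eq f g q j x : x < lcs f g q j -> f (q - 1 - x) = g (j - 1 - x).
Proof. apply (lcs_spec f g q j (lcs f g q j)); auto. Qed.

Definition maxl (f : nat -> nat) (i j l : nat) : Prop := eqn f i j l /\ f (i + l) <> f (j + l).

(** The last [h] letters before position [q] have period [p]; offsets count backwards from [q], as
    in [lcs]. *)
Definition isper (f : nat -> nat) (p q h : nat) : Prop :=
  h <= q /\ forall x, x + p < h -> f (q - 1 - x) = f (q - 1 - (x + p)).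

(* The length of the longest suffix of period [p] of the prefix of length [q]. *)
Definition lam (f : nat -> nat) (p q : nat) : nat := p + lcs f f q (q - p).

(** A word has period [p] iff it agrees with its own shift by [p], so runs are measured by common
    suffixes of the string with itself. *)
Lemma lam_spec f p q h : p <= q -> p <= h -> (h <= lam f p q <-> isper f p q h).
Proof.
  assert (E : h <= p + lcs f f q (q - p) <-> h - p <= lcs f f q (q - p)) by lia. rewrite E, lcs_spec. split.
  - intros (H1 & H2 & H3). split; [lia|]. intros x Hx. rewrite H3 by lia. f_equal. lia.
  - intros (H1 & H2). do 2 (split; [lia|]). intros x Hx. rewrite H2 by lia. f_equal. lia.
Qed.

Lemma lam_bounds f p q : p <= q -> p <= lam f p q <= q.
Proof.
  split; [unfold lam; lia|]. apply (lam_spec f p q (lam f p q)); auto. unfold lam. lia.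
Qed.

Lemma lam_per f p q x : p <= q -> x + p < lam f p q -> f (q - 1 - x) = f (q - 1 - (x + p)).
Proof.
  intros H Hx. destruct (proj1 (lam_spec f p q (lam f p q) H ltac:(unfold lam; lia)) (le_n _)) as [_ A]. auto.
Qed.

Lemma lam_step f p q : 1 <= p -> p <= q -> f q = f (q - p) -> lam f p (q + 1) = lam f p q + 1.
Proof.
  intros Hp Hq E. unfold lam. replace (q + 1) with (S q) by lia. replace (S q - p) with (S (q - p)) by lia.
  cbn [lcs]. rewrite E, Nat.eqb_refl. lia.
Qed.

(** Agreement on one period propagates as long as both runs last. If the runs have different
    lengths, the common suffix stops with the shorter one: one more common letter would continue the
    period there too. Equal runs may break with the same letter, so nothing can be said about them;
    such occurrences are kept one by one. *)
Lemma lcs_periodic f g q j p :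
  1 <= p -> p <= lcs f g q j ->
  Nat.min (lam f p q) (lam g p j) <= lcs f g q j /\
  (lam f p q <> lam g p j -> lcs f g q j = Nat.min (lam f p q) (lam g p j)).
Proof.
  intros Hp HL. pose proof (lcs_le f g q j) as [Lq Lj].
  pose proof (lam_bounds f p q ltac:(lia)) as Bq. pose proof (lam_bounds g p j ltac:(lia)) as Bj.
  set (l := lam f p q) in *. set (e := lam g p j) in *. assert (A : Nat.min l e <= lcs f g q j).
  { apply lcs_spec. do 2 (split; [lia|]). induction x as [x IH] using lt_wf_ind. intros Hx.
    destruct (Nat.lt_ge_cases x p) as [C|C]; [apply lcs_eq; lia|].
    pose proof (lam_per f p q (x - p) ltac:(lia) ltac:(fold l; lia)) as P1.
    pose proof (lam_per g p j (x - p) ltac:(lia) ltac:(fold e; lia)) as P2.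
    replace (x - p + p) with x in P1, P2 by lia. rewrite <- P1, <- P2. apply IH; lia. }
  split; [exact A|]. intros Hne. apply Nat.le_antisymm; [|exact A].
  apply Nat.nlt_ge. intros C. destruct (Nat.lt_ge_cases l e) as [D|D].
  - assert (X : l + 1 <= lam f p q).
    { apply lam_spec; [lia|lia|]. split; [lia|]. intros x Hx.
      rewrite (lcs_eq f g q j x), (lcs_eq f g q j (x + p)) by lia. apply lam_per; [lia|fold e; lia]. }
    lia.
  - assert (X : e + 1 <= lam g p j).
    { apply lam_spec; [lia|lia|]. split; [lia|]. intros x Hx.
      rewrite <- (lcs_eq f g q j x), <- (lcs_eq f g q j (x + p)) by lia. apply lam_per; [lia|fold l; lia]. }
    lia.
Qed.

(** * Least periods and the distances between occurrences *)

Definition minper (f : nat -> nat) (B g p : nat) : Prop :=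
  1 <= p <= g /\ isper f p B g /\ forall p', 1 <= p' < p -> ~ isper f p' B g.

Lemma minper_unique f B g p p' : minper f B g p -> minper f B g p' -> p = p'.
Proof.
  intros (H1 & H2 & H3) (H1' & H2' & H3'). destruct (Nat.lt_trichotomy p p') as [C|[C|C]]; auto; exfalso.
  - apply (H3' p); [lia|assumption].
  - apply (H3 p'); [lia|assumption].
Qed.

Section Occurrences.
Variables (sf tf : nat -> nat) (B g p : nat).
Hypothesis Hmin : minper tf B g p.
Notation occ q := (g <= lcs sf tf q B).

Lemma minper_gB : g <= B.
Proof. destruct Hmin as (_ & [H _] & _). assumption. Qed.

Lemma occ_eq q x : occ q -> x < g -> sf (q - 1 - x) = tf (B - 1 - x).
Proof. intros H Hx. apply lcs_eq. lia. Qed.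

Lemma occ_ge q : occ q -> g <= q.
Proof. pose proof (lcs_le sf tf q B). lia. Qed.

(** The distance [d] is a period of the word, so [p <= d]. If [p < d], there would be an occurrence
    at [q + p] in between: its first [g - p] letters lie in the occurrence at [q], its last [p]
    letters in the one at [q'], and the periods [p] and [d] identify them. As [2 * d <= g], both
    periods apply to those last letters. *)
Lemma occ_gap q q' : occ q -> occ q' -> q < q' -> (forall x, q < x < q' -> ~ occ x) ->
  2 * (q' - q) <= g -> q' = q + p.
Proof.
  intros H1 H2 Hlt Hno Hd. destruct Hmin as (Hp & [HgB HY] & Hpm).
  pose proof (occ_ge q H1). set (d := q' - q) in *. assert (Pd : isper tf d B g).
  { split; [assumption|]. intros x Hx. rewrite <- (occ_eq q' (x + d)), <- (occ_eq q x) by (auto; lia).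
    f_equal. lia. }
  destruct (Nat.lt_trichotomy p d) as [C|[C|C]].
  - exfalso. apply (Hno (q + p)); [lia|]. apply lcs_spec. do 2 (split; [lia|]).
    intros y Hy. destruct (Nat.lt_ge_cases y p) as [D|D].
    + replace (q + p - 1 - y) with (q' - 1 - (d - p + y)) by lia.
      rewrite (occ_eq q') by (auto; lia). rewrite (HY (d - p + y)) by lia.
      replace (d - p + y + p) with (y + d) by lia. symmetry. apply Pd. lia.
    + replace (q + p - 1 - y) with (q - 1 - (y - p)) by lia.
      rewrite (occ_eq q) by (auto; lia). rewrite (HY (y - p)) by lia. f_equal. lia.
  - lia.
  - exfalso. apply (Hpm d); [lia|assumption].
Qed.

(** Consecutive occurrences overlap in at least [p] letters, so they belong to one run of [S]. Along
    a chain only the first run length has to be measured. *)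
Lemma occ_chain q : 2 * p <= g -> occ q -> occ (q + p) -> lam sf p (q + p) = lam sf p q + p.
Proof.
  intros H2p H1 H2. destruct Hmin as (Hp & [HgB HY] & Hpm). pose proof (occ_ge q H1).
  pose proof (lam_bounds sf p q ltac:(lia)) as Bq. pose proof (lam_bounds sf p (q + p) ltac:(lia)) as Bq'.
  apply Nat.le_antisymm.
  - assert (X : lam sf p (q + p) - p <= lam sf p q \/ lam sf p (q + p) < 2 * p) by
     (destruct (Nat.lt_ge_cases (lam sf p (q + p)) (2 * p)); [right; assumption|left;
       apply lam_spec; [lia|lia|]; split; [lia|]; intros x Hx;
       pose proof (lam_per sf p (q + p) (x + p) ltac:(lia) ltac:(lia)) as P;
       replace (q + p - 1 - (x + p)) with (q - 1 - x) in P by lia;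
       replace (q + p - 1 - (x + p + p)) with (q - 1 - (x + p)) in P by lia; exact P]).
    lia.
  - apply lam_spec; [lia|lia|]. split; [lia|]. intros x Hx. destruct (Nat.lt_ge_cases x p) as [D|D].
    + rewrite (occ_eq (q + p) x), (occ_eq (q + p) (x + p)) by (auto; lia). apply HY. lia.
    + pose proof (lam_per sf p q (x - p) ltac:(lia) ltac:(lia)) as P.
      replace (q + p - 1 - x) with (q - 1 - (x - p)) by lia. rewrite P. f_equal. lia.
Qed.

(** A run of [g + p] letters would contain an occurrence one period earlier. Hence measuring the run
    at the head of a chain takes O(g) comparisons. *)
Lemma occ_first q : occ q -> (g + p <= q -> ~ occ (q - p)) -> lam sf p q < g + p.
Proof.
  intros H1 Hno. destruct Hmin as (Hp & [HgB HY] & Hpm). pose proof (occ_ge q H1).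
  destruct (Nat.lt_ge_cases (lam sf p q) (g + p)) as [|C]; auto. exfalso.
  pose proof (lam_bounds sf p q ltac:(lia)) as Bq.
  apply Hno; [lia|]. apply lcs_spec. do 2 (split; [lia|]). intros y Hy.
  rewrite <- (occ_eq q y) by (auto; lia). rewrite (lam_per sf p q y) by lia. f_equal. lia.
Qed.

Lemma occ_lam q : occ q -> g <= lam sf p q.
Proof.
  intros H1. destruct Hmin as (Hp & [HgB HY] & Hpm). pose proof (occ_ge q H1).
  apply lam_spec; [lia|lia|]. split; [lia|]. intros x Hx. rewrite !(occ_eq q) by (auto; lia). apply HY. assumption.
Qed.

Lemma text_lam : g <= lam tf p B.
Proof.
  destruct Hmin as (Hp & HY & Hpm). pose proof minper_gB. apply lam_spec; auto; lia.
Qed.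
End Occurrences.

Lemma per_iter (f : nat -> nat) p lo hi k : forall z,
  (forall x, lo + p <= x < hi -> f x = f (x - p)) -> lo <= z -> z + k * p < hi -> f (z + k * p) = f z.
Proof.
  induction k as [|k IH]; intros z H Hz Hk; [f_equal; lia|].
  cbn [Nat.mul] in *. rewrite H by lia. replace (z + (p + k * p) - p) with (z + k * p) by lia. apply IH; auto. lia.
Qed.

(** Inside a run of period [p], whether [f x = f (x - p')] depends only on [x] modulo [p]. *)
Lemma per_shift (f : nat -> nat) p p' lo hi x y :
  1 <= p -> p' < p -> lo + 2 * p <= hi ->
  (forall z, lo + p <= z < hi -> f z = f (z - p)) ->
  lo + p' <= x -> x < hi -> lo + p' <= y -> y < hi ->
  (exists k, x + k * p = y \/ y + k * p = x) -> f y = f (y - p') -> f x = f (x - p').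
Proof.
  intros Hp Hpp H2 Hper Hx1 Hx2 Hy1 Hy2 (k & [E|E]) H.
  - rewrite <- (per_iter f p lo hi k x) by (auto; lia). rewrite <- (per_iter f p lo hi k (x - p')) by (auto; lia).
    replace (x - p' + k * p) with (y - p') by lia. rewrite E. exact H.
  - rewrite <- E. rewrite (per_iter f p lo hi k y) by (auto; lia).
    replace (y + k * p - p') with (y - p' + k * p) by lia.
    rewrite (per_iter f p lo hi k (y - p')) by (auto; lia). exact H.
Qed.

Lemma window_rep p lo z : 1 <= p -> exists k y, lo <= y < lo + p /\ (z + k * p = y \/ y + k * p = z).
Proof.
  destruct (Nat.le_gt_cases lo z) as [C|C].
  - exists ((z - lo) / p), (lo + (z - lo) mod p).
    pose proof (Nat.div_mod_eq (z - lo) p). pose proof (Nat.mod_upper_bound (z - lo) p ltac:(lia)). nia.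
  - exists ((lo - z + p - 1) / p), (z + (lo - z + p - 1) / p * p).
    pose proof (Nat.div_mod_eq (lo - z + p - 1) p). pose proof (Nat.mod_upper_bound (lo - z + p - 1) p ltac:(lia)).
    split; [nia|]. left. reflexivity.
Qed.

(** A smaller period of the window before [B'] would hold on [p] consecutive positions, which meet
    every residue class modulo [p], and so on the whole run, including the window before [B]. The
    run therefore has one least period, wherever it is read. *)
Lemma minper_transfer (f : nat -> nat) B B' g p lo hi :
  2 * p <= g -> (forall z, lo + p <= z < hi -> f z = f (z - p)) ->
  lo <= B - g -> g <= B -> B <= hi -> lo <= B' - g -> g <= B' -> B' <= hi ->
  minper f B g p -> minper f B' g p.
Proof.
  intros H2 Hper H3 H4 H5 H6 H7 H8 (Hp & HY & Hmin). split; [assumption|]. split.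
  - split; [assumption|]. intros x Hx. rewrite Hper by lia. f_equal. lia.
  - intros p' Hp' [_ HP]. apply (Hmin p' Hp'). split; [assumption|]. intros x Hx.
    set (z := B - 1 - x). replace (B - 1 - (x + p')) with (z - p') by lia.
    destruct (window_rep p (B' - p) z ltac:(lia)) as (k & y & Hy & Hk).
    apply (per_shift f p p' lo hi z y); try lia; auto.
    + eauto.
    + specialize (HP (B' - 1 - y) ltac:(lia)).
      replace (B' - 1 - (B' - 1 - y)) with y in HP by lia. rewrite HP. f_equal. lia.
Qed.

Lemma minper_extend (f : nat -> nat) B B' g p : 2 * p <= g -> B <= B' ->
  (forall x, B <= x < B' -> f x = f (x - p)) -> minper f B g p -> minper f B' g p.
Proof.
  intros H2 HB HP Hmin. pose proof Hmin as (Hp & [HgB HY] & _).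
  apply (minper_transfer f B B' g p (B - g) B'); auto; try lia.
  intros z Hz. destruct (Nat.lt_ge_cases z B) as [C|C]; [|apply HP; lia].
  specialize (HY (B - 1 - z) ltac:(lia)). replace (B - 1 - (B - 1 - z)) with z in HY by lia.
  rewrite HY. f_equal. lia.
Qed.

Lemma lcs_stop f g q j : lcs f g q j < q -> lcs f g q j < j ->
  f (q - 1 - lcs f g q j) <> g (j - 1 - lcs f g q j).
Proof.
  intros H1 H2 E. assert (X : S (lcs f g q j) <= lcs f g q j); [|lia].
  apply lcs_spec. do 2 (split; [lia|]). intros x Hx.
  destruct (Nat.eq_dec x (lcs f g q j)) as [->|]; [exact E|]. apply lcs_eq. lia.
Qed.

Lemma lcs_S f g q j : f q = g j -> lcs f g (q + 1) (j + 1) = lcs f g q j + 1.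
Proof.
  intros E. replace (q + 1) with (S q) by lia. replace (j + 1) with (S j) by lia.
  cbn [lcs]. rewrite E, Nat.eqb_refl. lia.
Qed.

(** * Prefix matches and borders, after Knuth, Morris and Pratt *)

Definition mt (Y f : nat -> nat) (k i : nat) : Prop := k <= i /\ forall x, x < k -> Y (k - 1 - x) = f (i - 1 - x).
Definition brd (Y : nat -> nat) (k k' : nat) : Prop := k' < k /\ forall x, x < k' -> Y (k' - 1 - x) = Y (k - 1 - x).
Definition fail (Y : nat -> nat) (k kf : nat) : Prop := brd Y k kf /\ forall k', brd Y k k' -> k' <= kf.
Definition kmax (Y f : nat -> nat) (L k i : nat) : Prop :=
  k <= L /\ mt Y f k i /\ forall k', k < k' <= L -> ~ mt Y f k' i.
(** The invariant while a letter is being processed: longer candidates that match so far are known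
    not to be continued by [f i]. The full pattern is exempt because it has no next letter. *)
Definition kinv (Y f : nat -> nat) (L k i : nat) : Prop :=
  k <= L /\ mt Y f k i /\ forall k', k < k' < L -> mt Y f k' i -> Y k' <> f i.

Lemma kmax_kinv Y f L k i : kmax Y f L k i -> kinv Y f L k i.
Proof.
  intros (H1 & H2 & H3). do 2 (split; [assumption|]). intros k' Hk Hm. exfalso. apply (H3 k'); [lia|assumption].
Qed.

Lemma mt_pred Y f k i : mt Y f (k + 1) (i + 1) -> mt Y f k i /\ Y k = f i.
Proof.
  intros [H1 H2]. split.
  - split; [lia|]. intros x Hx. specialize (H2 (x + 1) ltac:(lia)).
    replace (k + 1 - 1 - (x + 1)) with (k - 1 - x) in H2 by lia.
    replace (i + 1 - 1 - (x + 1)) with (i - 1 - x) in H2 by lia. exact H2.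
  - specialize (H2 0 ltac:(lia)). replace (k + 1 - 1 - 0) with k in H2 by lia.
    replace (i + 1 - 1 - 0) with i in H2 by lia. exact H2.
Qed.

Lemma mt_succ Y f k i : mt Y f k i -> Y k = f i -> mt Y f (k + 1) (i + 1).
Proof.
  intros [H1 H2] E. split; [lia|]. intros x Hx. destruct x as [|x].
  - replace (k + 1 - 1 - 0) with k by lia. replace (i + 1 - 1 - 0) with i by lia. exact E.
  - replace (k + 1 - 1 - S x) with (k - 1 - x) by lia.
    replace (i + 1 - 1 - S x) with (i - 1 - x) by lia. apply H2. lia.
Qed.

Lemma step_match Y f L k i : kinv Y f L k i -> k < L -> Y k = f i -> kmax Y f L (k + 1) (i + 1).
Proof.
  intros (H1 & H2 & H3) Hk E. split; [lia|]. split; [apply mt_succ; assumption|].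
  intros k' Hk' Hm. replace k' with (k' - 1 + 1) in Hm by lia. apply mt_pred in Hm as [A B].
  apply (H3 (k' - 1)); auto. lia.
Qed.

Lemma step_zero Y f L i : kinv Y f L 0 i -> Y 0 <> f i -> kmax Y f L 0 (i + 1).
Proof.
  intros (H1 & H2 & H3) E. split; [lia|]. split; [split; intros; lia|].
  intros k' Hk' Hm. replace k' with (k' - 1 + 1) in Hm by lia. apply mt_pred in Hm as [A B].
  destruct (Nat.eq_dec (k' - 1) 0) as [Z|Z]; [rewrite Z in B; contradiction|]. apply (H3 (k' - 1)); auto. lia.
Qed.

Lemma step_fail Y f L k i kf : kinv Y f L k i -> (k < L -> Y k <> f i) -> fail Y k kf -> kinv Y f L kf i.
Proof.
  intros (H1 & [H2 H2'] & H3) E ([F1 F1'] & F2). split; [lia|]. split.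
  - split; [lia|]. intros x Hx. rewrite F1' by assumption. apply H2'. lia.
  - intros k' Hk' [Hm Hm']. destruct (Nat.lt_trichotomy k' k) as [C|[->|C]].
    + assert (B : brd Y k k'); [|specialize (F2 _ B); lia].
      split; [assumption|]. intros x Hx. rewrite Hm' by assumption. symmetry. apply H2'. lia.
    + lia.
    + apply H3; [lia|]. split; assumption.
Qed.

(** The failure function is the search of the pattern in itself, started one letter later so that
    the trivial match is excluded. *)
Lemma kmax_fail Y k i L : i + 1 <= L -> k <= i -> kmax Y (fun x => Y (S x)) L k i -> fail Y (i + 1) k.
Proof.
  intros HL Hk (H1 & [H2 H2'] & H3). split.
  - split; [lia|]. intros x Hx. rewrite H2' by assumption. f_equal. lia.
  - intros k' [B B']. destruct (Nat.le_gt_cases k' k) as [|C]; auto. exfalso. apply (H3 k'); [lia|].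
    split; [lia|]. intros x Hx. rewrite B' by assumption. f_equal. lia.
Qed.

(** A border of length [k] is a period [g - k], so the longest border gives the least period. *)
Lemma fail_minper (tf Y : nat -> nat) B g kf : 1 <= g <= B ->
  (forall x, x < g -> Y x = tf (B - g + x)) -> fail Y g kf -> minper tf B g (g - kf).
Proof.
  intros Hg HY ([F1 F1'] & F2). split; [lia|]. split.
  - split; [lia|]. intros x Hx. specialize (F1' x ltac:(lia)). rewrite !HY in F1' by lia.
    replace (B - 1 - x) with (B - g + (g - 1 - x)) by lia. rewrite <- F1'. f_equal. lia.
  - intros p' Hp' [_ HP]. assert (X : brd Y g (g - p')); [|specialize (F2 _ X); lia].
    split; [lia|]. intros x Hx. specialize (HP x ltac:(lia)). rewrite !HY by lia.
    replace (B - g + (g - 1 - x)) with (B - 1 - x) by lia. rewrite HP. f_equal. lia.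
Qed.

Lemma mt_lcs (tf Y f : nat -> nat) B g q : g <= B ->
  (forall x, x < g -> Y x = tf (B - g + x)) -> (mt Y f g q <-> g <= lcs f tf q B).
Proof.
  intros Hg HY. rewrite lcs_spec. split.
  - intros [H1 H2]. do 2 (split; [assumption|]). intros x Hx.
    rewrite <- H2 by assumption. rewrite HY by lia. f_equal. lia.
  - intros (H1 & _ & H2). split; [assumption|]. intros x Hx. rewrite HY by lia.
    rewrite H2 by assumption. f_equal. lia.
Qed.

Lemma lcs_pred f g q j : 0 < lcs f g q (j + 1) ->
  exists q0, q = q0 + 1 /\ f q0 = g j /\ lcs f g q (j + 1) = lcs f g q0 j + 1.
Proof.
  replace (j + 1) with (S j) in * by lia. destruct q as [|q]; cbn [lcs] in *; [lia|].
  destruct (Nat.eqb_spec (f q) (g j)) as [E|E]; [|lia]. exists q. repeat split; auto; lia.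
Qed.

Lemma lam_back f p q k : 1 <= p -> p <= q -> p <= k -> k + p <= lam f p q -> lam f p (q - p) = lam f p q - p.
Proof.
  intros Hp Hq Hk HL. pose proof (lam_bounds f p q Hq) as LB.
  pose proof (lam_bounds f p (q - p) ltac:(lia)) as LB'. assert (P1 : lam f p q - p <= lam f p (q - p)).
  { apply lam_spec; [lia|lia|]. split; [lia|]. intros x Hx. pose proof (lam_per f p q (x + p) Hq ltac:(lia)) as P.
    replace (q - p - 1 - x) with (q - 1 - (x + p)) by lia. rewrite P. f_equal. lia. }
  assert (P2 : lam f p (q - p) + p <= lam f p q).
  { apply lam_spec; [lia|lia|]. split; [lia|]. intros x Hx.
    destruct (Nat.lt_ge_cases (x + p) (lam f p q)) as [C|C]; [apply lam_per; lia|].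
    pose proof (lam_per f p (q - p) (x - p) ltac:(lia) ltac:(lia)) as P.
    replace (q - p - 1 - (x - p)) with (q - 1 - x) in P by lia. rewrite P. f_equal. lia. }
  lia.
Qed.

(** A window with the last [e] letters sees each match truncated to length [e]. *)
Lemma lcs_window f h h' q e j : e <= j -> (forall x, x < e -> h' x = h (j - e + x)) ->
  lcs f h' q e = Nat.min e (lcs f h q j).
Proof.
  intros He Hh. pose proof (lcs_le f h q j) as [L1 L2]. pose proof (lcs_le f h' q e) as [L3 L4].
  apply Nat.le_antisymm.
  - apply Nat.min_glb; [assumption|]. apply lcs_spec. split; [assumption|]. split; [lia|].
    intros x Hx. rewrite (lcs_eq f h' q e x Hx), Hh by lia. f_equal. lia.
  - apply lcs_spec. do 2 (split; [lia|]). intros x Hx.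
    rewrite (lcs_eq f h q j x) by lia. rewrite Hh by lia. f_equal. lia.
Qed.

(** * Matching statistics and the pairs to report *)

Section Max.
Variables (f h : nat -> nat) (m : nat).

Fixpoint maxto (k j : nat) : nat :=
  match k with 0 => lcs f h 0 j | S k' => Nat.max (maxto k' j) (lcs f h k j) end.
Definition msf (j : nat) : nat := maxto m j.

Lemma msf_ge j q : q <= m -> lcs f h q j <= msf j.
Proof.
  unfold msf. induction m as [|k IH]; intros H; cbn [maxto].
  - replace q with 0 by lia. lia.
  - destruct (Nat.eq_dec q (S k)) as [->|]; [lia|]. lia.
Qed.

Lemma msf_ex j : exists q, q <= m /\ msf j = lcs f h q j.
Proof.
  unfold msf. induction m as [|k (q & Hq & E)]; cbn [maxto].
  - eauto.
  - destruct (Nat.max_spec (maxto k j) (lcs f h (S k) j)) as [[_ ->]|[_ ->]].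
    + eauto. + eauto.
Qed.

Lemma msf_unique j v : (forall q, q <= m -> lcs f h q j <= v) -> (exists q, q <= m /\ v <= lcs f h q j) -> v = msf j.
Proof.
  intros H1 (q & Hq & H2). destruct (msf_ex j) as (q' & Hq' & E).
  pose proof (msf_ge j q Hq). specialize (H1 q' Hq'). lia.
Qed.

Lemma msf_le j : msf j <= j.
Proof. destruct (msf_ex j) as (q & _ & ->). apply lcs_le. Qed.

(** Whether a pair ending at [i] is reported depends on [msf (i + 1)], so with [j] letters read only
    the ends below [j] are decided. The most recent pair comes first, as on the machine. *)
Fixpoint outs (j : nat) : list (nat * nat) :=
  match j with
  | 0 => []
  | S i => if (0 <? msf i) && negb (msf i <? msf (i + 1)) then (i - msf i + 1, i) :: outs i else outs i
  end.
End Max.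

(** * A small modulus that separates given letters *)

Fixpoint bin (n k : nat) : nat :=
  match n, k with
  | _, 0 => 1
  | 0, S _ => 0
  | S n', S k' => bin n' k' + bin n' k
  end.

Lemma bin_0 n : bin n 0 = 1.
Proof. destruct n; reflexivity. Qed.

(** The absorption identity, stated at successors to avoid subtraction. *)
Lemma bin_mul n : forall k, S k * bin (S n) (S k) = S n * bin n k.
Proof.
  induction n as [|n IH]; intros k.
  - cbn. destruct k; lia.
  - destruct k as [|k].
    + specialize (IH 0). cbn [bin] in *. rewrite !bin_0 in *. nia.
    + pose proof (IH k) as A. pose proof (IH (S k)) as B.
      change (bin (S (S n)) (S (S k))) with (bin (S n) (S k) + bin (S n) (S (S k))).
      change (bin (S n) (S k)) with (bin n k + bin n (S k)) in *. nia.
Qed.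

Lemma bin_pos n : forall k, k <= n -> 1 <= bin n k.
Proof.
  induction n as [|n IH]; intros [|k] H; cbn [bin]; try lia. specialize (IH k ltac:(lia)). lia.
Qed.

Lemma bin_central k : 2 ^ k <= bin (2 * k) k.
Proof.
  induction k as [|k IH]; [reflexivity|]. replace (2 * S k) with (S (S (2 * k))) by lia. cbn [bin Nat.pow].
  destruct k as [|k]; [cbn; lia|]. lia.
Qed.

(* The identity of the Leibniz harmonic triangle: [1 / w = 1 / v - 1 / u] for
   [u = c * bin n c], [v = c * bin (n - 1) c] and [w = (c + 1) * bin n (c + 1)]. *)
Lemma bin_divides c : forall n x, 1 <= c <= n ->
  (forall i, 1 <= i <= n -> Nat.divide i x) -> Nat.divide (c * bin n c) x.
Proof.
  induction c as [|c IH]; [lia|]. intros n x Hc Hx. destruct n as [|n]; [lia|].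
  rewrite bin_mul. destruct c as [|c].
  - rewrite bin_0, Nat.mul_1_r. apply Hx. lia.
  - destruct (IH (S n) x ltac:(lia) Hx) as [b Hb].
    destruct (IH n x ltac:(lia)) as [a Ha]; [intros; apply Hx; lia|].
    rewrite bin_mul in Hb. set (U := bin n c) in *. set (V := bin n (S c)) in *.
    assert (HU : 1 <= U) by (apply bin_pos; lia).
    (* x = b (n+1) U = a (c+1) V, and (n+1) bin(n,c) = (c+1) bin(n+1,c+1) = (c+1) (U + V) *)
    pose proof (bin_mul n c) as E. cbn [bin] in E. exists (a - b). assert (EQ : U * ((a - b) * (S n * V)) = U * x).
    {
      rewrite Nat.mul_sub_distr_r. nia. }
    apply Nat.mul_cancel_l in EQ; lia.
Qed.

Fixpoint prodn (d : nat -> nat) (N : nat) : nat := match N with 0 => 1 | S k => prodn d k * d k end.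

Lemma prodn_divide d N i : i < N -> Nat.divide (d i) (prodn d N).
Proof.
  induction N as [|N IH]; [lia|]. intros H. cbn [prodn]. destruct (Nat.eq_dec i N) as [->|].
  - exists (prodn d N). reflexivity.
  - destruct (IH ltac:(lia)) as [z ->]. exists (z * d N). ring.
Qed.

Lemma prodn_bounds d N b : (forall i, i < N -> 1 <= d i <= 2 ^ b) -> 1 <= prodn d N <= 2 ^ (b * N).
Proof.
  induction N as [|N IH]; intros H; cbn [prodn].
  - rewrite Nat.mul_0_r. cbn. lia.
  - destruct (IH ltac:(intros; apply H; lia)) as [A B]. destruct (H N ltac:(lia)) as [C D].
    rewrite Nat.mul_succ_r, Nat.pow_add_r. split; [nia|]. apply Nat.mul_le_mono; assumption.
Qed.

Definition good (f : nat -> nat) (m p : nat) : Prop :=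
  forall x y, x < m -> y < m -> f x mod p = f y mod p -> f x = f y.

(** Of the two truncated differences one is 0, so their sum is the distance of [a] and [b]. *)
Lemma divide_diff a b p : p <> 0 -> a mod p = b mod p -> Nat.divide p ((a - b) + (b - a)).
Proof.
  pose proof (Nat.div_mod_eq a p) as A. pose proof (Nat.div_mod_eq b p) as B.
  exists ((a / p - b / p) + (b / p - a / p)). nia.
Qed.

(* Otherwise every [p] up to [P] divides a difference of letters, hence so does
   [lcm(1..P)] their product, which is too small for that. *)
Lemma good_modulus f m b : (forall i, i < m -> f i < 2 ^ b) ->
  exists p, 1 <= p <= 2 * (b * (m * m) + 1) /\ good f m p.
Proof.
  intros Hf. set (P := 2 * (b * (m * m) + 1)).
  (* A pair of positions [x], [y] is coded as [x * m + y], so that one index runs over all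
     differences. *)
  pose (bad := fun p => existsb (fun i => (f (i / m) mod p =? f (i mod m) mod p) && negb (f (i / m) =? f (i mod m))) (seq 0 (m * m))).
  assert (GB : forall p, bad p = false -> good f m p).
  { intros p Hb x y Hx Hy E. destruct (Nat.eq_dec (f x) (f y)) as [|C]; [assumption|exfalso].
    assert (X : bad p = true); [|congruence]. apply existsb_exists. exists (x * m + y).
    split; [apply in_seq; nia|]. replace ((x * m + y) / m) with x by (apply (Nat.div_unique _ m x y); lia).
    replace ((x * m + y) mod m) with y by (apply (Nat.mod_unique _ m x y); lia).
    apply andb_true_iff. split; [apply Nat.eqb_eq; assumption|]. apply negb_true_iff, Nat.eqb_neq. assumption. }
  destruct (forallb bad (seq 1 P)) eqn:E.
  - rewrite forallb_forall in E.
    pose (d := fun i => if f (i / m) =? f (i mod m) then 1 else (f (i / m) - f (i mod m)) + (f (i mod m) - f (i / m))).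
    assert (HD : forall i, 1 <= i <= P -> Nat.divide i (prodn d (m * m))).
    { intros p Hp. specialize (E p ltac:(apply in_seq; lia)). apply existsb_exists in E as (i & Hi & C).
      apply in_seq in Hi. apply andb_true_iff in C as [Ca Cb]. apply Nat.eqb_eq in Ca.
      apply Nat.divide_trans with (d i); [|apply prodn_divide; lia]. unfold d.
      destruct (f (i / m) =? f (i mod m)); [discriminate|]. apply divide_diff; [lia|assumption]. }
    assert (BD : 1 <= prodn d (m * m) <= 2 ^ (b * (m * m))).
    { apply prodn_bounds. intros i Hi. assert (X1 : i / m < m) by (apply Nat.Div0.div_lt_upper_bound; lia).
      pose proof (Hf _ X1). pose proof (Hf (i mod m) ltac:(apply Nat.mod_upper_bound; lia)). unfold d.
      destruct (Nat.eqb_spec (f (i / m)) (f (i mod m))); lia. }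
    set (k := b * (m * m) + 1) in *. pose proof (bin_divides k P (prodn d (m * m)) ltac:(lia) HD) as [z Hz].
    pose proof (bin_central k) as BC. fold P in BC.
    assert (2 ^ k = 2 * 2 ^ (b * (m * m))) by (unfold k; rewrite Nat.pow_add_r; cbn; lia).
    assert (BZ : 1 * bin P k <= z * k * bin P k) by (apply Nat.mul_le_mono_r; nia). lia.
  - assert (X : exists p, In p (seq 1 P) /\ bad p = false).
    { induction (seq 1 P) as [|a l IH]; [discriminate|]. cbn in E. destruct (bad a) eqn:B.
      - destruct (IH E) as (p & H1 & H2). exists p. split; [right|]; assumption.
      - exists a. split; [left; reflexivity|assumption]. }
    destruct X as (p & H1 & H2). apply in_seq in H1. exists p. split; [lia|]. apply GB. assumption.
Qed.

(** * Program logic *)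

Section Semantics.
Variables (M Q : nat) (Sl Tl : list nat).

Definition opsem (o : aop) (x y : nat) : nat :=
  match o with
  | AAdd => (x + y) mod M
  | ASub => (x + (M - y)) mod M
  | AMul => (x * y) mod M
  | ADiv => x / y
  | AMod => x mod y
  end.

Fixpoint eval (s : state) (e : expr) : nat :=
  match e with
  | EV x => sc s x
  | EC v => v
  | EO o a b => opsem o (eval s a) (eval s b)
  | EA k e => ar s k (clip Q (eval s e))
  | ES e => nth (clip (length Sl) (eval s e)) Sl 0
  end.

Fixpoint evalb (s : state) (b : bexp) : bool :=
  match b with
  | BLt a b => eval s a <? eval s b
  | BEq a b => eval s a =? eval s b
  | BAnd p q => evalb s p && evalb s q
  | BNot p => negb (evalb s p)
  end.

Fixpoint sem (c : cmd) (s : state) : state :=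
  match c with
  | CSkip => s
  | CSet x e => setsc x (eval s e) (tick s)
  | CSto k i e => setar k (clip Q (eval s i)) (eval s e) (tick s)
  (* Variable 1 counts the letters that remain in the stream. *)
  | CNext x => if sc s 1 =? 0 then tick s else
      setsc 1 (sc s 1 - 1) (setsc x (nth (inp s) Tl 0)
        (St (sc s) (ar s) (inp s + 1) (outp s) (tk s + 1)))
  | COut a b => St (sc s) (ar s) (inp s) ((eval s a, eval s b) :: outp s) (tk s + 1)
  | CIf b c1 c2 => if evalb s b then sem c1 (tick s) else sem c2 (tick s)
  | CRep e c => iter (eval s e) (fun s' => sem c (tick s')) (tick s)
  | CSeq c1 c2 => sem c2 (sem c1 s)
  end.

Lemma sc_tick s x : sc (tick s) x = sc s x. Proof. reflexivity. Qed.
Lemma ar_tick s k i : ar (tick s) k i = ar s k i. Proof. reflexivity. Qed.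

Lemma iter_inv {A} (P : A -> Prop) (f : A -> A) n x :
  P x -> (forall y, P y -> P (f y)) -> P (iter n f x).
Proof. induction n; simpl; auto. Qed.

Lemma frame {A} (f : state -> A) (p : cmd -> bool) : (forall s, f (tick s) = f s) ->
  (forall c s, match c with CIf _ _ _ | CSeq _ _ | CRep _ _ => False | _ => True end ->
     p c = false -> f (sem c s) = f s) ->
  forall c, writes p c = false -> forall s, f (sem c s) = f s.
Proof.
  intros HT HP. induction c as [|y e|k i e|y|a b|b c1 IH1 c2 IH2|e c IH|c1 IH1 c2 IH2]; cbn [writes]; intros H s;
    try apply orb_false_elim in H as [H1 H2]; try (apply HP; auto; fail); cbn [sem].
  - destruct (evalb s b); [rewrite IH1|rewrite IH2]; auto.
  - apply (iter_inv (fun s' => f s' = f s)); [apply HT|]. intros y Hy. rewrite IH, HT; auto.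
  - rewrite IH2, IH1; auto.
Qed.

(** Everything that, by its syntax, [c] cannot have changed. The tactic [frall] rewrites with it
    along a chain of states. *)
Definition agree (c : cmd) (s s' : state) : Prop :=
  (forall x, wS x c = false -> sc s' x = sc s x) /\
  (forall k i, wA k c = false -> ar s' k i = ar s k i) /\
  (wI c = false -> inp s' = inp s) /\ (wO c = false -> outp s' = outp s).

Lemma agree_sem c s : agree c s (sem c s).
Proof.
  split; [|split; [|split]]; intros; [apply (frame (fun s => sc s x) _) with (3 := H)|
    apply (frame (fun s => ar s k i) _) with (3 := H)|apply (frame inp _) with (3 := H)|
    apply (frame outp _) with (3 := H)]; try reflexivity; clear c s H; intros c s HP H;
    destruct c; try contradiction; try discriminate; cbn [sem]; try destruct (sc s 1 =? 0);
    try reflexivity; cbn [setsc setar sc ar]; try rewrite H; try reflexivity.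
  apply orb_false_elim in H as [-> ->]. reflexivity.
Qed.

Lemma agree_tick c s s' : agree c s s' -> agree c s (sem c (tick s')).
Proof.
  intros (A & B & C & D). destruct (agree_sem c (tick s')) as (A' & B' & C' & D').
  repeat split; intros; rewrite ?A', ?B', ?C', ?D' by assumption; cbn; auto.
Qed.

(** The frame condition is handed to the induction step, so that invariants mention only what the
    loop changes. *)
Lemma rep_ind (I : nat -> state -> Prop) e c s :
  I 0 (tick s) ->
  (forall k s', k < eval s e -> agree c s s' -> I k s' -> I (S k) (sem c (tick s'))) ->
  I (eval s e) (sem (CRep e c) s).
Proof.
  intros H0 HS. assert (H : forall k, k <= eval s e ->
    I k (iter k (fun s' => sem c (tick s')) (tick s)) /\
    agree c s (iter k (fun s' => sem c (tick s')) (tick s))).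
  { induction k; intros Hk; simpl.
    - split; [assumption|]. repeat split.
    - destruct IHk as [IH1 IH2]; [lia|]. split; [apply HS; auto; lia|]. apply agree_tick. assumption. }
  apply H. lia.
Qed.

(* Replaces the state after a command by a variable of which only the frame and the proved facts are
   known; otherwise the terms would grow with each command. *)
Tactic Notation "run" constr(r) "as" ident(s') ident(F) :=
  lazymatch r with sem ?c ?s => pose proof (agree_sem c s) as F; set (s' := r) in *; clearbody s' end.

Lemma sem_seq a b s : sem (CSeq a b) s = sem b (sem a s).
Proof. reflexivity. Qed.

Lemma sem_if b c1 c2 s :
  sem (CIf b c1 c2) s = if evalb s b then sem c1 (tick s) else sem c2 (tick s).
Proof. reflexivity. Qed.

Lemma incr_sem x s : sem (incr x) s = setsc x (opsem AAdd (sc s x) 1) (tick s).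
Proof. reflexivity. Qed.

Lemma for_ind (I : nat -> state -> Prop) x e c s N :
  eval (setsc x 0 (tick s)) e = N -> wS x c = false -> N < M ->
  I 0 (tick (setsc x 0 (tick s))) ->
  (forall k s', k < N -> agree (For x e c) s s' -> sc s' x = k -> I k s' ->
     I (S k) (sem (incr x) (sem c (tick s')))) ->
  I N (sem (For x e c) s) /\ sc (sem (For x e c) s) x = N.
Proof.
  intros HN Hx HM H0 HS. rewrite <- HN. apply (rep_ind (fun k s' => I k s' /\ sc s' x = k)).
  - cbn. now rewrite Nat.eqb_refl.
  - rewrite HN. intros k s' Hk (A & B & C & D) [J E]. rewrite sem_seq. split.
    + apply HS; auto. repeat split; auto. intros y Hy.
      apply orb_false_elim in Hy as [H1 H2]. rewrite A by exact H2. cbn. now rewrite H1.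
    + rewrite incr_sem. cbn [setsc sc]. rewrite Nat.eqb_refl, (proj1 (agree_sem c (tick s'))) by assumption.
      cbn [tick sc opsem]. rewrite E, Nat.mod_small; lia.
Qed.

Lemma opsem_add x y : x + y < M -> opsem AAdd x y = x + y.
Proof. intros. apply Nat.mod_small. assumption. Qed.
Lemma opsem_sub x y : y <= x -> x < M -> opsem ASub x y = x - y.
Proof.
  intros. simpl. replace (x + (M - y)) with (x - y + 1 * M) by lia.
  rewrite Nat.Div0.mod_add. apply Nat.mod_small. lia.
Qed.
Lemma opsem_mul x y : x * y < M -> opsem AMul x y = x * y.
Proof. intros. apply Nat.mod_small. assumption. Qed.
Lemma opsem_div x y : opsem ADiv x y = x / y. Proof. reflexivity. Qed.
Lemma opsem_mod x y : opsem AMod x y = x mod y. Proof. reflexivity. Qed.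
Lemma clip_lt b i : i < b -> clip b i = i.
Proof. unfold clip. destruct (Nat.ltb_spec i b); lia. Qed.

(** Operations are simplified innermost first, so that the bounds left to [lia] are free of machine
    arithmetic. *)
Ltac noop t := lazymatch t with context [opsem _ _ _] => fail | context [clip _ _] => fail | _ => idtac end.

Ltac ev1 :=
  match goal with
  | |- context [opsem AAdd ?x ?y] => noop x; noop y; rewrite (opsem_add x y) by lia
  | |- context [opsem ASub ?x ?y] => noop x; noop y; rewrite (opsem_sub x y) by lia
  | |- context [opsem AMul ?x ?y] => noop x; noop y; rewrite (opsem_mul x y) by lia
  | |- context [opsem ADiv ?x ?y] => noop x; noop y; rewrite (opsem_div x y)
  | |- context [opsem AMod ?x ?y] => noop x; noop y; rewrite (opsem_mod x y)
  | |- context [clip ?b ?i] => noop i; rewrite (clip_lt b i) by lia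
  end.
Ltac ev := repeat ev1.

Ltac xs := cbn [sem eval evalb sc ar inp outp tk setsc setar tick Nat.eqb For incr].

(* Replace the condition of the first conditional to be executed by a proved value. *)
Ltac cond_is v :=
  let H := fresh in rewrite ?sem_seq;
  match goal with |- context [sem (CIf ?b ?c ?c') ?s] =>
    lazymatch s with context [CIf _ _ _] => fail | _ =>
      assert (H : evalb s b = v); [|rewrite (sem_if b c c' s), H; clear H] end end.

Ltac frall := repeat match goal with
  | F : agree _ _ ?s1 |- context [sc ?s1 ?x] => rewrite ((proj1 F) x eq_refl)
  | F : agree _ _ ?s1 |- context [ar ?s1 ?k ?i] => rewrite ((proj1 (proj2 F)) k i eq_refl)
  end.

Hypothesis HM : 20 * Q + 100 < M.

(** * Linear-time suffix sorting *)

Definition pass_clear : cmd := For i1 (!pk + #1) (CSto aCNT (!i1) #0).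
Definition pass_count : cmd := For i1 (!pl)
   (x1 ::= aKEY.[aPA.[!i1]] + #1 ;; CSto aCNT (!x1) (aCNT.[!x1] + #1)).
Definition pass_sum : cmd := For i1 (!pk)
   (CSto aCNT (!i1 + #1) (aCNT.[!i1 + #1] + aCNT.[!i1])).
Definition pass_place : cmd := For i1 (!pl)
   (x1 ::= aPA.[!i1] ;; o1 ::= aCNT.[aKEY.[!x1]] ;; CSto aPB (!o1) (!x1) ;;
    CSto aCNT (aKEY.[!x1]) (!o1 + #1)).
Definition pass_copy : cmd := For i1 (!pl) (CSto aPA (!i1) (aPB.[!i1])).
Definition PASS : cmd :=
  (pass_clear ;; pass_count ;; pass_sum ;; pass_place ;; pass_copy)%c.

Lemma pass_clear_ok s K :
  sc s pk = K -> K < Q ->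
  (forall c, c < K + 1 -> ar (sem pass_clear s) aCNT c = 0) /\
  tk (sem pass_clear s) <= tk s + 4 * (K + 1) + 4.
Proof.
  intros HK HKQ. destruct (for_ind (fun k s' => (forall c, c < k -> ar s' aCNT c = 0) /\
      tk s' <= tk s + 4 * k + 4) i1 (!pk + #1)%e (CSto aCNT (!i1) #0)%c s (K + 1)) as [R _]; auto.
  - xs. rewrite HK. ev. reflexivity.
  - lia.
  - xs. split; [lia|lia].
  - intros k s' Hk F Hi [I1 I2]. xs. rewrite Hi. ev. split; [|lia].
    intros c Hc. destruct (Nat.eqb_spec c k); [reflexivity|]. apply I1. lia.
Qed.

Lemma pass_count_ok s L K (key : nat -> nat) :
  sc s pl = L -> L <= Q -> K < Q ->
  (forall r, r < L -> ar s aPA r < Q) ->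
  (forall r, ar s aKEY (ar s aPA r) = key r) -> (forall r, r < L -> key r < K) ->
  (forall c, c < K + 1 -> ar s aCNT c = 0) ->
  (forall c, c < K -> ar (sem pass_count s) aCNT (c + 1) = count (fun r => key r =? c) L) /\
  ar (sem pass_count s) aCNT 0 = 0 /\ tk (sem pass_count s) <= tk s + 6 * L + 4.
Proof.
  intros HL HLQ HKQ HPA Hkey HKEY H1.
  destruct (for_ind (fun k s' => (forall c, c < K -> ar s' aCNT (c + 1) = count (fun r => key r =? c) k) /\
      ar s' aCNT 0 = 0 /\ tk s' <= tk s + 6 * k + 4) i1 (!pl)%e
      (x1 ::= aKEY.[aPA.[!i1]] + #1 ;; CSto aCNT (!x1) (aCNT.[!x1] + #1))%c s L) as [R _]; auto.
  - lia.
  - xs. split; [|split; [|lia]].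
    + intros c Hc. apply H1. lia.
    + apply H1. lia.
  - intros k s' Hk F Hi (I1 & I2 & I3). xs. rewrite Hi. frall. pose proof (HPA k Hk). pose proof (HKEY k Hk).
    pose proof (count_le (fun r => key r =? key k) k).
    ev. rewrite !Hkey. ev. rewrite (I1 (key k)) by assumption. ev. split; [|split; [|lia]].
    + intros c Hc. cbn [count]. destruct (Nat.eqb_spec (c + 1) (key k + 1)).
      * replace c with (key k) by lia. rewrite Nat.eqb_refl. reflexivity.
      * rewrite I1 by assumption. destruct (Nat.eqb_spec (key k) c); lia.
    + destruct (key k + 1) eqn:E0; [lia|assumption].
Qed.

Lemma pass_sum_ok s L K key :
  sc s pk = K -> L <= Q -> K < Q ->
  (forall c, c < K -> ar s aCNT (c + 1) = count (fun r => key r =? c) L) -> ar s aCNT 0 = 0 ->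
  (forall c, c <= K -> ar (sem pass_sum s) aCNT c = count (fun r => key r <? c) L) /\
  tk (sem pass_sum s) <= tk s + 5 * K + 4.
Proof.
  intros HK HLQ HKQ H2 H20. destruct (for_ind (fun k s' =>
      (forall c, c <= k -> ar s' aCNT c = count (fun r => key r <? c) L) /\
      (forall c, k <= c < K -> ar s' aCNT (c + 1) = count (fun r => key r =? c) L) /\
      tk s' <= tk s + 5 * k + 4) i1 (!pk)%e
      (CSto aCNT (!i1 + #1) (aCNT.[!i1 + #1] + aCNT.[!i1]))%c s K) as [R _]; auto.
  - lia.
  - xs. split; [|split; [|lia]].
    + intros c Hc. replace c with 0 by lia. rewrite H20. symmetry. apply count_zero. reflexivity.
    + intros c Hc. apply H2. lia.
  - intros k s' Hk F Hi (I1 & I2 & I3). xs. rewrite Hi. ev.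
    rewrite (I1 k), (I2 k) by lia. pose proof (count_le_sum key k L). ev. split; [|split; [|lia]].
    + intros c Hc. destruct (Nat.eqb_spec c (k + 1)) as [->|].
      * replace (k + 1) with (S k) by lia. rewrite count_split. lia.
      * apply I1. lia.
    + intros c Hc. destruct (Nat.eqb_spec (c + 1) (k + 1)); [lia|]. apply I2. lia.
  - destruct R as (R1 & R2 & R3). split; assumption.
Qed.

(** At any time cell [c] of [aCNT] is the next free place for the key [c]. *)
Lemma pass_place_ok s L K (key : nat -> nat) pos :
  sc s pl = L -> L <= Q -> K < Q ->
  (forall r, r < L -> ar s aPA r < Q) ->
  (forall r, ar s aKEY (ar s aPA r) = key r) -> (forall r, r < L -> key r < K) ->
  (forall c, c <= K -> ar s aCNT c = count (fun r => key r <? c) L) ->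
  (forall r, pos r = count (fun i => key i <? key r) L + count (fun i => key i =? key r) r) ->
  (forall r, r < L -> pos r < L) ->
  (forall r r', r < L -> r' < L -> pos r = pos r' -> r = r') ->
  (forall r, r < L -> ar (sem pass_place s) aPB (pos r) = ar s aPA r) /\
  tk (sem pass_place s) <= tk s + 7 * L + 4.
Proof.
  intros HL HLQ HKQ HPA Hkey HKEY H3 Epos Hpos Hinj. destruct (for_ind (fun k s' =>
      (forall r, r < k -> ar s' aPB (pos r) = ar s aPA r) /\
      (forall c, c < K -> ar s' aCNT c = count (fun r => key r <? c) L + count (fun r => key r =? c) k) /\
      tk s' <= tk s + 7 * k + 4) i1 (!pl)%e
      (x1 ::= aPA.[!i1] ;; o1 ::= aCNT.[aKEY.[!x1]] ;; CSto aPB (!o1) (!x1) ;;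
       CSto aCNT (aKEY.[!x1]) (!o1 + #1))%c s L) as [R _]; auto.
  - lia.
  - xs. split; [|split; [|lia]].
    + lia.
    + intros c Hc. simpl. rewrite H3 by lia. lia.
  - intros k s' Hk F Hi (I1 & I2 & I3). xs. rewrite Hi. frall. pose proof (HPA k Hk). pose proof (HKEY k Hk).
    ev. rewrite !Hkey. ev. rewrite (I2 (key k)), <- (Epos k) by assumption.
    pose proof (Hpos k Hk). ev. split; [|split; [|lia]].
    + intros r Hr. destruct (Nat.eqb_spec (pos r) (pos k)) as [E|E].
      * apply Hinj in E; [|lia|lia]. rewrite E. reflexivity.
      * apply I1. assert (r <> k) by (intros ->; lia). lia.
    + intros c Hc. cbn [count]. destruct (Nat.eqb_spec c (key k)) as [->|].
      * rewrite Nat.eqb_refl, Epos. lia.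
      * rewrite I2 by assumption. destruct (Nat.eqb_spec (key k) c); lia.
  - destruct R as (R1 & R2 & R3). split; assumption.
Qed.

Lemma pass_copy_ok s L :
  sc s pl = L -> L <= Q ->
  (forall r, r < L -> ar (sem pass_copy s) aPA r = ar s aPB r) /\
  tk (sem pass_copy s) <= tk s + 4 * L + 4.
Proof.
  intros HL HLQ. destruct (for_ind (fun k s' =>
      (forall r, r < k -> ar s' aPA r = ar s aPB r) /\
      tk s' <= tk s + 4 * k + 4) i1 (!pl)%e
      (CSto aPA (!i1) (aPB.[!i1]))%c s L) as [R _]; auto.
  - lia.
  - xs. split; [|lia]. intros; lia.
  - intros k s' Hk F Hi (I1 & I2). xs. rewrite Hi. frall. ev. split; [|lia].
    intros r Hr. destruct (Nat.eqb_spec r k) as [->|]; [reflexivity|]. apply I1. lia.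
Qed.

Lemma pass_ok s L K :
  sc s pl = L -> sc s pk = K -> L <= Q -> K < Q ->
  (forall r, r < L -> ar s aPA r < Q) ->
  (forall r, r < L -> ar s aKEY (ar s aPA r) < K) ->
  let s' := sem PASS s in
  exists pos, (forall r, r < L -> pos r < L /\ ar s' aPA (pos r) = ar s aPA r) /\
    (forall r r', r < L -> r' < L ->
       (ar s aKEY (ar s aPA r) < ar s aKEY (ar s aPA r') \/
        ar s aKEY (ar s aPA r) = ar s aKEY (ar s aPA r') /\ r < r') -> pos r < pos r') /\
    tk s' <= tk s + 30 * (L + K + 1).
Proof.
  intros HL HK HLQ HKQ HPA HKEY s'. pose (key := fun r => ar s aKEY (ar s aPA r)).
  assert (Ekey : forall r, ar s aKEY (ar s aPA r) = key r) by reflexivity.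
  (* The place in a stable sort: after all smaller keys and all equal keys that come earlier. *)
  pose (pos := fun r => count (fun i => key i <? key r) L + count (fun i => key i =? key r) r).
  assert (Epos : forall r, pos r = count (fun i => key i <? key r) L + count (fun i => key i =? key r) r)
    by reflexivity.
  assert (Hpos : forall r, r < L -> pos r < L).
  { intros r Hr. rewrite Epos. pose proof (count_le_sum key (key r) L).
    pose proof (count_lt (fun i => key i =? key r) L r Hr (Nat.eqb_refl _)). lia. }
  assert (Hord : forall r r', r < L -> r' < L ->
     (key r < key r' \/ key r = key r' /\ r < r') -> pos r < pos r').
  { intros r r' Hr Hr' [C|[C1 C2]]; rewrite !Epos.
    - pose proof (count_lt (fun i => key i =? key r) L r Hr (Nat.eqb_refl _)).
      pose proof (count_key_mono key (S (key r)) (key r') L C) as H0. rewrite count_split in H0. lia.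
    - rewrite C1. pose proof (count_lt (fun i => key i =? key r') r' r C2) as H0.
      cbn beta in H0. rewrite C1, Nat.eqb_refl in H0. lia. }
  assert (Hinj : forall r r', r < L -> r' < L -> pos r = pos r' -> r = r').
  { intros r r' Hr Hr' E. destruct (Nat.lt_trichotomy (key r) (key r')) as [D|[D|D]].
    - pose proof (Hord r r' Hr Hr' (or_introl D)). lia.
    - destruct (Nat.lt_trichotomy r r') as [C|[C|C]]; auto; exfalso.
      + pose proof (Hord r r' Hr Hr' (or_intror (conj D C))). lia.
      + pose proof (Hord r' r Hr' Hr (or_intror (conj (eq_sym D) C))). lia.
    - pose proof (Hord r' r Hr' Hr (or_introl D)). lia. }
  subst s'. unfold PASS. rewrite !sem_seq. destruct (pass_clear_ok s K HK HKQ) as [H1 T1].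
  run (sem pass_clear s) as s1 F1.
  destruct (pass_count_ok s1 L K key) as (H2 & H20 & T2); auto; try (intros; frall; auto).
  run (sem pass_count s1) as s2 F2.
  destruct (pass_sum_ok s2 L K key) as (H3 & T3); auto; try (intros; frall; auto).
  run (sem pass_sum s2) as s3 F3. destruct (pass_place_ok s3 L K key pos) as (H4 & T4); auto;
    try (intros; frall; auto).
  run (sem pass_place s3) as s4 F4. destruct (pass_copy_ok s4 L) as (H5 & T5); auto;
    try (frall; auto).
  exists pos. split; [|split].
  - split; [auto|]. rewrite H5 by auto. rewrite H4 by auto. frall. reflexivity.
  - intros r r'. rewrite !Ekey. apply Hord.
  - lia.
Qed.

(** [R] is the order reached by earlier passes; stability makes it the tie-breaker, so successive
    passes sort triples of letters, or the digits of a number. *)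
Lemma pass_sorts s L K (R : nat -> nat -> Prop) :
  sc s pl = L -> sc s pk = K -> L <= Q -> K < Q ->
  (forall r, r < L -> ar s aPA r < Q) ->
  (forall r, r < L -> ar s aKEY (ar s aPA r) < K) ->
  (forall r r', r < r' -> r' < L -> R (ar s aPA r) (ar s aPA r')) ->
  let s' := sem PASS s in
  (forall r r', r < r' -> r' < L ->
     let x := ar s' aPA r in let y := ar s' aPA r' in
     ar s aKEY x < ar s aKEY y \/ ar s aKEY x = ar s aKEY y /\ R x y) /\
  (forall r, r < L -> exists r', r' < L /\ ar s' aPA r = ar s aPA r') /\
  (forall r, r < L -> exists r', r' < L /\ ar s' aPA r' = ar s aPA r) /\
  tk s' <= tk s + 30 * (L + K + 1).
Proof.
  intros HL HK HLQ HKQ HPA HKEY HR s'. destruct (pass_ok s L K HL HK HLQ HKQ HPA HKEY) as (pos & H1 & H2 & HT).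
  fold s' in H1, HT. assert (Hinj : forall r r', r < L -> r' < L -> pos r = pos r' -> r = r').
  { intros r r' Hr Hr' E.
    destruct (Nat.lt_trichotomy (ar s aKEY (ar s aPA r)) (ar s aKEY (ar s aPA r'))) as [D|[D|D]].
    - pose proof (H2 r r' Hr Hr' (or_introl D)). lia.
    - destruct (Nat.lt_trichotomy r r') as [C|[C|C]]; auto; exfalso.
      + pose proof (H2 r r' Hr Hr' (or_intror (conj D C))). lia.
      + pose proof (H2 r' r Hr' Hr (or_intror (conj (eq_sym D) C))). lia.
    - pose proof (H2 r' r Hr' Hr (or_introl D)). lia. }
  assert (Hsur : forall y, y < L -> exists r, r < L /\ pos r = y).
  { apply inj_surj; [intros; apply H1; assumption|assumption]. }
  split; [|split; [|split]]; auto.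
  - intros r r' Hrr Hr'. destruct (Hsur r) as (u & Hu & Eu); [lia|].
    destruct (Hsur r' Hr') as (v & Hv & Ev). cbv zeta.
    rewrite <- Eu, <- Ev. destruct (H1 u Hu) as [_ ->]. destruct (H1 v Hv) as [_ ->].
    destruct (Nat.lt_trichotomy (ar s aKEY (ar s aPA u)) (ar s aKEY (ar s aPA v))) as [D|[D|D]].
    + lia.
    + destruct (Nat.lt_trichotomy u v) as [C|[C|C]]; auto; exfalso.
      * subst. lia.
      * pose proof (H2 v u Hv Hu (or_intror (conj (eq_sym D) C))). lia.
    + pose proof (H2 v u Hv Hu (or_introl D)). lia.
  - intros r Hr. destruct (Hsur r Hr) as (u & Hu & Eu). exists u. split; [assumption|].
    rewrite <- Eu. apply H1. assumption.
  - eauto.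
Qed.

(** * One level down: sorting and naming the triples *)

Definition down_pos : cmd := For i2 (!vL2)
  (CIf (!i2 <? !vn1) (q2 ::= #3 * !i2 + #1) (q2 ::= #3 * (!i2 - !vn1) + #2) ;;
   CSto aSS (!i2) (!q2) ;; CSto aPA (!i2) (!i2)).
Definition down_key (d : nat) : cmd := For i2 (!vL2)
  (CSto aKEY (!i2) (aLV.[!voff + aSS.[!i2] + #d])).
Definition down_name : cmd := For i2 (!vL2)
  (x2 ::= aPA.[!i2] ;; q2 ::= !voff + aSS.[!x2] ;;
   CIf ((aLV.[!q2] =? !vc0) && ((aLV.[!q2 + #1] =? !vc1) && (aLV.[!q2 + #2] =? !vc2))) CSkip
     (incr vnm ;; vc0 ::= aLV.[!q2] ;; vc1 ::= aLV.[!q2 + #1] ;; vc2 ::= aLV.[!q2 + #2]) ;;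
   CSto aLV (!vno + !x2) (!vnm)).
(** The letters of a level are at most [L + 3], so the initial value of [vc0] differs from all of
    them and the first triple opens a new name. *)
Definition down_pre : cmd :=
  (vn1 ::= (!vL + #2) / #3 ;; vL2 ::= !vn1 + !vL / #3 ;; vno ::= !voff + !vL + #3 ;;
   pl ::= !vL2 ;; pk ::= !vL + #4 ;; vnm ::= #0 ;; vc0 ::= !vL + #9)%c.
Definition down_post : cmd :=
  (CSto aLV (!vno + !vL2) #0 ;; CSto aLV (!vno + !vL2 + #1) #0 ;;
   CSto aLV (!vno + !vL2 + #2) #0 ;; incr vh ;; CSto aOF (!vh) (!vno) ;;
   CSto aLN (!vh) (!vL2) ;; voff ::= !vno ;; vL ::= !vL2)%c.
Definition DOWN : cmd :=
  (down_pre ;; down_pos ;; down_key 2 ;; PASS ;; down_key 1 ;; PASS ;; down_key 0 ;; PASS ;;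
   down_name ;; down_post)%c.

Lemma down_pos_ok s L2 n1 :
  sc s vL2 = L2 -> sc s vn1 = n1 -> L2 <= Q -> n1 <= Q ->
  (forall x, x < L2 -> ar (sem down_pos s) aSS x = spos n1 x) /\
  (forall x, x < L2 -> ar (sem down_pos s) aPA x = x) /\
  tk (sem down_pos s) <= tk s + 10 * L2 + 10.
Proof.
  intros HL Hn1 HLQ HnQ. destruct (for_ind (fun k s' => (forall x, x < k -> ar s' aSS x = spos n1 x) /\
      (forall x, x < k -> ar s' aPA x = x) /\
      tk s' <= tk s + 10 * k + 10) i2 (!vL2)%e
   (CIf (!i2 <? !vn1) (q2 ::= #3 * !i2 + #1) (q2 ::= #3 * (!i2 - !vn1) + #2) ;;
   CSto aSS (!i2) (!q2) ;; CSto aPA (!i2) (!i2))%c s L2) as [R _]; auto.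
  - lia.
  - xs. split; [|split]; lia.
  - intros k s' Hk F Hi (I1 & I2 & I3). assert (E1 : sc s' vn1 = n1) by (frall; assumption).
    xs. rewrite Hi, E1. destruct (Nat.ltb_spec k n1) as [C|C]; xs; rewrite ?Hi, ?E1; ev.
    + split; [|split; [|lia]]; intros x Hx; destruct (Nat.eqb_spec x k) as [->|]; auto.
      * unfold spos. destruct (Nat.ltb_spec k n1); lia.
      * apply I1; lia.
      * apply I2; lia.
    + split; [|split; [|lia]]; intros x Hx; destruct (Nat.eqb_spec x k) as [->|]; auto.
      * unfold spos. destruct (Nat.ltb_spec k n1); lia.
      * apply I1; lia.
      * apply I2; lia.
Qed.

Lemma down_key_ok d s L2 off (p : nat -> nat) :
  sc s vL2 = L2 -> sc s voff = off -> L2 <= Q -> d <= 2 ->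
  (forall x, x < L2 -> ar s aSS x = p x /\ off + p x + 2 < Q) ->
  (forall x, x < L2 -> ar (sem (down_key d) s) aKEY x = ar s aLV (off + p x + d)) /\
  tk (sem (down_key d) s) <= tk s + 10 * L2 + 10.
Proof.
  intros HL Hoff HLQ Hd Hp. destruct (for_ind (fun k s' =>
      (forall x, x < k -> ar s' aKEY x = ar s aLV (off + p x + d)) /\
      tk s' <= tk s + 10 * k + 10) i2 (!vL2)%e
   (CSto aKEY (!i2) (aLV.[!voff + aSS.[!i2] + #d]))%c s L2) as [R _]; auto.
  - lia.
  - xs. split; lia.
  - intros k s' Hk F Hi (I1 & I3). destruct (Hp k Hk) as [P1 P2]. xs. rewrite Hi. frall. ev. split; [|lia].
    intros x Hx; destruct (Nat.eqb_spec x k) as [->|]; auto. apply I1. lia.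
Qed.

Lemma down_name_ok s L L2 off no (p PA : nat -> nat) f :
  sc s vL2 = L2 -> sc s voff = off -> sc s vno = no -> sc s vnm = 0 -> sc s vc0 = L + 9 ->
  L2 <= Q -> L <= Q -> no = off + L + 3 -> no + L2 < Q ->
  (forall x, x < L2 -> ar s aSS x = p x /\ p x <= L) ->
  (forall r, ar s aPA r = PA r) -> (forall r, r < L2 -> PA r < L2) ->
  (forall r r', r < L2 -> r' < L2 -> PA r = PA r' -> r = r') ->
  (forall i, ar s aLV (off + i) = f i) -> (forall i, i < L + 3 -> f i <= L + 3) ->
  (forall r r', r < r' -> r' < L2 -> tlt f (p (PA r)) (p (PA r')) \/ teq f (p (PA r)) (p (PA r'))) ->
  let s' := sem down_name s in
  (forall i, i < no -> ar s' aLV i = ar s aLV i) /\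
  (forall r, r < L2 -> 1 <= ar s' aLV (no + PA r) <= L2) /\
  (forall r r', r < r' -> r' < L2 ->
     (tlt f (p (PA r)) (p (PA r')) -> ar s' aLV (no + PA r) < ar s' aLV (no + PA r')) /\
     (teq f (p (PA r)) (p (PA r')) -> ar s' aLV (no + PA r) = ar s' aLV (no + PA r'))) /\
  tk s' <= tk s + 20 * L2 + 10.
Proof.
  intros HL Hoff Hno Hnm Hc0 HLQ HLQ' Eno HnoQ Hp HPA HPAlt HPAinj Hf Hfb Hsort s'. destruct (for_ind (fun k s' =>
    (forall i, i < no -> ar s' aLV i = ar s aLV i) /\
    (forall r, r < k -> 1 <= ar s' aLV (no + PA r) <= sc s' vnm) /\
    (forall r r', r < r' -> r' < k ->
     (tlt f (p (PA r)) (p (PA r')) -> ar s' aLV (no + PA r) < ar s' aLV (no + PA r')) /\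
     (teq f (p (PA r)) (p (PA r')) -> ar s' aLV (no + PA r) = ar s' aLV (no + PA r'))) /\
    sc s' vnm <= k /\
    (match k with 0 => sc s' vc0 = L + 9 | S k0 => sc s' vc0 = f (p (PA k0)) /\
       sc s' vc1 = f (p (PA k0) + 1) /\ sc s' vc2 = f (p (PA k0) + 2) /\
       ar s' aLV (no + PA k0) = sc s' vnm end) /\
    tk s' <= tk s + 20 * k + 10) i2 (!vL2)%e
  (x2 ::= aPA.[!i2] ;; q2 ::= !voff + aSS.[!x2] ;;
   CIf ((aLV.[!q2] =? !vc0) && ((aLV.[!q2 + #1] =? !vc1) && (aLV.[!q2 + #2] =? !vc2))) CSkip
     (incr vnm ;; vc0 ::= aLV.[!q2] ;; vc1 ::= aLV.[!q2 + #1] ;; vc2 ::= aLV.[!q2 + #2]) ;;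
   CSto aLV (!vno + !x2) (!vnm))%c s L2) as [R _]; auto.
  - lia.
  - xs. split; [|split; [|split; [|split; [|split]]]]; auto; try lia.
  - intros k s1 Hk F Hi (I1 & I2 & I3 & I4 & I5 & I6).
    pose proof (HPAlt k Hk) as Px. destruct (Hp _ Px) as [Sx Bx].
    assert (E0 : ar s1 aPA k = PA k) by (frall; apply HPA).
    assert (E1 : sc s1 voff = off) by (frall; assumption).
    assert (E2 : ar s1 aSS (PA k) = p (PA k)) by (frall; assumption).
    assert (E3 : sc s1 vno = no) by (frall; assumption). set (x := PA k) in *.
    assert (E4 : forall d, d < 3 -> ar s1 aLV (off + p x + d) = f (p x + d)).
    { intros d Hd. rewrite I1 by lia. rewrite <- Nat.add_assoc. apply Hf. }
    pose proof (E4 0 ltac:(lia)) as E40. pose proof (E4 1 ltac:(lia)) as E41.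
    pose proof (E4 2 ltac:(lia)) as E42. rewrite !Nat.add_0_r in E40.
    assert (Hne : forall r, r < k -> no + PA r =? no + x = false).
    { intros r Hr. apply Nat.eqb_neq. intros E. assert (PA r = PA k) by (fold x; lia). apply HPAinj in H; lia. }
    cond_is ((f (p x) =? sc s1 vc0) && ((f (p x + 1) =? sc s1 vc1) && (f (p x + 2) =? sc s1 vc2))).
    { xs. rewrite Hi. ev. rewrite E0, E1. ev. rewrite E2, E40, E41, E42. reflexivity. }
    destruct ((f (p x) =? sc s1 vc0) && ((f (p x + 1) =? sc s1 vc1) && (f (p x + 2) =? sc s1 vc2)))
      eqn:EB.
    + apply andb_prop in EB as [B0 EB]. apply andb_prop in EB as [B1 B2]. apply Nat.eqb_eq in B0, B1, B2.
      destruct k as [|k0]; [pose proof (Hfb (p x) ltac:(lia)); lia|]. destruct I5 as (V0 & V1 & V2 & V3).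
      xs. rewrite Hi. ev. rewrite E0, E3. split; [|split; [|split; [|split; [|split]]]].
      * intros i Hi'. destruct (Nat.eqb_spec i (no + x)); [lia|auto].
      * intros r Hr. destruct (Nat.eq_dec r (S k0)) as [->|].
        -- rewrite Nat.eqb_refl. pose proof (I2 k0 ltac:(lia)). lia.
        -- rewrite Hne by lia. apply I2. lia.
      * intros r r' Hr Hr'. rewrite (Hne r) by lia. destruct (Nat.eq_dec r' (S k0)) as [->|].
        -- fold x. rewrite Nat.eqb_refl. destruct (Nat.eq_dec r k0) as [->|].
           ++ unfold tlt, teq. lia.
           ++ destruct (I3 r k0 ltac:(lia) ltac:(lia)) as [A B]. unfold tlt, teq in *. lia.
        -- rewrite Hne by lia. apply I3; lia.
      * lia.
      * rewrite Nat.eqb_refl. auto.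
      * lia.
    + assert (HB : ~ (f (p x) = sc s1 vc0 /\ f (p x + 1) = sc s1 vc1 /\ f (p x + 2) = sc s1 vc2)).
      { intros (B0 & B1 & B2). rewrite B0, B1, B2, !Nat.eqb_refl in EB. discriminate. }
      xs. rewrite Hi. ev. rewrite E0, E1. ev. rewrite E2, E40, E41, E42, E3.
      assert (HO : forall r, r < k -> tlt f (p (PA r)) (p x)).
      { intros r Hr. destruct k as [|k0]; [lia|].
        destruct (Hsort k0 (S k0) ltac:(lia) Hk) as [T|T]; fold x in T; [|unfold teq in T; lia].
        destruct (Nat.eq_dec r k0) as [->|]; [assumption|].
        destruct (Hsort r k0 ltac:(lia) ltac:(lia)) as [T'|T']; unfold tlt, teq in *; lia. }
      split; [|split; [|split; [|split; [|split]]]].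
      * intros i Hi'. destruct (Nat.eqb_spec i (no + x)); [lia|auto].
      * intros r Hr. destruct (Nat.eq_dec r k) as [->|].
        -- rewrite Nat.eqb_refl. lia.
        -- rewrite Hne by lia. pose proof (I2 r ltac:(lia)). lia.
      * intros r r' Hr Hr'. rewrite (Hne r) by lia. destruct (Nat.eq_dec r' k) as [->|].
        -- fold x. rewrite Nat.eqb_refl. pose proof (I2 r ltac:(lia)).
           specialize (HO r ltac:(lia)). unfold tlt, teq in *. lia.
        -- rewrite Hne by lia. apply I3; lia.
      * lia.
      * rewrite Nat.eqb_refl. auto.
      * lia.
  - destruct R as (R1 & R2 & R3 & R4 & R5 & R6). split; [|split; [|split]]; auto.
    intros r Hr. pose proof (R2 r Hr). unfold s', down_name in *. lia.
Qed.

Lemma down_pre_ok s L off :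
  sc s vL = L -> sc s voff = off -> L <= Q -> off + L + 3 <= Q -> 2 <= L ->
  let s' := sem down_pre s in
  sc s' vn1 = (L + 2) / 3 /\ sc s' vL2 = red L /\ sc s' vno = off + L + 3 /\ sc s' pl = red L /\
  sc s' pk = L + 4 /\ sc s' vnm = 0 /\ sc s' vc0 = L + 9 /\ tk s' <= tk s + 10.
Proof.
  intros HL Hoff HLQ HoQ H2 s'. subst s'. unfold down_pre. xs. rewrite HL, Hoff.
  pose proof (red_bounds L H2) as B. unfold red in B. ev. repeat split; auto; try lia.
Qed.

Lemma down_post_ok s h no L2 :
  sc s vno = no -> sc s vL2 = L2 -> sc s vh = h -> no + L2 + 5 <= Q -> h + 2 <= Q ->
  let s' := sem down_post s in
  sc s' vh = h + 1 /\ sc s' vL = L2 /\ sc s' voff = no /\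
  (forall k, ar s' aLN k = if k =? h + 1 then L2 else ar s aLN k) /\
  (forall k, ar s' aOF k = if k =? h + 1 then no else ar s aOF k) /\
  (forall i, i < no + L2 -> ar s' aLV i = ar s aLV i) /\
  (forall i, i < 3 -> ar s' aLV (no + L2 + i) = 0) /\ tk s' <= tk s + 8.
Proof.
  intros H1 H2 H3 HQ1 HQ2 s'. subst s'. unfold down_post. xs. rewrite H1, H2, H3. ev. do 3 (split; [reflexivity|]).
  split; [intros k; reflexivity|]. split; [intros k; reflexivity|]. split; [|split; [|lia]]; intros i Hi.
  - destruct (Nat.eqb_spec i (no + L2 + 2)), (Nat.eqb_spec i (no + L2 + 1)),
     (Nat.eqb_spec i (no + L2)); try lia.
  - destruct (Nat.eqb_spec (no + L2 + i) (no + L2 + 2)), (Nat.eqb_spec (no + L2 + i) (no + L2 + 1)),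
     (Nat.eqb_spec (no + L2 + i) (no + L2)); try lia.
Qed.

Lemma down_ok s h L off :
  sc s vh = h -> sc s vL = L -> sc s voff = off -> 2 <= L ->
  ar s aLN h = L -> ar s aOF h = off -> level_ok s h -> off + 12 * L <= Q -> h + 2 <= Q ->
  let s' := sem DOWN s in
  sc s' vh = h + 1 /\ sc s' vL = red L /\ sc s' voff = off + L + 3 /\
  (forall k, ar s' aLN k = if k =? h + 1 then red L else ar s aLN k) /\
  (forall k, ar s' aOF k = if k =? h + 1 then off + L + 3 else ar s aOF k) /\
  (forall i, i < off + L + 3 -> ar s' aLV i = ar s aLV i) /\
  level_ok s' (h + 1) /\ names_ok (lv s h) (lv s' (h + 1)) L /\
  tk s' <= tk s + 500 * L.
Proof.
  intros Hh HL Hoff H2 HLN HOF Hlev HQ HhQ s'. subst s'. unfold DOWN. rewrite !sem_seq.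
  pose proof (red_bounds L H2) as (RB1 & RB2 & _ & RB3).
  set (n1 := (L + 2) / 3). set (L2 := red L). set (no := off + L + 3).
  assert (Hn1 : n1 <= L2) by (unfold n1, L2, red; lia). pose (p := spos n1).
  assert (Hp : forall x, x < L2 -> p x <= L) by (intros; apply spos_le; assumption).
  pose (f := fun i => ar s aLV (off + i)). assert (Hf : forall i, ar s aLV (off + i) = f i) by reflexivity.
  assert (Hflv : forall i, i < L + 3 -> f i = lv s h i).
  { intros i Hi. rewrite <- Hf, <- HOF. apply level_raw; auto. lia. }
  assert (Hfb : forall i, i < L + 3 -> f i <= L + 3).
  { intros i Hi. rewrite Hflv by assumption. unfold lv. destruct (Nat.ltb_spec i (ar s aLN h)); [|lia].
    destruct Hlev as [A _]. specialize (A i H). lia. }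
  destruct (down_pre_ok s L off HL Hoff ltac:(lia) ltac:(lia) H2)
    as (A1 & A2 & A3 & A4 & A5 & A6 & A7 & T1).
  fold L2 in A2, A4. run (sem down_pre s) as s1 F1.
  destruct (down_pos_ok s1 L2 n1 A2 A1 ltac:(lia) ltac:(lia)) as (B1 & B2 & T2). run (sem down_pos s1) as s2 F2.
  destruct (down_key_ok 2 s2 L2 off p) as (C1 & T3); try (frall; auto; lia).
  { intros x Hx. rewrite B1 by assumption. split; [reflexivity|]. specialize (Hp x Hx). lia. }
  run (sem (down_key 2) s2) as s3 F3. assert (P3 : forall x, x < L2 -> ar s3 aPA x = x) by (intros; frall; auto).
  assert (K3 : forall x, x < L2 -> ar s3 aKEY x = f (p x + 2)).
  { intros x Hx. rewrite C1 by assumption. rewrite <- Hf. frall. f_equal. lia. }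
  destruct (pass_sorts s3 L2 (L + 4) (fun a b => a < b)) as (D1 & D2 & D3 & T4);
    try (frall; auto; lia).
  { intros r Hr. rewrite P3 by assumption. lia. }
  { intros r Hr. rewrite !P3, K3 by (rewrite ?P3; assumption). specialize (Hp r Hr).
    specialize (Hfb (p r + 2) ltac:(lia)). lia. }
  { intros r r' Hr Hr'. rewrite !P3 by lia. assumption. }
  run (sem PASS s3) as s4 F4. assert (P4 : forall r, r < L2 -> ar s4 aPA r < L2).
  { intros r Hr. destruct (D2 r Hr) as (r' & Hr' & ->). rewrite P3; assumption. }
  destruct (down_key_ok 1 s4 L2 off p) as (C2 & T5); try (frall; auto; lia).
  { intros x Hx. frall. rewrite B1 by assumption. split; [reflexivity|]. specialize (Hp x Hx). lia. }
  run (sem (down_key 1) s4) as s5 F5. assert (K5 : forall x, x < L2 -> ar s5 aKEY x = f (p x + 1)).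
  { intros x Hx. rewrite C2 by assumption. rewrite <- Hf. frall. f_equal. lia. }
  assert (P5 : forall r, ar s5 aPA r = ar s4 aPA r) by (intros; frall; reflexivity).
  destruct (pass_sorts s5 L2 (L + 4)
     (fun a b => f (p a + 2) < f (p b + 2) \/ f (p a + 2) = f (p b + 2) /\ a < b))
     as (D4 & D5 & D6 & T6); try (frall; auto; lia).
  { intros r Hr. rewrite P5 by assumption. specialize (P4 r Hr). lia. }
  { intros r Hr. rewrite P5. specialize (P4 r Hr). rewrite K5 by assumption. specialize (Hp _ P4).
    specialize (Hfb (p (ar s4 aPA r) + 1) ltac:(lia)). lia. }
  { intros r r' Hr Hr'. rewrite !P5. specialize (D1 r r' Hr Hr'). cbv zeta in D1.
    rewrite !K3 in D1 by (apply P4; lia). exact D1. }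
  run (sem PASS s5) as s6 F6. assert (P6 : forall r, r < L2 -> ar s6 aPA r < L2).
  { intros r Hr. destruct (D5 r Hr) as (r' & Hr' & ->). rewrite P5; auto. }
  destruct (down_key_ok 0 s6 L2 off p) as (C3 & T7); try (frall; auto; lia).
  { intros x Hx. frall. rewrite B1 by assumption. split; [reflexivity|]. specialize (Hp x Hx). lia. }
  run (sem (down_key 0) s6) as s7 F7. assert (K7 : forall x, x < L2 -> ar s7 aKEY x = f (p x)).
  { intros x Hx. rewrite C3 by assumption. rewrite <- Hf. frall. f_equal. lia. }
  assert (P7 : forall r, ar s7 aPA r = ar s6 aPA r) by (intros; frall; reflexivity).
  destruct (pass_sorts s7 L2 (L + 4)
     (fun a b => f (p a + 1) < f (p b + 1) \/ f (p a + 1) = f (p b + 1) /\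
        (f (p a + 2) < f (p b + 2) \/ f (p a + 2) = f (p b + 2) /\ a < b)))
     as (D7 & D8 & D9 & T8); try (frall; auto; lia).
  { intros r Hr. rewrite P7 by assumption. specialize (P6 r Hr). lia. }
  { intros r Hr. rewrite P7. specialize (P6 r Hr). rewrite K7 by assumption. specialize (Hp _ P6).
    specialize (Hfb (p (ar s6 aPA r)) ltac:(lia)). lia. }
  { intros r r' Hr Hr'. rewrite !P7. specialize (D4 r r' Hr Hr'). cbv zeta in D4.
    rewrite !K5 in D4 by (apply P6; lia). exact D4. }
  run (sem PASS s7) as s8 F8. assert (P8 : forall r, r < L2 -> ar s8 aPA r < L2).
  { intros r Hr. destruct (D8 r Hr) as (r' & Hr' & ->). rewrite P7; auto. }
  (* The index, last tie-breaker of the three passes, shows that the sorted entries are distinct. *)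
  assert (SO : forall r r', r < r' -> r' < L2 ->
    let a := ar s8 aPA r in let b := ar s8 aPA r' in
    (tlt f (p a) (p b) \/ teq f (p a) (p b)) /\ a <> b).
  { intros r r' Hr Hr'. specialize (D7 r r' Hr Hr'). cbv zeta in *.
    rewrite !K7 in D7 by (apply P8; lia). unfold tlt, teq.
    generalize dependent (ar s8 aPA r). intros; split; [lia|]. intros ->. lia. }
  assert (INJ : forall r r', r < L2 -> r' < L2 -> ar s8 aPA r = ar s8 aPA r' -> r = r').
  { intros r r' Hr Hr' E. destruct (Nat.lt_trichotomy r r') as [C|[C|C]]; auto.
    - destruct (SO r r' C Hr') as [_ N]. contradiction.
    - destruct (SO r' r C Hr) as [_ N]. symmetry in E. contradiction. }
  pose proof (inj_surj (ar s8 aPA) L2 P8 INJ) as SUR. destruct (down_name_ok s8 L L2 off no p (ar s8 aPA) f)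
    as (G1 & G2 & G3 & T9); auto; try (frall; auto; lia).
  { intros x Hx. frall. rewrite B1 by assumption. split; [reflexivity|auto]. }
  { intros i. frall. apply Hf. }
  { intros r r' Hr Hr'. apply (SO r r' Hr Hr'). }
  run (sem down_name s8) as s9 F9. assert (X1 : sc s9 vno = no) by (frall; assumption).
  assert (X2 : sc s9 vL2 = L2) by (frall; assumption). assert (X3 : sc s9 vh = h) by (frall; assumption).
  assert (X4 : forall k, ar s9 aLN k = ar s aLN k) by (intros; frall; reflexivity).
  assert (X5 : forall k, ar s9 aOF k = ar s aOF k) by (intros; frall; reflexivity).
  assert (X6 : forall i, i < no -> ar s9 aLV i = ar s aLV i).
  { intros i Hi. rewrite G1 by assumption. frall. reflexivity. }
  assert (X8 : forall x, x < L2 -> 1 <= ar s9 aLV (no + x) <= L2).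
  { intros x Hx. destruct (SUR x Hx) as (r & Hr & <-). auto. }
  assert (X9 : forall x y, x < L2 -> y < L2 ->
    (ar s9 aLV (no + x) < ar s9 aLV (no + y) <-> tlt f (p x) (p y))).
  { intros x y Hx Hy. destruct (SUR x Hx) as (r & Hr & Er). destruct (SUR y Hy) as (r' & Hr' & Er').
    destruct (Nat.lt_trichotomy r r') as [C|[C|C]].
    - destruct (G3 r r' C Hr') as [U V]. destruct (SO r r' C Hr') as [W _].
      rewrite Er, Er' in U, V, W. unfold tlt, teq in *. lia.
    - subst. unfold tlt. lia.
    - destruct (G3 r' r C Hr) as [U V]. destruct (SO r' r C Hr) as [W _].
      rewrite Er, Er' in U, V, W. unfold tlt, teq in *. lia. }
  destruct (down_post_ok s9 h no L2 X1 X2 X3 ltac:(lia) HhQ)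
    as (W1 & W2 & W3 & W4 & W5 & W6 & W7 & T10).
  set (s10 := sem down_post s9) in *.
  assert (E1 : ar s10 aLN (h + 1) = L2) by (rewrite W4, Nat.eqb_refl; reflexivity).
  assert (E2 : ar s10 aOF (h + 1) = no) by (rewrite W5, Nat.eqb_refl; reflexivity). do 3 (split; [assumption|]).
  split; [intros k; rewrite W4, X4; reflexivity|]. split; [intros k; rewrite W5, X5; reflexivity|].
  split; [|split; [|split]].
  - intros i Hi. rewrite W6, X6 by lia. reflexivity.
  - unfold level_ok. rewrite E1, E2. split; intros i Hi.
    + rewrite W6 by lia. specialize (X8 i Hi). lia.
    + auto.
  - intros x y Hx Hy. unfold lv at 1 2. rewrite E1, E2.
    destruct (Nat.ltb_spec x L2); [|lia]. destruct (Nat.ltb_spec y L2); [|lia].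
    rewrite !W6 by lia. rewrite X9 by assumption. pose proof (Hp x Hx). pose proof (Hp y Hy).
    unfold tlt. rewrite !Hflv by lia. reflexivity.
  - lia.
Qed.

(** * One level up: merging sampled and other suffixes *)

Definition up_pre : cmd :=
  (vL2 ::= aLN.[!vh] ;; vh ::= !vh - #1 ;; voff ::= aOF.[!vh] ;; vL ::= aLN.[!vh] ;;
   vn1 ::= (!vL + #2) / #3 ;; vk2 ::= #0 ;; pl ::= !vn1 ;; pk ::= !vL + #4 ;;
   b1 ::= #0 ;; a1 ::= #0)%c.
Definition up_clear : cmd := For i2 (!vL + #3) (CSto aSR (!i2) #0).
Definition up_samp : cmd := For i2 (!vL2)
  (CIf (!i2 <? !vn1) (q2 ::= #3 * !i2 + #1) (q2 ::= #3 * (!i2 - !vn1) + #2) ;;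
   CSto aSS (aRK.[!i2] - #1) (!q2) ;; CSto aSR (!q2) (aRK.[!i2])).
(** Going through the sampled suffixes by rank lists the positions [3 * y] in the order of the
    suffixes at [3 * y + 1]; one stable pass by first letters then sorts the suffixes at [3 * y]. *)
Definition up_zero : cmd := For i2 (!vL2)
  (q2 ::= aSS.[!i2] ;; CIf (!q2 %% #3 =? #1) (CSto aPA (!vk2) (!q2 / #3) ;; incr vk2) CSkip).
Definition up_key : cmd := For i2 (!vn1) (CSto aKEY (!i2) (aLV.[!voff + #3 * !i2])).
(** If [L] is 1 modulo 3, the empty suffix at [L] is among the sampled ones. It has rank 1 and must
    not enter the merge. *)
Definition up_skip : cmd := CIf (!vL %% #3 =? #1) (a1 ::= #1) CSkip.
Definition lessb : bexp :=
  (let f k := aLV.[!voff + !k] in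
   let f1 k := aLV.[!voff + !k + #1] in
   BOr (f vii <? f vjj) ((f vii =? f vjj) &&
     BOr ((!vii %% #3 =? #1) && (aSR.[!vii + #1] <? aSR.[!vjj + #1]))
       ((~~ (!vii %% #3 =? #1)) && BOr (f1 vii <? f1 vjj)
          ((f1 vii =? f1 vjj) && (aSR.[!vii + #2] <? aSR.[!vjj + #2])))))%e.
Definition up_merge : cmd := For i2 (!vL)
  (vii ::= aSS.[!a1] ;; vjj ::= #3 * aPA.[!b1] ;;
   CIf (~~ (!b1 <? !vn1)) (vtake ::= #1)
     (CIf (~~ (!a1 <? !vL2)) (vtake ::= #0)
       (CIf lessb (vtake ::= #1) (vtake ::= #0))) ;;
   CIf (!vtake =? #1) (CSto aRK (!vii) (!i2 + #1) ;; incr a1)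
     (CSto aRK (!vjj) (!i2 + #1) ;; incr b1)).
Definition UP : cmd :=
  (up_pre ;; up_clear ;; up_samp ;; up_zero ;; up_key ;; PASS ;; up_skip ;; up_merge)%c.

Lemma up_pre_ok s h L off L2 :
  sc s vh = h + 1 -> ar s aLN (h + 1) = L2 -> ar s aLN h = L -> ar s aOF h = off ->
  h + 1 < Q -> L <= Q -> off <= Q ->
  let s' := sem up_pre s in
  sc s' vL2 = L2 /\ sc s' vh = h /\ sc s' voff = off /\ sc s' vL = L /\ sc s' vn1 = (L + 2) / 3 /\
  sc s' vk2 = 0 /\ sc s' pl = (L + 2) / 3 /\ sc s' pk = L + 4 /\ sc s' b1 = 0 /\ sc s' a1 = 0 /\
  tk s' <= tk s + 10.
Proof.
  intros Hh H1 H2 H3 HhQ HLQ HoQ s'. subst s'. unfold up_pre. xs. rewrite Hh. ev.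
  replace (h + 1 - 1) with h by lia. ev. rewrite H2, H3. lia.
Qed.

Lemma up_clear_ok s L : sc s vL = L -> L + 3 <= Q ->
  (forall p, p < L + 3 -> ar (sem up_clear s) aSR p = 0) /\
  tk (sem up_clear s) <= tk s + 5 * L + 20.
Proof.
  intros HL HLQ. destruct (for_ind (fun k s' => (forall p, p < k -> ar s' aSR p = 0) /\
      tk s' <= tk s + 5 * k + 5) i2 (!vL + #3)%e (CSto aSR (!i2) #0)%c s (L + 3)) as [[R1 R2] _]; auto.
  - xs. rewrite HL. ev. reflexivity.
  - lia.
  - xs. split; lia.
  - intros k s' Hk F Hi [I1 I2]. xs. rewrite Hi. ev. split; [|lia].
    intros c Hc. destruct (Nat.eqb_spec c k); [reflexivity|]. apply I1. lia.
  - split; [assumption|]. unfold up_clear. lia.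
Qed.

Lemma up_samp_ok s L L2 n1 (rk : nat -> nat) :
  sc s vL2 = L2 -> sc s vn1 = n1 -> n1 <= L2 -> L2 <= L -> L + 3 <= Q ->
  (forall x, ar s aRK x = rk x) -> (forall x, x < L2 -> 1 <= rk x <= L2) ->
  (forall x y, x < L2 -> y < L2 -> rk x = rk y -> x = y) ->
  (forall x, x < L2 -> spos n1 x <= L) ->
  (forall p, p < L + 3 -> ar s aSR p = 0) ->
  let s' := sem up_samp s in
  (forall x, x < L2 -> ar s' aSS (rk x - 1) = spos n1 x) /\
  (forall x, x < L2 -> ar s' aSR (spos n1 x) = rk x) /\
  (forall p, p < L + 3 -> (forall x, x < L2 -> p <> spos n1 x) -> ar s' aSR p = 0) /\
  tk s' <= tk s + 10 * L2 + 10.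
Proof.
  intros HL2 Hn1 Hn1L HL2L HLQ Hrk Hrb Hinj Hpos Hz s'.
  assert (Hpi : forall x y, x < L2 -> y < L2 -> spos n1 x = spos n1 y -> x = y).
  { intros x y Hx Hy. unfold spos. destruct (Nat.ltb_spec x n1), (Nat.ltb_spec y n1); lia. }
  destruct (for_ind (fun k s' =>
    (forall x, x < k -> ar s' aSS (rk x - 1) = spos n1 x) /\
    (forall x, x < k -> ar s' aSR (spos n1 x) = rk x) /\
    (forall p, p < L + 3 -> (forall x, x < k -> p <> spos n1 x) -> ar s' aSR p = 0) /\
    tk s' <= tk s + 10 * k + 10) i2 (!vL2)%e
    (CIf (!i2 <? !vn1) (q2 ::= #3 * !i2 + #1) (q2 ::= #3 * (!i2 - !vn1) + #2) ;;
     CSto aSS (aRK.[!i2] - #1) (!q2) ;; CSto aSR (!q2) (aRK.[!i2]))%c s L2) as [R _]; auto.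
  - lia.
  - xs. repeat split; intros; try lia. apply Hz; assumption.
  - intros k s1 Hk F Hi (I1 & I2 & I3 & I4). assert (E1 : sc s1 vn1 = n1) by (frall; assumption).
    assert (E2 : ar s1 aRK k = rk k) by (frall; apply Hrk).
    pose proof (Hrb k Hk) as Rk. pose proof (Hpos k Hk) as Pk.
    assert (X : forall z, z = spos n1 k -> forall A B C T T', T <= T' ->
      A = ar s1 aSS -> B = ar s1 aSR -> C = rk k ->
      (forall x, x < S k -> (if rk x - 1 =? rk k - 1 then z else A (rk x - 1)) = spos n1 x) /\
      (forall x, x < S k -> (if spos n1 x =? z then C else B (spos n1 x)) = rk x) /\
      (forall p, p < L + 3 -> (forall x, x < S k -> p <> spos n1 x) -> (if p =? z then C else B p) = 0) /\
      T <= T').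
    { intros z -> A B C T T' HT -> -> ->. split; [|split; [|split]]; auto.
      - intros x Hx. destruct (Nat.eqb_spec (rk x - 1) (rk k - 1)) as [E|E].
        + assert (x < L2) as Hx2 by lia. pose proof (Hrb x Hx2).
          assert (x = k) as -> by (apply Hinj; auto; lia). reflexivity.
        + apply I1. assert (x <> k) by (intros ->; lia). lia.
      - intros x Hx. destruct (Nat.eqb_spec (spos n1 x) (spos n1 k)) as [E|E].
        + apply Hpi in E; [|lia|lia]. subst. reflexivity.
        + apply I2. assert (x <> k) by (intros ->; lia). lia.
      - intros p Hp Hne. destruct (Nat.eqb_spec p (spos n1 k)) as [E|E].
        + exfalso. apply (Hne k); [lia|assumption].
        + auto. }
    unfold spos in Pk. cond_is (k <? n1); [xs; rewrite Hi, E1; reflexivity|].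
    destruct (Nat.ltb_spec k n1) as [C|C]; xs; rewrite Hi, ?E1; ev; rewrite E2; ev;
     apply X; auto; try lia; unfold spos; destruct (Nat.ltb_spec k n1); lia.
Qed.

Lemma up_zero_ok s L L2 n1 (rk : nat -> nat) :
  sc s vL2 = L2 -> sc s vk2 = 0 -> n1 <= L2 -> L2 <= L -> L + 3 <= Q ->
  (forall x, x < L2 -> 1 <= rk x <= L2) ->
  (forall x y, x < L2 -> y < L2 -> rk x = rk y -> x = y) ->
  (forall x, x < L2 -> spos n1 x <= L) ->
  (forall x, x < L2 -> ar s aSS (rk x - 1) = spos n1 x) ->
  (forall r, 1 <= r <= L2 -> exists x, x < L2 /\ rk x = r) ->
  let s' := sem up_zero s in
  (forall j, j < n1 -> ar s' aPA j < n1) /\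
  (forall j j', j < j' -> j' < n1 -> rk (ar s' aPA j) < rk (ar s' aPA j')) /\
  tk s' <= tk s + 10 * L2 + 10.
Proof.
  intros HL2 Hk2 Hn1L HL2L HLQ Hrb Hinj Hpos Hss Hsurj s'.
  assert (Hm : forall x, x < L2 -> (spos n1 x mod 3 = 1 <-> x < n1) /\ (x < n1 -> spos n1 x / 3 = x)).
  { intros x Hx. unfold spos. destruct (Nat.ltb_spec x n1).
    - split.
      + split; [auto|]. rewrite Nat.add_comm, Nat.mul_comm, Nat.Div0.mod_add. reflexivity.
      + rewrite Nat.add_comm, Nat.mul_comm, Nat.div_add by lia. reflexivity.
    - rewrite Nat.add_comm, Nat.mul_comm, Nat.Div0.mod_add. cbn. split; lia. }
  destruct (for_ind (fun k s' =>
    let k2 := sc s' vk2 in k2 <= k /\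
    (forall j, j < k2 -> ar s' aPA j < n1 /\ rk (ar s' aPA j) <= k) /\
    (forall j j', j < j' -> j' < k2 -> rk (ar s' aPA j) < rk (ar s' aPA j')) /\
    (forall x, x < n1 -> rk x <= k -> exists j, j < k2 /\ ar s' aPA j = x) /\
    tk s' <= tk s + 10 * k + 10) i2 (!vL2)%e
    (q2 ::= aSS.[!i2] ;; CIf (!q2 %% #3 =? #1) (CSto aPA (!vk2) (!q2 / #3) ;; incr vk2) CSkip)%c s L2) as [R _]; auto.
  - lia.
  - xs. repeat split; intros; try lia. specialize (Hrb x ltac:(lia)). lia.
  - intros k s1 Hk F Hi (I0 & I1 & I2 & I3 & I4). destruct (Hsurj (k + 1) ltac:(lia)) as (x & Hx & Rx).
    assert (E1 : ar s1 aSS k = spos n1 x). { frall. rewrite <- (Hss x Hx). f_equal. lia. }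
    destruct (Hm x Hx) as [M1 M2]. cond_is (x <? n1).
    { xs. rewrite Hi. ev. rewrite E1. destruct (Nat.eqb_spec (spos n1 x mod 3) 1), (Nat.ltb_spec x n1); lia. }
 destruct (Nat.ltb_spec x n1) as [C|C].
    + xs. rewrite Hi. ev. rewrite E1, M2 by assumption. set (k2 := sc s1 vk2) in *.
      split; [lia|]. split; [|split; [|split; [|lia]]].
      * intros j Hj. destruct (Nat.eqb_spec j k2); [lia|]. specialize (I1 j ltac:(lia)). lia.
      * intros j j' Hj Hj'. destruct (Nat.eqb_spec j k2); [lia|].
        destruct (Nat.eqb_spec j' k2); [|apply I2; lia]. specialize (I1 j ltac:(lia)). lia.
      * intros y Hy Hry. destruct (Nat.eq_dec (rk y) (k + 1)) as [E|E].
        -- exists k2. split; [lia|]. rewrite Nat.eqb_refl. apply Hinj; lia.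
        -- destruct (I3 y Hy ltac:(lia)) as (j & Hj & Ej). exists j. split; [lia|].
           destruct (Nat.eqb_spec j k2); [lia|assumption].
    + xs. split; [lia|]. split; [|split; [|split; [|lia]]].
      * intros j Hj. specialize (I1 j Hj). lia.
      * exact I2.
      * intros y Hy Hry. destruct (Nat.eq_dec (rk y) (k + 1)) as [E|E].
        -- assert (y = x) by (apply Hinj; lia). lia.
        -- apply I3; lia.
  - fold up_zero in R. fold s' in R. set (k2 := sc s' vk2) in *.
    destruct R as (R0 & R1 & R2 & R3 & R4). assert (E : k2 = n1).
    { apply Nat.le_antisymm.
      - apply inj_card with (f := ar s' aPA).
        + intros j Hj. apply R1. assumption.
        + intros i j Hii Hj E. destruct (Nat.lt_trichotomy i j) as [C|[C|C]]; auto.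
          * specialize (R2 i j C Hj). rewrite E in R2. lia.
          * specialize (R2 j i C Hii). rewrite E in R2. lia.
      - apply surj_card with (f := ar s' aPA). intros y Hy. apply R3; auto. specialize (Hrb y ltac:(lia)). lia. }
    rewrite E in *. split; [|split]; auto. intros j Hj. apply R1. assumption.
Qed.

Lemma up_key_ok s L n1 off :
  sc s vn1 = n1 -> sc s voff = off -> n1 <= L -> 3 * n1 <= L + 3 -> off + L + 3 < Q ->
  (forall y, y < n1 -> ar (sem up_key s) aKEY y = ar s aLV (off + 3 * y)) /\
  tk (sem up_key s) <= tk s + 10 * L + 10.
Proof.
  intros HL Hoff HLQ H3 HoQ. destruct (for_ind (fun k s' =>
      (forall x, x < k -> ar s' aKEY x = ar s aLV (off + 3 * x)) /\
      tk s' <= tk s + 10 * k + 10) i2 (!vn1)%e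
   (CSto aKEY (!i2) (aLV.[!voff + #3 * !i2]))%c s n1) as [[R1 R2] _]; auto.
  - lia.
  - xs. split; lia.
  - intros k s' Hk F Hi (I1 & I3). xs. rewrite Hi. frall. ev. split; [|lia].
    intros x Hx; destruct (Nat.eqb_spec x k) as [->|]; auto. apply I1. lia.
  - split; [assumption|]. unfold up_key. lia.
Qed.

(** The invariant splits the positions into those output and those pending, every suffix of the
    first kind preceding every one of the second. The comparison of the two heads is [cmp1] or
    [cmp2]. *)
Lemma up_merge_ok s L n1 off L2 a0 f (SS PA sr : nat -> nat) :
  str f L ->
  sc s vL = L -> sc s vn1 = n1 -> sc s voff = off -> sc s vL2 = L2 -> sc s a1 = a0 -> sc s b1 = 0 ->
  off + L + 3 < Q -> a0 <= L2 -> L2 <= L -> n1 <= L -> L2 - a0 + n1 = L ->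
  (forall i, i < L + 3 -> ar s aLV (off + i) = f i) ->
  (forall r, ar s aSS r = SS r) -> (forall r, ar s aPA r = PA r) ->
  (forall p, p < L + 3 -> ar s aSR p = sr p) ->
  (forall p q, p mod 3 <> 0 -> q mod 3 <> 0 -> p < L \/ q < L -> (sr p < sr q <-> lexlt f p q)) ->
  (forall r, a0 <= r < L2 -> SS r < L /\ SS r mod 3 <> 0) ->
  (forall r, r < n1 -> 3 * PA r < L) ->
  (forall r r', a0 <= r -> r < r' -> r' < L2 -> lexlt f (SS r) (SS r')) ->
  (forall r r', r < r' -> r' < n1 -> lexlt f (3 * PA r) (3 * PA r')) ->
  (forall p, p < L -> (exists r, a0 <= r < L2 /\ p = SS r) \/ (exists r, r < n1 /\ p = 3 * PA r)) ->
  let s' := sem up_merge s in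
  ranks f L (ar s' aRK) /\ tk s' <= tk s + 12 * L + 10.
Proof.
  intros Hf HL Hn1 Hoff HL2 Ha1 Hb1 HQ Ha0 HL2L Hn1L Hcnt HLV HSS HPA HSR Hsr HA HB HSA HSB Hall s'.
  assert (H30 : forall y, (3 * y) mod 3 = 0) by (intros y; rewrite Nat.mul_comm; apply Nat.Div0.mod_mul).
  destruct (for_ind (fun k s' => exists u v,
    sc s' a1 = a0 + u /\ sc s' b1 = v /\ u + v = k /\ a0 + u <= L2 /\ v <= n1 /\
    let proc p := (exists r, a0 <= r < a0 + u /\ p = SS r) \/ (exists r, r < v /\ p = 3 * PA r) in
    let unp p := (exists r, a0 + u <= r < L2 /\ p = SS r) \/ (exists r, v <= r < n1 /\ p = 3 * PA r) in
    (forall p, proc p -> 1 <= ar s' aRK p <= k) /\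
    (forall p q, proc p -> proc q -> lexlt f p q -> ar s' aRK p < ar s' aRK q) /\
    (forall p q, proc p -> unp q -> lexlt f p q) /\
    tk s' <= tk s + 12 * k + 10) i2 (!vL)%e
   (vii ::= aSS.[!a1] ;; vjj ::= #3 * aPA.[!b1] ;;
   CIf (~~ (!b1 <? !vn1)) (vtake ::= #1)
     (CIf (~~ (!a1 <? !vL2)) (vtake ::= #0)
       (CIf lessb (vtake ::= #1) (vtake ::= #0))) ;;
   CIf (!vtake =? #1) (CSto aRK (!vii) (!i2 + #1) ;; incr a1)
     (CSto aRK (!vjj) (!i2 + #1) ;; incr b1))%c s L) as [R _]; auto.
  - lia.
  - xs. exists 0, 0. do 5 (split; [lia|]). split; [|split; [|split; [|lia]]].
    + intros p [(r & H & _)|(r & H & _)]; lia.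
    + intros p q [(r & H & _)|(r & H & _)]; lia.
    + intros p q [(r & H & _)|(r & H & _)]; lia.
  - intros k s1 Hk F Hi (u & v & I1 & I2 & I3 & I4 & I5 & I6 & I7 & I8 & I9).
    set (proc := fun p => (exists r, a0 <= r < a0 + u /\ p = SS r) \/ (exists r, r < v /\ p = 3 * PA r)) in *.
    set (unp := fun p => (exists r, a0 + u <= r < L2 /\ p = SS r) \/ (exists r, v <= r < n1 /\ p = 3 * PA r)) in *.
    assert (E1 : sc s1 vn1 = n1) by (frall; assumption). assert (E2 : sc s1 vL2 = L2) by (frall; assumption).
    assert (E3 : sc s1 voff = off) by (frall; assumption).
    assert (E4 : forall i, i < L + 3 -> ar s1 aLV (off + i) = f i) by (intros; frall; auto).
    assert (E5 : forall r, ar s1 aSS r = SS r) by (intros; frall; auto).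
    assert (E6 : forall r, ar s1 aPA r = PA r) by (intros; frall; auto).
    assert (E7 : forall p, p < L + 3 -> ar s1 aSR p = sr p) by (intros; frall; auto).
    (* the element moved to the output precedes all remaining ones *)
    assert (STEP : forall take : bool,
      (if take then a0 + u < L2 /\ forall q, unp q -> q = SS (a0 + u) \/ lexlt f (SS (a0 + u)) q
       else v < n1 /\ forall q, unp q -> q = 3 * PA v \/ lexlt f (3 * PA v) q) ->
      let m := if take then SS (a0 + u) else 3 * PA v in
      exists u' v', (if take then a0 + u + 1 else a0 + u) = a0 + u' /\ (if take then v else v + 1) = v' /\
        u' + v' = S k /\ a0 + u' <= L2 /\ v' <= n1 /\
       let proc p := (exists r, a0 <= r < a0 + u' /\ p = SS r) \/ (exists r, r < v' /\ p = 3 * PA r) in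
       let unp p := (exists r, a0 + u' <= r < L2 /\ p = SS r) \/ (exists r, v' <= r < n1 /\ p = 3 * PA r) in
       (forall p, proc p -> 1 <= (if p =? m then k + 1 else ar s1 aRK p) <= S k) /\
       (forall p q, proc p -> proc q -> lexlt f p q ->
          (if p =? m then k + 1 else ar s1 aRK p) < (if q =? m then k + 1 else ar s1 aRK q)) /\
       (forall p q, proc p -> unp q -> lexlt f p q)).
    { intros take HT m. exists (if take then u + 1 else u), (if take then v else v + 1).
      split; [destruct take; lia|]. split; [reflexivity|]. split; [destruct take; lia|].
      split; [destruct take; lia|]. split; [destruct take; lia|]. assert (Um : unp m).
      { destruct take.
        - left. exists (a0 + u). split; [lia|reflexivity].
        - right. exists v. split; [lia|reflexivity]. }
      assert (Hmin : forall q, unp q -> q = m \/ lexlt f m q) by (unfold m; destruct take; apply HT).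
      intros proc' unp'. assert (Hproc : forall p, proc' p -> p = m \/ proc p).
      { intros p [(r & Hr & ->)|(r & Hr & ->)]; unfold m, proc; destruct take.
        - destruct (Nat.eq_dec r (a0 + u)) as [->|]; [left; reflexivity|].
          right. left. exists r. split; [lia|reflexivity].
        - eauto.
        - eauto.
        - destruct (Nat.eq_dec r v) as [->|]; [left; reflexivity|].
          right. right. exists r. split; [lia|reflexivity]. }
      assert (Hunp : forall p, unp' p -> unp p /\ (p = m \/ lexlt f m p) /\ (p = m -> False)).
      { intros p Hp. assert (U : unp p).
        { destruct Hp as [(r & Hr & ->)|(r & Hr & ->)]; [left|right]; exists r; (split; [destruct take; lia|reflexivity]). }
        split; [assumption|]. split; [apply Hmin; assumption|]. intros ->. unfold m in Hp. destruct take.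
        - destruct Hp as [(r & Hr & E)|(r & Hr & E)].
          + apply (lexlt_irrefl f (SS r)). rewrite <- E at 1. apply HSA; lia.
          + destruct (HA (a0 + u)) as [_ N]; [lia|]. rewrite E in N. apply N. apply H30.
        - destruct Hp as [(r & Hr & E)|(r & Hr & E)].
          + destruct (HA r) as [_ N]; [lia|]. rewrite <- E in N. apply N. apply H30.
          + apply (lexlt_irrefl f (3 * PA r)). rewrite <- E at 1. apply HSB; lia. }
      assert (Hpm : forall p, proc p -> p =? m = false).
      { intros p Hp. apply Nat.eqb_neq. intros ->. apply (lexlt_irrefl f m). apply I8; assumption. }
      split; [|split].
      - intros p Hp. destruct (Hproc p Hp) as [->|Hp'].
        + rewrite Nat.eqb_refl. lia.
        + rewrite Hpm by assumption. specialize (I6 p Hp'). lia.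
      - intros p q Hp Hq Hpq. destruct (Hproc p Hp) as [->|Hp'], (Hproc q Hq) as [->|Hq'].
        + exfalso. eapply lexlt_irrefl; eauto.
        + exfalso. apply (lexlt_asym f m q Hpq). apply I8; assumption.
        + rewrite Hpm, Nat.eqb_refl by assumption. specialize (I6 p Hp'). lia.
        + rewrite !Hpm by assumption. apply I7; assumption.
      - intros p q Hp Hq. destruct (Hunp q Hq) as (U1 & U2 & U3). destruct (Hproc p Hp) as [->|Hp'].
        + destruct U2 as [U2|U2]; [contradiction|assumption].
        + auto. }
    assert (TA : (v < n1 -> a0 + u < L2 -> lexlt f (SS (a0 + u)) (3 * PA v)) -> a0 + u < L2 ->
       forall q, unp q -> q = SS (a0 + u) \/ lexlt f (SS (a0 + u)) q).
    { intros H Hu q [(r & Hr & ->)|(r & Hr & ->)].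
      - destruct (Nat.eq_dec r (a0 + u)) as [->|]; [left; reflexivity|]. right. apply HSA; lia.
      - right. specialize (H ltac:(lia) Hu). destruct (Nat.eq_dec r v) as [->|]; [assumption|].
        eapply lexlt_trans; [exact H|]. apply HSB; lia. }
    assert (TB : (v < n1 -> a0 + u < L2 -> lexlt f (3 * PA v) (SS (a0 + u))) -> v < n1 ->
       forall q, unp q -> q = 3 * PA v \/ lexlt f (3 * PA v) q).
    { intros H Hu q [(r & Hr & ->)|(r & Hr & ->)].
      - right. specialize (H Hu ltac:(lia)). destruct (Nat.eq_dec r (a0 + u)) as [->|]; [assumption|].
        eapply lexlt_trans; [exact H|]. apply HSA; lia.
      - destruct (Nat.eq_dec r v) as [->|]; [left; reflexivity|]. right. apply HSB; lia. }
    cond_is (negb (v <? n1)); [xs; rewrite E1, I2; reflexivity|].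
    destruct (Nat.ltb_spec v n1) as [Cv|Cv]; cbn [negb].
    + pose proof (HB v Cv) as Bv. cond_is (negb (a0 + u <? L2)); [xs; rewrite E2, I1; reflexivity|].
      destruct (Nat.ltb_spec (a0 + u) L2) as [Cu|Cu]; cbn [negb].
      * pose proof (HA (a0 + u) ltac:(lia)) as [Bu Mu]. set (i := SS (a0 + u)) in *. set (j := 3 * PA v) in *.
        assert (HL01 : exists b : bool, evalb (tick (tick (sem (vjj ::= #3 * aPA.[!b1])%c
             (sem (vii ::= aSS.[!a1])%c (tick s1))))) lessb = b /\
             (b = true <-> lexlt f i j)).
        { eexists. split; [reflexivity|].
          unfold lessb, BOr. xs. rewrite I1, I2. ev. rewrite E5, E6. fold i. ev. fold j. rewrite E3.
          assert (A1' : forall a b, off + a + b = off + (a + b)) by (intros; lia).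
          rewrite !A1', !E4, !E7 by lia. destruct (Nat.eqb_spec (i mod 3) 1) as [M1|M1].
          - rewrite <- (cmp1 f L sr Hsr i j M1 (H30 _) Bu Bv). clearbody i j.
            destruct (Nat.ltb_spec (f i) (f j)), (Nat.eqb_spec (f i) (f j)),
              (Nat.ltb_spec (sr (i + 1)) (sr (j + 1))); cbn; split; intros; try lia; try discriminate; auto.
          - assert (M2 : i mod 3 = 2) by (destruct (mod3 i) as [Z|[Z|Z]]; [contradiction|contradiction|exact Z]).
            rewrite <- (cmp2 f L Hf sr Hsr i j M2 (H30 _) Bu Bv). clearbody i j.
            destruct (Nat.ltb_spec (f i) (f j)), (Nat.eqb_spec (f i) (f j)),
              (Nat.ltb_spec (sr (i + 2)) (sr (j + 2))), (Nat.ltb_spec (f (i + 1)) (f (j + 1))),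
              (Nat.eqb_spec (f (i + 1)) (f (j + 1))); cbn; split; intros; try lia; try discriminate; auto. }
        destruct HL01 as (b & Eb & Hb). cond_is b; [exact Eb|]. destruct b.
        -- xs. rewrite Hi, I1, I2, E5. ev.
           destruct (STEP true) as (u' & v' & Z1 & Z2 & Z3 & Z4 & Z5 & Z6 & Z7 & Z8).
           { split; [assumption|]. apply TA; auto. intros _ _. apply Hb. reflexivity. }
           exists u', v'. do 5 (split; [lia|]). split; [exact Z6|split; [exact Z7|split; [exact Z8|lia]]].
        -- xs. rewrite Hi, I1, I2, E6. ev.
           destruct (STEP false) as (u' & v' & Z1 & Z2 & Z3 & Z4 & Z5 & Z6 & Z7 & Z8).
           { split; [assumption|]. apply TB; auto. intros _ _. apply (lexlt_lt f L); auto.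
             - intros E. apply Mu. rewrite <- E. apply H30.
             - intros C. apply Hb in C. discriminate. }
           exists u', v'. do 5 (split; [lia|]). split; [exact Z6|split; [exact Z7|split; [exact Z8|lia]]].
      * xs. rewrite Hi, I1, I2, E6. ev. destruct (STEP false) as (u' & v' & Z1 & Z2 & Z3 & Z4 & Z5 & Z6 & Z7 & Z8).
        { split; [assumption|]. apply TB; auto. intros; lia. }
        exists u', v'. do 5 (split; [lia|]). split; [exact Z6|split; [exact Z7|split; [exact Z8|lia]]].
    + assert (Cu : a0 + u < L2) by lia. pose proof (HA (a0 + u) ltac:(lia)) as [Bu Mu].
      xs. rewrite Hi, I1, I2, E5. ev. destruct (STEP true) as (u' & v' & Z1 & Z2 & Z3 & Z4 & Z5 & Z6 & Z7 & Z8).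
      { split; [assumption|]. apply TA; auto. intros; lia. }
      exists u', v'. do 5 (split; [lia|]). split; [exact Z6|split; [exact Z7|split; [exact Z8|lia]]].
  - destruct R as (u & v & R1 & R2 & R3 & R4 & R5 & R6 & R7 & R8 & R9).
    assert (a0 + u = L2) by lia. assert (Ev : v = n1) by lia. clear R2. subst v.
    assert (HP : forall p, p < L -> (exists r, a0 <= r < a0 + u /\ p = SS r) \/
       (exists r, r < n1 /\ p = 3 * PA r)).
    { intros p Hp. rewrite H. apply Hall. assumption. }
    split; [|assumption]. split.
    + auto.
    + auto.
Qed.

Lemma up_skip_ok s L : sc s vL = L -> sc s a1 = 0 ->
  sc (sem up_skip s) a1 = (if L mod 3 =? 1 then 1 else 0) /\
  tk (sem up_skip s) <= tk s + 3.
Proof.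
  intros HL Ha. unfold up_skip. cond_is (L mod 3 =? 1).
  - xs. rewrite HL. reflexivity.
  - destruct (L mod 3 =? 1); xs; split; auto; lia.
Qed.

Definition level_ranks (s : state) (k : nat) : Prop :=
  ranks (lv s k) (ar s aLN k) (ar s aRK).

Lemma up_ok s h L off :
  sc s vh = h + 1 -> ar s aLN (h + 1) = red L -> ar s aLN h = L -> ar s aOF h = off ->
  2 <= L -> h + 1 < Q -> off + 12 * L < Q ->
  level_ok s h -> level_ok s (h + 1) -> names_ok (lv s h) (lv s (h + 1)) L ->
  level_ranks s (h + 1) ->
  let s' := sem UP s in
  sc s' vh = h /\ level_ranks s' h /\ tk s' <= tk s + 500 * L.
Proof.
  intros Hh HLN1 HLN HOF H2 HhQ HQ Hlev Hlev1 Hnames Hrk s'. subst s'. unfold UP. rewrite !sem_seq.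
  pose proof (red_bounds L H2) as (RB1 & RB2 & _ & RB3). assert (Hn1 : (L + 2) / 3 <= red L) by (unfold red; lia).
  pose proof (spos_le L) as Hpos. fold (red L) in Hpos.
  pose proof (level_str s h Hlev) as Hstr. rewrite HLN in Hstr.
  pose proof (level_str s (h + 1) Hlev1) as Hstr1. rewrite HLN1 in Hstr1.
  assert (Hraw : forall i, i < L + 3 -> ar s aLV (off + i) = lv s h i).
  { intros i Hi. rewrite <- HOF. apply level_raw; auto. lia. }
  assert (Hfb : forall i, i < L + 3 -> lv s h i <= L + 3).
  { intros i Hi. unfold lv. destruct (Nat.ltb_spec i (ar s aLN h)); [|lia].
    destruct Hlev as [A _]. specialize (A i H). lia. }
  unfold level_ranks in *. rewrite HLN1 in Hrk.
  pose (f := lv s h). pose (f' := lv s (h + 1)). pose (rk := ar s aRK).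
  fold f in Hstr, Hraw, Hnames, Hfb. fold f' in Hstr1, Hnames, Hrk. fold rk in Hrk.
  assert (Ef : forall s1, agree UP s s1 -> ranks f L (ar s1 aRK) ->
     ranks (lv s1 h) (ar s1 aLN h) (ar s1 aRK)).
  { intros s1 F R. frall. rewrite HLN. destruct R as [R1 R2]. split; [assumption|].
    intros i j Hi Hj (l & El & Ll). apply R2; auto.
    assert (EE : forall z, lv s1 h z = f z) by (intros z; unfold lv, f; frall; reflexivity).
    exists l. split; [intros x Hx; rewrite <- !EE; apply El; assumption|]. rewrite <- !EE. assumption. }
  pose proof (agree_sem UP s) as FU. unfold UP in FU at 2. rewrite !sem_seq in FU.
  assert (Hrkinj : forall x y, x < red L -> y < red L -> rk x = rk y -> x = y)
    by (intros; eapply ranks_inj; eauto).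
  assert (Hrksurj : forall r, 1 <= r <= red L -> exists x, x < red L /\ rk x = r)
    by (intros; eapply ranks_surj; eauto).
  assert (Erk : forall x, ar s aRK x = rk x) by reflexivity.
  assert (Hrkb : forall x, x < red L -> 1 <= rk x <= red L) by (apply Hrk).
  clearbody f f' rk. remember ((L + 2) / 3) as n1 eqn:En1.
  destruct (up_pre_ok s h L off (red L) Hh HLN1 HLN HOF) as
    (A1 & A2 & A3 & A4 & A5 & A6 & A7 & A8 & A9 & A10 & T1); try lia.
  rewrite <- En1 in *. run (sem up_pre s) as s1 F1. destruct (up_clear_ok s1 L A4 ltac:(lia)) as (B1 & T2).
  run (sem up_clear s1) as s2 F2.
  destruct (up_samp_ok s2 L (red L) n1 rk) as (C1 & C2 & C3 & T3); auto; try (frall; auto; lia).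
  { intros x. frall. apply Erk. }
  run (sem up_samp s2) as s3 F3.
  destruct (up_zero_ok s3 L (red L) n1 rk) as (D1 & D2 & T4); auto; try (frall; auto; lia).
  run (sem up_zero s3) as s4 F4. assert (H3n : 3 * n1 <= L + 2).
  { rewrite En1. pose proof (Nat.div_mod_eq (L + 2) 3). lia. }
  destruct (up_key_ok s4 L n1 off) as (E1 & T5); auto; try (frall; auto; lia). run (sem up_key s4) as s5 F5.
  assert (K5 : forall y, y < n1 -> ar s5 aKEY y = f (3 * y)).
  { intros y Hy. rewrite E1 by assumption. frall. apply Hraw. lia. }
  assert (P5 : forall r, ar s5 aPA r = ar s4 aPA r) by (intros; frall; reflexivity).
  destruct (pass_sorts s5 n1 (L + 4) (fun a b => rk a < rk b))
    as (G1 & G2 & G3 & T6); try (frall; auto; lia).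
  { intros r Hr. rewrite P5. specialize (D1 r Hr). lia. }
  { intros r Hr. rewrite P5, K5 by auto. specialize (D1 r Hr). specialize (Hfb (3 * ar s4 aPA r) ltac:(lia)). lia. }
  { intros r r' Hr Hr'. rewrite !P5. auto. }
  run (sem PASS s5) as s6 F6. assert (P6 : forall r, r < n1 -> ar s6 aPA r < n1).
  { intros r Hr. destruct (G2 r Hr) as (r' & Hr' & ->). rewrite P5. auto. }
  destruct (up_skip_ok s6 L) as (S1 & T7); try (frall; auto; lia). run (sem up_skip s6) as s7 F7.
  pose (sr := fun p => if p <? L + 3 then ar s3 aSR p else 0).
  assert (Hsr1 : forall x, x < red L -> sr (spos n1 x) = rk x).
  { intros x Hx. unfold sr. specialize (Hpos x Hx). destruct (Nat.ltb_spec (spos n1 x) (L + 3)); auto. lia. }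
  assert (Hsr0 : forall p, (forall x, x < red L -> p <> spos n1 x) -> sr p = 0).
  { intros p Hp. unfold sr. destruct (Nat.ltb_spec p (L + 3)); auto. }
  assert (Esr : forall p, p < L + 3 -> ar s3 aSR p = sr p).
  { intros p Hp. unfold sr. destruct (Nat.ltb_spec p (L + 3)); auto. lia. }
  clearbody sr. assert (Hsr : forall p q, p mod 3 <> 0 -> q mod 3 <> 0 -> p < L \/ q < L ->
     (sr p < sr q <-> lexlt f p q)).
  { apply (sample_rank f f' L rk sr); auto; rewrite <- En1; auto. }
  assert (H30 : forall y, (3 * y) mod 3 = 0) by (intros y; rewrite Nat.mul_comm; apply Nat.Div0.mod_mul).
  assert (Hspm : forall x, spos n1 x mod 3 <> 0).
  { intros x. unfold spos. destruct (x <? n1); rewrite Nat.add_comm, Nat.mul_comm, Nat.Div0.mod_add; cbn; lia. }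
  assert (Hlex : forall x y, x < red L -> y < red L -> rk x < rk y -> lexlt f (spos n1 x) (spos n1 y)).
  { intros x y Hx Hy Hlt. rewrite En1. rewrite <- (reduce_iff f f' L Hstr Hstr1 Hnames x y Hx Hy).
    apply (ranks_iff f' (red L) rk); assumption. }
  assert (HSS7 : forall x, x < red L -> ar s7 aSS (rk x - 1) = spos n1 x).
  { intros x Hx. frall. apply C1. assumption. }
  assert (Hdiv : L = 3 * (L / 3) + L mod 3 /\ L mod 3 < 3 /\ n1 = L / 3 + (if L mod 3 =? 0 then 0 else 1)).
  { rewrite En1. destruct (div3 L) as (a & r & E & Hr & E1' & E2'). rewrite E1', E2'.
    assert (L mod 3 = r) as -> by (rewrite E, Nat.add_comm, Nat.mul_comm, Nat.Div0.mod_add; apply Nat.mod_small; assumption).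
    lia. }
  destruct Hdiv as (V1 & V2 & V3).
  (* The suffix at [L] is all padding, so no suffix can be smaller. *)
  assert (Hdummy : L mod 3 = 1 -> forall x, x < red L -> spos n1 x = L -> rk x = 1).
  { intros M1 x Hx Ex. destruct (Nat.eq_dec (rk x) 1) as [|Hne]; auto. exfalso.
    destruct (Hrksurj 1 ltac:(lia)) as (y & Hy & Ry).
    pose proof (Hlex y x Hy Hx ltac:(specialize (Hrkb x Hx); lia)) as HL. rewrite Ex in HL.
    destruct HL as (l & _ & Hl). destruct Hstr as [_ Z]. rewrite (Z (L + l)) in Hl by lia. lia. }
  assert (Hdummy2 : L mod 3 = 1 -> n1 - 1 < red L /\ spos n1 (n1 - 1) = L).
  { intros M1. destruct (Nat.eqb_spec (L mod 3) 0); [lia|]. split; [lia|]. unfold spos.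
    destruct (Nat.ltb_spec (n1 - 1) n1); lia. }
  assert (HnotL : L mod 3 <> 1 -> forall x, x < red L -> spos n1 x <> L).
  { intros M1 x Hx. unfold spos. assert (Ered : red L = n1 + L / 3) by (unfold red; rewrite <- En1; reflexivity).
    destruct (Nat.ltb_spec x n1); destruct (Nat.eqb_spec (L mod 3) 0); try lia. }
  set (a0 := if L mod 3 =? 1 then 1 else 0) in *.
  destruct (up_merge_ok s7 L n1 off (red L) a0 f (ar s7 aSS) (ar s7 aPA) sr) as (R & T8); auto;
    try (frall; auto; lia).
  - unfold a0. destruct (L mod 3 =? 1); lia.
  - unfold a0. unfold red. rewrite <- En1. destruct (Nat.eqb_spec (L mod 3) 1), (Nat.eqb_spec (L mod 3) 0); lia.
  - intros i Hi. frall. auto.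
  - intros p Hp. frall. auto.
  - intros r Hr. destruct (Hrksurj (r + 1) ltac:(lia)) as (x & Hx & Rx).
    replace r with (rk x - 1) by lia. rewrite HSS7 by assumption. split; [|apply Hspm].
    specialize (Hpos x Hx). destruct (Nat.eq_dec (spos n1 x) L) as [E|E]; [|lia]. exfalso.
    unfold a0 in Hr. destruct (Nat.eqb_spec (L mod 3) 1) as [M1|M1].
    + specialize (Hdummy M1 x Hx E). lia.
    + apply (HnotL M1 x Hx E).
  - intros r Hr. frall. specialize (P6 r Hr). lia.
  - intros r r' Hr Hrr Hr'. destruct (Hrksurj (r + 1) ltac:(lia)) as (x & Hx & Rx).
    destruct (Hrksurj (r' + 1) ltac:(lia)) as (y & Hy & Ry).
    replace r with (rk x - 1) by lia. replace r' with (rk y - 1) by lia.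
    rewrite !HSS7 by assumption. apply Hlex; auto. lia.
  - intros r r' Hr Hr'. frall. specialize (G1 r r' Hr Hr'). cbv zeta in G1. rewrite !K5 in G1 by (apply P6; lia).
    pose proof (P6 r ltac:(lia)) as Q1. pose proof (P6 r' Hr') as Q2.
    set (x := ar s6 aPA r) in *. set (y := ar s6 aPA r') in *. assert (HN : x <> y).
    { intros E. rewrite E in G1. lia. }
    apply (cmp0 f L sr Hsr); auto; try lia. assert (ES : forall z, z < n1 -> sr (3 * z + 1) = rk z).
    { intros z Hz. rewrite <- (Hsr1 z) by lia. f_equal. unfold spos. destruct (Nat.ltb_spec z n1); lia. }
    rewrite !ES by assumption. exact G1.
  - intros p Hp. pose proof (Nat.div_mod_eq p 3) as DM. pose proof (Nat.mod_upper_bound p 3 ltac:(lia)).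
    destruct (Nat.eq_dec (p mod 3) 0) as [M0|M0].
    + right. assert (INJ : forall i j, i < n1 -> j < n1 -> ar s7 aPA i = ar s7 aPA j -> i = j).
      { intros i j Hii Hj. frall. intros E. destruct (Nat.lt_trichotomy i j) as [C|[C|C]]; auto.
        - specialize (G1 i j C Hj). cbv zeta in G1. rewrite E in G1. lia.
        - specialize (G1 j i C Hii). cbv zeta in G1. rewrite E in G1. lia. }
      destruct (inj_surj (ar s7 aPA) n1) with (y := p / 3) as (r & Hr & Er); auto.
      * intros i Hii. frall. auto.
      * destruct (Nat.eqb_spec (L mod 3) 0); lia.
      * exists r. lia.
    + left. assert (exists x, x < red L /\ spos n1 x = p) as (x & Hx & Ex).
      { assert (Ered : red L = n1 + L / 3) by (unfold red; rewrite <- En1; reflexivity).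
        assert (D : p mod 3 = 1 \/ p mod 3 = 2) by lia. destruct D as [D|D].
        - exists (p / 3). unfold spos. destruct (Nat.eqb_spec (L mod 3) 0), (Nat.ltb_spec (p / 3) n1); lia.
        - exists (n1 + p / 3). unfold spos. destruct (Nat.ltb_spec (n1 + p / 3) n1); [lia|]. lia. }
      exists (rk x - 1). rewrite HSS7 by assumption. specialize (Hrkb x Hx).
      destruct (Nat.eqb_spec (L mod 3) 1) as [M1|M1]; [|lia]. destruct (Nat.eq_dec (rk x) 1) as [R1|R1]; [|lia].
      destruct (Hdummy2 M1) as [Hz Ez]. pose proof (Hdummy M1 _ Hz Ez) as R1'.
      assert (x = n1 - 1) by (apply Hrkinj; auto; lia). subst x. lia.
  - run (sem up_merge s7) as s8 F8. split; [frall; assumption|]. split.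
    + auto.
    + lia.
Qed.

(** * The whole recursion, level by level *)

Definition suf_init : cmd :=
  (CSto aLV (!vN) #0 ;; CSto aLV (!vN + #1) #0 ;; CSto aLV (!vN + #2) #0 ;;
   vh ::= #0 ;; voff ::= #0 ;; vL ::= !vN ;; CSto aOF #0 #0 ;; CSto aLN #0 (!vN))%c.
(** The length drops at each level, so [vN] rounds reach a string of length 1; the remaining rounds
    are idle and cost a constant each. *)
Definition suf_down : cmd := CRep (!vN) (CIf (#1 <? !vL) DOWN CSkip).
Definition suf_up : cmd := CRep (!vh) UP.
Definition SUFSORT : cmd := (suf_init ;; suf_down ;; CSto aRK #0 #1 ;; suf_up)%c.

Definition levels (s : state) (N h : nat) : Prop :=
  ar s aLN 0 = N /\ ar s aOF 0 = 0 /\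
  (forall j, j <= h -> level_ok s j /\ ar s aOF j + 12 * ar s aLN j <= 12 * N) /\
  (forall j, j < h -> names_ok (lv s j) (lv s (j + 1)) (ar s aLN j) /\
     ar s aLN (j + 1) = red (ar s aLN j) /\ 2 <= ar s aLN j).

Lemma suf_down_ok s N :
  sc s vN = N -> 1 <= N -> 12 * N + 10 < Q ->
  sc s vh = 0 -> sc s voff = 0 -> sc s vL = N -> ar s aOF 0 = 0 -> ar s aLN 0 = N ->
  level_ok s 0 ->
  let s' := sem suf_down s in
  exists h, sc s' vh = h /\ h <= N /\ ar s' aLN h = 1 /\ levels s' N h /\
    (forall i, i < N + 3 -> ar s' aLV i = ar s aLV i) /\ tk s' <= tk s + 2100 * N + 10.
Proof.
  intros HN HN1 HNQ Hh Hoff HL HOF HLN Hlev s'.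
  (* A level of length [L] costs [500 * L <= 2000 * (L - red L)] by [red_bounds], so the total
     telescopes to [2000 * (N - L)]. *)
  pose proof (rep_ind (fun k s' => exists h L off, sc s' vh = h /\ sc s' vL = L /\
    sc s' voff = off /\ ar s' aLN h = L /\ ar s' aOF h = off /\ 1 <= L /\ (L = 1 \/ L + k <= N) /\
    h + L <= N /\ levels s' N h /\
    (forall j, j <= h -> ar s' aOF j + ar s' aLN j <= off + L) /\
    (forall i, i < N + 3 -> ar s' aLV i = ar s aLV i) /\
    tk s' <= tk s + 2 * k + 2000 * (N - L) + 5) (!vN)%e (CIf (#1 <? !vL) DOWN CSkip) s) as R.
  cbn [eval] in R. fold suf_down in R. fold s' in R.
  destruct R as (h & L & off & R1 & R2 & R3 & R4 & R5 & R6 & R7 & R8 & R9 & R10 & R11 & R12).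
  - exists 0, N, 0. xs. do 8 (split; [auto; lia|]). split; [|split; [|split]].
    + do 2 (split; [assumption|]). split; intros j Hj; [|lia].
      replace j with 0 by lia. split; [exact Hlev|]. xs. lia.
    + intros j Hj. replace j with 0 by lia. lia.
    + auto.
    + lia.
  - intros k s1 Hk F (h & L & off & I1 & I2 & I3 & I4 & I5 & I6 & I7 & I8 & I9 & I10 & I11 & I12).
    destruct I9 as (J1 & J2 & J3 & J4). cond_is (1 <? L); [xs; rewrite I2; reflexivity|].
    destruct (Nat.ltb_spec 1 L) as [CL|CL].
    + destruct (J3 h (le_n _)) as [K1 K2]. assert (D : level_ok (tick (tick s1)) h). { exact K1. }
      pose proof (down_ok (tick (tick s1)) h L off I1 I2 I3 CL I4 I5 D ltac:(lia) ltac:(lia)) as Z.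
      set (s2 := sem DOWN (tick (tick s1))) in *.
      destruct Z as (Z1 & Z2 & Z3 & Z4 & Z5 & Z6 & Z7 & Z8 & Z9). cbn [tick ar tk] in Z4, Z5, Z6, Z9.
      pose proof (red_bounds L CL) as (RB1 & RB2 & RB3 & RB4).
      assert (ELN : forall j, j <= h -> ar s2 aLN j = ar s1 aLN j).
      { intros j Hj. rewrite Z4. destruct (Nat.eqb_spec j (h + 1)); [lia|reflexivity]. }
      assert (EOF' : forall j, j <= h -> ar s2 aOF j = ar s1 aOF j).
      { intros j Hj. rewrite Z5. destruct (Nat.eqb_spec j (h + 1)); [lia|reflexivity]. }
      assert (ELV : forall j i, j <= h -> i < ar s1 aLN j + 3 ->
         ar s2 aLV (ar s1 aOF j + i) = ar s1 aLV (ar s1 aOF j + i)).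
      { intros j i Hj Hi. apply Z6. specialize (I10 j Hj). lia. }
      assert (Elv : forall j z, j <= h -> lv s1 j z = lv s2 j z).
      { intros j z Hj. unfold lv. rewrite ELN, EOF' by assumption.
        destruct (Nat.ltb_spec z (ar s1 aLN j)); [|reflexivity]. rewrite ELV by lia. reflexivity. }
      exists (h + 1), (red L), (off + L + 3). do 3 (split; [assumption|]).
      split; [rewrite Z4, Nat.eqb_refl; reflexivity|]. split; [rewrite Z5, Nat.eqb_refl; reflexivity|].
      do 3 (split; [lia|]). split; [|split; [|split]].
      * split; [rewrite ELN by lia; assumption|]. split; [rewrite EOF' by lia; assumption|]. split.
        -- intros j Hj. destruct (Nat.eq_dec j (h + 1)) as [->|].
           ++ split; [assumption|]. rewrite Z4, Z5, Nat.eqb_refl. lia.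
           ++ destruct (J3 j ltac:(lia)) as [[W1 W2] W3]. split.
              ** split; rewrite ELN, EOF' by lia.
                 --- intros i Hi. rewrite ELV by lia. apply W1. assumption.
                 --- intros i Hi. rewrite <- Nat.add_assoc, ELV by lia.
                     rewrite Nat.add_assoc. apply W2. assumption.
              ** rewrite ELN, EOF' by lia. assumption.
        -- intros j Hj. destruct (Nat.eq_dec j h) as [->|].
           ++ rewrite ELN, I4 by lia. split; [|split].
              ** eapply names_ok_ext; [| |exact Z8].
                 --- eauto.
                 --- lia.
              ** rewrite Z4, Nat.eqb_refl. reflexivity.
              ** lia.
           ++ destruct (J4 j ltac:(lia)) as (W1 & W2 & W3). rewrite !ELN by lia. split; [|split]; auto.
              eapply names_ok_ext; [| |exact W1]; intros z; apply Elv; lia.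
      * intros j Hj. destruct (Nat.eq_dec j (h + 1)) as [->|].
        -- rewrite Z4, Z5, Nat.eqb_refl. lia.
        -- rewrite ELN, EOF' by lia. specialize (I10 j ltac:(lia)). lia.
      * intros i Hi. rewrite Z6; [apply I11; assumption|]. specialize (I10 0 ltac:(lia)). lia.
      * lia.
    + exists h, L, off. xs. do 6 (split; [assumption|]). split; [lia|]. split; [assumption|].
      split; [exact (conj J1 (conj J2 (conj J3 J4)))|]. do 2 (split; [assumption|]). lia.
  - exists h. split; [assumption|]. do 2 (split; [lia|]). do 2 (split; [assumption|]). lia.
Qed.

Lemma suf_up_ok s N h :
  sc s vh = h -> h <= N -> 12 * N + 10 < Q -> ar s aLN h = 1 -> levels s N h ->
  ar s aRK 0 = 1 ->
  let s' := sem suf_up s in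
  ranks (lv s 0) N (ar s' aRK) /\ tk s' <= tk s + 2100 * N + 2100.
Proof.
  intros Hh HhN HNQ HLN Hlev HRK s'. destruct Hlev as (J1 & J2 & J3 & J4).
  pose proof (rep_ind (fun k s' => sc s' vh = h - k /\
    ranks (lv s (h - k)) (ar s aLN (h - k)) (ar s' aRK) /\
    tk s' <= tk s + 2 * k + 2000 * ar s aLN (h - k) + 5) (!vh)%e UP s) as R.
  cbn [eval] in R. rewrite Hh in R. fold suf_up in R. fold s' in R. destruct R as (R1 & R2 & R3).
  - xs. rewrite Nat.sub_0_r. split; [assumption|]. split; [|lia]. split.
    + intros i Hi. replace i with 0 by lia. lia.
    + intros i j Hi Hj L. exfalso. replace i with j in L by lia. eapply lexlt_irrefl; eauto.
  - intros k s1 Hk F (I1 & I2 & I3).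
    set (j := h - S k). assert (Ej : h - k = j + 1) by (unfold j; lia). rewrite Ej in *.
    destruct (J4 j ltac:(lia)) as (W1 & W2 & W3).
    destruct (J3 j ltac:(lia)) as (V1 & V2). destruct (J3 (j + 1) ltac:(lia)) as (V3 & V4).
    pose proof (red_bounds _ W3) as (RB1 & RB2 & RB3 & RB4).
    assert (ELN : forall i, ar s1 aLN i = ar s aLN i) by (intros; frall; reflexivity).
    assert (EOF' : forall i, ar s1 aOF i = ar s aOF i) by (intros; frall; reflexivity).
    assert (ELV : forall i, ar s1 aLV i = ar s aLV i) by (intros; frall; reflexivity).
    assert (Elv : forall i z, lv s1 i z = lv s i z).
    { intros i z. unfold lv. rewrite ELN, EOF', ELV. reflexivity. }
    assert (Elok : forall i, level_ok s i -> level_ok (tick s1) i).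
    { intros i [A B]. split; xs.
      - rewrite ELN, EOF'. intros x Hx. rewrite ELV. apply A; assumption.
      - rewrite ELN, EOF'. intros x Hx. rewrite ELV. apply B; assumption. }
    pose proof (up_ok (tick s1) j (ar s aLN j) (ar s aOF j)) as Z. run (sem UP (tick s1)) as s2 FU.
    destruct Z as (Z1 & Z2 & Z3); auto; xs; rewrite ?ELN, ?EOF'; auto; try lia.
    + eapply names_ok_ext; [| |exact W1]; intros z; symmetry; apply (Elv _ z).
    + unfold level_ranks. xs. rewrite ELN.
      eapply ranks_ext; [| |exact I2]; [intros z; symmetry; apply (Elv _ z)|reflexivity].
    + split; [assumption|]. split.
      * unfold level_ranks in Z2. assert (E1 : ar s2 aLN j = ar s aLN j) by (frall; xs; apply ELN).
        rewrite E1 in Z2. eapply ranks_ext; [| |exact Z2]; [|reflexivity].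
        intros z. unfold lv. frall. rewrite !ar_tick. frall. reflexivity.
      * cbn [tick tk] in Z3. lia.
  - replace (h - h) with 0 in * by lia. rewrite J1 in *. split; [assumption|]. lia.
Qed.

Lemma sufsort_ok s N :
  sc s vN = N -> 1 <= N -> 12 * N + 10 < Q ->
  (forall i, i < N -> 1 <= ar s aLV i <= N + 3) ->
  let s' := sem SUFSORT s in
  ranks (fun i => if i <? N then ar s aLV i else 0) N (ar s' aRK) /\
  (forall i, i < N -> ar s' aLV i = ar s aLV i) /\ ar s' aLV N = 0 /\ tk s' <= tk s + 4300 * N + 2200.
Proof.
  intros HN HN1 HNQ HLV s'. subst s'. unfold SUFSORT. rewrite !sem_seq.
  assert (A : let s1 := sem suf_init s in sc s1 vh = 0 /\ sc s1 voff = 0 /\ sc s1 vL = N /\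
     sc s1 vN = N /\
     ar s1 aOF 0 = 0 /\ ar s1 aLN 0 = N /\ (forall i, i < N -> ar s1 aLV i = ar s aLV i) /\
     (forall i, i < 3 -> ar s1 aLV (N + i) = 0) /\ tk s1 <= tk s + 10).
  { unfold suf_init. xs. rewrite HN. ev. do 6 (split; [auto|]). split; [|split; [|lia]]; intros i Hi.
    - destruct (Nat.eqb_spec i (N + 2)), (Nat.eqb_spec i (N + 1)), (Nat.eqb_spec i N); try lia.
    - destruct (Nat.eqb_spec (N + i) (N + 2)), (Nat.eqb_spec (N + i) (N + 1)),
       (Nat.eqb_spec (N + i) N); lia. }
  set (s1 := sem suf_init s) in *.
  destruct A as (A1 & A2 & A3 & A4 & A5 & A6 & A7 & A8 & A9). assert (Lev : level_ok s1 0).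
  { split; rewrite A5, A6; intros i Hi; cbn [Nat.add]; auto. rewrite A7 by assumption. auto. }
  destruct (suf_down_ok s1 N) as (h & B1 & B2 & B3 & B4 & B5 & B6); auto.
  set (s2 := sem suf_down s1) in *. set (s3 := sem (CSto aRK #0 #1)%c s2).
  assert (C : sc s3 vh = h /\ ar s3 aLN h = 1 /\ levels s3 N h /\ ar s3 aRK 0 = 1 /\
     tk s3 = tk s2 + 1 /\ (forall z, lv s3 0 z = lv s2 0 z) /\ (forall i, ar s3 aLV i = ar s2 aLV i)).
  { unfold s3. xs. ev. do 2 (split; [assumption|]). split; [exact B4|]. split; [reflexivity|]. split; [lia|].
    split; [|reflexivity]. reflexivity. }
  destruct C as (C1 & C2 & C3 & C4 & C5 & C6 & C7). destruct (suf_up_ok s3 N h) as (D1 & D2); auto.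
  run (sem suf_up s3) as s4 FU. split; [|split].
  - eapply ranks_ext; [| |exact D1]; [|reflexivity].
    intros z. rewrite C6. unfold lv. destruct B4 as (E1 & E2 & _). rewrite E1, E2.
    destruct (Nat.ltb_spec z N); [|reflexivity]. rewrite B5, A7 by lia. reflexivity.
  - intros i Hi. frall. rewrite C7, B5, A7 by lia. reflexivity.
  - split; [|lia]. frall. rewrite C7, B5 by lia. specialize (A8 0 ltac:(lia)).
    rewrite Nat.add_0_r in A8. assumption.
Qed.

(** * Longest common prefixes with the nearest marked suffixes *)

Definition nb_init : cmd := For i2 (!vN) (CSto aSA (aRK.[!i2] - #1) (!i2)).
(** A missing neighbour is coded as [vN]: the letter there is the padding 0, so the common prefix
    with it is empty. *)
Definition nb_scan (e : expr) : cmd :=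
  (vlast ::= !vN ;; For i2 (!vN) (x2 ::= aSA.[e] ;;
     CIf (!va <? !x2) (CSto aNB (!x2) (!vlast)) (vlast ::= !x2)))%c.
(** One comparison in the manner of Kasai et al. A match raises [vkh]; a mismatch raises [vki] and
    lowers [vkh] by at most 1. Thus [2 * vki + vkh] grows in every round, and as [vki + vkh] stays
    at most [vN], [2 * vN] rounds finish. Position [i] is recorded at index [vN - i], the length of
    the suffix. *)
Definition kas_body : cmd :=
  (CIf (!vki <? !vN)
    (CIf (aLV.[!vki + !vkh] =? aLV.[aNB.[!vki] + !vkh]) (incr vkh)
       (CIf (aSH.[!vN - !vki] <? !vkh) (CSto aSH (!vN - !vki) (!vkh)) CSkip ;;
        incr vki ;; CIf (#0 <? !vkh) (vkh ::= !vkh - #1) CSkip)) CSkip)%c.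
Definition KAS : cmd := (vki ::= !va + #1 ;; vkh ::= #0 ;; CRep (#2 * !vN) kas_body)%c.

Lemma kas_ok s N a f nb :
  sc s vN = N -> sc s va = a -> a < N -> 3 * N + 3 < Q ->
  (forall i, i <= N -> ar s aLV i = f i) -> (forall i, i < N -> 0 < f i) -> f N = 0 ->
  (forall i, a < i < N -> ar s aNB i = nb i /\ (nb i <= a \/ nb i = N)) ->
  (forall i h, a < i -> i + 1 < N -> eqn f i (nb i) (h + 1) -> eqn f (i + 1) (nb (i + 1)) h) ->
  let s' := sem KAS s in
  (forall i, a < i < N -> exists l, maxl f i (nb i) l /\ ar s' aSH (N - i) = Nat.max (ar s aSH (N - i)) l) /\
  tk s' <= tk s + 20 * N + 10.
Proof.
  intros HN Ha HaN HNQ HLV Hpos HfN HNB Hk2 s'. subst s'. unfold KAS. rewrite !sem_seq.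
  set (s0 := sem (vkh ::= #0)%c (sem (vki ::= !va + #1)%c s)).
  assert (X : sc s0 vki = a + 1 /\ sc s0 vkh = 0 /\ sc s0 vN = N /\ tk s0 = tk s + 2 /\
    (forall k i, ar s0 k i = ar s k i)).
  { unfold s0. xs. ev. repeat split; auto. lia. }
  destruct X as (X1 & X2 & X3 & X4 & X5).
  assert (MX : forall i l, a < i < N -> eqn f i (nb i) l -> i + l <= N /\ nb i + l <= N).
  { intros i l Hi HE. destruct (HNB i Hi) as [_ [C|C]].
    - split.
      + destruct (Nat.le_gt_cases (i + l) N); auto. specialize (HE (N - i) ltac:(lia)).
        replace (i + (N - i)) with N in HE by lia. specialize (Hpos (nb i + (N - i)) ltac:(lia)). lia.
      + destruct (Nat.le_gt_cases (i + l) N); [lia|]. specialize (HE (N - i) ltac:(lia)).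
        replace (i + (N - i)) with N in HE by lia. specialize (Hpos (nb i + (N - i)) ltac:(lia)). lia.
    - destruct l as [|l]; [lia|]. specialize (HE 0 ltac:(lia)).
      rewrite !Nat.add_0_r, C, HfN in HE. specialize (Hpos i ltac:(lia)). lia. }
  pose proof (rep_ind (fun k s' => exists i h, sc s' vki = i /\ sc s' vkh = h /\
    a + 1 <= i <= N /\ (i < N -> eqn f i (nb i) h) /\ (i < N -> 2 * a + 2 + k <= 2 * i + h) /\ h <= N /\
    (forall i', a < i' < i -> exists l, maxl f i' (nb i') l /\
        ar s' aSH (N - i') = Nat.max (ar s aSH (N - i')) l) /\
    (forall i', i <= i' < N -> ar s' aSH (N - i') = ar s aSH (N - i')) /\
    tk s' <= tk s + 10 * k + 3) (#2 * !vN)%e kas_body s0) as R.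
  assert (EV : eval s0 (#2 * !vN)%e = 2 * N) by (xs; rewrite X3; ev; reflexivity).
  rewrite EV in R. destruct R as (i & h & R1 & R2 & R3 & R4 & R5 & R6 & R7 & R8 & R9).
  - exists (a + 1), 0. xs. do 2 (split; [assumption|]). split; [lia|].
    split; [intros _ x Hx; lia|]. do 2 (split; [lia|]). split; [intros; lia|]. split; [intros; apply X5|]. lia.
  - intros k s1 Hk F (i & h & I1 & I2 & I3 & I4 & I5 & I6 & I7 & I8 & I9).
    assert (E1 : sc s1 vN = N) by (frall; assumption).
    assert (E2 : forall j, ar s1 aLV j = ar s aLV j) by (intros; frall; apply X5).
    assert (E3 : forall j, ar s1 aNB j = ar s aNB j) by (intros; frall; apply X5).
    unfold kas_body. cond_is (i <? N); [xs; rewrite I1, E1; reflexivity|]. destruct (Nat.ltb_spec i N) as [Ci|Ci].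
    + specialize (I4 Ci). destruct (HNB i ltac:(lia)) as [N1 N2].
      destruct (MX i h ltac:(lia) I4) as [B1 B2]. cond_is (f (i + h) =? f (nb i + h)).
      { xs. rewrite I1, I2. ev. rewrite E3, N1. ev. rewrite !E2, !HLV by lia. reflexivity. }
 destruct (Nat.eqb_spec (f (i + h)) (f (nb i + h))) as [Cf|Cf].
      * assert (HE : eqn f i (nb i) (h + 1)).
        { intros x Hx. destruct (Nat.eq_dec x h) as [->|]; [assumption|]. apply I4. lia. }
        exists i, (h + 1). xs. rewrite I2. ev. split; [assumption|]. split; [reflexivity|].
        split; [lia|]. split; [auto|]. do 2 (split; [lia|]). do 2 (split; [assumption|]). lia.
      * assert (HMX : maxl f i (nb i) h) by (split; assumption).
        assert (HN' : i + 1 < N -> eqn f (i + 1) (nb (i + 1)) (h - 1)).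
        { intros C. destruct h as [|h]; [intros x Hx; lia|].
          apply Hk2; [lia|assumption|]. intros x Hx. apply I4. lia. }
        assert (HSH : ar s1 aSH (N - i) = ar s aSH (N - i)) by (apply I8; lia).
        assert (POST : forall A T, (forall e, A e = if e =? N - i then Nat.max (ar s1 aSH (N - i)) h else ar s1 aSH e) ->
          T <= tk s1 + 10 ->
          a + 1 <= i + 1 <= N /\ (i + 1 < N -> eqn f (i + 1) (nb (i + 1)) (h - 1)) /\
          (i + 1 < N -> 2 * a + 2 + S k <= 2 * (i + 1) + (h - 1)) /\ h - 1 <= N /\
          (forall i', a < i' < i + 1 -> exists l, maxl f i' (nb i') l /\
            A (N - i') = Nat.max (ar s aSH (N - i')) l) /\
          (forall i', i + 1 <= i' < N -> A (N - i') = ar s aSH (N - i')) /\ T <= tk s + 10 * S k + 3).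
        { intros A T HA HT. split; [lia|]. split; [assumption|]. do 2 (split; [lia|]). split; [|split; [|lia]].
          - intros i' Hi'. destruct (Nat.eq_dec i' i) as [->|].
            + exists h. split; [assumption|]. rewrite HA, Nat.eqb_refl, HSH. reflexivity.
            + destruct (I7 i' ltac:(lia)) as (l & L1 & L2). exists l. split; [assumption|].
              rewrite HA. destruct (Nat.eqb_spec (N - i') (N - i)); [lia|assumption].
          - intros i' Hi'. rewrite HA. destruct (Nat.eqb_spec (N - i') (N - i)); [lia|]. apply I8. lia. }
        cond_is (ar s aSH (N - i) <? h). { xs. rewrite I1, I2, E1. ev. rewrite HSH. reflexivity. }
        destruct (Nat.ltb_spec (ar s aSH (N - i)) h) as [Ch|Ch].
        -- cond_is (0 <? h); [xs; rewrite I2; reflexivity|]. exists (i + 1), (h - 1).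
           destruct (Nat.ltb_spec 0 h) as [C0|C0]; [|lia].
           xs. rewrite I1, I2, E1. ev. do 2 (split; [reflexivity|]).
           apply (POST (fun e => if e =? N - i then h else ar s1 aSH e)); [|lia]. intros e. destruct (Nat.eqb_spec e (N - i)); lia.
        -- cond_is (0 <? h); [xs; rewrite I2; reflexivity|]. exists (i + 1), (h - 1).
           destruct (Nat.ltb_spec 0 h) as [C0|C0].
           ++ xs. rewrite I1, I2. ev. do 2 (split; [reflexivity|]).
              apply (POST (ar s1 aSH)); [|lia]. intros e. destruct (Nat.eqb_spec e (N - i)) as [->|]; lia.
           ++ xs. rewrite I1, I2. ev. split; [reflexivity|]. split; [lia|].
              apply (POST (ar s1 aSH)); [|lia]. intros e. destruct (Nat.eqb_spec e (N - i)) as [->|]; lia.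
    + exists i, h. xs. do 2 (split; [assumption|]). split; [lia|].
      split; [intros; lia|]. split; [intros; lia|]. split; [lia|]. do 2 (split; [assumption|]). lia.
  - assert (i = N).
    { destruct (Nat.eq_dec i N) as [|]; auto. assert (Ci : i < N) by lia.
      destruct (MX i h ltac:(lia) (R4 Ci)). lia. }
    split; [|lia]. intros i' Hi'. apply R7. lia.
Qed.

(* [lt] is the lexicographic order of the suffixes or its converse; [nb] is the closest
   position at most [a] on the side of smaller elements, or [N] if there is none. *)
Definition nearest (lt : nat -> nat -> Prop) (a N i u : nat) : Prop :=
  (u <= a /\ lt u i /\ forall u', u' <= a -> lt u' i -> u' = u \/ lt u' u) \/
  (u = N /\ forall u', u' <= a -> ~ lt u' i).

(** Dropping the first common letter keeps [nb + 1] and [i + 1] in order, with [h] letters in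
    common. Since the letter at [a] occurs nowhere beyond, [nb] is below [a] and [nb + 1] is still
    marked. The nearest marked suffix of [i + 1] lies between the two, so it shares these
    letters. *)
Lemma nearest_step f lt a N i nb nb' h :
  (forall i u, f i = f u -> lt u i -> lt (u + 1) (i + 1)) ->
  (forall x y z h, lt x y -> lt y z -> eqn f x z h -> eqn f y z h) ->
  (forall i, i < N -> 0 < f i) -> f N = 0 -> (forall i, a < i < N -> f a <> f i) ->
  a < i -> i + 1 < N -> nearest lt a N i nb -> nearest lt a N (i + 1) nb' ->
  eqn f i nb (h + 1) -> eqn f (i + 1) nb' h.
Proof.
  intros Htail Hbet Hpos HfN Hsep Hai HiN H1 H2 HE. assert (E0 : f i = f nb).
  { specialize (HE 0 ltac:(lia)). rewrite !Nat.add_0_r in HE. assumption. }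
  destruct H1 as [(U1 & U2 & U3)|(-> & _)].
  2:{ specialize (Hpos i ltac:(lia)). lia. } assert (Hnb : nb < a).
  { destruct (Nat.eq_dec nb a) as [->|]; [|lia]. exfalso. apply (Hsep i); [lia|auto]. }
  pose proof (Htail i nb E0 U2) as T. assert (E1 : eqn f (i + 1) (nb + 1) h).
  { intros x Hx. specialize (HE (x + 1) ltac:(lia)).
    replace (i + 1 + x) with (i + (x + 1)) by lia. replace (nb + 1 + x) with (nb + (x + 1)) by lia. assumption. }
  destruct H2 as [(V1 & V2 & V3)|(_ & V)].
  - destruct (V3 (nb + 1) ltac:(lia) T) as [<-|L]; [assumption|]. assert (eqn f nb' (i + 1) h).
    { apply (Hbet _ _ _ _ L V2). intros x Hx. symmetry. apply E1. assumption. }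
    intros x Hx. symmetry. apply H. assumption.
  - exfalso. apply (V (nb + 1)); [lia|assumption].
Qed.

Lemma nb_init_ok s N f :
  sc s vN = N -> N < Q -> str f N -> ranks f N (ar s aRK) ->
  (forall i, i < N -> ar (sem nb_init s) aSA (ar s aRK i - 1) = i) /\
  tk (sem nb_init s) <= tk s + 5 * N + 5.
Proof.
  intros HN HNQ Hf HR. destruct (for_ind (fun k s' => (forall i, i < k -> ar s' aSA (ar s aRK i - 1) = i) /\
      tk s' <= tk s + 5 * k + 5) i2 (!vN)%e (CSto aSA (aRK.[!i2] - #1) (!i2))%c s N) as [R _]; auto.
  - lia.
  - xs. split; lia.
  - intros k s' Hk F Hi [I1 I2]. destruct HR as [H1 H2]. pose proof (H1 k Hk).
    xs. rewrite Hi. frall. ev. split; [|lia].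
    intros c Hc. destruct (Nat.eqb_spec (ar s aRK c - 1) (ar s aRK k - 1)) as [E|E].
    + pose proof (H1 c ltac:(lia)). apply (ranks_inj f N (ar s aRK)); auto; try lia. split; assumption.
    + apply I1. assert (c <> k) by (intros ->; lia). lia.
Qed.

(** The order [lt] and the traversal [sa] are abstract, so that the lemma serves the upward and the
    downward scan of the suffix array. *)
Lemma nb_scan_ok e s N a lt (sa : nat -> nat) :
  sc s vN = N -> sc s va = a -> N < Q -> a < N ->
  (forall k s', k < N -> sc s' i2 = k -> sc s' vN = N -> (forall i, ar s' aSA i = ar s aSA i) ->
     ar s' aSA (clip Q (eval s' e)) = sa k) ->
  (forall r, r < N -> sa r < N) ->
  (forall r r', r < N -> r' < N -> (lt (sa r) (sa r') <-> r < r')) ->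
  (forall i, i < N -> exists r, r < N /\ sa r = i) ->
  let s' := sem (nb_scan e) s in
  (forall i, a < i < N -> nearest lt a N i (ar s' aNB i)) /\ tk s' <= tk s + 10 * N + 10.
Proof.
  intros HN Ha HNQ HaN He Hsa Hlt Hsurj s'. subst s'. unfold nb_scan. rewrite sem_seq.
  set (s0 := sem (vlast ::= !vN)%c s).
  assert (X : sc s0 vlast = N /\ sc s0 vN = N /\ sc s0 va = a /\ tk s0 = tk s + 1 /\
    (forall k i, ar s0 k i = ar s k i)).
  { repeat split; auto. }
  destruct X as (X1 & X2 & X3 & X4 & X5). destruct (for_ind (fun k s' =>
      (forall r, r < k -> a < sa r -> nearest lt a N (sa r) (ar s' aNB (sa r))) /\
      ((sc s' vlast = N /\ forall r, r < k -> a < sa r) \/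
       (exists r0, r0 < k /\ sc s' vlast = sa r0 /\ sa r0 <= a /\ forall r, r0 < r -> r < k -> a < sa r)) /\
      tk s' <= tk s0 + 10 * k + 5) i2 (!vN)%e (x2 ::= aSA.[e] ;;
     CIf (!va <? !x2) (CSto aNB (!x2) (!vlast)) (vlast ::= !x2))%c s0 N) as [R _]; auto.
  - lia.
  - xs. split; [intros; lia|]. split; [|lia]. left. split; [assumption|]. intros; lia.
  - intros k s1 Hk F Hi (I1 & I2 & I3). assert (E1 : sc s1 va = a) by (frall; assumption).
    assert (E2' : ar (tick s1) aSA (clip Q (eval (tick s1) e)) = sa k).
    { apply He; auto; [xs; frall; assumption|]. intros i. xs. frall. apply X5. }
    pose proof (Hsa k Hk) as Sk. assert (NEW : a < sa k -> nearest lt a N (sa k) (sc s1 vlast)).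
    { destruct I2 as [(J1 & J2)|(r0 & J1 & J2 & J3 & J4)].
      - right. split; [assumption|]. intros u Hu Hl. destruct (Hsurj u ltac:(lia)) as (r & Hr & <-).
        apply Hlt in Hl; auto. specialize (J2 r Hl). lia.
      - left. rewrite J2. split; [assumption|]. split; [apply Hlt; lia|].
        intros u Hu Hl. destruct (Hsurj u ltac:(lia)) as (r & Hr & <-).
        apply Hlt in Hl; auto. destruct (Nat.lt_trichotomy r r0) as [D|[D|D]].
        + right. apply Hlt; lia.
        + auto.
        + specialize (J4 r D Hl). lia. }
    cond_is (a <? sa k). { cbn [sem eval setsc sc evalb Nat.eqb]. rewrite !sc_tick, E1, E2'. reflexivity. }
    destruct (Nat.ltb_spec a (sa k)) as [C|C].
    + cbn [sem eval setsc sc setar ar tk incr Nat.eqb]. rewrite E2'. xs. ev. split; [|split; [|lia]].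
      * intros r Hr Ca. destruct (Nat.eqb_spec (sa r) (sa k)) as [E|E].
        -- rewrite E. apply NEW. assumption.
        -- apply I1; auto. assert (r <> k) by (intros ->; lia). lia.
      * destruct I2 as [(J1 & J2)|(r0 & J1 & J2 & J3 & J4)].
        -- left. split; [assumption|]. intros r Hr. destruct (Nat.eq_dec r k) as [->|]; auto. apply J2. lia.
        -- right. exists r0. split; [lia|]. do 2 (split; [assumption|]).
           intros r Hr Hr'. destruct (Nat.eq_dec r k) as [->|]; auto. apply J4; lia.
    + cbn [sem eval setsc sc setar ar tk incr Nat.eqb]. rewrite E2'. xs. split; [|split; [|lia]].
      * intros r Hr Ca. apply I1; auto. assert (r <> k) by (intros ->; lia). lia.
      * right. exists k. split; [lia|]. split; [reflexivity|]. split; [lia|]. intros; lia.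
  - destruct R as (R1 & R2 & R3). split; [|lia]. intros i Hi.
    destruct (Hsurj i ltac:(lia)) as (r & Hr & <-). apply R1; auto. lia.
Qed.

Definition NEAR : cmd :=
  (nb_init ;; nb_scan (!i2) ;; KAS ;; nb_scan (!vN - #1 - !i2) ;; KAS)%c.

(** The best partner of a suffix is one of its two nearest marked suffixes. Results are combined by
    maximum with the previous contents of [aSH], which thereby accumulates over the chunks of
    [S]. *)
Lemma near_ok s N a f :
  sc s vN = N -> sc s va = a -> a < N -> 3 * N + 3 < Q -> str f N ->
  (forall i, i <= N -> ar s aLV i = f i) -> ranks f N (ar s aRK) ->
  (forall i, a < i < N -> f a <> f i) ->
  let s' := sem NEAR s in
  (forall i, a < i < N ->
    (forall u h, u <= a -> eqn f i u h -> h <= ar s' aSH (N - i)) /\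
    (ar s' aSH (N - i) = ar s aSH (N - i) \/ ar s' aSH (N - i) = 0 \/
       exists u, u <= a /\ eqn f i u (ar s' aSH (N - i))) /\
    ar s aSH (N - i) <= ar s' aSH (N - i)) /\
  tk s' <= tk s + 80 * N + 80.
Proof.
  intros HN Ha HaN HNQ Hstr HLV HR Hsep s'. subst s'. unfold NEAR. rewrite !sem_seq.
  pose proof Hstr as [Hpos Hz]. pose proof HR as [HR1 HR2].
  destruct (nb_init_ok s N f HN ltac:(lia) Hstr HR) as [A1 T1]. run (sem nb_init s) as s1 F1.
  assert (SA1 : forall r, r < N -> ar s1 aSA r < N /\ ar s aRK (ar s1 aSA r) = r + 1).
  { intros r Hr. destruct (ranks_surj f N (ar s aRK) (r + 1) Hstr HR ltac:(lia)) as (i & Hi & Ri).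
    specialize (A1 i Hi). rewrite Ri in A1. replace (r + 1 - 1) with r in A1 by lia. rewrite A1. auto. }
  assert (SA2 : forall r r', r < N -> r' < N -> (lexlt f (ar s1 aSA r) (ar s1 aSA r') <-> r < r')).
  { intros r r' Hr Hr'. destruct (SA1 r Hr) as [U1 U2], (SA1 r' Hr') as [V1 V2].
    rewrite <- (ranks_iff f N (ar s aRK)) by assumption. lia. }
  assert (SA3 : forall i, i < N -> exists r, r < N /\ ar s1 aSA r = i).
  { intros i Hi. specialize (HR1 i Hi). exists (ar s aRK i - 1). split; [lia|]. apply A1. assumption. }
  destruct (nb_scan_ok (!i2)%e s1 N a (lexlt f) (ar s1 aSA)) as [B1 T2];
    try (frall; auto; lia); auto.
  { intros k s' Hk Hi HvN HE. xs. rewrite Hi. ev. apply HE. }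
  { intros r Hr. apply SA1. assumption. }
  run (sem (nb_scan (!i2)%e) s1) as s2 F2.
  assert (TAIL : forall i u, f i = f u -> lexlt f u i -> lexlt f (u + 1) (i + 1)).
  { intros i u E. apply lexlt_tail. auto. }
  assert (NBB : forall lt i u, nearest lt a N i u -> u <= a \/ u = N). { intros lt i u [(U & _)|(U & _)]; auto. }
  destruct (kas_ok s2 N a f (ar s2 aNB)) as [C1 T3]; try (frall; auto; lia); auto. { intros i Hi. frall. auto. }
  { eauto. }
  { intros i h Hi HiN HE. refine (nearest_step f (lexlt f) a N i _ _ h TAIL _ Hpos _ Hsep Hi HiN _ _ HE).
    - intros x y z h' Hxy Hyz Hxz. apply (eqn_between f x y z h' Hxy Hyz Hxz).
    - auto.
    - apply B1. lia.
    - apply B1. lia. }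
  run (sem KAS s2) as s3 F3.
  destruct (nb_scan_ok (!vN - #1 - !i2)%e s3 N a (fun x y => lexlt f y x) (fun r => ar s1 aSA (N - 1 - r)))
    as [D1 T4]; try (frall; auto; lia); auto.
  { intros k s' Hk Hi HvN HE. xs. rewrite Hi, HvN. ev. rewrite HE. frall. reflexivity. }
  { intros r Hr. apply SA1. lia. }
  { intros r r' Hr Hr'. rewrite SA2 by lia. lia. }
  { intros i Hi. destruct (SA3 i Hi) as (r & Hr & Er). exists (N - 1 - r). split; [lia|].
    replace (N - 1 - (N - 1 - r)) with r by lia. assumption. }
  run (sem (nb_scan (!vN - #1 - !i2)%e) s3) as s4 F4.
  destruct (kas_ok s4 N a f (ar s4 aNB)) as [E1 T5]; try (frall; auto; lia); auto. { intros i Hi. frall. auto. }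
  { eauto. }
  { intros i h Hi HiN HE. refine (nearest_step f (fun x y => lexlt f y x) a N i _ _ h _ _ Hpos _ Hsep Hi HiN _ _ HE).
    - auto.
    - intros x y z h' Hxy Hyz Hxz.
      assert (X : eqn f z y h') by (apply (eqn_between f z y x h' Hyz Hxy); intros w Hw; symmetry; auto).
      intros w Hw. symmetry. auto.
    - auto.
    - apply D1. lia.
    - apply D1. lia. }
  set (s5 := sem KAS s4) in *. split; [|lia].
  intros i Hi. destruct (C1 i Hi) as (l & [L1 L2] & L3). destruct (E1 i Hi) as (l' & [L1' L2'] & L3').
  assert (X4 : ar s4 aSH (N - i) = ar s3 aSH (N - i)) by (frall; reflexivity).
  assert (X2 : ar s2 aSH (N - i) = ar s aSH (N - i)) by (frall; reflexivity).
  specialize (B1 i Hi). specialize (D1 i Hi). assert (NX : ar s4 aNB i = ar s4 aNB i) by reflexivity.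
  assert (NN : forall l u, eqn f i u l -> f (i + l) <> f (u + l) -> forall h, eqn f i u h -> h <= l).
  { intros l0 u0 _ Hne h Hh. destruct (Nat.le_gt_cases h l0) as [|C]; auto. exfalso. apply Hne. apply Hh. assumption. }
  assert (Zl : forall l u, eqn f i u l -> u = N -> l = 0).
  { intros l0 u0 He ->. destruct l0; auto. specialize (He 0 ltac:(lia)).
    rewrite !Nat.add_0_r, (Hz N) in He by lia. specialize (Hpos i ltac:(lia)). lia. }
  split; [|split; [|lia]].
  - intros u h Hu HE. destruct (lexlt_total f N u i Hstr) as [C|C]; try lia.
    + destruct B1 as [(U1 & U2 & U3)|(_ & U)]; [|exfalso; apply (U u Hu C)]. assert (EN : eqn f i (ar s2 aNB i) h).
      { destruct (U3 u Hu C) as [<-|L]; [assumption|].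
        destruct (eqn_between f u (ar s2 aNB i) i h L U2) as [_ X]; [intros x Hx; symmetry; auto|].
        intros x Hx. symmetry. auto. }
      specialize (NN l _ L1 L2 h EN). lia.
    + destruct D1 as [(U1 & U2 & U3)|(_ & U)]; [|exfalso; apply (U u Hu C)]. assert (EN : eqn f i (ar s4 aNB i) h).
      { destruct (U3 u Hu C) as [<-|L]; [assumption|].
        destruct (eqn_between f i (ar s4 aNB i) u h U2 L HE) as [X _]. exact X. }
      specialize (NN l' _ L1' L2' h EN). lia.
  - destruct (Nat.eq_dec (ar s5 aSH (N - i)) (ar s aSH (N - i))) as [|Hns]; [left; assumption|].
    right. right. destruct (Nat.le_ge_cases l l').
    + assert (Ev : ar s5 aSH (N - i) = l') by lia. exists (ar s4 aNB i). rewrite Ev. split; [|assumption].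
      destruct (NBB _ _ _ D1) as [|Hn]; [assumption|]. specialize (Zl l' _ L1' Hn). lia.
    + assert (Ev : ar s5 aSH (N - i) = l) by lia. exists (ar s2 aNB i). rewrite Ev. split; [|assumption].
      destruct (NBB _ _ _ B1) as [|Hn]; [assumption|]. specialize (Zl l _ L1 Hn). lia.
Qed.

(** * Short matches *)

Definition digit : cmd := For i2 (!vN)
  (CSto aKEY (!i2) (aRV.[!i2] %% !vbeta) ;; CSto aRV (!i2) (aRV.[!i2] / !vbeta)).
Definition RADIX : cmd := CRep (!vt) (digit ;; PASS).

Lemma digit_ok s N be (rv : nat -> nat) :
  sc s vN = N -> sc s vbeta = be -> N <= Q ->
  (forall i, i < N -> ar s aRV i = rv i) ->
  (forall i, i < N -> ar (sem digit s) aKEY i = rv i mod be) /\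
  (forall i, i < N -> ar (sem digit s) aRV i = rv i / be) /\
  tk (sem digit s) <= tk s + 10 * N + 5.
Proof.
  intros HN Hbe HNQ Hrv. destruct (for_ind (fun k s' => (forall i, i < k -> ar s' aKEY i = rv i mod be) /\
     (forall i, i < k -> ar s' aRV i = rv i / be) /\ (forall i, k <= i < N -> ar s' aRV i = rv i) /\
     tk s' <= tk s + 10 * k + 5) i2 (!vN)%e
     (CSto aKEY (!i2) (aRV.[!i2] %% !vbeta) ;; CSto aRV (!i2) (aRV.[!i2] / !vbeta))%c s N) as [R _]; auto.
  - lia.
  - xs. split; [intros; lia|]. split; [intros; lia|]. split; [intros; apply Hrv; lia|lia].
  - intros k s1 Hk F Hi (I1 & I2 & I3 & I4). assert (E1 : sc s1 vbeta = be) by (frall; assumption).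
    xs. rewrite Hi, E1. ev. rewrite I3 by lia. split; [|split; [|split; [|lia]]]; intros i Hii.
    + destruct (Nat.eqb_spec i k) as [->|]; [reflexivity|]. apply I1. lia.
    + destruct (Nat.eqb_spec i k) as [->|]; [reflexivity|]. apply I2. lia.
    + destruct (Nat.eqb_spec i k) as [->|]; [lia|]. apply I3. lia.
  - destruct R as (R1 & R2 & _ & R3). auto.
Qed.

Lemma radix_ok s N be t (res : nat -> nat) :
  sc s vN = N -> sc s vbeta = be -> sc s vt = t -> sc s pl = N -> sc s pk = be ->
  N < Q -> 1 <= be < Q ->
  (forall i, i < N -> ar s aRV i = res i) -> (forall i, i < N -> res i < be ^ t) ->
  (forall i, i < N -> ar s aPA i = i) ->
  let s' := sem RADIX s in
  (forall r r', r < r' -> r' < N -> res (ar s' aPA r) < res (ar s' aPA r') \/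
     res (ar s' aPA r) = res (ar s' aPA r') /\ ar s' aPA r < ar s' aPA r') /\
  (forall r, r < N -> ar s' aPA r < N) /\
  (forall i, i < N -> exists r, r < N /\ ar s' aPA r = i) /\
  tk s' <= tk s + (50 * N + 30 * be + 50) * t + 1.
Proof.
  intros HN Hbe Ht Hpl Hpk HNQ HbeQ Hrv Hres HPA s'. pose proof (rep_ind (fun k s' =>
     (forall r r', r < r' -> r' < N -> res (ar s' aPA r) mod be ^ k < res (ar s' aPA r') mod be ^ k \/
       res (ar s' aPA r) mod be ^ k = res (ar s' aPA r') mod be ^ k /\ ar s' aPA r < ar s' aPA r') /\
     (forall r, r < N -> ar s' aPA r < N) /\
     (forall i, i < N -> exists r, r < N /\ ar s' aPA r = i) /\
     (forall i, i < N -> ar s' aRV i = res i / be ^ k) /\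
     tk s' <= tk s + (50 * N + 30 * be + 50) * k + 1) (!vt)%e (digit ;; PASS)%c s) as R.
  cbn [eval] in R. rewrite Ht in R. destruct R as (R1 & R2 & R3 & R4 & R5).
  - xs. split; [|split; [|split; [|split]]].
    + intros r r' Hr Hr'. rewrite !HPA by lia. auto.
    + intros r Hr. rewrite HPA; auto.
    + eauto.
    + intros i Hi. rewrite Nat.div_1_r. auto.
    + lia.
  - intros k s1 Hk F (I1 & I2 & I3 & I4 & I5). rewrite sem_seq.
    destruct (digit_ok (tick s1) N be (fun i => res i / be ^ k)) as (D1 & D2 & D3);
      try (xs; frall; auto; lia).
    run (sem digit (tick s1)) as s2 F1.
    assert (P2 : forall r, ar s2 aPA r = ar s1 aPA r) by (intros; frall; reflexivity). destruct (pass_sorts s2 N be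
       (fun a b => res a mod be ^ k < res b mod be ^ k \/ res a mod be ^ k = res b mod be ^ k /\ a < b))
       as (G1 & G2 & G3 & T).
    + frall. xs. frall. assumption.
    + frall. xs. frall. assumption.
    + lia.
    + lia.
    + intros r Hr. rewrite P2. specialize (I2 r Hr). lia.
    + intros r Hr. rewrite P2, D1 by auto. apply Nat.mod_upper_bound. lia.
    + intros r r' Hr Hr'. rewrite !P2. apply I1; assumption.
    + run (sem PASS s2) as s3 F2. assert (P3 : forall r, r < N -> ar s3 aPA r < N).
      { intros r Hr. destruct (G2 r Hr) as (r' & Hr' & ->). rewrite P2. auto. }
      split; [|split; [|split; [|split]]]; auto.
      * intros r r' Hr Hr'. specialize (G1 r r' Hr Hr'). cbv zeta in G1. rewrite !D1 in G1 by (apply P3; lia).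
        set (x := ar s3 aPA r) in *. set (y := ar s3 aPA r') in *. clearbody x y.
        rewrite Nat.pow_succ_r', (Nat.mul_comm be), !Nat.Div0.mod_mul_r.
        assert (Hpos : be ^ k <> 0) by (apply Nat.pow_nonzero; lia).
        pose proof (Nat.mod_upper_bound (res x) (be ^ k) Hpos).
        pose proof (Nat.mod_upper_bound (res y) (be ^ k) Hpos). destruct G1 as [G1|[G1 G1']]; [left; nia|]. lia.
      * intros i Hi. destruct (I3 i Hi) as (r & Hr & Er). destruct (G3 r Hr) as (r' & Hr' & Er').
        exists r'. split; [assumption|]. rewrite Er', P2. assumption.
      * intros i Hi. frall. rewrite D2 by assumption. rewrite Nat.Div0.div_div, Nat.pow_succ_r'. f_equal. lia.
      * cbn [tick tk] in D3. lia.
  - split; [|split; [|split]]; auto. intros r r' Hr Hr'. specialize (R1 r r' Hr Hr').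
    rewrite !Nat.mod_small in R1 by (apply Hres; apply R2; lia). assumption.
Qed.

(** Letters come sorted by residue and then by index, so in each class the letters of the chunk
    precede those of the window. The former are equal to each other, because the modulus separates
    letters of [S]; a letter of the window is compared with the last of them and gets its name, or
    else 2, a name that no letter of the chunk has. The separator is named 1, and [vsg] is larger
    than every letter. *)
Definition NAMES : cmd :=
  (vnm ::= #2 ;; vcv ::= !vsg ;; For i2 (!vN)
    (x2 ::= aPA.[!i2] ;; v1 ::= aX.[!x2] ;;
     CIf (!x2 <? !va)
       (CIf (!v1 =? !vcv) CSkip (incr vnm ;; vcv ::= !v1) ;; CSto aLV (!x2) (!vnm))
       (CIf (!x2 =? !va) (CSto aLV (!x2) #1)
         (CIf (!v1 =? !vcv) (CSto aLV (!x2) (!vnm)) (CSto aLV (!x2) #2)))))%c.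

Lemma names_letters s N a sg pm (X PA : nat -> nat) :
  sc s vN = N -> sc s va = a -> sc s vsg = sg -> N < Q ->
  (forall i, i < N -> ar s aX i = X i) -> (forall i, i < N -> X i < sg) ->
  (forall r, r < N -> ar s aPA r = PA r /\ PA r < N) ->
  (forall i, i < N -> exists r, r < N /\ PA r = i) ->
  (forall r r', r < r' -> r' < N -> X (PA r) mod pm < X (PA r') mod pm \/
     X (PA r) mod pm = X (PA r') mod pm /\ PA r < PA r') ->
  (forall u u', u < a -> u' < a -> u < N -> u' < N -> X u mod pm = X u' mod pm -> X u = X u') ->
  let s' := sem NAMES s in
  (forall i, i < N -> 1 <= ar s' aLV i <= N + 3) /\
  (forall i, i < N -> i <> a -> 2 <= ar s' aLV i) /\
  (a < N -> ar s' aLV a = 1) /\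
  (forall u i, u < a -> a < i < N -> (ar s' aLV u = ar s' aLV i <-> X u = X i)) /\
  tk s' <= tk s + 20 * N + 20.
Proof.
  intros HN Ha Hsg HNQ HX HXsg HPA Hsurj Hsort Hinj s'. subst s'. unfold NAMES. rewrite !sem_seq.
  set (s0 := sem (vcv ::= !vsg)%c (sem (vnm ::= #2)%c s)).
  assert (X0 : sc s0 vnm = 2 /\ sc s0 vcv = sg /\ sc s0 vN = N /\ sc s0 va = a /\ tk s0 = tk s + 2 /\
    (forall k i, ar s0 k i = ar s k i)).
  { unfold s0. xs. repeat split; auto. lia. }
  destruct X0 as (X1 & X2 & X3 & X4 & X5 & X6).
  assert (PAinj : forall r r', r < N -> r' < N -> PA r = PA r' -> r = r').
  { intros r r' Hr Hr' E. destruct (Nat.lt_trichotomy r r') as [C|[C|C]]; auto; exfalso.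
    - specialize (Hsort r r' C Hr'). rewrite E in Hsort. lia.
    - specialize (Hsort r' r C Hr). rewrite E in Hsort. lia. }
  destruct (for_ind (fun k s' => let nm := sc s' vnm in let cv := sc s' vcv in
     let L := ar s' aLV in
     2 <= nm <= 2 + k /\
     (forall r, r < k -> PA r < a -> 3 <= L (PA r) <= nm /\ (L (PA r) = nm <-> X (PA r) = cv) /\
         X (PA r) mod pm <= cv mod pm) /\
     (forall r, r < k -> a < PA r -> 2 <= L (PA r) <= nm) /\
     (forall r, r < k -> PA r = a -> L (PA r) = 1) /\
     (forall r r', r < k -> r' < k -> PA r < a -> a < PA r' -> (L (PA r) = L (PA r') <-> X (PA r) = X (PA r'))) /\
     ((cv = sg /\ forall r, r < k -> a <= PA r) \/
      exists r0, r0 < k /\ PA r0 < a /\ X (PA r0) = cv) /\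
     tk s' <= tk s0 + 15 * k + 5) i2 (!vN)%e
    (x2 ::= aPA.[!i2] ;; v1 ::= aX.[!x2] ;;
     CIf (!x2 <? !va)
       (CIf (!v1 =? !vcv) CSkip (incr vnm ;; vcv ::= !v1) ;; CSto aLV (!x2) (!vnm))
       (CIf (!x2 =? !va) (CSto aLV (!x2) #1)
         (CIf (!v1 =? !vcv) (CSto aLV (!x2) (!vnm)) (CSto aLV (!x2) #2))))%c s0 N) as [R _]; auto.
  - lia.
  - xs. rewrite X1, X2. split; [lia|]. do 4 (split; [intros; lia|]). split; [|lia].
    left. split; [reflexivity|]. intros; lia.
  - intros k s1 Hk F Hi (I0 & I1 & I2 & I3 & I4 & I5 & I6). destruct (HPA k Hk) as [P1 P2].
    assert (E1 : sc s1 va = a) by (frall; assumption).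
    assert (E2 : ar s1 aPA k = PA k) by (frall; rewrite X6; assumption).
    assert (E3 : ar s1 aX (PA k) = X (PA k)) by (frall; rewrite X6; auto).
    set (x := PA k) in *. set (nm := sc s1 vnm) in *. set (cv := sc s1 vcv) in *. set (L := ar s1 aLV) in *.
    assert (Hne : forall r, r < k -> PA r =? x = false).
    { intros r Hr. apply Nat.eqb_neq. intros E. apply PAinj in E; lia. }
    assert (Hres : forall r, r < k -> X (PA r) mod pm < X x mod pm \/
        X (PA r) mod pm = X x mod pm /\ PA r < x) by (intros; apply Hsort; lia).
    assert (UU : forall r r', r < N -> r' < N -> PA r < a -> PA r' < a -> X (PA r) mod pm = X (PA r') mod pm ->
       X (PA r) = X (PA r')).
    { intros r r' Hr Hr' Ca Ca' E. apply Hinj; auto; apply HPA; assumption. }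
    cond_is (x <? a); [xs; rewrite Hi, E1; ev; rewrite E2; reflexivity|]. destruct (Nat.ltb_spec x a) as [Ca|Ca].
    + cond_is (X x =? cv); [xs; rewrite Hi; ev; rewrite E2; ev; rewrite E3; reflexivity|].
      destruct (Nat.eqb_spec (X x) cv) as [Cv|Cv].
      * assert (Hr0 : exists r0, r0 < k /\ PA r0 < a /\ X (PA r0) = cv).
        { destruct I5 as [[J1 J2]|J]; auto. pose proof (HXsg x P2). lia. }
        destruct Hr0 as (r0 & J1 & J2 & J3). destruct (I1 r0 J1 J2) as (V1 & V2 & V3). apply V2 in J3 as J4.
        xs. rewrite Hi. ev. rewrite E2. fold nm cv.
        split; [lia|]. split; [|split; [|split; [|split; [|split; [|lia]]]]].
        -- intros r Hr Hra. destruct (Nat.eq_dec r k) as [->|].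
           ++ fold x. rewrite Nat.eqb_refl, Cv. repeat split; lia.
           ++ rewrite Hne by lia. apply I1; [lia|assumption].
        -- intros r Hr Hra. destruct (Nat.eq_dec r k) as [->|]; [fold x in Hra; lia|].
           rewrite Hne by lia. apply I2; [lia|assumption].
        -- intros r Hr Hra. destruct (Nat.eq_dec r k) as [->|]; [fold x in Hra; lia|].
           rewrite Hne by lia. apply I3; [lia|assumption].
        -- intros r r' Hr Hr' Hra Hra'. destruct (Nat.eq_dec r' k) as [->|]; [fold x in Hra'; lia|].
           rewrite (Hne r') by lia. destruct (Nat.eq_dec r k) as [->|].
           ++ fold x. rewrite Nat.eqb_refl, Cv, <- J3, <- J4. apply I4; auto; lia.
           ++ rewrite Hne by lia. apply I4; auto; lia.
        -- right. exists r0. repeat split; auto; lia.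
      * xs. rewrite Hi. ev. rewrite E2, E3. fold L. assert (OLD : forall r, r < k -> PA r < a -> X (PA r) <> X x).
        { intros r Hr Hra E. destruct (I1 r Hr Hra) as (_ & _ & V3).
          destruct I5 as [[J1 J2]|(r0 & J1 & J2 & J3)]; [specialize (J2 r Hr); lia|].
          specialize (Hres r0 J1). rewrite J3, <- E in Hres.
          apply Cv. rewrite <- E, <- J3. apply UU; auto; try lia; rewrite J3; lia. }
        split; [lia|]. split; [|split; [|split; [|split; [|split; [|lia]]]]].
        -- intros r Hr Hra. destruct (Nat.eq_dec r k) as [->|].
           ++ fold x. rewrite Nat.eqb_refl. repeat split; lia.
           ++ rewrite Hne by lia. destruct (I1 r ltac:(lia) Hra) as (V1 & V2 & V3).
              specialize (OLD r ltac:(lia) Hra). specialize (Hres r ltac:(lia)). repeat split; lia.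
        -- intros r Hr Hra. destruct (Nat.eq_dec r k) as [->|]; [fold x in Hra; lia|].
           rewrite Hne by lia. specialize (I2 r ltac:(lia) Hra). lia.
        -- intros r Hr Hra. destruct (Nat.eq_dec r k) as [->|]; [fold x in Hra; lia|].
           rewrite Hne by lia. apply I3; [lia|assumption].
        -- intros r r' Hr Hr' Hra Hra'. destruct (Nat.eq_dec r' k) as [->|]; [fold x in Hra'; lia|].
           rewrite (Hne r') by lia. destruct (Nat.eq_dec r k) as [->|].
           ++ fold x. rewrite Nat.eqb_refl. specialize (I2 r' ltac:(lia) Hra').
              split; [lia|]. intros E. specialize (Hres r' ltac:(lia)). rewrite E in Hres. lia.
           ++ rewrite Hne by lia. apply I4; auto; lia.
        -- right. exists k. repeat split; auto; lia.
    + assert (POST : forall v, (x = a -> v = 1) -> (a < x -> 2 <= v <= nm) ->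
         (a < x -> forall r, r < k -> PA r < a -> (L (PA r) = v <-> X (PA r) = X x)) ->
         forall T, T <= tk s1 + 12 ->
         2 <= nm <= 2 + S k /\
     (forall r, r < S k -> PA r < a -> 3 <= (if PA r =? x then v else L (PA r)) <= nm /\
         ((if PA r =? x then v else L (PA r)) = nm <-> X (PA r) = cv) /\
         X (PA r) mod pm <= cv mod pm) /\
     (forall r, r < S k -> a < PA r -> 2 <= (if PA r =? x then v else L (PA r)) <= nm) /\
     (forall r, r < S k -> PA r = a -> (if PA r =? x then v else L (PA r)) = 1) /\
     (forall r r', r < S k -> r' < S k -> PA r < a -> a < PA r' ->
        ((if PA r =? x then v else L (PA r)) = (if PA r' =? x then v else L (PA r')) <-> X (PA r) = X (PA r'))) /\
     ((cv = sg /\ forall r, r < S k -> a <= PA r) \/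
      exists r0, r0 < S k /\ PA r0 < a /\ X (PA r0) = cv) /\
     T <= tk s0 + 15 * S k + 5).
      { intros v Hv1 Hv2 Hv3 T HT. split; [lia|]. split; [|split; [|split; [|split; [|split; [|lia]]]]].
        -- intros r Hr Hra. destruct (Nat.eq_dec r k) as [->|]; [fold x in Hra; lia|].
           rewrite Hne by lia. apply I1; [lia|assumption].
        -- intros r Hr Hra. destruct (Nat.eq_dec r k) as [->|].
           ++ rewrite Nat.eqb_refl. auto.
           ++ rewrite Hne by lia. apply I2; [lia|assumption].
        -- intros r Hr Hra. destruct (Nat.eq_dec r k) as [->|].
           ++ rewrite Nat.eqb_refl. auto.
           ++ rewrite Hne by lia. apply I3; [lia|assumption].
        -- intros r r' Hr Hr' Hra Hra'. destruct (Nat.eq_dec r k) as [->|]; [fold x in Hra; lia|].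
           rewrite (Hne r) by lia. destruct (Nat.eq_dec r' k) as [->|].
           ++ rewrite Nat.eqb_refl. apply Hv3; auto; lia.
           ++ rewrite Hne by lia. apply I4; auto; lia.
        -- destruct I5 as [[J1 J2]|(r0 & J1 & J2 & J3)].
           ++ left. split; [assumption|]. intros r Hr. destruct (Nat.eq_dec r k) as [->|]; [assumption|].
              apply J2. lia.
           ++ right. exists r0. repeat split; auto; lia. }
      cond_is (x =? a); [xs; rewrite Hi, E1; ev; rewrite E2; reflexivity|]. destruct (Nat.eqb_spec x a) as [Cx|Cx].
      * xs. rewrite Hi. ev. rewrite E2. apply POST; auto; lia.
      * cond_is (X x =? cv); [xs; rewrite Hi; ev; rewrite E2; ev; rewrite E3; reflexivity|].
        destruct (Nat.eqb_spec (X x) cv) as [Cv|Cv].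
        -- xs. rewrite Hi. ev. rewrite E2. apply POST; auto; try lia.
           intros _ r Hr Hra. rewrite Cv. apply I1; auto.
        -- xs. rewrite Hi. ev. rewrite E2. apply POST; auto; try lia.
           intros _ r Hr Hra. destruct (I1 r Hr Hra) as (V1 & V2 & V3). split; [lia|].
           intros E. exfalso. destruct I5 as [[J1 J2]|(r0 & J1 & J2 & J3)]; [specialize (J2 r Hr); lia|].
           specialize (Hres r0 J1). rewrite J3, <- E in Hres.
           apply Cv. rewrite <- E, <- J3. apply UU; auto; try lia; rewrite J3; lia.
  - match goal with |- context [sem (For ?a ?b ?c) s0] => set (s' := sem (For a b c) s0) in * end.
    destruct R as (R0 & R1 & R2 & R3 & R4 & R5 & R6). split; [|split; [|split; [|split]]].
    + intros i Hi. destruct (Hsurj i Hi) as (r & Hr & <-). destruct (Nat.lt_trichotomy (PA r) a) as [C|[C|C]].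
      * specialize (R1 r Hr C). lia.
      * specialize (R3 r Hr C). lia.
      * specialize (R2 r Hr C). lia.
    + intros i Hi Hia. destruct (Hsurj i Hi) as (r & Hr & <-). destruct (Nat.lt_trichotomy (PA r) a) as [C|[C|C]].
      * specialize (R1 r Hr C). lia.
      * lia.
      * specialize (R2 r Hr C). lia.
    + intros Hia. destruct (Hsurj a Hia) as (r & Hr & Er). rewrite <- Er at 1. apply R3; assumption.
    + intros u i Hu Hi. destruct (Hsurj u ltac:(lia)) as (r & Hr & <-).
      destruct (Hsurj i ltac:(lia)) as (r' & Hr' & <-). apply R4; auto. lia.
    + lia.
Qed.

Variables m g : nat.
Notation Sf := (fun i => nth i Sl 0).
Notation Tf := (fun i => nth i Tl 0).
Hypothesis HQ : Q = 100 * g.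
Hypothesis Hg : 1 <= g.
Hypothesis Hm : length Sl = m.
Hypothesis Hm0 : 0 < m.
Hypothesis HmM : 2 * m + 100 < M.

(** * Matches between a window of the text and a chunk of [S] *)

Section Chunk.
Variables sg pm t : nat.
Hypothesis HSsg : forall i, i < m -> nth i Sl 0 < sg.
Hypothesis Hpm : forall i j, i < m -> j < m ->
  nth i Sl 0 mod pm = nth j Sl 0 mod pm -> nth i Sl 0 = nth j Sl 0.
Hypothesis Hpm0 : 1 <= pm <= (g + 1) ^ t.

Record consts (s : state) : Prop := {
  c_m : sc s vm = m; c_g : sc s vg = g; c_sg : sc s vsg = sg; c_pm : sc s vpm = pm;
  c_t : sc s vt = t; c_beta : sc s vbeta = g + 1 }.

Lemma consts_agree c s s' : agree c s s' ->
  wS vm c = false -> wS vg c = false -> wS vsg c = false -> wS vpm c = false ->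
  wS vt c = false -> wS vbeta c = false -> consts s -> consts s'.
Proof.
  intros (F & _) H1 H2 H3 H4 H5 H6 []. constructor; rewrite F; auto.
Qed.

Definition chunk_pre : cmd :=
  (CIf (!vm - !vs <? #4 * !vg) (va ::= !vm - !vs) (va ::= #4 * !vg) ;;
   vb ::= !vhl + !vbl ;; vN ::= !va + #1 + !vb ;; pl ::= !vN ;; pk ::= !vbeta ;;
   CSto aX (!va) #0)%c.
(** Chunk and window are loaded backwards: common suffixes of prefixes become common prefixes of
    suffixes, which the suffix array provides. *)
Definition load1 : cmd := For i2 (!va) (CSto aX (!i2) (ES (!vs + !va - #1 - !i2))).
Definition load2 : cmd := For i2 (!vb) (CSto aX (!va + #1 + !i2) (aBUF.[!vb - #1 - !i2])).
Definition load3 : cmd := For i2 (!vN)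
  (CSto aRV (!i2) (aX.[!i2] %% !vpm) ;; CSto aPA (!i2) (!i2)).
Definition CHUNK : cmd :=
  (chunk_pre ;; load1 ;; load2 ;; load3 ;; RADIX ;; NAMES ;; SUFSORT ;; NEAR)%c.

Lemma chunk_pre_ok s sx b :
  consts s -> sc s vs = sx -> sx <= m -> sc s vhl + sc s vbl = b -> b <= 2 * g ->
  let a := Nat.min (4 * g) (m - sx) in
  let s' := sem chunk_pre s in
  sc s' va = a /\ sc s' vb = b /\ sc s' vN = a + 1 + b /\ sc s' pl = a + 1 + b /\
  sc s' pk = g + 1 /\ ar s' aX a = 0 /\ tk s' <= tk s + 10.
Proof.
  intros [] Hs Hsx Hb Hbg a s'. subst s'. unfold chunk_pre. cond_is (m - sx <? 4 * g).
  { xs. rewrite c_m0, c_g0, Hs. ev. reflexivity. }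
  destruct (Nat.ltb_spec (m - sx) (4 * g)) as [C|C].
  - assert (Ea : a = m - sx) by (unfold a; lia). rewrite Ea. xs. rewrite c_m0, c_beta0, Hs. ev.
    rewrite Nat.eqb_refl. repeat split; lia.
  - assert (Ea : a = 4 * g) by (unfold a; lia). rewrite Ea. xs. rewrite c_g0, c_beta0. ev.
    rewrite Nat.eqb_refl. repeat split; lia.
Qed.

Lemma load1_ok s sx a :
  sc s va = a -> sc s vs = sx -> sx + a <= m -> a <= 4 * g ->
  (forall i, i < a -> ar (sem load1 s) aX i = Sf (sx + a - 1 - i)) /\
  (forall i, a <= i -> ar (sem load1 s) aX i = ar s aX i) /\
  tk (sem load1 s) <= tk s + 5 * a + 5.
Proof.
  intros Ha Hs Hsa Hag. destruct (for_ind (fun k s' => (forall i, i < k -> ar s' aX i = Sf (sx + a - 1 - i)) /\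
    (forall i, a <= i -> ar s' aX i = ar s aX i) /\ tk s' <= tk s + 5 * k + 5) i2 (!va)%e
    (CSto aX (!i2) (ES (!vs + !va - #1 - !i2)))%c s a) as [R _]; auto.
  - lia.
  - xs. split; [intros; lia|]. split; [reflexivity|lia].
  - intros k s1 Hk F Hi (I1 & I2 & I3). assert (E1 : sc s1 va = a) by (frall; assumption).
    assert (E2 : sc s1 vs = sx) by (frall; assumption).
    xs. rewrite Hi, E1, E2, Hm. ev. split; [|split; [|lia]]; intros i Hii.
    + destruct (Nat.eqb_spec i k) as [->|]; [reflexivity|]. apply I1. lia.
    + destruct (Nat.eqb_spec i k) as [->|]; [lia|]. apply I2. lia.
Qed.

Lemma load2_ok s a b (Bf : nat -> nat) :
  sc s va = a -> sc s vb = b -> b <= 2 * g -> a <= 4 * g ->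
  (forall i, i < b -> ar s aBUF i = Bf i) ->
  (forall i, i < b -> ar (sem load2 s) aX (a + 1 + i) = Bf (b - 1 - i)) /\
  (forall i, i <= a -> ar (sem load2 s) aX i = ar s aX i) /\
  tk (sem load2 s) <= tk s + 5 * b + 5.
Proof.
  intros Ha Hb Hbg Hag HB.
  destruct (for_ind (fun k s' => (forall i, i < k -> ar s' aX (a + 1 + i) = Bf (b - 1 - i)) /\
    (forall i, i <= a -> ar s' aX i = ar s aX i) /\ tk s' <= tk s + 5 * k + 5) i2 (!vb)%e
    (CSto aX (!va + #1 + !i2) (aBUF.[!vb - #1 - !i2]))%c s b) as [R _]; auto.
  - lia.
  - xs. split; [intros; lia|]. split; [reflexivity|lia].
  - intros k s1 Hk F Hi (I1 & I2 & I3). assert (E1 : sc s1 va = a) by (frall; assumption).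
    assert (E2 : sc s1 vb = b) by (frall; assumption).
    assert (E3 : ar s1 aBUF (b - 1 - k) = Bf (b - 1 - k)) by (frall; apply HB; lia).
    xs. rewrite Hi, E1, E2. ev. rewrite E3. split; [|split; [|lia]]; intros i Hii.
    + destruct (Nat.eqb_spec (a + 1 + i) (a + 1 + k)); [replace i with k by lia; reflexivity|]. apply I1. lia.
    + destruct (Nat.eqb_spec i (a + 1 + k)) as [->|]; [lia|]. apply I2. lia.
Qed.

Lemma load3_ok s N :
  sc s vN = N -> N < Q ->
  (forall i, i < N -> ar (sem load3 s) aRV i = ar s aX i mod (sc s vpm)) /\
  (forall i, i < N -> ar (sem load3 s) aPA i = i) /\
  tk (sem load3 s) <= tk s + 5 * N + 5.
Proof.
  intros HN HNQ. destruct (for_ind (fun k s' => (forall i, i < k -> ar s' aRV i = ar s aX i mod (sc s vpm)) /\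
    (forall i, i < k -> ar s' aPA i = i) /\ tk s' <= tk s + 5 * k + 5) i2 (!vN)%e
    (CSto aRV (!i2) (aX.[!i2] %% !vpm) ;; CSto aPA (!i2) (!i2))%c s N) as [R _]; auto.
  - lia.
  - xs. split; [intros; lia|]. split; [intros; lia|lia].
  - intros k s1 Hk F Hi (I1 & I2 & I3). xs. rewrite Hi. frall. ev. split; [|split; [|lia]]; intros i Hii.
    + destruct (Nat.eqb_spec i k) as [->|]; [reflexivity|]. apply I1. lia.
    + destruct (Nat.eqb_spec i k) as [->|]; [lia|]. apply I2. lia.
Qed.

Lemma chunk_ok s sx b (Bf : nat -> nat) :
  consts s -> sc s vs = sx -> sx <= m -> sc s vhl + sc s vbl = b -> b <= 2 * g ->
  (forall i, i < b -> ar s aBUF i = Bf i /\ Bf i < sg) ->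
  let a := Nat.min (4 * g) (m - sx) in
  let Uf := fun y => Sf (sx + y) in
  let s' := sem CHUNK s in
  (forall e, 1 <= e <= b ->
    (forall y, y <= a -> lcs Uf Bf y e <= ar s' aSH e) /\
    (ar s' aSH e = ar s aSH e \/ ar s' aSH e = 0 \/ exists y, y <= a /\ ar s' aSH e <= lcs Uf Bf y e) /\
    ar s aSH e <= ar s' aSH e) /\
  tk s' <= tk s + (500 * g + 500) * t + 400 * Q.
Proof.
  intros Hc Hs Hsx Hb Hbg HB a Uf s'. subst s'. unfold CHUNK. rewrite !sem_seq.
  assert (Haa : a <= 4 * g /\ sx + a <= m) by (unfold a; lia). destruct Haa as [Ha1 Ha2].
  destruct (chunk_pre_ok s sx b Hc Hs Hsx Hb Hbg) as (A1 & A2 & A3 & A4 & A5 & A6 & T1).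
  pose proof (agree_sem chunk_pre s) as F1.
  assert (Hc1 : consts (sem chunk_pre s)) by (eapply consts_agree; eauto). fold a in A1, A3, A4, A6. clearbody a.
  set (s1 := sem chunk_pre s) in *. remember (a + 1 + b) as N eqn:EN.
  destruct (load1_ok s1 sx a A1 ltac:(frall; assumption) Ha2 Ha1) as (B1 & B2 & T2).
  pose proof (agree_sem load1 s1) as F2. assert (Hc2 : consts (sem load1 s1)) by (eapply consts_agree; eauto).
  set (s2 := sem load1 s1) in *. destruct (load2_ok s2 a b Bf) as (C1 & C2 & T3); try (frall; auto; lia).
  { intros i Hi. frall. apply HB. assumption. }
  pose proof (agree_sem load2 s2) as F3. assert (Hc3 : consts (sem load2 s2)) by (eapply consts_agree; eauto).
  set (s3 := sem load2 s2) in *.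
  pose (X := fun i => if i <? a then Sf (sx + a - 1 - i) else if i =? a then 0 else Bf (b - 1 - (i - a - 1))).
  assert (HX : forall i, i < N -> ar s3 aX i = X i).
  { intros i Hi. unfold X. destruct (Nat.ltb_spec i a).
    - rewrite C2 by lia. apply B1. assumption.
    - destruct (Nat.eqb_spec i a) as [->|].
      + rewrite C2, B2 by lia. assumption.
      + replace i with (a + 1 + (i - a - 1)) at 1 by lia. apply C1. lia. }
  assert (HSX : forall i, i < N -> X i < sg).
  { intros i Hi. unfold X. destruct (Nat.ltb_spec i a); [apply HSsg; lia|].
    destruct (Nat.eqb_spec i a); [|apply HB; lia]. specialize (HSsg 0 Hm0). lia. }
  assert (XU : forall u, u < a -> X u = Sf (sx + a - 1 - u)).
  { intros u Hu. unfold X. destruct (Nat.ltb_spec u a); [reflexivity|lia]. }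
  assert (XW : forall i, a < i -> X i = Bf (b - 1 - (i - a - 1))).
  { intros i Hi. unfold X. destruct (Nat.ltb_spec i a); [lia|]. destruct (Nat.eqb_spec i a); [lia|reflexivity]. }
  destruct (load3_ok s3 N) as (D1 & D2 & T4); try (frall; auto; lia).
  pose proof (agree_sem load3 s3) as F4. assert (Hc4 : consts (sem load3 s3)) by (eapply consts_agree; eauto).
  set (s4 := sem load3 s3) in *. destruct (radix_ok s4 N (g + 1) t (fun i => X i mod pm)) as (E1 & E2 & E3 & T5);
    try (frall; auto; lia).
  { apply Hc4. } { apply Hc4. }
  { intros i Hi. rewrite D1 by assumption. rewrite HX by assumption. rewrite (c_pm _ Hc3). reflexivity. }
  { intros i Hi. pose proof (Nat.mod_upper_bound (X i) pm). lia. }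
  pose proof (agree_sem RADIX s4) as F5. assert (Hc5 : consts (sem RADIX s4)) by (eapply consts_agree; eauto).
  set (s5 := sem RADIX s4) in *.
  destruct (names_letters s5 N a sg pm X (ar s5 aPA)) as (G1 & G2 & G3 & G4 & T6); auto;
    try (frall; auto; lia).
  { apply Hc5. } { intros i Hi. frall. auto. }
  { intros u u' Hu Hu' _ _ E. rewrite !XU in * by assumption. apply Hpm; auto; lia. }
  run (sem NAMES s5) as s6 F6. destruct (sufsort_ok s6 N) as (H1 & H2 & H3 & T7); auto; try (frall; auto; lia).
  run (sem SUFSORT s6) as s7 F7. pose (f := fun i => if i <? N then ar s6 aLV i else 0).
  assert (Hf1 : forall i, i < N -> f i = ar s6 aLV i).
  { intros i Hi. unfold f. destruct (Nat.ltb_spec i N); [reflexivity|lia]. }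
  assert (Hf0 : forall i, N <= i -> f i = 0).
  { intros i Hi. unfold f. destruct (Nat.ltb_spec i N); [lia|reflexivity]. }
  assert (Hstr : str f N). { split; auto. intros i Hi. rewrite Hf1 by assumption. specialize (G1 i Hi). lia. }
  assert (Hfa : forall i, i < N -> i <> a -> f i <> f a).
  { intros i Hi Hia. rewrite !Hf1 by lia. specialize (G2 i Hi Hia). lia. }
  destruct (near_ok s7 N a f) as (K1 & T8); auto; try (frall; auto; lia).
  { intros i Hi. destruct (Nat.eq_dec i N) as [->|]; [rewrite H3, Hf0 by lia; reflexivity|].
    rewrite H2, Hf1 by lia. reflexivity. }
  { intros i Hi. apply not_eq_sym. apply Hfa; lia. }
  assert (SH7 : forall e, ar s7 aSH e = ar s aSH e) by (intros; frall; reflexivity). split.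
  - intros e He. destruct (K1 (N - e) ltac:(lia)) as (L1 & L2 & L3).
    replace (N - (N - e)) with e in * by lia. rewrite SH7 in *.
    (* In the reversed concatenation, the suffix at [N - e] starts with the window's prefix of
       length [e] read backwards, and the suffix at [a - y] with the chunk's prefix of length
       [y]. *)
    assert (EQ : forall y h, y <= a -> (h <= lcs Uf Bf y e <-> eqn f (N - e) (a - y) h)).
    { intros y h Hy. rewrite lcs_spec.
      assert (LET : forall x, x < y -> x < e -> (f (N - e + x) = f (a - y + x) <-> Uf (y - 1 - x) = Bf (e - 1 - x))).
      { intros x Hx1 Hx2. rewrite !Hf1 by lia. pose proof (G4 (a - y + x) (N - e + x) ltac:(lia) ltac:(lia)) as GG.
        rewrite (XU (a - y + x)), (XW (N - e + x)) in GG by lia.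
        replace (sx + a - 1 - (a - y + x)) with (sx + (y - 1 - x)) in GG by (clear - Hy Hx1; lia).
        replace (b - 1 - (N - e + x - a - 1)) with (e - 1 - x) in GG by (clear - EN He Hx2; lia).
        unfold Uf. split; intros EE.
        - lia.
        - lia. }
      split.
      - intros (Q1 & Q2 & Q3) x Hx. apply LET; auto; lia.
      (* A match longer than [y] would align the separator, whose name is unique, with another
         position. *)
      - intros HE. assert (Q1 : h <= y).
        { destruct (Nat.le_gt_cases h y) as [|C]; auto. exfalso. specialize (HE y C).
          replace (a - y + y) with a in HE by lia. destruct (Nat.lt_ge_cases (N - e + y) N).
          - apply (Hfa (N - e + y)); auto. lia.
          - rewrite Hf0 in HE by assumption. rewrite Hf1, G3 in HE by lia. lia. }
        assert (Q2 : h <= e).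
        { destruct (Nat.le_gt_cases h e) as [|C]; auto. specialize (HE e C). rewrite Hf0 in HE by lia.
          destruct Hstr as [P _]. specialize (P (a - y + e) ltac:(lia)). lia. }
        do 2 (split; [assumption|]). intros x Hx. apply LET; try lia. apply HE. assumption. }
    split; [|split; [|assumption]].
    + intros y Hy. apply (L1 (a - y)); [lia|]. apply EQ; auto.
    + destruct L2 as [L2|[L2|(u & U1 & U2)]]; auto. right. right. exists (a - u). split; [lia|]. apply EQ; [lia|].
      replace (a - (a - u)) with u by lia. assumption.
  - assert (TT : (50 * N + 30 * (g + 1) + 50) * t <= (500 * g + 500) * t) by (apply Nat.mul_le_mono_r; lia). lia.
Qed.

Definition SHORT : cmd :=
  (For i2 (!vhl + !vbl + #1) (CSto aSH (!i2) #0) ;; vs ::= #0 ;;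
   CRep (!vm / (#2 * !vg) + #1) (CHUNK ;; vs ::= !vs + #2 * !vg))%c.

(* A match of length at most [2 * g] lies inside one of the overlapping chunks. *)
Lemma short_ok s b (Bf : nat -> nat) :
  consts s -> sc s vhl + sc s vbl = b -> b <= 2 * g ->
  (forall i, i < b -> ar s aBUF i = Bf i /\ Bf i < sg) ->
  let s' := sem SHORT s in
  (forall e, 1 <= e <= b ->
    (forall q, q <= m -> lcs Sf Bf q e <= ar s' aSH e) /\
    (exists q, q <= m /\ ar s' aSH e <= lcs Sf Bf q e)) /\
  tk s' <= tk s + ((500 * g + 500) * t + 400 * Q + 100) * (m / (2 * g) + 1) + 20 * g + 20.
Proof.
  intros Hc Hb Hbg HB s'. subst s'. unfold SHORT. rewrite !sem_seq.
  set (c1 := For i2 (!vhl + !vbl + #1) (CSto aSH (!i2) #0)).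
  assert (A : (forall e, e < b + 1 -> ar (sem c1 s) aSH e = 0) /\ tk (sem c1 s) <= tk s + 5 * (b + 1) + 5).
  { destruct (for_ind (fun k s' => (forall e, e < k -> ar s' aSH e = 0) /\
      tk s' <= tk s + 5 * k + 5) i2 (!vhl + !vbl + #1)%e (CSto aSH (!i2) #0)%c s (b + 1)) as [R _]; auto.
    - xs. ev. rewrite Hb. reflexivity.
    - lia.
    - xs. split; [intros; lia|lia].
    - intros k s1 Hk F Hi (I1 & I2). xs. rewrite Hi. ev. split; [|lia].
      intros i Hii. destruct (Nat.eqb_spec i k) as [->|]; [reflexivity|]. apply I1. lia. }
  pose proof (agree_sem c1 s) as F1. assert (Hc1 : consts (sem c1 s)) by (eapply consts_agree; eauto).
  set (s1 := sem c1 s) in *. destruct A as [A1 A2]. set (s2 := sem (vs ::= #0)%c s1).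
  assert (X : consts s2 /\ sc s2 vs = 0 /\ sc s2 vhl + sc s2 vbl = b /\
     (forall k i, ar s2 k i = ar s1 k i) /\ tk s2 = tk s1 + 1).
  { unfold s2. destruct Hc1. split; [constructor; xs; assumption|]. xs. frall. auto. }
  destruct X as (X1 & X2 & X3 & X4 & X5). assert (D2 : 2 * g * (m / (2 * g)) <= m < 2 * g * (m / (2 * g)) + 2 * g).
  { pose proof (Nat.div_mod_eq m (2 * g)). pose proof (Nat.mod_upper_bound m (2 * g) ltac:(lia)). lia. }
  assert (EV : eval s2 (!vm / (#2 * !vg) + #1)%e = m / (2 * g) + 1).
  { xs. rewrite (c_m _ X1), (c_g _ X1). assert (m / (2 * g) <= m) by (apply Nat.Div0.div_le_upper_bound; nia). ev. reflexivity. }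
  (* A match ending at [q] starts at [q - lcs]. After [k] chunks, the matches that start before
     [2 * g * k] have been accounted for. *)
  set (nc := m / (2 * g)) in *. pose proof (rep_ind (fun k s' => consts s' /\ sc s' vs = 2 * g * k /\
    (forall e, 1 <= e <= b ->
      (forall q, q <= m -> q < lcs Sf Bf q e + 2 * g * k -> lcs Sf Bf q e <= ar s' aSH e) /\
      (exists q, q <= m /\ ar s' aSH e <= lcs Sf Bf q e)) /\
    tk s' <= tk s2 + ((500 * g + 500) * t + 400 * Q + 10) * k + 1)
    (!vm / (#2 * !vg) + #1)%e (CHUNK ;; vs ::= !vs + #2 * !vg)%c s2) as R.
  destruct R as (R1 & R2 & R3 & R4).
  - split; [destruct X1; constructor; xs; assumption|]. xs. split; [lia|]. split; [|lia].
    intros e He. rewrite X4, A1 by lia. split.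
    + intros q Hq Hlt. pose proof (lcs_le Sf Bf q e). lia.
    + exists 0. split; lia.
  - intros k s3 Hk F (I1 & I2 & I3 & I4). rewrite sem_seq. assert (HG : 2 * g * k <= m).
    { transitivity (2 * g * nc); [apply Nat.mul_le_mono_l; lia|lia]. }
    remember (2 * g * k) as G eqn:EG.
    assert (I1' : consts (tick s3)) by (destruct I1; constructor; xs; assumption).
    destruct (chunk_ok (tick s3) G b Bf) as (K1 & K2); auto. { xs. frall. assumption. }
    { intros i Hi. xs. frall. rewrite X4. frall. apply HB. assumption. }
    pose proof (agree_sem CHUNK (tick s3)) as FC.
    assert (Hc4 : consts (sem CHUNK (tick s3))) by (eapply consts_agree; eauto).
    assert (Hvs4 : sc (sem CHUNK (tick s3)) vs = G) by (frall; xs; assumption).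
    set (s4 := sem CHUNK (tick s3)) in *. clearbody s4. pose proof (c_g _ Hc4) as Eg.
    split; [destruct Hc4; constructor; xs; assumption|]. split; [xs; rewrite Hvs4, Eg; ev; lia|]. split.
    + intros e He. destruct (K1 e He) as (L1 & L2 & L3). destruct (I3 e He) as (J1 & J2).
      cbn [sem setsc ar tick]. assert (REL : forall y h, y + G <= m ->
         (h <= lcs (fun y => Sf (G + y)) Bf y e <-> h <= lcs Sf Bf (G + y) e /\ h <= y)).
      { intros y h Hy. rewrite !lcs_spec. split.
        - intros (Q1 & Q2 & Q3). split; [|assumption]. split; [lia|]. split; [assumption|].
          intros x Hx. rewrite <- Q3 by assumption. f_equal. lia.
        - intros ((Q1 & Q2 & Q3) & Q4). do 2 (split; [assumption|]).
          intros x Hx. rewrite <- Q3 by assumption. f_equal. lia. }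
      split.
      * intros q Hq Hlt. pose proof (lcs_le Sf Bf q e) as [B1 B2].
        destruct (Nat.lt_ge_cases q (lcs Sf Bf q e + G)) as [C|C].
        -- etransitivity; [apply J1; auto|]. exact L3.
        -- rewrite <- (L1 (q - G)) by lia. apply REL; [lia|]. replace (G + (q - G)) with q by lia. split; lia.
      * destruct L2 as [L2|[L2|(y & Y1 & Y2)]].
        -- rewrite L2. exact J2.
        -- exists 0. split; lia.
        -- exists (G + y). split; [lia|]. apply REL in Y2; [|lia]. apply Y2.
    + cbn [sem setsc tk tick] in *. lia.
  - split.
    + intros e He. destruct (R3 e He) as (J1 & J2). split; [|exact J2]. intros q Hq. apply J1; auto. lia.
    + lia.
Qed.
End Chunk.

(** A consequence of [m <= 4 * g ^ 2]: lists with at most [4 * m / g] entries fit in the arrays. *)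
Hypothesis Hsmall : forall z, g * z <= 4 * m -> z <= 16 * g.

(** A while loop with a cap of [N] rounds: [L] is the number of successes before the condition first
    fails, after which the state, and with it the condition, no longer changes. *)
Lemma extend_loop (x : nat) e b s N L v :
  eval (tick s) e = N -> eval s e = N -> sc s x = v -> v + N < M ->
  (forall s' d, agree (incr x) s s' -> sc s' x = v + d -> d < N -> d <= L -> evalb s' b = (d <? L)) ->
  sc (sem (CRep e (CIf b (incr x) CSkip)) s) x = v + Nat.min N L /\
  agree (incr x) s (sem (CRep e (CIf b (incr x) CSkip)) s) /\
  tk (sem (CRep e (CIf b (incr x) CSkip)) s) <= tk s + 3 * N + 1.
Proof.
  intros _ HN Hv HM' HB. pose proof (rep_ind (fun k s' => sc s' x = v + Nat.min k L /\ agree (incr x) s s' /\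
    tk s' <= tk s + 3 * k + 1) e (CIf b (incr x) CSkip) s) as R. rewrite HN in R. apply R; clear R.
  - split; [cbn; lia|]. split; [repeat split|cbn; lia].
  - intros k s1 Hk _ (I1 & I2 & I3). rewrite sem_if. rewrite (HB (tick s1) (Nat.min k L)); auto; [|lia|lia].
    destruct (Nat.ltb_spec (Nat.min k L) L) as [C|C].
    + split; [|split].
      * xs. rewrite Nat.eqb_refl, I1. ev. lia.
      * apply (agree_tick). exact I2.
      * xs. lia.
    + split; [|split; [exact I2|]]; cbn [sem sc tick tk]; lia.
Qed.

(** * Long matches *)

(** One round reads a letter or follows a failure link. In both cases [2 * vfi - vkk] grows, so
    [2 * vg] rounds suffice. *)
Definition FSTEP : cmd :=
  (CIf (!vfi + #1 <? !vg)
    (CIf (aBUF.[!vhl + !vkk] =? aBUF.[!vhl + !vfi + #1])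
      (incr vkk ;; incr vfi ;; CSto aFL (!vfi + #1) (!vkk))
      (CIf (!vkk =? #0) (incr vfi ;; CSto aFL (!vfi + #1) #0) (vkk ::= aFL.[!vkk])))
    CSkip)%c.
Definition FAIL : cmd := (CSto aFL #1 #0 ;; vfi ::= #0 ;; vkk ::= #0 ;; CRep (#2 * !vg) FSTEP)%c.

Lemma fail_ok s hl (Y : nat -> nat) :
  sc s vg = g -> sc s vhl = hl -> hl <= g -> (forall x, x < g -> ar s aBUF (hl + x) = Y x) ->
  let s' := sem FAIL s in
  (forall k, 1 <= k <= g -> fail Y k (ar s' aFL k)) /\ tk s' <= tk s + 20 * g + 20.
Proof.
  intros Eg Eh Hh HY s'. subst s'. unfold FAIL. rewrite !sem_seq.
  set (s1 := sem (vkk ::= #0)%c (sem (vfi ::= #0)%c (sem (CSto aFL #1 #0)%c s))).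
  assert (X : sc s1 vg = g /\ sc s1 vhl = hl /\ sc s1 vfi = 0 /\ sc s1 vkk = 0 /\ ar s1 aFL 1 = 0 /\
    (forall x, x < g -> ar s1 aBUF (hl + x) = Y x) /\ tk s1 = tk s + 3).
  { unfold s1. xs. ev. repeat split; auto; try lia. }
  destruct X as (X1 & X2 & X3 & X4 & X5 & X6 & X7).
  assert (EV : eval s1 (#2 * !vg)%e = 2 * g) by (xs; rewrite X1; ev; reflexivity).
  pose proof (rep_ind (fun n s' => sc s' vfi + 1 <= g /\ sc s' vkk <= sc s' vfi /\
    kinv Y (fun x => Y (S x)) g (sc s' vkk) (sc s' vfi) /\
    (forall k, 1 <= k <= sc s' vfi + 1 -> fail Y k (ar s' aFL k)) /\
    (n + sc s' vkk <= 2 * sc s' vfi \/ sc s' vfi + 1 = g) /\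
    tk s' <= tk s1 + 10 * n + 1) (#2 * !vg)%e FSTEP s1) as R.
  destruct R as (R1 & R2 & R3 & R4 & R5 & R6).
  - xs. do 2 (split; [lia|]). split. { split; [lia|]. split; [split; intros; lia|]. intros k' Hk [Hm' _]. lia. }
    split; [|lia]. intros k Hk. replace k with 1 by lia. split; [split; intros; lia|]. intros k' [B _]. lia.
  - intros n s2 Hn F (I1 & I2 & I3 & I4 & I5 & I6). assert (E1 : sc s2 vg = g) by (frall; assumption).
    assert (E2 : sc s2 vhl = hl) by (frall; assumption).
    assert (E3 : forall x, x < g -> ar s2 aBUF (hl + x) = Y x) by (intros; frall; auto).
    set (i := sc s2 vfi) in *. set (k := sc s2 vkk) in *. unfold FSTEP. cond_is (i + 1 <? g).
    { xs. rewrite E1. ev. reflexivity. }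
    destruct (Nat.ltb_spec (i + 1) g) as [C|C].
    2:{ xs. do 2 (split; [lia|]). split; [exact I3|]. split; [exact I4|]. lia. } cond_is (Y k =? Y (S i)).
    { xs. fold i k. rewrite E2. ev. rewrite E3 by lia. replace (hl + i + 1) with (hl + S i) by lia.
      rewrite E3 by lia. reflexivity. }
    destruct (Nat.eqb_spec (Y k) (Y (S i))) as [D|D].
    + pose proof (step_match _ _ _ _ _ I3 ltac:(lia) D) as KM.
      xs. fold i k. ev. do 2 (split; [lia|]). split; [apply kmax_kinv; exact KM|].
      split; [|lia]. intros k' Hk'. destruct (Nat.eqb_spec k' (i + 1 + 1)) as [->|].
      * apply kmax_fail with (L := g); auto; lia.
      * apply I4. lia.
    + cond_is (k =? 0). { auto. } destruct (Nat.eqb_spec k 0) as [Z|Z].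
      * rewrite Z in *. pose proof (step_zero _ _ _ _ I3 D) as KM.
        xs. fold i k. rewrite Z. ev. do 2 (split; [lia|]). split; [apply kmax_kinv; exact KM|].
        split; [|lia]. intros k' Hk'. destruct (Nat.eqb_spec k' (i + 1 + 1)) as [->|].
        -- apply kmax_fail with (L := g); auto; lia.
        -- apply I4. lia.
      * pose proof (I4 k ltac:(lia)) as FK. pose proof (step_fail _ _ _ _ _ _ I3 (fun _ => D) FK) as KM.
        assert (FL : ar s2 aFL k < k) by apply FK. xs. fold i k. ev. do 2 (split; [lia|]). split; [exact KM|].
        split; [assumption|lia].
  - split.
    + intros k Hk. apply R4. destruct (Nat.eq_dec (sc (sem (CRep (#2 * !vg)%e FSTEP) s1) vfi + 1) g); lia.
    + lia.
Qed.

(** * Finding the occurrences in [S] at the end of a block *)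

Section Boundary.
Variables (B1 hl D : nat).
Hypothesis HD : D = hl + g.
Hypothesis Hhl : hl <= g.
Hypothesis HDB : D <= B1.
Hypothesis HBM : B1 < M.
Variables (p per e2 nE : nat) (eq el : nat -> nat).
Notation occ q := (g <= lcs Sf Tf q B1).
Hypothesis Hmin : minper Tf B1 g p.
Hypothesis Hper : per = if 2 * p <=? g then 1 else 0.
Hypothesis He2 : per = 1 -> e2 = lam Tf p B1.
Hypothesis HnE : g * nE <= 4 * m.
Hypothesis Hel : forall x, x < nE -> el x <= lcs Sf Tf (eq x) B1.
(** Only the last [D] letters of the text are stored, so a longer match cannot be measured again.
    Its length is taken from the list carried along since the previous boundary; in the periodic
    case this concerns the occurrences whose run is as long as that of the text. *)
Hypothesis Hcomp : forall q, q <= m -> (per = 1 -> lam Sf p q = e2) -> D < lcs Sf Tf q B1 ->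
  exists x, x < nE /\ eq x = q /\ el x = lcs Sf Tf q B1.

Record benv (s : state) : Prop := {
  b_m : sc s vm = m; b_g : sc s vg = g; b_hl : sc s vhl = hl; b_D : sc s vD = D;
  b_p : sc s vp = p; b_per : sc s vper = per; b_e2 : sc s ve2 = e2; b_nE : sc s vnE = nE;
  b_buf : forall x, x < D -> ar s aBUF x = Tf (B1 - D + x);
  b_eq : forall x, ar s aEQ x = eq x; b_el : forall x, ar s aEL x = el x;
  b_fl : forall k, 1 <= k <= g -> fail (fun x => Tf (B1 - g + x)) k (ar s aFL k) }.

Lemma nE_small : nE <= 16 * g.
Proof. exact (Hsmall _ HnE). Qed.

Definition benv_frame (c : cmd) : bool :=
  negb (wS vm c || wS vg c || wS vhl c || wS vD c || wS vp c || wS vper c || wS ve2 c || wS vnE c ||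
        wA aBUF c || wA aEQ c || wA aEL c || wA aFL c).
Lemma benv_agree c s s' : agree c s s' -> benv_frame c = true -> benv s -> benv s'.
Proof.
  intros (F & G & _) H []. apply negb_true_iff in H.
  repeat (apply orb_false_iff in H; destruct H as [H ?]). constructor; try (rewrite F by assumption; assumption).
  - intros x Hx. rewrite G by assumption. auto.
  - intros x. rewrite G by assumption. auto.
  - intros x. rewrite G by assumption. auto.
  - intros k Hk. rewrite G by assumption. auto.
Qed.

Definition PUSHG : cmd := (CSto aGQ2 (!vnG2) (!vlq) ;; CSto aGL2 (!vnG2) (!vll) ;; incr vnG2)%c.
Definition EXT : cmd := (vdd ::= #0 ;;
  CRep (!vD) (CIf ((!vdd <? !vfi) && (ES (!vfi - #1 - !vdd) =? aBUF.[!vD - #1 - !vdd])) (incr vdd) CSkip))%c.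
Definition LOOK : cmd :=
  (CIf (!vdd =? !vD) (For i3 (!vnE) (CIf ((aEQ.[!i3] =? !vfi) && (!vdd <? aEL.[!i3]))
     (vdd ::= aEL.[!i3]) CSkip)) CSkip)%c.
Definition PUSHE : cmd := (CSto aEQ2 (!vnE2) (!vfi) ;; CSto aEL2 (!vnE2) (!vdd) ;; incr vnE2)%c.
Definition EXPL : cmd := (EXT ;; LOOK ;; PUSHE)%c.

Lemma ext_ok s q : benv s -> sc s vfi = q -> q <= m ->
  sc (sem EXT s) vdd = Nat.min D (lcs Sf Tf q B1) /\ tk (sem EXT s) <= tk s + 3 * D + 2.
Proof.
  intros E Hq Hqm. unfold EXT. rewrite sem_seq. set (s1 := sem (vdd ::= #0)%c s).
  assert (X : benv s1 /\ sc s1 vdd = 0 /\ sc s1 vfi = q /\ tk s1 = tk s + 1).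
  { pose proof (agree_sem (vdd ::= #0)%c s) as F. split; [eapply benv_agree; eauto|]. repeat split; auto. }
  destruct X as (X1 & X2 & X3 & X4). pose proof (lcs_le Sf Tf q B1) as [Lq Lb]. destruct (extend_loop vdd (!vD)%e
    ((!vdd <? !vfi) && (ES (!vfi - #1 - !vdd) =? aBUF.[!vD - #1 - !vdd]))%e s1 D (lcs Sf Tf q B1) 0)
    as (R1 & R2 & R3); [apply X1|apply X1|exact X2|lia| |].
  - intros s' d F Hd HdD HdL. assert (E1 : benv s') by (eapply benv_agree; eauto).
    assert (E2 : sc s' vfi = q) by (frall; assumption).
    cbn [evalb eval]. rewrite E2, Hd, (b_D _ E1), Hm. cbn [Nat.add].
    destruct (Nat.ltb_spec d q) as [C|C]; cbn [andb].
    + ev. rewrite (b_buf _ E1) by lia. replace (B1 - D + (D - 1 - d)) with (B1 - 1 - d) by lia.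
      destruct (Nat.ltb_spec d (lcs Sf Tf q B1)) as [K|K].
      * apply Nat.eqb_eq. apply (lcs_eq Sf Tf). assumption.
      * apply Nat.eqb_neq. pose proof (lcs_stop Sf Tf q B1) as ST.
        replace (lcs Sf Tf q B1) with d in ST by lia. apply ST; lia.
    + symmetry. apply Nat.ltb_ge. lia.
  - lia.
Qed.

Lemma look_ok s q : benv s -> sc s vfi = q -> q <= m -> (per = 1 -> lam Sf p q = e2) ->
  sc s vdd = Nat.min D (lcs Sf Tf q B1) ->
  sc (sem LOOK s) vdd = lcs Sf Tf q B1 /\ tk (sem LOOK s) <= tk s + 5 * nE + 6.
Proof.
  intros E Hq Hqm Hsp Hd. pose proof nE_small as NS. unfold LOOK. cond_is (Nat.min D (lcs Sf Tf q B1) =? D).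
  { xs. rewrite Hd, (b_D _ E). reflexivity. }
  destruct (Nat.eqb_spec (Nat.min D (lcs Sf Tf q B1)) D) as [C|C].
  2:{ xs. lia. } assert (Ht : benv (tick s)). { destruct E. constructor; xs; auto. }
  assert (Hd' : sc (tick s) vdd = D) by (xs; lia).
  assert (TT : tk (tick s) = tk s + 1) by reflexivity. set (s0 := tick s) in *.
  destruct (for_ind (fun k s' => sc s' vdd <= lcs Sf Tf q B1 /\ D <= sc s' vdd /\
    (forall x, x < k -> eq x = q -> el x <= sc s' vdd) /\ tk s' <= tk s0 + 5 * k + 5) i3 (!vnE)%e
    (CIf ((aEQ.[!i3] =? !vfi) && (!vdd <? aEL.[!i3])) (vdd ::= aEL.[!i3]) CSkip)%c s0 nE) as [R _]; auto.
  - apply Ht. - lia.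
  - xs. do 2 (split; [lia|]). split; [intros; lia|lia].
  - intros k s1 Hk F Hi (I1 & I2 & I3 & I4). assert (E1 : benv s1) by (eapply benv_agree; eauto).
    assert (E2 : sc s1 vfi = q) by (frall; assumption).
    rewrite sem_if. cbn [evalb eval sc tick]. rewrite Hi, E2. ev.
    cbn [ar tick sc]. rewrite (b_eq _ E1), (b_el _ E1). destruct (Nat.eqb_spec (eq k) q) as [K|K]; cbn [andb].
    + destruct (Nat.ltb_spec (sc s1 vdd) (el k)) as [K2|K2].
      * xs. rewrite Hi. ev. rewrite (b_el _ E1). pose proof (Hel k Hk) as EK. rewrite K in EK.
        do 2 (split; [lia|]). split; [|lia].
        intros x Hx Ex. destruct (Nat.eq_dec x k) as [->|]; [lia|]. specialize (I3 x ltac:(lia) Ex). lia.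
      * xs. do 2 (split; [lia|]). split; [|lia].
        intros x Hx Ex. destruct (Nat.eq_dec x k) as [->|]; [lia|]. specialize (I3 x ltac:(lia) Ex). lia.
    + xs. do 2 (split; [lia|]). split; [|lia].
      intros x Hx Ex. destruct (Nat.eq_dec x k) as [->|]; [lia|]. specialize (I3 x ltac:(lia) Ex). lia.
  - destruct R as (R1 & R2 & R3 & R4). destruct (Nat.eq_dec (lcs Sf Tf q B1) D) as [Z|Z]; [lia|].
    destruct (Hcomp q Hqm Hsp ltac:(lia)) as (x & X1 & X2 & X3). specialize (R3 x X1 X2). lia.
Qed.

Lemma expl_ok s q : benv s -> sc s vfi = q -> q <= m -> (per = 1 -> lam Sf p q = e2) -> sc s vnE2 < 20 * g ->
  let s' := sem EXPL s in
  sc s' vnE2 = sc s vnE2 + 1 /\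
  (forall x, ar s' aEQ2 x = if x =? sc s vnE2 then q else ar s aEQ2 x) /\
  (forall x, ar s' aEL2 x = if x =? sc s vnE2 then lcs Sf Tf q B1 else ar s aEL2 x) /\
  tk s' <= tk s + (5 * D + 5 * nE + 15).
Proof.
  intros E Hq Hqm Hsp HnE2 s'. subst s'. unfold EXPL. rewrite !sem_seq. destruct (ext_ok s q E Hq Hqm) as [A1 A2].
  pose proof (agree_sem EXT s) as F1. assert (E1 : benv (sem EXT s)) by (eapply benv_agree; eauto).
  set (s1 := sem EXT s) in *. destruct (look_ok s1 q E1) as [B1' B2]; auto. { frall. assumption. }
  pose proof (agree_sem LOOK s1) as F2.
  set (s2 := sem LOOK s1) in *. assert (HN2 : sc s2 vnE2 = sc s vnE2) by (frall; reflexivity).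
  assert (HF2 : sc s2 vfi = q) by (frall; assumption). unfold PUSHE. xs. rewrite HN2, HF2, B1'. ev.
  split; [reflexivity|]. split; [intros; frall; reflexivity|]. split; [intros; frall; reflexivity|lia].
Qed.

(** The cap of [2 * g] rounds is enough where this is used, at the head of a chain: there
    [occ_first] bounds the run by [g + p]. *)
Definition LAMB : cmd := (vll ::= !vp ;; CRep (#2 * !vg)
  (CIf ((!vll <? !vfi) && (ES (!vfi - #1 - !vll) =? ES (!vfi - #1 - !vll + !vp))) (incr vll) CSkip))%c.

Lemma lamb_ok s q : benv s -> sc s vfi = q -> q <= m -> p <= q -> lam Sf p q <= p + 2 * g ->
  sc (sem LAMB s) vll = lam Sf p q /\ tk (sem LAMB s) <= tk s + 6 * g + 2.
Proof.
  intros E Hq Hqm Hpq Hl. unfold LAMB. rewrite sem_seq. destruct Hmin as (Hp & _).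
  set (s1 := sem (vll ::= !vp)%c s). assert (X : benv s1 /\ sc s1 vll = p /\ sc s1 vfi = q /\ tk s1 = tk s + 1).
  { pose proof (agree_sem (vll ::= !vp)%c s) as F.
    split; [eapply benv_agree; eauto|]. unfold s1. xs. rewrite (b_p _ E). repeat split; auto. }
  destruct X as (X1 & X2 & X3 & X4). pose proof (lcs_le Sf Sf q (q - p)) as [Lq Lb]. unfold lam in *.
  destruct (extend_loop vll (#2 * !vg)%e
    ((!vll <? !vfi) && (ES (!vfi - #1 - !vll) =? ES (!vfi - #1 - !vll + !vp)))%e s1 (2 * g) (lcs Sf Sf q (q - p)) p)
    as (R1 & R2 & R3); [| |exact X2|lia| |].
  - xs. rewrite (b_g _ X1). ev. reflexivity.
  - xs. rewrite (b_g _ X1). ev. reflexivity.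
  - intros s' d F Hd HdD HdL. assert (E1 : benv s') by (eapply benv_agree; eauto).
    assert (E2 : sc s' vfi = q) by (frall; assumption). cbn [evalb eval]. rewrite E2, Hd, (b_p _ E1), Hm.
    destruct (Nat.ltb_spec (p + d) q) as [C|C]; cbn [andb].
    + ev. replace (q - 1 - (p + d) + p) with (q - 1 - d) by lia.
      replace (q - 1 - (p + d)) with (q - p - 1 - d) by lia.
      destruct (Nat.ltb_spec d (lcs Sf Sf q (q - p))) as [K|K].
      * apply Nat.eqb_eq. symmetry. apply (lcs_eq Sf Sf). assumption.
      * apply Nat.eqb_neq. pose proof (lcs_stop Sf Sf q (q - p)) as ST.
        replace (lcs Sf Sf q (q - p)) with d in ST by lia. apply not_eq_sym. apply ST; lia.
    + symmetry. apply Nat.ltb_ge. lia.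
  - lia.
Qed.

(** [vlq] and [vll] describe the latest occurrence and its run. A chain is stored when it is over,
    by its last occurrence. The initial [vlq = 0] means that none has been seen, as no occurrence
    ends before [g]. *)
Definition OCC : cmd :=
  (CIf (!vper =? #1)
    (CIf ((#0 <? !vlq) && (!vfi =? !vlq + !vp)) (vll ::= !vll + !vp)
       (CIf (#0 <? !vlq) PUSHG CSkip ;; LAMB) ;;
     CIf (!vll =? !ve2) EXPL CSkip)
    EXPL ;;
   vlq ::= !vfi)%c.

(** The counting clauses [oi_c0] and [oi_c1] rest on [occ_gap]: without a short period successive
    occurrences, and with one the end of a chain and the head of the next, are more than [g / 2]
    apart. Run lengths strictly increase along a chain, so at most one of its occurrences has a run
    of length [e2] and is listed explicitly. *)
Record OI (i : nat) (s : state) : Prop := {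
  oi_env : benv s;
  oi_lq : sc s vlq <= i /\ (0 < sc s vlq -> occ (sc s vlq));
  oi_last : forall q, sc s vlq < q <= i -> ~ occ q;
  oi_E : forall x, x < sc s vnE2 -> ar s aEQ2 x <= i /\ ar s aEL2 x <= lcs Sf Tf (ar s aEQ2 x) B1;
  oi_ex : forall q, q <= i -> occ q -> (per = 1 -> lam Sf p q = e2) ->
    exists x, x < sc s vnE2 /\ ar s aEQ2 x = q /\ ar s aEL2 x = lcs Sf Tf q B1;
  oi_c0 : per = 0 -> sc s vnG2 = 0 /\ (sc s vlq = 0 -> sc s vnE2 = 0) /\
    (0 < sc s vlq -> g * (sc s vnE2 + 1) <= 2 * sc s vlq);
  oi_c1 : per = 1 -> (sc s vlq = 0 -> sc s vnG2 = 0) /\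
    (0 < sc s vlq -> g * (sc s vnG2 + 2) <= 2 * sc s vlq /\ sc s vll = lam Sf p (sc s vlq)) /\
    sc s vnE2 <= sc s vnG2 + (if (0 <? sc s vlq) && (e2 <=? sc s vll) then 1 else 0);
  oi_G : per = 1 -> forall x, x < sc s vnG2 -> ar s aGQ2 x <= i /\ occ (ar s aGQ2 x) /\
    ar s aGL2 x = lam Sf p (ar s aGQ2 x);
  oi_cov : per = 1 -> forall q, q <= i -> occ q ->
    (exists x k, x < sc s vnG2 /\ ar s aGQ2 x = q + k * p /\ ar s aGL2 x = lam Sf p q + k * p) \/
    (exists k, sc s vlq = q + k * p /\ sc s vll = lam Sf p q + k * p) }.

(** The potential of the scan: its costly events, which are explicit extensions and new chains, each
    raise it and may cost O(g). *)
Definition cnt (s : state) : nat := sc s vnE2 + sc s vnG2 + Nat.min 1 (sc s vlq).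

Lemma OI_small i s : OI i s -> i <= m -> sc s vnE2 + 1 <= 8 * g + 1 /\ sc s vnG2 <= 8 * g.
Proof.
  intros [] Hi. assert (Z : forall z, g * (z + 1) <= 2 * m -> z + 1 <= 8 * g).
  { intros z Hz. assert (2 * (z + 1) <= 16 * g) by (apply Hsmall; lia). lia. }
  assert (PP : per = 0 \/ per = 1) by (rewrite Hper; destruct (2 * p <=? g); auto). destruct PP as [P|P].
  - destruct (Nat.eq_dec (sc s vlq) 0) as [E|E].
    + lia.
    + specialize (Z (sc s vnE2) ltac:(lia)). lia.
  - destruct (oi_c3 P) as (A & B & C). destruct (Nat.eq_dec (sc s vlq) 0) as [E|E].
    + rewrite E in C. cbn in C. lia.
    + specialize (Z (sc s vnG2 + 1) ltac:(lia)). destruct ((0 <? sc s vlq) && (e2 <=? sc s vll)); lia.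
Qed.

Definition LLUPD : cmd :=
  (CIf ((#0 <? !vlq) && (!vfi =? !vlq + !vp)) (vll ::= !vll + !vp)
       (CIf (#0 <? !vlq) PUSHG CSkip ;; LAMB))%c.

Lemma llupd_ok s i q : q = i + 1 -> OI i s -> occ q -> sc s vfi = q -> q <= m -> per = 1 ->
  let s' := sem LLUPD s in
  sc s' vll = lam Sf p q /\
  (forall x, x < sc s vnG2 -> ar s' aGQ2 x = ar s aGQ2 x /\ ar s' aGL2 x = ar s aGL2 x) /\
  (0 < sc s vlq /\ q = sc s vlq + p /\ sc s' vnG2 = sc s vnG2 /\ sc s' vll = sc s vll + p /\ tk s' <= tk s + 5 \/
   sc s' vnG2 = sc s vnG2 + Nat.min 1 (sc s vlq) /\
   (0 < sc s vlq -> 2 * sc s vlq + g < 2 * q /\ ar s' aGQ2 (sc s vnG2) = sc s vlq /\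
      ar s' aGL2 (sc s vnG2) = sc s vll) /\ tk s' <= tk s + 6 * g + 15).
Proof.
  intros Eq O Ho Hf Hqm P. pose proof (OI_small i s O ltac:(lia)) as [SE SG]. destruct O.
  destruct Hmin as (Hp & _). assert (H2p : 2 * p <= g).
  { rewrite Hper in P. destruct (Nat.leb_spec (2 * p) g); [assumption|discriminate]. }
  destruct (oi_c3 P) as (C1 & C2 & C3). destruct oi_lq0 as [L1 L2]. pose proof (occ_ge Sf Tf B1 g q Ho) as Hgq.
  assert (GAP : 0 < sc s vlq -> 2 * (q - sc s vlq) <= g -> q = sc s vlq + p).
  { intros Z1 Z2. eapply (occ_gap Sf Tf B1 g p); eauto; try lia. intros x Hx. apply oi_last0. lia. }
  intros s'. subst s'. unfold LLUPD. cond_is ((0 <? sc s vlq) && (q =? sc s vlq + p)).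
  { xs. rewrite Hf, (b_p _ oi_env0). ev. reflexivity. }
  destruct ((0 <? sc s vlq) && (q =? sc s vlq + p)) eqn:C.
  - apply andb_true_iff in C as [Ca Cb]. apply Nat.ltb_lt in Ca. apply Nat.eqb_eq in Cb.
    destruct (C2 Ca) as [C2a C2b]. specialize (L2 Ca).
    pose proof (occ_chain Sf Tf B1 g p Hmin (sc s vlq) H2p L2) as CH. rewrite <- Cb in CH. specialize (CH Ho).
    pose proof (lam_bounds Sf p q ltac:(lia)) as LB.
    xs. rewrite (b_p _ oi_env0). ev. split; [lia|]. split; [auto|]. left. repeat split; auto; lia.
  - assert (NC : 0 < sc s vlq -> q <> sc s vlq + p).
    { intros Z1 Z2. apply andb_false_iff in C as [C|C].
      - apply Nat.ltb_ge in C. lia. - apply Nat.eqb_neq in C. contradiction. }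
    (* An occurrence at [q - p] would be at most the last one seen, which then is within
       [p <= g / 2] of [q] and so, by [GAP], at [q - p] exactly; that case has been excluded. *)
    assert (LM : lam Sf p q < g + p).
    { apply (occ_first Sf Tf B1 g p Hmin q Ho). intros Z1 Z2. assert (Z3 : q - p <= sc s vlq).
      { apply Nat.nlt_ge. intros Z4. apply (oi_last0 (q - p)); [lia|exact Z2]. }
      apply NC; [lia|]. apply GAP; lia. }
    rewrite sem_seq.
    assert (X : exists s1, sem (CIf (#0 <? !vlq) PUSHG CSkip)%c (tick s) = s1 /\ benv s1 /\ sc s1 vfi = q /\
      sc s1 vnG2 = sc s vnG2 + Nat.min 1 (sc s vlq) /\
      (forall x, x < sc s vnG2 -> ar s1 aGQ2 x = ar s aGQ2 x /\ ar s1 aGL2 x = ar s aGL2 x) /\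
      (0 < sc s vlq -> ar s1 aGQ2 (sc s vnG2) = sc s vlq /\ ar s1 aGL2 (sc s vnG2) = sc s vll) /\
      tk s1 <= tk s + 5).
    { eexists. split; [reflexivity|]. split.
      { eapply benv_agree; [apply (agree_tick (CIf (#0 <? !vlq) PUSHG CSkip)%c s s)| |]; auto. repeat split. }
      rewrite sem_if. cbn [evalb eval sc tick]. destruct (Nat.ltb_spec 0 (sc s vlq)) as [Z|Z].
      - unfold PUSHG. xs. ev. rewrite Nat.eqb_refl. split; [assumption|]. split; [lia|]. split; [|split; [auto|lia]].
        intros x Hx. destruct (Nat.eqb_spec x (sc s vnG2)); [lia|auto].
      - xs. split; [assumption|]. split; [lia|]. split; [auto|]. split; [lia|lia]. }
    destruct X as (s1 & -> & X1 & X2 & X3 & X4 & X5 & X6).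
    destruct (lamb_ok s1 q X1 X2 Hqm ltac:(lia) ltac:(lia)) as [Y1 Y2]. run (sem LAMB s1) as s2 F.
    split; [exact Y1|]. split. { intros x Hx. frall. apply X4. assumption. }
    right. split; [frall; assumption|]. split; [|lia].
    intros Z. destruct (X5 Z). split; [|split; frall; assumption].
    apply Nat.nle_gt. intros C4. apply (NC Z). apply GAP; lia.
Qed.

Notation A := (5 * D + 5 * nE + 6 * g + 40).

Lemma cond_expl s q : benv s -> sc s vfi = q -> q <= m -> sc s vnE2 < 20 * g -> sc s vll = lam Sf p q -> per = 1 ->
  let s' := sem (CIf (!vll =? !ve2) EXPL CSkip)%c s in
  let b := lam Sf p q =? e2 in
  sc s' vnE2 = sc s vnE2 + (if b then 1 else 0) /\
  (b = true -> ar s' aEQ2 (sc s vnE2) = q /\ ar s' aEL2 (sc s vnE2) = lcs Sf Tf q B1) /\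
  (forall x, x < sc s vnE2 -> ar s' aEQ2 x = ar s aEQ2 x /\ ar s' aEL2 x = ar s aEL2 x) /\
  tk s' <= tk s + (if b then 5 * D + 5 * nE + 15 else 0) + 1.
Proof.
  intros E Hf Hqm HnE2 Hll P s' b. subst s'. cond_is b. { xs. rewrite Hll, (b_e2 _ E). reflexivity. }
  assert (Et : benv (tick s)) by (destruct E; constructor; xs; auto). destruct b eqn:B.
  - apply Nat.eqb_eq in B. destruct (expl_ok (tick s) q Et Hf Hqm (fun _ => B) HnE2) as (A1 & A2 & A3 & A4).
    cbn [sc ar tk tick] in *. split; [exact A1|]. split. { rewrite A2, A3, Nat.eqb_refl. auto. }
    split; [|lia]. intros x Hx. rewrite A2, A3. destruct (Nat.eqb_spec x (sc s vnE2)); [lia|auto].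
  - cbn [sem sc ar tk tick]. repeat split; auto; try lia; discriminate.
Qed.

Lemma occ_step s i q : q = i + 1 -> OI i s -> occ q -> sc s vfi = q -> q <= m ->
  let s' := sem OCC s in
  OI q s' /\ tk s' + A * cnt s <= tk s + A * cnt s' + 15.
Proof.
  intros Eq O Ho Hf Hqm s'. pose proof (OI_small i s O ltac:(lia)) as [SE SG].
  pose proof (occ_ge Sf Tf B1 g q Ho) as Hgq. pose proof Hmin as (Hp & _).
  assert (Hsg : forall q', q' <= q -> q' = q \/ q' <= i) by lia.
  assert (PP : per = 0 \/ per = 1) by (rewrite Hper; destruct (2 * p <=? g); auto).
  subst s'. unfold OCC. rewrite sem_seq. destruct PP as [P|P].
  - cond_is false. { xs. rewrite (b_per _ (oi_env _ _ O)), P. reflexivity. }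
    destruct O. destruct (oi_c2 P) as (C1 & C2 & C3). destruct oi_lq0 as [L1 L2].
    assert (H2p : g < 2 * p). { rewrite Hper in P. destruct (Nat.leb_spec (2 * p) g); [discriminate|assumption]. }
    assert (Et : benv (tick s)) by (destruct oi_env0; constructor; xs; auto).
    destruct (expl_ok (tick s) q Et Hf Hqm ltac:(lia) ltac:(cbn [sc tick]; lia)) as (A1 & A2 & A3 & A4).
    pose proof (agree_sem EXPL (tick s)) as F.
    assert (E1 : benv (sem EXPL (tick s))) by (eapply benv_agree; eauto).
    set (s1 := sem EXPL (tick s)) in *. clearbody s1. cbn [sc ar tick tk] in A1, A2, A3, A4.
    assert (F1 : sc s1 vfi = q) by (frall; exact Hf). assert (F2 : sc s1 vnG2 = 0) by (frall; exact C1). clear F.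
    assert (GAP : 0 < sc s vlq -> g < 2 * (q - sc s vlq)).
    { intros Z1. apply Nat.nle_gt. intros Z2. assert (q = sc s vlq + p); [|lia].
      eapply (occ_gap Sf Tf B1 g p); eauto; try lia. intros x Hx. apply oi_last0. lia. }
    split.
    + assert (V : sc (sem (vlq ::= !vfi)%c s1) vlq = q) by (xs; assumption).
      constructor; rewrite ?V; cbn [sem sc ar setsc tick Nat.eqb]; try lia.
      * eapply benv_agree; [apply (agree_sem (vlq ::= !vfi)%c)| |]; auto.
      * intros x Hx. rewrite A1 in Hx. rewrite A2, A3. destruct (Nat.eqb_spec x (sc s vnE2)); [lia|].
        specialize (oi_E0 x ltac:(lia)). lia.
      * intros q' Hq' Ho' _. destruct (Hsg q' Hq') as [->|Hq2].
        -- exists (sc s vnE2). rewrite A1, A2, A3, Nat.eqb_refl. repeat split; lia.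
        -- destruct (oi_ex0 q' Hq2 Ho' ltac:(lia)) as (x & X1 & X2). exists x. rewrite A1, A2, A3.
           destruct (Nat.eqb_spec x (sc s vnE2)); [lia|]. split; [lia|exact X2].
    + unfold cnt. cbn [sem sc ar setsc tick Nat.eqb tk eval]. rewrite A1, F2, C1, F1.
      assert (A * (sc s vnE2 + 0 + Nat.min 1 (sc s vlq)) + A <= A * (sc s vnE2 + 1 + 0 + Nat.min 1 q)).
      { rewrite <- Nat.mul_succ_r. apply Nat.mul_le_mono_l. clear - Hgq Hg. lia. }
      lia.
  - cond_is true. { xs. rewrite (b_per _ (oi_env _ _ O)), P. reflexivity. } rewrite sem_seq.
    assert (Ot : OI i (tick s)) by (destruct O as [E ? ? ? ? ? ? ? ?]; constructor; auto; destruct E; constructor; auto).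
    destruct (llupd_ok (tick s) i q Eq Ot Ho Hf Hqm P) as (A1 & A2 & A3).
    pose proof (agree_sem LLUPD (tick s)) as F1.
    assert (E1 : benv (sem LLUPD (tick s))) by (eapply benv_agree; [eassumption|reflexivity|apply Ot]).
    fold LLUPD. set (s1 := sem LLUPD (tick s)) in *. clearbody s1. cbn [sc ar tick tk] in A1, A2, A3.
    destruct (cond_expl s1 q E1) as (B1' & B2 & B3 & B4); auto. { frall. exact Hf. } { frall. cbn [sc tick]. lia. }
    pose proof (agree_sem (CIf (!vll =? !ve2) EXPL CSkip)%c s1) as F2.
    assert (E2 : benv (sem (CIf (!vll =? !ve2) EXPL CSkip)%c s1)) by (eapply benv_agree; eauto).
    set (s2 := sem (CIf (!vll =? !ve2) EXPL CSkip)%c s1) in *. clearbody s2.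
    assert (N1 : sc s1 vnE2 = sc s vnE2) by (frall; reflexivity). rewrite N1 in *.
    assert (N2 : forall x, ar s1 aEQ2 x = ar s aEQ2 x /\ ar s1 aEL2 x = ar s aEL2 x) by (intros; split; frall; reflexivity).
    assert (N3 : sc s2 vfi = q) by (frall; exact Hf).
    assert (N4 : sc s2 vnG2 = sc s1 vnG2) by (frall; reflexivity).
    assert (N5 : sc s2 vll = lam Sf p q) by (rewrite ((proj1 F2) vll eq_refl); exact A1).
    assert (N6 : forall x, ar s2 aGQ2 x = ar s1 aGQ2 x /\ ar s2 aGL2 x = ar s1 aGL2 x) by (intros; split; frall; reflexivity).
    clear F1 F2 Ot. destruct O. destruct (oi_c3 P) as (C1 & C2 & C3). destruct oi_lq0 as [L1 L2].
    clear oi_c2. specialize (oi_G0 P). specialize (oi_cov0 P). assert (PM : 0 = per -> False) by lia. split.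
    + assert (V : sc (sem (vlq ::= !vfi)%c s2) vlq = q) by (xs; assumption).
      constructor; rewrite ?V; cbn [sem sc ar setsc tick Nat.eqb]; rewrite ?B1', ?N4, ?N5; try lia.
      * eapply benv_agree; [apply (agree_sem (vlq ::= !vfi)%c)| |]; auto.
      * intros x Hx. destruct (Nat.eq_dec x (sc s vnE2)) as [->|Hne].
        -- destruct (lam Sf p q =? e2); [|lia]. destruct (B2 eq_refl) as [-> ->]. lia.
        -- assert (Hx' : x < sc s vnE2) by (destruct (lam Sf p q =? e2); lia).
           destruct (B3 x Hx') as [-> ->]. destruct (N2 x) as [-> ->]. specialize (oi_E0 x Hx'). lia.
      * intros q' Hq' Ho' Hs. destruct (Hsg q' Hq') as [->|Hq2].
        -- exists (sc s vnE2). rewrite (proj2 (Nat.eqb_eq _ _) (Hs P)) in *. destruct (B2 eq_refl) as [-> ->].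
           repeat split; lia.
        -- destruct (oi_ex0 q' Hq2 Ho' Hs) as (x & X1 & X2 & X3). exists x.
           destruct (B3 x X1) as [-> ->]. destruct (N2 x) as [-> ->]. split; [lia|auto].
      * intros _. split; [lia|]. split.
        -- intros _. split; [|reflexivity]. destruct A3 as [(Z1 & Z2 & Z3 & _)|(Z1 & Z2 & _)].
           ++ specialize (C2 Z1). lia.
           ++ destruct (Nat.eq_dec (sc s vlq) 0) as [Z|Z]; [rewrite C1 in * by assumption; lia|].
              destruct (Z2 ltac:(lia)) as [Z3 _]. destruct (C2 ltac:(lia)) as [Z4 _].
              replace (sc s1 vnG2) with (sc s vnG2 + 1) by lia. lia.
        -- destruct (Nat.ltb_spec 0 q); [|lia]. cbn [andb]. destruct A3 as [(Z1 & Z2 & Z3 & Z4 & _)|(Z1 & Z2 & _)].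
           ++ destruct (Nat.ltb_spec 0 (sc s vlq)); [|lia]. cbn [andb] in C3.
              destruct (Nat.eqb_spec (lam Sf p q) e2); destruct (Nat.leb_spec e2 (lam Sf p q));
                destruct (Nat.leb_spec e2 (sc s vll)); lia.
           ++ assert (sc s vnE2 <= sc s1 vnG2).
              { destruct (Nat.ltb_spec 0 (sc s vlq)); cbn [andb] in C3; [destruct (e2 <=? sc s vll)|]; lia. }
              destruct (Nat.eqb_spec (lam Sf p q) e2); destruct (Nat.leb_spec e2 (lam Sf p q)); lia.
      * intros _ x Hx. destruct (N6 x) as [-> ->]. destruct (Nat.lt_ge_cases x (sc s vnG2)) as [Hx'|Hx'].
        -- destruct (A2 x Hx') as [-> ->]. specialize (oi_G0 x Hx'). intuition lia.
        -- destruct A3 as [(Z1 & Z2 & Z3 & _)|(Z1 & Z2 & _)]; [lia|].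
           destruct (Z2 ltac:(lia)) as (Z3 & Z4 & Z5). replace x with (sc s vnG2) by lia. rewrite Z4, Z5.
           split; [lia|]. split; [apply L2; lia|]. apply C2. lia.
      * intros _ q' Hq' Ho'. destruct (Hsg q' Hq') as [->|Hq2].
        -- right. exists 0. lia.
        -- destruct (oi_cov0 q' Hq2 Ho') as [(x & k & X1 & X2 & X3)|(k & X1 & X2)].
           ++ left. exists x, k. destruct (N6 x) as [-> ->]. destruct (A2 x X1) as [-> ->].
              split; [|auto]. destruct A3 as [(Z1 & Z2 & Z3 & _)|(Z1 & Z2 & _)]; lia.
           ++ destruct A3 as [(Z1 & Z2 & Z3 & Z4 & _)|(Z1 & Z2 & _)].
              ** right. exists (k + 1). lia.
              ** left. exists (sc s vnG2), k. destruct (N6 (sc s vnG2)) as [-> ->].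
                 assert (Z : 0 < sc s vlq) by (pose proof (occ_ge Sf Tf B1 g q' Ho'); lia).
                 destruct (Z2 Z) as (_ & -> & ->). split; [lia|auto].
    + unfold cnt. cbn [sem sc ar setsc tick Nat.eqb tk eval]. rewrite N3, N4, B1'.
      destruct A3 as [(Z1 & Z2 & Z3 & Z4 & Z5)|(Z1 & Z2 & Z5)].
      * destruct (lam Sf p q =? e2).
        -- assert (A * (sc s vnE2 + 1 + sc s vnG2 + Nat.min 1 q) = A * (sc s vnE2 + sc s vnG2 + Nat.min 1 (sc s vlq)) + A)
             by (replace (Nat.min 1 q) with 1 by lia; replace (Nat.min 1 (sc s vlq)) with 1 by lia; clear; lia). lia.
        -- replace (Nat.min 1 (sc s vlq)) with 1 by lia. lia.
      * destruct (lam Sf p q =? e2).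
        -- lia.
        -- lia.
Qed.

Lemma OI_skip i s : OI i s -> ~ occ (i + 1) -> OI (i + 1) s.
Proof.
  intros [E [L1 L2] La HE Hex H0 H1 HG Hc] Hn. constructor; auto.
  - lia.
  - intros q Hq. destruct (Nat.eq_dec q (i + 1)) as [->|]; [assumption|]. apply La. lia.
  - intros x Hx. specialize (HE x Hx). lia.
  - intros q Hq Ho. destruct (Nat.eq_dec q (i + 1)) as [->|]; [contradiction|]. apply Hex; auto. lia.
  - intros P x Hx. specialize (HG P x Hx). intuition lia.
  - intros P q Hq Ho. destruct (Nat.eq_dec q (i + 1)) as [->|]; [contradiction|]. apply Hc; auto. lia.
Qed.

Definition scan_frame (c : cmd) : bool :=
  negb (wS vlq c || wS vll c || wS vnE2 c || wS vnG2 c || wA aEQ2 c || wA aEL2 c || wA aGQ2 c || wA aGL2 c).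

Lemma OI_agree c i s s' : agree c s s' -> benv_frame c = true -> scan_frame c = true -> OI i s ->
  OI i s' /\ cnt s' = cnt s.
Proof.
  intros F H1 H2 O. pose proof F as (FS & FA & _). apply negb_true_iff in H2.
  repeat (apply orb_false_iff in H2; destruct H2 as [H2 ?]).
  assert (E1 : sc s' vlq = sc s vlq) by auto. assert (E2 : sc s' vll = sc s vll) by auto.
  assert (E3 : sc s' vnE2 = sc s vnE2) by auto. assert (E4 : sc s' vnG2 = sc s vnG2) by auto.
  split; [|unfold cnt; rewrite E1, E3, E4; reflexivity].
  destruct O as [E HL La HE Hex H0' H1' HG Hc]. constructor; rewrite ?E1, ?E2, ?E3, ?E4; auto.
  - eapply benv_agree; eauto.
  - intros x Hx. rewrite !FA by assumption. auto.
  - intros q Hq Ho Hs. destruct (Hex q Hq Ho Hs) as (x & X). exists x. rewrite !FA by assumption. auto.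
  - intros P x Hx. rewrite !FA by assumption. auto.
  - intros P q Hq Ho. destruct (Hc P q Hq Ho) as [(x & k & X)|X]; [left; exists x, k; rewrite !FA by assumption|right]; auto.
Qed.

Definition SSTEP : cmd :=
  (CIf (!vfi <? !vm)
    (CIf ((!vkk <? !vg) && (aBUF.[!vhl + !vkk] =? ES (!vfi)))
      ((incr vkk ;; incr vfi) ;; CIf (!vkk =? !vg) OCC CSkip)
      (CIf (!vkk =? #0) (incr vfi) (vkk ::= aFL.[!vkk])))
    CSkip)%c.
Notation Y := (fun x => Tf (B1 - g + x)).

Lemma kmax_occ k i : kmax Y Sf g k i -> (occ i <-> k = g).
Proof.
  intros (K1 & K2 & K3). rewrite <- (mt_lcs Tf Y Sf B1 g i) by (lia || auto). split.
  - intros Ho. destruct (Nat.eq_dec k g) as [|C]; auto. exfalso. apply (K3 g); [lia|assumption].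
  - intros ->. assumption.
Qed.

Lemma sstep_ok s n :
  sc s vfi <= m -> kinv Y Sf g (sc s vkk) (sc s vfi) -> OI (sc s vfi) s ->
  (n + sc s vkk <= 2 * sc s vfi \/ sc s vfi = m) ->
  let s' := sem SSTEP s in
  sc s' vfi <= m /\ kinv Y Sf g (sc s' vkk) (sc s' vfi) /\ OI (sc s' vfi) s' /\
  (S n + sc s' vkk <= 2 * sc s' vfi \/ sc s' vfi = m) /\
  tk s' + A * cnt s <= tk s + A * cnt s' + 20.
Proof.
  intros Hfm HK O Hn s'. subst s'. pose proof (oi_env _ _ O) as E.
  set (i := sc s vfi) in *. set (k := sc s vkk) in *. assert (Hkg : k <= g) by apply HK.
  unfold SSTEP. cond_is (i <? m). { xs. fold i. rewrite (b_m _ E). reflexivity. }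
  destruct (Nat.ltb_spec i m) as [C|C].
  2:{ change (sem CSkip (tick s)) with (tick s). cbn [sc tick tk]. fold i k. split; [lia|].
      split; [exact HK|]. split; [|split; [right; lia|]].
      - apply (OI_agree CSkip i s); auto. repeat split.
      - change (cnt (tick s)) with (cnt s). lia. }
  cond_is ((k <? g) && (Y k =? Sf i)).
  { xs. fold k i. rewrite (b_g _ E), (b_hl _ E), Hm. destruct (Nat.ltb_spec k g) as [D1|D1]; [|reflexivity].
    cbn [andb]. ev. rewrite (b_buf _ E) by lia. replace (B1 - D + (hl + k)) with (B1 - g + k) by lia. reflexivity. }
 destruct ((k <? g) && (Y k =? Sf i)) eqn:D1.
  - apply andb_true_iff in D1 as [Da Db]. apply Nat.ltb_lt in Da. apply Nat.eqb_eq in Db.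
    pose proof (step_match _ _ _ _ _ HK Da Db) as KM. pose proof (kmax_occ _ _ KM) as KO.
    rewrite sem_seq. destruct (OI_agree (incr vkk ;; incr vfi)%c i s (sem (incr vkk ;; incr vfi)%c (tick (tick s)))) as [O1 C1]; auto.
    { apply (agree_tick (incr vkk ;; incr vfi)%c s (tick s)). repeat split. }
    assert (X : sc (sem (incr vkk ;; incr vfi)%c (tick (tick s))) vkk = k + 1 /\
                sc (sem (incr vkk ;; incr vfi)%c (tick (tick s))) vfi = i + 1 /\
                tk (sem (incr vkk ;; incr vfi)%c (tick (tick s))) = tk s + 4).
    { xs. ev. repeat split; lia. }
    set (s1 := sem (incr vkk ;; incr vfi)%c (tick (tick s))) in *. destruct X as (X1 & X2 & X3).
    cond_is (k + 1 =? g). { xs. rewrite X1, (b_g _ (oi_env _ _ O1)). reflexivity. }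
    destruct (Nat.eqb_spec (k + 1) g) as [G|G].
    + destruct (OI_agree CSkip i s1 (tick s1)) as [O2 C2]; auto. { repeat split. }
      destruct (occ_step (tick s1) i (i + 1) eq_refl O2 (proj2 KO G) X2 ltac:(lia)) as [O3 T3].
      run (sem OCC (tick s1)) as s2 F. assert (Y1 : sc s2 vkk = k + 1) by (frall; exact X1).
      assert (Y2 : sc s2 vfi = i + 1) by (frall; exact X2).
      rewrite Y1, Y2. split; [lia|]. split; [apply kmax_kinv; exact KM|]. split; [exact O3|].
      split; [lia|]. cbn [tk tick] in T3. lia.
    + change (sem CSkip (tick s1)) with (tick s1). cbn [sc tick tk]. rewrite X1, X2. split; [lia|].
      split; [apply kmax_kinv; exact KM|]. split; [|split; [lia|]].
      * apply OI_skip; [|rewrite KO; exact G]. apply (OI_agree CSkip i s1); auto. repeat split.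
      * change (cnt (tick s1)) with (cnt s1). lia.
  - assert (NE : k < g -> Y k <> Sf i).
    { intros Z. apply andb_false_iff in D1 as [D1|D1]; [apply Nat.ltb_ge in D1; lia|]. apply Nat.eqb_neq. exact D1. }
    cond_is (k =? 0). { auto. } destruct (Nat.eqb_spec k 0) as [Z|Z].
    + rewrite Z in *. pose proof (step_zero _ _ _ _ HK (NE ltac:(lia))) as KM. pose proof (kmax_occ _ _ KM) as KO.
      destruct (OI_agree (incr vfi) i s (sem (incr vfi) (tick (tick (tick s))))) as [O1 C1]; auto.
      { apply (agree_tick (incr vfi) s (tick (tick s))). repeat split. }
      assert (X : sc (sem (incr vfi) (tick (tick (tick s)))) vkk = 0 /\
                  sc (sem (incr vfi) (tick (tick (tick s)))) vfi = i + 1 /\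
                  tk (sem (incr vfi) (tick (tick (tick s)))) = tk s + 4).
      { xs. ev. repeat split; lia. }
      destruct X as (X1 & X2 & X3). rewrite X1, X2. split; [lia|]. split; [apply kmax_kinv; exact KM|].
      split; [apply OI_skip; [assumption|rewrite KO; lia]|]. lia.
    + pose proof (b_fl _ E k ltac:(lia)) as FK. pose proof (step_fail _ _ _ _ _ _ HK NE FK) as KM.
      assert (FL : ar s aFL k < k) by apply FK.
      destruct (OI_agree (vkk ::= aFL.[!vkk])%c i s (sem (vkk ::= aFL.[!vkk])%c (tick (tick (tick s))))) as [O1 C1]; auto.
      { apply (agree_tick (vkk ::= aFL.[!vkk])%c s (tick (tick s))). repeat split. }
      assert (X : sc (sem (vkk ::= aFL.[!vkk])%c (tick (tick (tick s)))) vkk = ar s aFL k /\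
                  sc (sem (vkk ::= aFL.[!vkk])%c (tick (tick (tick s)))) vfi = i /\
                  tk (sem (vkk ::= aFL.[!vkk])%c (tick (tick (tick s)))) = tk s + 4).
      { xs. ev. repeat split; lia. }
      destruct X as (X1 & X2 & X3). rewrite X1, X2. split; [lia|]. split; [exact KM|]. split; [exact O1|]. lia.
Qed.

(** As in [FAIL], each round advances in [S] or follows a failure link, whence [2 * vm] rounds. The
    chain that is still open at the end is stored afterwards. *)
Definition SCAN : cmd :=
  ((vfi ::= #0 ;; vkk ::= #0 ;; vlq ::= #0 ;; vll ::= #0 ;; vnE2 ::= #0 ;; vnG2 ::= #0) ;;
   CRep (#2 * !vm) SSTEP ;; CIf ((!vper =? #1) && (#0 <? !vlq)) PUSHG CSkip)%c.

Lemma scan_ok s : benv s ->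
  let s' := sem SCAN s in
  (forall x, x < sc s' vnE2 -> ar s' aEQ2 x <= m /\ ar s' aEL2 x <= lcs Sf Tf (ar s' aEQ2 x) B1) /\
  (forall q, q <= m -> occ q -> (per = 1 -> lam Sf p q = e2) ->
    exists x, x < sc s' vnE2 /\ ar s' aEQ2 x = q /\ ar s' aEL2 x = lcs Sf Tf q B1) /\
  (per = 0 -> sc s' vnG2 = 0) /\
  g * (sc s' vnE2 + sc s' vnG2) <= 4 * m /\
  (per = 1 -> forall x, x < sc s' vnG2 -> ar s' aGQ2 x <= m /\ occ (ar s' aGQ2 x) /\
    ar s' aGL2 x = lam Sf p (ar s' aGQ2 x)) /\
  (per = 1 -> forall q, q <= m -> occ q ->
    exists x k, x < sc s' vnG2 /\ ar s' aGQ2 x = q + k * p /\ ar s' aGL2 x = lam Sf p q + k * p) /\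
  exists c, g * c <= 4 * m /\ tk s' <= tk s + 42 * m + A * c + 20.
Proof.
  intros E s'. subst s'. unfold SCAN. rewrite sem_seq.
  set (c1 := (vfi ::= #0 ;; vkk ::= #0 ;; vlq ::= #0 ;; vll ::= #0 ;; vnE2 ::= #0 ;; vnG2 ::= #0)%c).
  pose proof (agree_sem c1 s) as F1. assert (E1 : benv (sem c1 s)) by (eapply benv_agree; eauto).
  assert (X : sc (sem c1 s) vfi = 0 /\ sc (sem c1 s) vkk = 0 /\ sc (sem c1 s) vlq = 0 /\ sc (sem c1 s) vll = 0 /\
    sc (sem c1 s) vnE2 = 0 /\ sc (sem c1 s) vnG2 = 0 /\ tk (sem c1 s) = tk s + 6).
  { unfold c1. xs. repeat split; lia. }
  set (s1 := sem c1 s) in *. destruct X as (X1 & X2 & X3 & X4 & X5 & X6 & X7).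
  rewrite sem_seq. assert (EV : eval s1 (#2 * !vm)%e = 2 * m) by (xs; rewrite (b_m _ E1); ev; reflexivity).
  pose proof (rep_ind (fun n s' => sc s' vfi <= m /\ kinv Y Sf g (sc s' vkk) (sc s' vfi) /\ OI (sc s' vfi) s' /\
    (n + sc s' vkk <= 2 * sc s' vfi \/ sc s' vfi = m) /\ tk s' <= tk s1 + 1 + 21 * n + A * cnt s') (#2 * !vm)%e SSTEP s1) as R.
  rewrite EV in R. destruct R as (R1 & R2 & R3 & R4 & R5).
  - cbn [sc tick tk]. split; [lia|]. split; [|split; [|lia]].
    + split; [lia|]. split; [split; intros; lia|]. intros k' Hk' [Hm' _]. lia.
    + constructor; cbn [sc ar tick]; rewrite ?X3, ?X4, ?X5, ?X6; try (intros; lia).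
      * destruct E1; constructor; auto.
      * intros q Hq Ho. pose proof (occ_ge Sf Tf B1 g q Ho). lia.
      * intros _ q Hq Ho. pose proof (occ_ge Sf Tf B1 g q Ho). lia.
  - intros n s2 Hn F (I1 & I2 & I3 & I4 & I5).
    destruct (OI_agree CSkip (sc s2 vfi) s2 (tick s2)) as [O2 C2]; auto. { repeat split. }
    destruct (sstep_ok (tick s2) n I1 I2 O2 I4) as (K1 & K2 & K3 & K4 & K5).
    split; [exact K1|]. split; [exact K2|]. split; [exact K3|]. cbn [tk tick] in K5. lia.
  - set (s2 := sem (CRep (#2 * !vm)%e SSTEP) s1) in *. clearbody s2.
    assert (Rm : sc s2 vfi = m) by lia. rewrite Rm in R3. clear R1 R2 R4 E1 X1 X2 X3 X4 X5 X6.
    pose proof (OI_small m s2 R3 (le_n _)) as [SE SG]. pose proof R3 as [E2 [L1 L2] La HE Hex H0 H1 HG Hc].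
    assert (PP : per = 0 \/ per = 1) by (rewrite Hper; destruct (2 * p <=? g); auto).
    cond_is ((per =? 1) && (0 <? sc s2 vlq)). { xs. rewrite (b_per _ E2). reflexivity. }
    assert (CN : g * cnt s2 <= 4 * m).
    { unfold cnt. destruct PP as [P|P].
      - destruct (Nat.eq_dec (sc s2 vlq) 0) as [Z|Z].
        + lia.
        + replace (Nat.min 1 (sc s2 vlq)) with 1 by lia. lia.
      - destruct (Nat.eq_dec (sc s2 vlq) 0) as [Z|Z].
        + rewrite Z in *. cbn in *. nia.
        + replace (Nat.min 1 (sc s2 vlq)) with 1 by lia.
          assert (Z5 : sc s2 vnE2 + sc s2 vnG2 + 1 <= 2 * (sc s2 vnG2 + 2)).
          { destruct ((0 <? sc s2 vlq) && (e2 <=? sc s2 vll)); lia. }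
          apply (Nat.mul_le_mono_l _ _ g) in Z5. lia. }
    destruct ((per =? 1) && (0 <? sc s2 vlq)) eqn:C.
    + apply andb_true_iff in C as [P C]. apply Nat.eqb_eq in P. apply Nat.ltb_lt in C.
      unfold PUSHG. xs. ev. split; [exact HE|]. split; [exact Hex|]. split; [lia|].
      split; [unfold cnt in CN; replace (Nat.min 1 (sc s2 vlq)) with 1 in CN by lia; lia|]. split; [|split].
      * intros _ x Hx. destruct (Nat.eqb_spec x (sc s2 vnG2)) as [Ex|Ex].
        -- lia.
        -- apply HG; auto. lia.
      * intros _ q Hq Ho. destruct (Hc P q Hq Ho) as [(x & k & Z1 & Z2 & Z3)|(k & Z1 & Z2)].
        -- exists x, k. destruct (Nat.eqb_spec x (sc s2 vnG2)); [lia|]. split; [lia|auto].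
        -- exists (sc s2 vnG2), k. rewrite Nat.eqb_refl. split; [lia|auto].
      * exists (cnt s2). lia.
    + assert (Z : per = 1 -> sc s2 vlq = 0 /\ sc s2 vnG2 = 0).
      { intros P. rewrite P in C. apply Nat.ltb_ge in C. lia. }
      xs. split; [exact HE|]. split; [exact Hex|]. split; [intros P; apply H0; exact P|].
      split; [transitivity (g * cnt s2); [apply Nat.mul_le_mono_l; unfold cnt; lia|exact CN]|]. split; [|split].
      * lia.
      * intros P q Hq Ho. destruct (Hc P q Hq Ho) as [(x & k & Z1 & _)|(k & Z1 & _)]; [lia|].
        pose proof (occ_ge Sf Tf B1 g q Ho). lia.
      * exists (cnt s2). lia.
Qed.
End Boundary.

(* [GQ] holds one representative per chain [q, q + p, q + 2p, ...] of occurrences in [S]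
   of the last [g] letters, when these are [p]-periodic. *)
Record LI (B j : nat) (s : state) : Prop := {
  li_E : forall x, x < sc s vnE -> ar s aEQ x <= m /\ ar s aEL x <= lcs Sf Tf (ar s aEQ x) j;
  li_cnt : g * (sc s vnE + sc s vnG) <= 4 * m;
  li_run : sc s vrun = 0 /\ sc s vnG = 0 /\
      (forall q, q <= m -> g + (j - B) <= lcs Sf Tf q j ->
         exists x, x < sc s vnE /\ ar s aEQ x = q /\ ar s aEL x = lcs Sf Tf q j) /\
      (forall p, minper Tf B g p -> 2 * p <= g -> exists x, B <= x < j /\ Tf x <> Tf (x - p)) \/
    sc s vrun = 1 /\ exists p, sc s vp = p /\ minper Tf B g p /\ 2 * p <= g /\ sc s ve = lam Tf p j /\
      (forall x, B <= x < j -> Tf x = Tf (x - p)) /\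
      (forall x, x < sc s vnG -> ar s aGQ x <= m /\ ar s aGL x = lam Sf p (ar s aGQ x) /\
         g <= ar s aGL x /\ g <= lcs Sf Tf (ar s aGQ x) j) /\
      (forall q, q <= m -> g + (j - B) <= lcs Sf Tf q j ->
         (exists x k, x < sc s vnG /\ ar s aGQ x = q + k * p /\ ar s aGL x = lam Sf p q + k * p) /\
         (lam Sf p q = sc s ve ->
            exists x, x < sc s vnE /\ ar s aEQ x = q /\ ar s aEL x = lcs Sf Tf q j)) }.

Definition long_frame (c : cmd) : bool :=
  negb (wS vnE c || wS vnG c || wS vrun c || wS vp c || wS ve c ||
        wA aEQ c || wA aEL c || wA aGQ c || wA aGL c).
Lemma LI_agree c B j s s' : agree c s s' -> long_frame c = true -> LI B j s -> LI B j s'.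
Proof.
  intros (F & G & _) H [L1 L2 L3]. apply negb_true_iff in H.
  repeat (apply orb_false_iff in H; destruct H as [H ?]).
  assert (E1 : sc s' vnE = sc s vnE) by auto. assert (E2 : sc s' vnG = sc s vnG) by auto.
  assert (E3 : sc s' vrun = sc s vrun) by auto. assert (E4 : sc s' vp = sc s vp) by auto.
  assert (E5 : sc s' ve = sc s ve) by auto.
  assert (E6 : forall x, ar s' aEQ x = ar s aEQ x) by auto. assert (E7 : forall x, ar s' aEL x = ar s aEL x) by auto.
  assert (E8 : forall x, ar s' aGQ x = ar s aGQ x) by auto. assert (E9 : forall x, ar s' aGL x = ar s aGL x) by auto.
  constructor.
  - intros x. rewrite E1, E6, E7. apply L1.
  - lia.
  - rewrite E1, E2, E3, E4, E5. destruct L3 as [(R1 & R2 & R3 & R4)|(R1 & p & R2 & R3 & R4 & R5 & R6 & R7 & R8)].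
    + left. repeat split; auto. intros q Hq Hl. destruct (R3 q Hq Hl) as (x & X). exists x. rewrite E6, E7. exact X.
    + right. split; [assumption|]. exists p. do 5 (split; [assumption|]). split.
      * intros x Hx. rewrite E8, E9. auto.
      * intros q Hq Hl. destruct (R8 q Hq Hl) as ((x & k & X) & Y). split.
        -- exists x, k. rewrite E8, E9. exact X.
        -- intros Z. destruct (Y Z) as (y & Y'). exists y. rewrite E6, E7. exact Y'.
Qed.

(** * Carrying the long matches over a block boundary *)

Definition TLAM : cmd := (ve2 ::= !vp ;;
  CRep (!vD) (CIf ((!ve2 <? !vD) && (aBUF.[!vD - #1 - !ve2] =? aBUF.[!vD - #1 - !ve2 + !vp])) (incr ve2) CSkip) ;;
  CIf ((!ve2 =? !vD) && (!vrun =? #1)) (ve2 ::= !ve) CSkip)%c.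
Definition COPY : cmd :=
  (vnE ::= !vnE2 ;; vnG ::= !vnG2 ;;
   For i3 (!vnE2) (CSto aEQ (!i3) (aEQ2.[!i3]) ;; CSto aEL (!i3) (aEL2.[!i3])) ;;
   For i3 (!vnG2) (CSto aGQ (!i3) (aGQ2.[!i3]) ;; CSto aGL (!i3) (aGL2.[!i3])) ;;
   vrun ::= !vper ;; ve ::= !ve2)%c.
Definition SHIFT : cmd := (For i3 (!vg) (CSto aBUF (!i3) (aBUF.[!vhl + !i3])) ;; vhl ::= !vg)%c.
Definition BPRE : cmd :=
  ((vD ::= !vhl + !vg ;; FAIL) ;; vp ::= !vg - aFL.[!vg] ;; TLAM ;;
   CIf (!vg <? #2 * !vp) (vper ::= #0) (vper ::= #1))%c.
Definition BOUNDARY : cmd := (BPRE ;; SCAN ;; COPY ;; SHIFT)%c.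

Lemma tlam_ok s B1 D p : sc s vD = D -> sc s vp = p -> 1 <= p <= D -> D <= B1 -> D <= 2 * g ->
  (forall x, x < D -> ar s aBUF x = Tf (B1 - D + x)) ->
  let s' := sem TLAM s in
  sc s' ve2 = (if (Nat.min D (lam Tf p B1) =? D) && (sc s vrun =? 1) then sc s ve else Nat.min D (lam Tf p B1)) /\
  tk s' <= tk s + 3 * D + 5.
Proof.
  intros ED Ep Hp HD HD2 HB s'. subst s'. unfold TLAM. rewrite !sem_seq. set (s1 := sem (ve2 ::= !vp)%c s).
  assert (X : sc s1 vD = D /\ sc s1 vp = p /\ sc s1 ve2 = p /\ sc s1 vrun = sc s vrun /\ sc s1 ve = sc s ve /\
     (forall x, ar s1 aBUF x = ar s aBUF x) /\ tk s1 = tk s + 1).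
  { repeat split; auto. }
  destruct X as (X1 & X2 & X3 & X4 & X5 & X6 & X7).
  pose proof (lcs_le Tf Tf B1 (B1 - p)) as [Lq Lb]. unfold lam. destruct (extend_loop ve2 (!vD)%e
    ((!ve2 <? !vD) && (aBUF.[!vD - #1 - !ve2] =? aBUF.[!vD - #1 - !ve2 + !vp]))%e s1 D
      (Nat.min (D - p) (lcs Tf Tf B1 (B1 - p))) p)
    as (R1 & R2 & R3); [exact X1|exact X1|exact X3|lia| |].
  - intros s' d F Hd HdD HdL. assert (E1 : sc s' vD = D) by (frall; assumption).
    assert (E2 : sc s' vp = p) by (frall; assumption).
    assert (E3 : forall x, x < D -> ar s' aBUF x = Tf (B1 - D + x)) by (intros; frall; rewrite X6; auto).
    cbn [evalb eval]. rewrite E1, Hd, E2. destruct (Nat.ltb_spec (p + d) D) as [C|C]; cbn [andb].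
    + ev. replace (D - 1 - (p + d) + p) with (D - 1 - d) by lia. rewrite !E3 by lia.
      replace (B1 - D + (D - 1 - d)) with (B1 - 1 - d) by lia.
      replace (B1 - D + (D - 1 - (p + d))) with (B1 - p - 1 - d) by lia.
      destruct (Nat.ltb_spec d (Nat.min (D - p) (lcs Tf Tf B1 (B1 - p)))) as [K|K].
      * apply Nat.eqb_eq. symmetry. apply (lcs_eq Tf Tf). lia.
      * apply Nat.eqb_neq. pose proof (lcs_stop Tf Tf B1 (B1 - p)) as ST.
        replace (lcs Tf Tf B1 (B1 - p)) with d in ST by lia. apply not_eq_sym. apply ST; lia.
    + symmetry. apply Nat.ltb_ge. lia.
  - set (s2 := sem _ s1) in *. assert (Y1 : sc s2 vD = D) by (frall; assumption).
    assert (Y2 : sc s2 vrun = sc s vrun) by (frall; assumption).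
    assert (Y3 : sc s2 ve = sc s ve) by (frall; assumption).
    assert (Y4 : sc s2 ve2 = Nat.min D (p + lcs Tf Tf B1 (B1 - p))) by lia.
    cond_is ((Nat.min D (p + lcs Tf Tf B1 (B1 - p)) =? D) && (sc s vrun =? 1)).
    { xs. rewrite Y1, Y2, Y4. reflexivity. }
    destruct ((Nat.min D (p + lcs Tf Tf B1 (B1 - p)) =? D) && (sc s vrun =? 1)).
    + xs. split; [exact Y3|lia].
    + xs. split; [exact Y4|lia].
Qed.

Lemma copy_ok s : sc s vnE2 <= 16 * g -> sc s vnG2 <= 16 * g ->
  let s' := sem COPY s in
  sc s' vnE = sc s vnE2 /\ sc s' vnG = sc s vnG2 /\ sc s' vrun = sc s vper /\ sc s' ve = sc s ve2 /\
  (forall x, x < sc s vnE2 -> ar s' aEQ x = ar s aEQ2 x /\ ar s' aEL x = ar s aEL2 x) /\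
  (forall x, x < sc s vnG2 -> ar s' aGQ x = ar s aGQ2 x /\ ar s' aGL x = ar s aGL2 x) /\
  tk s' <= tk s + 200 * g + 20.
Proof.
  intros H1 H2 s'. subst s'. unfold COPY. rewrite sem_seq, (sem_seq (vnG ::= !vnG2)%c).
  set (s1 := sem (vnG ::= !vnG2)%c (sem (vnE ::= !vnE2)%c s)).
  assert (X : sc s1 vnE = sc s vnE2 /\ sc s1 vnG = sc s vnG2 /\ agree (vnE ::= !vnE2 ;; vnG ::= !vnG2)%c s s1 /\ tk s1 = tk s + 2).
  { do 2 (split; [reflexivity|]). split; [apply (agree_sem)|unfold s1; xs; lia]. }
  destruct X as (X1 & X2 & F & X3). assert (Y1 : sc s1 vnE2 = sc s vnE2) by (frall; reflexivity). rewrite sem_seq.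
  destruct (for_ind (fun k s' => (forall x, x < k -> ar s' aEQ x = ar s1 aEQ2 x /\ ar s' aEL x = ar s1 aEL2 x) /\
    tk s' <= tk s1 + 6 * k + 5) i3 (!vnE2)%e (CSto aEQ (!i3) (aEQ2.[!i3]) ;; CSto aEL (!i3) (aEL2.[!i3]))%c s1 (sc s vnE2)) as [[R1 R2] _]; auto.
  - lia.
  - xs. split; [intros; lia|lia].
  - intros k s2 Hk F2 Hi (I1 & I2). xs. rewrite Hi. ev. split; [|lia].
    intros x Hx. destruct (Nat.eqb_spec x k) as [->|]; [frall; auto|]. destruct (I1 x ltac:(lia)) as [-> ->]. auto.
  - pose proof (agree_sem (For i3 (!vnE2) (CSto aEQ (!i3) (aEQ2.[!i3]) ;; CSto aEL (!i3) (aEL2.[!i3])))%c s1) as F2.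
    set (s2 := sem (For i3 (!vnE2) _)%c s1) in *. rewrite sem_seq.
    destruct (for_ind (fun k s' => (forall x, x < k -> ar s' aGQ x = ar s2 aGQ2 x /\ ar s' aGL x = ar s2 aGL2 x) /\
      tk s' <= tk s2 + 6 * k + 5) i3 (!vnG2)%e (CSto aGQ (!i3) (aGQ2.[!i3]) ;; CSto aGL (!i3) (aGL2.[!i3]))%c s2 (sc s vnG2)) as [[R3 R4] _]; auto.
    + xs. frall. reflexivity.
    + lia.
    + xs. split; [intros; lia|lia].
    + intros k s3 Hk F3 Hi (I1 & I2). xs. rewrite Hi. ev. split; [|lia].
      intros x Hx. destruct (Nat.eqb_spec x k) as [->|]; [frall; auto|].
      destruct (I1 x ltac:(lia)) as [-> ->]. auto.
    + pose proof (agree_sem (For i3 (!vnG2) (CSto aGQ (!i3) (aGQ2.[!i3]) ;; CSto aGL (!i3) (aGL2.[!i3])))%c s2) as F3.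
      set (s3 := sem (For i3 (!vnG2) _)%c s2) in *. xs.
      split; [frall; assumption|]. split; [frall; assumption|]. split; [frall; reflexivity|].
      split; [frall; reflexivity|]. split; [|split; [|lia]].
      * intros x Hx. destruct (R1 x Hx) as [Z1 Z2].
        rewrite ((proj1 (proj2 F3)) aEQ x eq_refl), ((proj1 (proj2 F3)) aEL x eq_refl), Z1, Z2. frall. auto.
      * intros x Hx. destruct (R3 x Hx) as [Z1 Z2]. rewrite Z1, Z2. frall. auto.
Qed.

Lemma shift_ok s : sc s vg = g -> sc s vhl <= g ->
  let s' := sem SHIFT s in
  sc s' vhl = g /\ (forall x, x < g -> ar s' aBUF x = ar s aBUF (sc s vhl + x)) /\ tk s' <= tk s + 5 * g + 10.
Proof.
  intros H1 H2 s'. subst s'. unfold SHIFT. rewrite sem_seq.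
  destruct (for_ind (fun k s' => (forall x, x < k -> ar s' aBUF x = ar s aBUF (sc s vhl + x)) /\
    (forall x, k <= x -> ar s' aBUF x = ar s aBUF x) /\
    tk s' <= tk s + 5 * k + 5) i3 (!vg)%e (CSto aBUF (!i3) (aBUF.[!vhl + !i3]))%c s g) as [(R1 & R2 & R3) _]; auto.
  - lia.
  - xs. split; [intros; lia|]. split; [auto|lia].
  - intros k s1 Hk F Hi (I1 & I2 & I3). xs. rewrite Hi. frall. ev. split; [|split; [|lia]].
    + intros x Hx. destruct (Nat.eqb_spec x k) as [->|]; [apply I2; lia|apply I1; lia].
    + intros x Hx. destruct (Nat.eqb_spec x k); [lia|apply I2; lia].
  - pose proof (agree_sem (For i3 (!vg) (CSto aBUF (!i3) (aBUF.[!vhl + !i3])))%c s) as F.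
    set (s1 := sem (For i3 _ _) s) in *. xs. split; [frall; assumption|]. split; [exact R1|lia].
Qed.

Lemma bpre_ok s B1 hl : sc s vg = g -> sc s vhl = hl -> hl <= g -> hl + g <= B1 ->
  (forall x, x < hl + g -> ar s aBUF x = Tf (B1 - (hl + g) + x)) ->
  let s' := sem BPRE s in
  exists p, sc s' vD = hl + g /\ sc s' vp = p /\ minper Tf B1 g p /\
  sc s' vper = (if 2 * p <=? g then 1 else 0) /\
  sc s' ve2 = (if (Nat.min (hl + g) (lam Tf p B1) =? hl + g) && (sc s vrun =? 1) then sc s ve
               else Nat.min (hl + g) (lam Tf p B1)) /\
  (forall k, 1 <= k <= g -> fail (fun x => Tf (B1 - g + x)) k (ar s' aFL k)) /\
  tk s' <= tk s + 30 * g + 40.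
Proof.
  intros Eg Eh Hh HB HBUF s'. subst s'. unfold BPRE. rewrite !sem_seq.
  pose proof (agree_sem (vD ::= !vhl + !vg)%c s) as F1.
  assert (X1 : sc (sem (vD ::= !vhl + !vg)%c s) vD = hl + g) by (xs; rewrite Eg, Eh; ev; reflexivity).
  assert (X2 : tk (sem (vD ::= !vhl + !vg)%c s) = tk s + 1) by reflexivity.
  set (s1 := sem (vD ::= !vhl + !vg)%c s) in *.
  destruct (fail_ok s1 hl (fun x => Tf (B1 - g + x))) as [Y1 Y2]; try (frall; auto; lia).
  { intros x Hx. frall. rewrite HBUF by lia. f_equal. lia. }
  run (sem FAIL s1) as s2 F2. set (kf := ar s2 aFL g) in *. pose proof (Y1 g ltac:(lia)) as FG.
  assert (HMP : minper Tf B1 g (g - kf)). { eapply (fail_minper Tf (fun x => Tf (B1 - g + x))); eauto; try lia. }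
  assert (Hkf : kf < g) by apply FG. pose proof (agree_sem (vp ::= !vg - aFL.[!vg])%c s2) as F3.
  assert (X3 : sc (sem (vp ::= !vg - aFL.[!vg])%c s2) vp = g - kf). { xs. frall. rewrite Eg. ev. reflexivity. }
  assert (X4 : tk (sem (vp ::= !vg - aFL.[!vg])%c s2) = tk s2 + 1) by reflexivity.
  set (s3 := sem (vp ::= !vg - aFL.[!vg])%c s2) in *. assert (W1 : sc s3 vD = hl + g) by (frall; exact X1).
  assert (W2 : forall x, x < hl + g -> ar s3 aBUF x = Tf (B1 - (hl + g) + x)) by (intros; frall; auto).
  destruct (tlam_ok s3 B1 (hl + g) (g - kf) W1 X3) as [Z1 Z2]; auto; try lia.
  assert (W3 : sc s3 vrun = sc s vrun) by (frall; reflexivity). assert (W4 : sc s3 ve = sc s ve) by (frall; reflexivity).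
  rewrite W3, W4 in Z1. run (sem TLAM s3) as s4 F4.
  assert (W5 : sc s4 vg = g) by (frall; exact Eg). assert (W6 : sc s4 vp = g - kf) by (frall; exact X3).
  assert (W7 : sc s4 vD = hl + g) by (frall; exact X1).
  assert (W8 : forall k, ar s4 aFL k = ar s2 aFL k) by (intros; frall; reflexivity).
  exists (g - kf). cond_is (g <? 2 * (g - kf)). { xs. rewrite W5, W6. ev. reflexivity. }
  destruct (Nat.ltb_spec g (2 * (g - kf))) as [C|C]; destruct (Nat.leb_spec (2 * (g - kf)) g) as [C'|C']; try lia;
    (xs; split; [exact W7|]; split; [exact W6|]; split; [exact HMP|]; split; [reflexivity|];
     split; [exact Z1|]; split; [intros; rewrite W8; auto|lia]).
Qed.

Lemma boundary_ok s B B1 hl : B1 = B + g -> B1 < M -> sc s vm = m -> sc s vg = g -> sc s vhl = hl ->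
  (hl = 0 /\ B = 0 \/ hl = g /\ g <= B) ->
  (forall x, x < hl + g -> ar s aBUF x = Tf (B1 - (hl + g) + x)) -> LI B B1 s ->
  let s' := sem BOUNDARY s in
  LI B1 B1 s' /\ sc s' vhl = g /\ (forall x, x < g -> ar s' aBUF x = Tf (B1 - g + x)) /\
  tk s' <= tk s + 600 * m + 300 * g + 90.
Proof.
  intros EB HBM Em Eg Eh Hh HBUF LIs s'. subst s'. unfold BOUNDARY. rewrite !sem_seq.
  destruct (bpre_ok s B1 hl) as (p & P1 & P2 & P3 & P4 & P5 & P6 & P7); auto; try lia. run (sem BPRE s) as s1 F1.
  pose (D := hl + g). fold D in P1, P5, HBUF. remember (if 2 * p <=? g then 1 else 0) as per eqn:Eper.
  set (nE := sc s vnE). set (eq := fun x => ar s aEQ x). set (el := fun x => ar s aEL x). set (e2 := sc s1 ve2).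
  destruct LIs as [LE LC LR]. pose proof P3 as (Hp & HY & _).
  assert (PER : per = 1 -> 2 * p <= g) by (intros Z; rewrite Z in Eper; destruct (Nat.leb_spec (2 * p) g); [assumption|discriminate]).
  assert (PER0 : per = 0 \/ per = 1) by (rewrite Eper; destruct (2 * p <=? g); auto).
  assert (LRG : g <= lam Tf p B1) by (apply (text_lam Tf B1 g p P3)).
  pose proof (lam_bounds Tf p B1 ltac:(lia)) as LB. assert (DB : D <= B1) by (unfold D; lia).
  (* The run that reaches back over the whole buffer is the one already recorded. *)
  assert (OLD : sc s vrun = 1 -> hl = g /\ per = 1 /\ sc s ve = lam Tf p B1).
  { intros R1. destruct LR as [(R & _)|(_ & p' & R2 & R3 & R4 & R5 & R6 & _)]; [lia|].
    pose proof (minper_gB _ _ _ _ R3) as HgB. split; [lia|]. assert (E : p' = p).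
    { apply (minper_unique Tf B1 g); [|exact P3]. apply (minper_extend Tf B); auto. lia. }
    rewrite E in *. split; [|exact R5]. rewrite Eper. destruct (Nat.leb_spec (2 * p) g); [reflexivity|lia]. }
  (* A run of period [p] over the whole buffer was not broken within the block, and the [g] letters
     before [B] have the same least period. So the run was recorded at [B]. *)
  assert (NEW : per = 1 -> D <= lam Tf p B1 -> hl = g -> sc s vrun = 1).
  { intros P L HG. destruct LR as [(R1 & R2 & R3 & R4)|(R & _)]; [exfalso|exact R].
    assert (PZ : forall z, B1 - D + p <= z < B1 -> Tf z = Tf (z - p)).
    { intros z Hz. pose proof (lam_per Tf p B1 (B1 - 1 - z) ltac:(lia) ltac:(lia)) as Z. cbv beta in Z.
      replace (B1 - 1 - (B1 - 1 - z)) with z in Z by lia. rewrite Z. f_equal. lia. }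
    destruct (R4 p) as (x & X1 & X2); [|lia|].
    - apply (minper_transfer Tf B1 B g p (B1 - D) B1); auto; unfold D; lia.
    - apply X2. apply PZ. unfold D. lia. }
  (* In the first block the buffer is the whole prefix and the run is measured exactly. Later, a run
     that fills the buffer is the recorded one and [ve] is its length. *)
  assert (E2 : per = 1 -> e2 = lam Tf p B1).
  { intros P. unfold e2. rewrite P5. destruct (Nat.eqb_spec (Nat.min D (lam Tf p B1)) D) as [C|C]; cbn [andb]; [|lia].
    destruct (Nat.eqb_spec (sc s vrun) 1) as [R|R]; [apply OLD; exact R|].
    destruct Hh as [[H1 H2]|[H1 H2]]; [unfold D in *; lia|]. exfalso. apply R. apply NEW; auto; lia. }
  assert (HEL : forall x, x < nE -> el x <= lcs Sf Tf (eq x) B1) by (intros x Hx; apply LE; exact Hx).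
  (* A match longer than the buffer covers the block and the [g] letters before it, so the invariant
     of the block has kept track of it. *)
  assert (HC : forall q, q <= m -> (per = 1 -> lam Sf p q = e2) -> D < lcs Sf Tf q B1 ->
    exists x, x < nE /\ eq x = q /\ el x = lcs Sf Tf q B1).
  { intros q Hq Hs HL. pose proof (lcs_le Sf Tf q B1) as [_ LL]. unfold D in HL. assert (HG : hl = g) by lia.
    destruct LR as [(R1 & R2 & R3 & R4)|(R & p' & R2 & R3 & R4 & R5 & R6 & R7 & R8)].
    - apply R3; auto. lia.
    - destruct (OLD R) as (O1 & O2 & O3). destruct (R8 q Hq ltac:(lia)) as [_ R9]. apply R9.
      rewrite O3, <- (E2 O2). assert (E : p' = p).
      { apply (minper_unique Tf B1 g); [|exact P3]. apply (minper_extend Tf B); auto. lia. }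
      rewrite E. apply Hs. exact O2. }
  assert (BE : benv B1 hl D p per e2 nE eq el s1).
  { constructor; auto.
    - frall. exact Em. - frall. exact Eg. - frall. exact Eh. - frall. reflexivity.
    - intros x Hx. frall. apply HBUF. exact Hx.
    - intros x. frall. reflexivity. - intros x. frall. reflexivity. }
  assert (HNE : g * nE <= 4 * m) by (unfold nE; lia). destruct (scan_ok B1 hl D eq_refl ltac:(lia) DB HBM
    p per e2 nE eq el P3 Eper E2 HNE HEL HC s1 BE) as (S1 & S2 & S3 & S4 & S5 & S6 & c & S7 & S8).
  run (sem SCAN s1) as s2 F2. pose proof Hsmall as SM. pose proof (SM _ S4) as SM4.
  destruct (copy_ok s2) as (C1 & C2 & C3 & C4 & C5 & C6 & C7); [lia|lia|]. run (sem COPY s2) as s3 F3.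
  assert (X1 : sc s3 vg = g) by (frall; exact Eg). assert (X2 : sc s3 vhl = hl) by (frall; exact Eh).
  assert (X3 : sc s3 vp = p) by (frall; exact P2).
  assert (X4 : forall x, x < D -> ar s3 aBUF x = Tf (B1 - D + x)) by (intros; frall; auto).
  assert (X5 : sc s3 vrun = per) by (rewrite C3; frall; exact P4).
  assert (X6 : sc s3 ve = e2) by (rewrite C4; frall; reflexivity).
  destruct (shift_ok s3 X1 ltac:(lia)) as (D1 & D2 & D3). pose proof (agree_sem SHIFT s3) as F4.
  assert (LI3 : LI B1 B1 s3).
  { clear F1 F2 F3 F4 D1 D2 D3 HBUF P6 BE. constructor.
    - rewrite C1. intros x Hx. destruct (C5 x Hx) as [-> ->]. apply S1. exact Hx.
    - auto; lia.
    - rewrite X5, X6, C1, C2, X3. destruct PER0 as [P|P].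
      + left. split; [exact P|]. split; [apply S3; exact P|]. split.
        * intros q Hq HL. destruct (S2 q Hq ltac:(lia) ltac:(lia)) as (x & Z1 & Z2).
          exists x. destruct (C5 x Z1) as [-> ->]. auto.
        * intros p' Hp' H2. rewrite (minper_unique _ _ _ _ _ Hp' P3) in H2.
          rewrite P in Eper. destruct (Nat.leb_spec (2 * p) g); [discriminate|lia].
      + right. split; [exact P|]. exists p. split; [reflexivity|]. split; [exact P3|]. split; [auto|].
        split; [auto|]. split; [intros; lia|]. split.
        * intros x Hx. destruct (C6 x Hx) as [-> ->]. destruct (S5 P x Hx) as (Z1 & Z2 & Z3).
          split; [exact Z1|]. split; [exact Z3|]. split; [|exact Z2]. rewrite Z3.
          apply (occ_lam Sf Tf B1 g p P3). exact Z2.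
        * intros q Hq HL. split.
          -- destruct (S6 P q Hq ltac:(lia)) as (x & k & Z1 & Z2). exists x, k.
             destruct (C6 x Z1) as [-> ->]. auto.
          -- intros Z. destruct (S2 q Hq ltac:(lia) ltac:(auto)) as (x & Z1 & Z2).
             exists x. destruct (C5 x Z1) as [-> ->]. auto. }
  split; [|split; [exact D1|split]].
  - eapply LI_agree; [exact F4|reflexivity|exact LI3].
  - intros x Hx. rewrite D2 by exact Hx. rewrite X2, X4 by (unfold D; lia). f_equal. clear - DB. lia.
  (* There are at most [4 * m / g] costly events, each of cost at most [136 * g]. *)
  - clear - S8 P7 C7 D3 SM4 S7 HNE Hg SM Hh EB Em. assert (T1 : (5 * D + 5 * nE + 6 * g + 40) * c <= 544 * m).
    { pose proof (SM _ HNE) as NB. assert (5 * D + 5 * nE + 6 * g + 40 <= 136 * g) by lia.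
      transitivity (136 * g * c); [apply Nat.mul_le_mono_r; assumption|]. lia. }
    lia.
Qed.

(** * Updating the long matches by one letter *)

Definition ebody : cmd :=
  (CIf ((aEQ.[!i3] <? !vm) && (ES (aEQ.[!i3]) =? !vc))
    (CSto aEQ (!vnE2) (aEQ.[!i3] + #1) ;; CSto aEL (!vnE2) (aEL.[!i3] + #1) ;; incr vnE2) CSkip)%c.
(** The list is filtered in place: the write index [vnE2] never overtakes the read index. *)
Definition EUPD : cmd := (vnE2 ::= #0 ;; For i3 (!vnE) ebody ;; vnE ::= !vnE2)%c.

Lemma eupd_ok s c : sc s vm = m -> sc s vc = c -> sc s vnE <= 20 * g ->
  (forall x, x < sc s vnE -> ar s aEQ x <= m /\ ar s aEL x <= m) ->
  let s' := sem EUPD s in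
  sc s' vnE <= sc s vnE /\
  (forall x', x' < sc s' vnE -> exists x, x < sc s vnE /\ ar s aEQ x < m /\ Sf (ar s aEQ x) = c /\
     ar s' aEQ x' = ar s aEQ x + 1 /\ ar s' aEL x' = ar s aEL x + 1) /\
  (forall x, x < sc s vnE -> ar s aEQ x < m -> Sf (ar s aEQ x) = c ->
     exists x', x' < sc s' vnE /\ ar s' aEQ x' = ar s aEQ x + 1 /\ ar s' aEL x' = ar s aEL x + 1) /\
  tk s' <= tk s + 8 * sc s vnE + 10.
Proof.
  intros Em Ec Hn HE s'. subst s'. unfold EUPD. rewrite !sem_seq. set (s1 := sem (vnE2 ::= #0)%c s).
  assert (X : agree (vnE2 ::= #0)%c s s1 /\ sc s1 vnE2 = 0 /\ tk s1 = tk s + 1).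
  { split; [apply (agree_sem)|]. auto. }
  destruct X as (F1 & X1 & X2). destruct (for_ind (fun k s' => sc s' vnE2 <= k /\
    (forall x, sc s' vnE2 <= x -> ar s' aEQ x = ar s aEQ x /\ ar s' aEL x = ar s aEL x) /\
    (forall x', x' < sc s' vnE2 -> exists x, x < sc s vnE /\ ar s aEQ x < m /\ Sf (ar s aEQ x) = c /\
       ar s' aEQ x' = ar s aEQ x + 1 /\ ar s' aEL x' = ar s aEL x + 1) /\
    (forall x, x < k -> ar s aEQ x < m -> Sf (ar s aEQ x) = c ->
       exists x', x' < sc s' vnE2 /\ ar s' aEQ x' = ar s aEQ x + 1 /\ ar s' aEL x' = ar s aEL x + 1) /\
    tk s' <= tk s1 + 7 * k + 5) i3 (!vnE)%e ebody s1 (sc s vnE)) as [R _].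
  - xs. frall. reflexivity. - auto. - lia.
  - xs. split; [lia|]. split; [intros; frall; auto|]. split; [intros; lia|]. split; [intros; lia|lia].
  - intros k s2 Hk F Hi (I1 & I2 & I3 & I4 & I5). destruct (HE k Hk) as [B1 B2].
    assert (E1 : sc s2 vm = m) by (frall; assumption). assert (E2 : sc s2 vc = c) by (frall; assumption).
    destruct (I2 k I1) as [E3 E4]. unfold ebody. cond_is ((ar s aEQ k <? m) && (Sf (ar s aEQ k) =? c)).
    { xs. rewrite Hi, E1, E2. ev. rewrite E3. destruct (Nat.ltb_spec (ar s aEQ k) m) as [D|D]; [|reflexivity].
      ev. reflexivity. }
    destruct ((ar s aEQ k <? m) && (Sf (ar s aEQ k) =? c)) eqn:C.
    + apply andb_true_iff in C as [C1 C2]. apply Nat.ltb_lt in C1. apply Nat.eqb_eq in C2.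
      xs. rewrite Hi. ev. rewrite E3, E4. set (n := sc s2 vnE2) in *. split; [lia|].
      split; [|split; [|split; [|lia]]].
      * intros x Hx. destruct (Nat.eqb_spec x n); [lia|]. apply I2. lia.
      * intros x' Hx'. destruct (Nat.eqb_spec x' n) as [->|Hne].
        -- exists k. auto.
        -- destruct (I3 x' ltac:(lia)) as (x & X). exists x. exact X.
      * intros x Hx Z1 Z2. destruct (Nat.eq_dec x k) as [->|Hne].
        -- exists n. rewrite Nat.eqb_refl. split; [lia|auto].
        -- destruct (I4 x ltac:(lia) Z1 Z2) as (x' & Y1 & Y2). exists x'.
           destruct (Nat.eqb_spec x' n); [lia|]. split; [lia|exact Y2].
    + xs. split; [lia|]. split; [exact I2|]. split; [exact I3|]. split; [|lia].
      intros x Hx Z1 Z2. destruct (Nat.eq_dec x k) as [->|Hne]; [|apply I4; auto; lia].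
      apply andb_false_iff in C as [C|C]; [apply Nat.ltb_ge in C; lia|apply Nat.eqb_neq in C; contradiction].
  - destruct R as (R1 & R2 & R3 & R4 & R5). set (s2 := sem (For i3 _ _) s1) in *. xs.
    split; [exact R1|]. split; [exact R3|]. split; [exact R4|lia].
Qed.

Definition gbody : cmd :=
  (CIf ((aGQ.[!i3] <? !vm) && (ES (aGQ.[!i3]) =? !vc))
    (CSto aGQ (!vnG2) (aGQ.[!i3] + #1) ;; CSto aGL (!vnG2) (aGL.[!i3] + #1) ;; incr vnG2)
    (CIf (aGL.[!i3] + #1 <? !vp + !vg) CSkip
      (CSto aGQ (!vnG2) (aGQ.[!i3] + #1 - !vp) ;; CSto aGL (!vnG2) (aGL.[!i3] + #1 - !vp) ;; incr vnG2)))%c.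
Definition CONT : cmd := (incr ve ;; vnG2 ::= #0 ;; For i3 (!vnG) gbody ;; vnG ::= !vnG2)%c.

(** The condition [p + g <= l + 1] ensures that one period earlier there is still a run of at least
    [g] letters, hence an occurrence. *)
Definition gmove (c p q l q' l' : nat) : Prop :=
  q < m /\ Sf q = c /\ q' = q + 1 /\ l' = l + 1 \/
  ~ (q < m /\ Sf q = c) /\ p + g <= l + 1 /\ q' = q + 1 - p /\ l' = l + 1 - p.

Lemma cont_ok s c p : sc s vm = m -> sc s vg = g -> sc s vc = c -> sc s vp = p -> p <= g -> sc s vnG <= 20 * g ->
  sc s ve + 1 < M ->
  (forall x, x < sc s vnG -> ar s aGQ x <= m /\ ar s aGL x <= ar s aGQ x) ->
  let s' := sem CONT s in
  sc s' ve = sc s ve + 1 /\ sc s' vnG <= sc s vnG /\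
  (forall x', x' < sc s' vnG -> exists x, x < sc s vnG /\ gmove c p (ar s aGQ x) (ar s aGL x) (ar s' aGQ x') (ar s' aGL x')) /\
  (forall x q' l', x < sc s vnG -> gmove c p (ar s aGQ x) (ar s aGL x) q' l' ->
     exists x', x' < sc s' vnG /\ ar s' aGQ x' = q' /\ ar s' aGL x' = l') /\
  tk s' <= tk s + 9 * sc s vnG + 10.
Proof.
  intros Em Eg Ec Ep Hp Hn He HE s'. subst s'. unfold CONT. rewrite !sem_seq.
  set (s1 := sem (vnG2 ::= #0)%c (sem (incr ve) s)).
  assert (X : agree (incr ve ;; vnG2 ::= #0)%c s s1 /\ sc s1 vnG2 = 0 /\ sc s1 ve = sc s ve + 1 /\ tk s1 = tk s + 2).
  { split; [apply (agree_sem (incr ve ;; vnG2 ::= #0)%c)|]. unfold s1. xs. ev. repeat split; lia. }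
  destruct X as (F1 & X1 & X2 & X3). pose proof (agree_sem (For i3 (!vnG) gbody) s1) as FF.
  destruct (for_ind (fun k s' => sc s' vnG2 <= k /\
    (forall x, sc s' vnG2 <= x -> ar s' aGQ x = ar s aGQ x /\ ar s' aGL x = ar s aGL x) /\
    (forall x', x' < sc s' vnG2 -> exists x, x < sc s vnG /\ gmove c p (ar s aGQ x) (ar s aGL x) (ar s' aGQ x') (ar s' aGL x')) /\
    (forall x q' l', x < k -> gmove c p (ar s aGQ x) (ar s aGL x) q' l' ->
       exists x', x' < sc s' vnG2 /\ ar s' aGQ x' = q' /\ ar s' aGL x' = l') /\
    tk s' <= tk s1 + 8 * k + 5) i3 (!vnG)%e gbody s1 (sc s vnG)) as [R _].
  - xs. frall. reflexivity. - auto. - lia.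
  - xs. split; [lia|]. split; [intros; frall; auto|]. split; [intros; lia|]. split; [intros; lia|lia].
  - intros k s2 Hk F Hi (I1 & I2 & I3 & I4 & I5). destruct (HE k Hk) as [B1 B2].
    assert (E1 : sc s2 vm = m) by (frall; assumption). assert (E2 : sc s2 vc = c) by (frall; assumption).
    assert (E5 : sc s2 vp = p) by (frall; assumption). assert (E6 : sc s2 vg = g) by (frall; assumption).
    destruct (I2 k I1) as [E3 E4]. unfold gbody.
    set (q := ar s aGQ k) in *. set (l := ar s aGL k) in *. cond_is ((q <? m) && (Sf q =? c)).
    { xs. rewrite Hi, E1, E2. ev. rewrite E3. destruct (Nat.ltb_spec q m) as [D|D]; [|reflexivity].
      ev. reflexivity. }
    destruct ((q <? m) && (Sf q =? c)) eqn:C.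
    + apply andb_true_iff in C as [C1 C2]. apply Nat.ltb_lt in C1. apply Nat.eqb_eq in C2.
      xs. rewrite Hi. ev. rewrite E3, E4. set (n := sc s2 vnG2) in *. split; [lia|].
      split; [|split; [|split; [|lia]]].
      * intros x Hx. destruct (Nat.eqb_spec x n); [lia|]. apply I2. lia.
      * intros x' Hx'. destruct (Nat.eqb_spec x' n) as [->|Hne].
        -- exists k. split; [assumption|]. left. auto.
        -- apply I3. lia.
      * intros x q' l' Hx Z. destruct (Nat.eq_dec x k) as [->|Hne].
        -- exists n. rewrite Nat.eqb_refl. split; [lia|].
           destruct Z as [(Z1 & Z2 & -> & ->)|(Z1 & _)]; [auto|]. exfalso. auto.
        -- destruct (I4 x q' l' ltac:(lia) Z) as (x' & Y1 & Y2). exists x'.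
           destruct (Nat.eqb_spec x' n); [lia|]. split; [lia|exact Y2].
    + assert (NC : ~ (q < m /\ Sf q = c)).
      { intros [Z1 Z2]. apply andb_false_iff in C as [C|C]; [apply Nat.ltb_ge in C; lia|apply Nat.eqb_neq in C; contradiction]. }
      cond_is (l + 1 <? p + g). { xs. rewrite Hi, E5, E6. ev. rewrite E4. reflexivity. }
      destruct (Nat.ltb_spec (l + 1) (p + g)) as [D|D].
      * xs. split; [lia|]. split; [exact I2|]. split; [exact I3|]. split; [|lia].
        intros x q' l' Hx Z. destruct (Nat.eq_dec x k) as [->|Hne]; [|apply I4 with (x := x); auto; lia].
        exfalso. destruct Z as [(Z1 & Z2 & _)|(_ & Z2 & _)]; [apply NC; auto|lia].
      * xs. rewrite Hi, E5. ev. rewrite E3, E4. set (n := sc s2 vnG2) in *. split; [lia|].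
        split; [|split; [|split; [|lia]]].
        -- intros x Hx. destruct (Nat.eqb_spec x n); [lia|]. apply I2. lia.
        -- intros x' Hx'. destruct (Nat.eqb_spec x' n) as [->|Hne].
           ++ exists k. split; [assumption|]. right. auto.
           ++ apply I3. lia.
        -- intros x q' l' Hx Z. destruct (Nat.eq_dec x k) as [->|Hne].
           ++ exists n. rewrite Nat.eqb_refl. split; [lia|].
              destruct Z as [(Z1 & Z2 & _)|(Z1 & Z2 & -> & ->)]; [|auto]. exfalso. auto.
           ++ destruct (I4 x q' l' ltac:(lia) Z) as (x' & Y1 & Y2). exists x'.
              destruct (Nat.eqb_spec x' n); [lia|]. split; [lia|exact Y2].
  - destruct R as (R1 & R2 & R3 & R4 & R5). set (s2 := sem (For i3 _ _) s1) in *. xs.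
    split; [frall; exact X2|]. split; [exact R1|]. split; [exact R3|]. split; [exact R4|lia].
Qed.

(** When the text leaves its run, an occurrence continues only if [S] leaves its own run with the
    same letter, that is, at the end of a chain. Its match is the shorter run plus the new letter;
    for runs of equal length this is only a lower bound, and the exact length is in the list of
    single occurrences. *)
Definition bbody : cmd :=
  (CIf ((aGQ.[!i3] <? !vm) && (ES (aGQ.[!i3]) =? !vc))
    (CSto aEQ (!vnE) (aGQ.[!i3] + #1) ;;
     CIf (aGL.[!i3] <? !ve) (CSto aEL (!vnE) (aGL.[!i3] + #1)) (CSto aEL (!vnE) (!ve + #1)) ;; incr vnE)
    CSkip)%c.
Definition BREAK : cmd := (For i3 (!vnG) bbody ;; vnG ::= #0 ;; vrun ::= #0)%c.

Lemma break_ok s c : sc s vm = m -> sc s vc = c -> sc s vnG <= 20 * g -> sc s vnE <= 20 * g ->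
  sc s ve + 1 < M ->
  (forall x, x < sc s vnG -> ar s aGQ x <= m /\ ar s aGL x <= ar s aGQ x) ->
  let s' := sem BREAK s in
  sc s' vnG = 0 /\ sc s' vrun = 0 /\ sc s vnE <= sc s' vnE <= sc s vnE + sc s vnG /\
  (forall x, x < sc s vnE -> ar s' aEQ x = ar s aEQ x /\ ar s' aEL x = ar s aEL x) /\
  (forall x', sc s vnE <= x' < sc s' vnE -> exists x, x < sc s vnG /\ ar s aGQ x < m /\ Sf (ar s aGQ x) = c /\
     ar s' aEQ x' = ar s aGQ x + 1 /\ ar s' aEL x' = Nat.min (ar s aGL x) (sc s ve) + 1) /\
  (forall x, x < sc s vnG -> ar s aGQ x < m -> Sf (ar s aGQ x) = c ->
     exists x', x' < sc s' vnE /\ ar s' aEQ x' = ar s aGQ x + 1 /\ ar s' aEL x' = Nat.min (ar s aGL x) (sc s ve) + 1) /\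
  tk s' <= tk s + 8 * sc s vnG + 10.
Proof.
  intros Em Ec Hn Hn2 He HE s'. subst s'. unfold BREAK. rewrite !sem_seq.
  destruct (for_ind (fun k s' => sc s vnE <= sc s' vnE <= sc s vnE + k /\
    (forall x, x < sc s vnE -> ar s' aEQ x = ar s aEQ x /\ ar s' aEL x = ar s aEL x) /\
    (forall x', sc s vnE <= x' < sc s' vnE -> exists x, x < sc s vnG /\ ar s aGQ x < m /\ Sf (ar s aGQ x) = c /\
       ar s' aEQ x' = ar s aGQ x + 1 /\ ar s' aEL x' = Nat.min (ar s aGL x) (sc s ve) + 1) /\
    (forall x, x < k -> ar s aGQ x < m -> Sf (ar s aGQ x) = c ->
       exists x', x' < sc s' vnE /\ ar s' aEQ x' = ar s aGQ x + 1 /\ ar s' aEL x' = Nat.min (ar s aGL x) (sc s ve) + 1) /\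
    tk s' <= tk s + 8 * k + 5) i3 (!vnG)%e bbody s (sc s vnG)) as [R _].
  - reflexivity. - auto. - lia.
  - xs. split; [lia|]. split; [auto|]. split; [intros; lia|]. split; [intros; lia|lia].
  - intros k s2 Hk F Hi (I1 & I2 & I3 & I4 & I5).
    assert (E1 : sc s2 vm = m) by (frall; assumption). assert (E2 : sc s2 vc = c) by (frall; assumption).
    assert (E3 : ar s2 aGQ k = ar s aGQ k) by (frall; reflexivity).
    assert (E4 : ar s2 aGL k = ar s aGL k) by (frall; reflexivity).
    assert (E5 : sc s2 ve = sc s ve) by (frall; reflexivity).
    unfold bbody. set (q := ar s aGQ k) in *. set (l := ar s aGL k) in *. cond_is ((q <? m) && (Sf q =? c)).
    { xs. rewrite Hi, E1, E2. ev. rewrite E3. destruct (Nat.ltb_spec q m) as [D|D]; [|reflexivity].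
      ev. reflexivity. }
    destruct ((q <? m) && (Sf q =? c)) eqn:C.
    + apply andb_true_iff in C as [C1 C2]. apply Nat.ltb_lt in C1. apply Nat.eqb_eq in C2.
      set (n := sc s2 vnE) in *. assert (X : exists s3, sem (CSto aEQ (!vnE) (aGQ.[!i3] + #1) ;;
         CIf (aGL.[!i3] <? !ve) (CSto aEL (!vnE) (aGL.[!i3] + #1)) (CSto aEL (!vnE) (!ve + #1)) ;; incr vnE)%c (tick (tick s2)) = s3 /\
         sc s3 vnE = n + 1 /\ (forall x, ar s3 aEQ x = if x =? n then q + 1 else ar s2 aEQ x) /\
         (forall x, ar s3 aEL x = if x =? n then Nat.min l (sc s ve) + 1 else ar s2 aEL x) /\ sc s3 i3 = k /\ tk s3 <= tk s2 + 6).
      { eexists. split; [reflexivity|]. cond_is (l <? sc s ve).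
        { xs. rewrite Hi, E5. ev. rewrite E4. reflexivity. }
        destruct (Nat.ltb_spec l (sc s ve)) as [D|D].
        - xs. rewrite Hi. ev. rewrite E3, E4. do 2 (split; [reflexivity|]).
          split; [intros; replace (Nat.min l (sc s ve)) with l by lia; reflexivity|]. split; [reflexivity|lia].
        - xs. rewrite Hi, E5. ev. rewrite E3. do 2 (split; [reflexivity|]).
          split; [intros; replace (Nat.min l (sc s ve)) with (sc s ve) by lia; reflexivity|]. split; [reflexivity|lia]. }
      destruct X as (s3 & -> & X1 & X2 & X3 & X4 & X5). xs. split; [lia|]. split; [|split; [|split; [|lia]]].
      * intros x Hx. rewrite X2, X3. destruct (Nat.eqb_spec x n); [lia|]. apply I2. lia.
      * intros x' Hx'. rewrite X2, X3. destruct (Nat.eqb_spec x' n) as [->|Hne].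
        -- exists k. auto.
        -- destruct (I3 x' ltac:(lia)) as (x & X). exists x. exact X.
      * intros x Hx Z1 Z2. destruct (Nat.eq_dec x k) as [->|Hne].
        -- exists n. rewrite X2, X3, Nat.eqb_refl. split; [lia|auto].
        -- destruct (I4 x ltac:(lia) Z1 Z2) as (x' & Y1 & Y2). exists x'. rewrite X2, X3.
           destruct (Nat.eqb_spec x' n); [lia|]. split; [lia|exact Y2].
    + xs. split; [lia|]. split; [exact I2|]. split; [exact I3|]. split; [|lia].
      intros x Hx Z1 Z2. destruct (Nat.eq_dec x k) as [->|Hne]; [|apply I4; auto; lia].
      apply andb_false_iff in C as [C|C]; [apply Nat.ltb_ge in C; fold q in Z1; lia|apply Nat.eqb_neq in C; contradiction].
  - destruct R as (R1 & R2 & R3 & R4 & R5). set (s2 := sem (For i3 _ _) s) in *. xs.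
    do 2 (split; [reflexivity|]). split; [exact R1|]. split; [exact R2|]. split; [exact R3|].
    split; [exact R4|lia].
Qed.

(** A representative vouches for a match as long as the shorter of the two runs. The rest of its
    chain has shorter runs, and runs as long as that of the text are covered by [aEL]. *)
Definition MAXES : cmd :=
  (For i3 (!vnE) (CIf (!vnms <? aEL.[!i3]) (vnms ::= aEL.[!i3]) CSkip) ;;
   For i3 (!vnG) (CIf ((!vnms <? aGL.[!i3]) && (!vnms <? !ve))
     (CIf (aGL.[!i3] <? !ve) (vnms ::= aGL.[!i3]) (vnms ::= !ve)) CSkip))%c.

Lemma maxes_ok s (P : nat -> Prop) : sc s vnE <= 20 * g -> sc s vnG <= 20 * g -> P (sc s vnms) ->
  (forall x, x < sc s vnE -> P (ar s aEL x)) ->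
  (forall x, x < sc s vnG -> P (Nat.min (ar s aGL x) (sc s ve))) ->
  let s' := sem MAXES s in
  P (sc s' vnms) /\ sc s vnms <= sc s' vnms /\ (forall x, x < sc s vnE -> ar s aEL x <= sc s' vnms) /\
  (forall x, x < sc s vnG -> Nat.min (ar s aGL x) (sc s ve) <= sc s' vnms) /\
  tk s' <= tk s + 8 * (sc s vnE + sc s vnG) + 10.
Proof.
  intros H1 H2 P0 PE PG s'. subst s'. unfold MAXES. rewrite !sem_seq.
  destruct (for_ind (fun k s' => P (sc s' vnms) /\ sc s vnms <= sc s' vnms /\
    (forall x, x < k -> ar s aEL x <= sc s' vnms) /\ tk s' <= tk s + 8 * k + 5) i3 (!vnE)%e
    (CIf (!vnms <? aEL.[!i3]) (vnms ::= aEL.[!i3]) CSkip)%c s (sc s vnE)) as [(R1 & R2 & R3 & R4) _].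
  - auto. - auto. - lia.
  - xs. split; [assumption|]. split; [lia|]. split; [intros; lia|lia].
  - intros k s2 Hk F Hi (I1 & I2 & I3 & I4).
    cond_is (sc s2 vnms <? ar s aEL k). { xs. rewrite Hi. frall. ev. reflexivity. }
    destruct (Nat.ltb_spec (sc s2 vnms) (ar s aEL k)) as [C|C].
    + xs. rewrite Hi. frall. ev. split; [auto|]. split; [lia|]. split; [|lia].
      intros x Hx. destruct (Nat.eq_dec x k) as [->|]; [lia|]. specialize (I3 x ltac:(lia)). lia.
    + xs. split; [auto|]. split; [lia|]. split; [|lia].
      intros x Hx. destruct (Nat.eq_dec x k) as [->|]; [lia|]. specialize (I3 x ltac:(lia)). lia.
  - pose proof (agree_sem (For i3 (!vnE) (CIf (!vnms <? aEL.[!i3]) (vnms ::= aEL.[!i3]) CSkip))%c s) as F.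
    set (s1 := sem (For i3 (!vnE) _)%c s) in *.
    destruct (for_ind (fun k s' => P (sc s' vnms) /\ sc s1 vnms <= sc s' vnms /\
      (forall x, x < k -> Nat.min (ar s aGL x) (sc s ve) <= sc s' vnms) /\ tk s' <= tk s1 + 8 * k + 5) i3 (!vnG)%e
      (CIf ((!vnms <? aGL.[!i3]) && (!vnms <? !ve))
         (CIf (aGL.[!i3] <? !ve) (vnms ::= aGL.[!i3]) (vnms ::= !ve)) CSkip)%c s1 (sc s vnG)) as [(R5 & R6 & R7 & R8) _].
    + xs. frall. reflexivity. + auto. + lia.
    + xs. split; [assumption|]. split; [lia|]. split; [intros; lia|lia].
    + intros k s2 Hk F2 Hi (I1 & I2 & I3 & I4).
      assert (E1 : ar s2 aGL k = ar s aGL k) by (frall; reflexivity). assert (E2 : sc s2 ve = sc s ve) by (frall; reflexivity).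
      specialize (PG k Hk).
      cond_is ((sc s2 vnms <? ar s aGL k) && (sc s2 vnms <? sc s ve)). { xs. rewrite Hi, E2. ev. rewrite E1. reflexivity. }
      destruct ((sc s2 vnms <? ar s aGL k) && (sc s2 vnms <? sc s ve)) eqn:C.
      * apply andb_true_iff in C as [C1 C2]. apply Nat.ltb_lt in C1, C2.
        cond_is (ar s aGL k <? sc s ve). { xs. rewrite Hi, E2. ev. rewrite E1. reflexivity. }
        destruct (Nat.ltb_spec (ar s aGL k) (sc s ve)) as [D|D].
        -- replace (Nat.min (ar s aGL k) (sc s ve)) with (ar s aGL k) in PG by lia.
           xs. rewrite Hi. ev. rewrite E1. split; [auto|]. split; [lia|]. split; [|lia].
           intros x Hx. destruct (Nat.eq_dec x k) as [->|]; [lia|]. specialize (I3 x ltac:(lia)). lia.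
        -- replace (Nat.min (ar s aGL k) (sc s ve)) with (sc s ve) in PG by lia.
           xs. rewrite E2. split; [auto|]. split; [lia|]. split; [|lia]. lia.
      * xs. split; [auto|]. split; [lia|]. split; [|lia].
        intros x Hx. destruct (Nat.eq_dec x k) as [->|]; [|specialize (I3 x ltac:(lia)); lia].
        apply andb_false_iff in C as [C|C]; apply Nat.ltb_ge in C; lia.
    + split; [assumption|]. split; [lia|]. split; [|split; [assumption|lia]].
      intros x Hx. specialize (R3 x Hx). lia.
Qed.

Definition RUNUPD : cmd :=
  (CIf (!vrun =? #1) (CIf (!vc =? aBUF.[!vhl + !i4 - !vp]) CONT BREAK) CSkip)%c.

(* A letter that continues the run turns an occurrence ending at [q] into one ending at [q + 1],
   or, when the letter of [S] differs, into the one ending a period earlier. *)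
Lemma gmove_ok p j q l q' l' : 1 <= p -> 2 * p <= g -> p <= j -> g + 1 <= lam Tf p (j + 1) -> Tf j = Tf (j - p) ->
  q <= m -> l = lam Sf p q -> g <= l -> g <= lcs Sf Tf q j ->
  gmove (Tf j) p q l q' l' ->
  q' <= m /\ l' = lam Sf p q' /\ g <= l' /\ g <= lcs Sf Tf q' (j + 1).
Proof.
  intros Hp H2 Hpj He Hc Hq Hl Hgl Hlc HG. pose proof (lcs_le Sf Tf q j) as [Lq Lj].
  assert (EQ : forall x, x < g -> Sf (q - 1 - x) = Tf (j - 1 - x)) by (intros x Hx; apply (lcs_eq Sf Tf); lia).
  destruct HG as [(Z1 & Z2 & -> & ->)|(Z1 & Z2 & -> & ->)].
  - split; [lia|]. split; [|split; [lia|rewrite (lcs_S Sf Tf) by exact Z2; lia]].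
    rewrite Hl. symmetry. apply lam_step; [assumption|lia|]. rewrite Z2, Hc.
    specialize (EQ (p - 1) ltac:(lia)). replace (q - 1 - (p - 1)) with (q - p) in EQ by lia.
    replace (j - 1 - (p - 1)) with (j - p) in EQ by lia. symmetry. exact EQ.
  - pose proof (lam_bounds Sf p q ltac:(lia)) as LB.
    assert (E1 : lam Sf p (q - p) = l - p) by (rewrite Hl; apply (lam_back Sf p q p); lia).
    assert (E2 : lam Sf p (q - p + 1) = l - p + 1).
    { rewrite <- E1. apply lam_step; [assumption|lia|].
      pose proof (lam_per Sf p q (p - 1) ltac:(lia) ltac:(lia)) as P.
      replace (q - 1 - (p - 1)) with (q - p) in P by lia. rewrite P. f_equal. lia. }
    (* Agreement on [p] letters is enough: [lcs_periodic] extends it to the shorter run, and both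
       runs have at least [g] letters. *)
    replace (q + 1 - p) with (q - p + 1) by lia. assert (B : p <= lcs Sf Tf (q - p + 1) (j + 1)).
    { apply lcs_spec. do 2 (split; [lia|]). intros x Hx. pose proof (EQ (x + p - 1) ltac:(lia)) as EX.
      replace (q - p + 1 - 1 - x) with (q - 1 - (x + p - 1)) by lia. rewrite EX.
      pose proof (lam_per Tf p (j + 1) x ltac:(lia) ltac:(lia)) as P. cbv beta in P. rewrite P. f_equal. lia. }
    destruct (lcs_periodic Sf Tf (q - p + 1) (j + 1) p Hp B) as [BB _]. lia.
Qed.

Lemma run_e B j p : minper Tf B g p -> B <= j -> (forall x, B <= x < j -> Tf x = Tf (x - p)) -> g + (j - B) <= lam Tf p j.
Proof.
  intros (Hp & [HgB HY] & _) HB HP. apply lam_spec; [lia|lia|]. split; [lia|]. intros x Hx.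
  destruct (Nat.lt_ge_cases x (j - B)) as [C|C].
  - rewrite HP by lia. f_equal. lia.
  - specialize (HY (x - (j - B)) ltac:(lia)). replace (B - 1 - (x - (j - B))) with (j - 1 - x) in HY by lia.
    rewrite HY. f_equal. lia.
Qed.

Lemma longstep_ok s B j c : LI B j s -> B <= j < B + g -> j + 1 < M -> c = Tf j -> sc s vc = c ->
  sc s vm = m -> sc s vg = g -> sc s i4 = j - B ->
  (g <= B -> sc s vhl = g /\ forall x, x < g + (j - B) -> ar s aBUF x = Tf (B - g + x)) ->
  let s' := sem RUNUPD (sem EUPD s) in
  LI B (j + 1) s' /\ tk s' <= tk s + 20 * (4 * m / g) + 40.
Proof.
  intros [LE LC LR] HBj HjM Hc Ec Em Eg Ei HBUF s'. subst s'. pose proof Hsmall as RB.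
  assert (RD : sc s vnE + sc s vnG <= 4 * m / g) by (apply Nat.div_le_lower_bound; lia).
  pose proof (RB _ LC) as LC'. remember (4 * m / g) as R eqn:ER. clear ER.
  assert (LEm : forall x, x < sc s vnE -> ar s aEQ x <= m /\ ar s aEL x <= m).
  { intros x Hx. destruct (LE x Hx) as [Z1 Z2]. pose proof (lcs_le Sf Tf (ar s aEQ x) j). lia. }
  destruct (eupd_ok s c Em Ec ltac:(lia) LEm) as (A1 & A2 & A3 & A4). run (sem EUPD s) as s1 F.
  assert (LE1 : forall x', x' < sc s1 vnE -> ar s1 aEQ x' <= m /\ ar s1 aEL x' <= lcs Sf Tf (ar s1 aEQ x') (j + 1)).
  { intros x' Hx'. destruct (A2 x' Hx') as (x & Z1 & Z2 & Z3 & Z4 & Z5). rewrite Z4, Z5.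
    rewrite (lcs_S Sf Tf) by congruence. destruct (LE x Z1). lia. }
  assert (E1 : sc s1 vrun = sc s vrun) by (frall; reflexivity). assert (E2 : sc s1 vnG = sc s vnG) by (frall; reflexivity).
  assert (E3 : sc s1 vp = sc s vp) by (frall; reflexivity). assert (E4 : sc s1 ve = sc s ve) by (frall; reflexivity).
  assert (E5 : forall x, ar s1 aGQ x = ar s aGQ x /\ ar s1 aGL x = ar s aGL x) by (intros; split; frall; reflexivity).
  assert (E6 : sc s1 vm = m) by (frall; assumption). assert (E7 : sc s1 vg = g) by (frall; assumption).
  assert (E8 : sc s1 vc = c) by (frall; assumption). assert (E9 : sc s1 i4 = j - B) by (frall; assumption).
  assert (HBUF1 : g <= B -> sc s1 vhl = g /\ forall x, x < g + (j - B) -> ar s1 aBUF x = Tf (B - g + x)).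
  { intros Z. destruct (HBUF Z) as [Z1 Z2]. split; [frall; exact Z1|]. intros x Hx. frall. auto. }
  clear F HBUF Em Eg Ec Ei. unfold RUNUPD. cond_is (sc s vrun =? 1). { xs. rewrite E1. reflexivity. }
  destruct LR as [(R1 & R2 & R3 & R4)|(R1 & p & R2 & R3 & R4 & R5 & R6 & R7 & R8)].
  - rewrite R1. cbn [Nat.eqb]. change (sem CSkip (tick s1)) with (tick s1). split; [|cbn [tk tick]; lia].
    constructor; cbn [sc ar tick].
    + exact LE1.
    + rewrite E2, R2. apply (Nat.mul_le_mono_l _ _ g) in A1. lia.
    + left. do 2 (split; [lia|]). split.
      * intros q Hq HL. destruct (lcs_pred Sf Tf q j ltac:(lia)) as (q0 & -> & Y2 & Y3).
        destruct (R3 q0 ltac:(lia) ltac:(lia)) as (x & X1 & X2 & X3). rewrite <- X2 in Y2.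
        destruct (A3 x X1 ltac:(lia) ltac:(congruence)) as (x' & X4 & X5 & X6).
        exists x'. split; [assumption|]. lia.
      * intros p Hp H2. destruct (R4 p Hp H2) as (x & X1 & X2). exists x. split; [lia|assumption].
  - rewrite R1. cbn [Nat.eqb]. pose proof R3 as (Hp & [HgB HY] & _).
    destruct (HBUF1 HgB) as [BU1 BU2]. rewrite R2 in E3.
    pose proof (run_e B j p R3 ltac:(lia) R6) as RE. pose proof (lam_bounds Tf p j ltac:(lia)) as LBj.
    assert (HGm : forall x, x < sc (tick s1) vnG -> ar (tick s1) aGQ x <= m /\ ar (tick s1) aGL x <= ar (tick s1) aGQ x).
    { intros x Hx. cbn [sc ar tick] in *. rewrite E2 in Hx. destruct (E5 x) as [-> ->].
      destruct (R7 x Hx) as (Z1 & Z2 & Z3 & Z4). split; [assumption|]. rewrite Z2.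
      apply lam_bounds. pose proof (lcs_le Sf Tf (ar s aGQ x) j). lia. }
    cond_is (c =? Tf (j - p)).
    { xs. rewrite E8, BU1, E9, E3. ev. rewrite BU2 by lia. replace (B - g + (g + (j - B) - p)) with (j - p) by lia. reflexivity. }
    clear BU1 BU2 HBUF1.
    assert (LEX : forall q, q <= m -> g + (j + 1 - B) <= lcs Sf Tf q (j + 1) -> exists q0, q = q0 + 1 /\ q0 < m /\ Sf q0 = c /\
        lcs Sf Tf q (j + 1) = lcs Sf Tf q0 j + 1 /\ g + (j - B) <= lcs Sf Tf q0 j).
    { intros q Hq HL. destruct (lcs_pred Sf Tf q j ltac:(lia)) as (q0 & -> & Y2 & Y3). exists q0.
      repeat split; lia. }
    assert (EXP : forall q0, Sf q0 = c -> q0 < m -> (exists x, x < sc s vnE /\ ar s aEQ x = q0 /\ ar s aEL x = lcs Sf Tf q0 j) ->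
       exists x, x < sc s1 vnE /\ ar s1 aEQ x = q0 + 1 /\ ar s1 aEL x = lcs Sf Tf q0 j + 1).
    { intros q0 Y1 Y2 (x & X1 & X2 & X3). destruct (A3 x X1) as (x' & X4 & X5 & X6).
      - rewrite X2. exact Y2. - rewrite X2. exact Y1. - exists x'. rewrite X5, X6, X2, X3. auto. }
    destruct (Nat.eqb_spec c (Tf (j - p))) as [CC|CC].
    + destruct (cont_ok (tick (tick s1)) c p) as (C1 & C2 & C3 & C4 & C5); auto;
        try (cbn [sc tick]; lia).
      run (sem CONT (tick (tick s1))) as s2 F. assert (G1 : sc s2 vnE = sc s1 vnE) by (frall; reflexivity).
      assert (G2 : forall x, ar s2 aEQ x = ar s1 aEQ x /\ ar s2 aEL x = ar s1 aEL x) by (intros; split; frall; reflexivity).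
      assert (G3 : sc s2 vrun = 1) by (frall; exact (eq_trans E1 R1)). assert (G4 : sc s2 vp = p) by (frall; exact E3).
      clear F. cbn [sc ar tick tk] in C1, C2, C3, C4, C5. rewrite E2 in *.
      assert (LS : lam Tf p (j + 1) = lam Tf p j + 1) by (apply lam_step; [lia|lia|congruence]).
      split; [|lia]. constructor.
      * intros x Hx. rewrite G1 in Hx. destruct (G2 x) as [-> ->]. auto.
      * rewrite G1. transitivity (g * (sc s vnE + sc s vnG)); [apply Nat.mul_le_mono_l; lia|lia].
      * right. split; [exact G3|]. exists p. split; [exact G4|]. split; [exact R3|]. split; [exact R4|].
        split; [rewrite C1, E4, R5; symmetry; exact LS|]. split; [|split].
        -- intros x Hx. destruct (Nat.eq_dec x j) as [->|]; [congruence|apply R6; lia].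
        -- intros x' Hx'. destruct (C3 x' Hx') as (x & X1 & X2). destruct (E5 x) as [Y1 Y2]. rewrite Y1, Y2 in X2.
           destruct (R7 x X1) as (Z1 & Z2 & Z3 & Z4). rewrite Hc in X2.
           apply (gmove_ok p j _ _ _ _ (proj1 Hp) R4 ltac:(lia) ltac:(lia) ltac:(congruence) Z1 Z2 Z3 Z4 X2).
        -- intros q Hq HL. destruct (LEX q Hq HL) as (q0 & -> & Y1 & Y2 & Y3 & Y4).
           destruct (R8 q0 ltac:(lia) Y4) as [(x & k & X1 & X2 & X3) R9].
           assert (LQ : p <= q0) by (pose proof (lcs_le Sf Tf q0 j); lia). assert (SQ : Sf q0 = Sf (q0 - p)).
           { pose proof (lcs_eq Sf Tf q0 j (p - 1) ltac:(lia)) as P. cbv beta in P.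
             replace (q0 - 1 - (p - 1)) with (q0 - p) in P by lia. replace (j - 1 - (p - 1)) with (j - p) in P by lia.
             cbv beta. congruence. }
           assert (LS' : lam Sf p (q0 + 1) = lam Sf p q0 + 1) by (apply lam_step; [lia|lia|exact SQ]).
           assert (GL : g <= lam Sf p q0).
           { destruct (lcs_periodic Sf Tf q0 j p ltac:(lia) ltac:(lia)) as [_ ND].
             pose proof (lam_spec Sf p q0 g ltac:(lia) ltac:(lia)) as SP. apply SP. split; [pose proof (lcs_le Sf Tf q0 j); lia|].
             intros y Hy. pose proof (lcs_eq Sf Tf q0 j y ltac:(lia)) as P1. pose proof (lcs_eq Sf Tf q0 j (y + p) ltac:(lia)) as P2.
             cbv beta in P1, P2. rewrite P1, P2. apply (lam_per Tf p j y); lia. }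
           split.
           (* The representative of [q0] lies [k] periods ahead. It advances if its next letter is
              [c]; otherwise it steps back one period and [k] decreases. For [k = 0] it is [q0]
              itself, which is followed by [c]. *)
           ++ destruct (E5 x) as [Z1 Z2]. destruct (Nat.lt_ge_cases (q0 + k * p) m) as [D|D];
                [destruct (Nat.eq_dec (Sf (q0 + k * p)) c) as [D2|D2]|].
              ** destruct (C4 x (q0 + k * p + 1) (lam Sf p q0 + k * p + 1) X1) as (x' & W1 & W2 & W3).
                 { rewrite Z1, Z2, X2, X3. left. auto. }
                 exists x', k. split; [exact W1|]. rewrite W2, W3, LS'. lia.
              ** destruct k as [|k]; [exfalso; apply D2; cbn [Nat.mul]; rewrite Nat.add_0_r; exact Y2|].
                 destruct (C4 x (q0 + S k * p + 1 - p) (lam Sf p q0 + S k * p + 1 - p) X1) as (x' & W1 & W2 & W3).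
                 { rewrite Z1, Z2, X2, X3. right. split; [intros [_ W]; contradiction|]. split; [cbn [Nat.mul]; lia|auto]. }
                 exists x', k. split; [exact W1|]. rewrite W2, W3, LS'. cbn [Nat.mul]. lia.
              ** destruct k as [|k]; [lia|].
                 destruct (C4 x (q0 + S k * p + 1 - p) (lam Sf p q0 + S k * p + 1 - p) X1) as (x' & W1 & W2 & W3).
                 { rewrite Z1, Z2, X2, X3. right. split; [intros [W _]; lia|]. split; [cbn [Nat.mul]; lia|auto]. }
                 exists x', k. split; [exact W1|]. rewrite W2, W3, LS'. cbn [Nat.mul]. lia.
           ++ intros Z. rewrite C1, E4, LS' in Z. destruct (EXP q0 Y2 Y1 (R9 ltac:(lia))) as (y & W1 & W2 & W3).
              exists y. rewrite G1. destruct (G2 y) as [-> ->]. split; [exact W1|]. split; [exact W2|]. rewrite W3. symmetry. exact Y3.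
    + destruct (break_ok (tick (tick s1)) c) as (C1 & C2 & C3 & C4 & C5 & C6 & C7); auto;
        try (cbn [sc tick]; lia).
      set (s2 := sem BREAK (tick (tick s1))) in *.
      cbn [sc ar tick tk] in C1, C2, C3, C4, C5, C6, C7. rewrite E2, E4 in *. split; [|lia]. constructor.
      * intros x' Hx'. destruct (Nat.lt_ge_cases x' (sc s1 vnE)) as [D|D].
        -- destruct (C4 x' D) as [-> ->]. auto.
        -- destruct (C5 x' ltac:(lia)) as (x & X1 & X2 & X3 & X4 & X5). rewrite X4, X5.
           destruct (E5 x) as [Y1 Y2]. rewrite Y1, Y2 in *. destruct (R7 x X1) as (Z1 & Z2 & Z3 & Z4).
           split; [lia|]. rewrite (lcs_S Sf Tf) by congruence. rewrite Z2, R5.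
           destruct (lcs_periodic Sf Tf (ar s aGQ x) j p ltac:(lia) ltac:(lia)) as [LP _]. lia.
      * transitivity (g * (sc s vnE + sc s vnG)); [apply Nat.mul_le_mono_l; lia|lia].
      * left. split; [exact C2|]. split; [exact C1|]. split.
        -- intros q Hq HL. destruct (LEX q Hq HL) as (q0 & -> & Y1 & Y2 & Y3 & Y4).
           destruct (R8 q0 ltac:(lia) Y4) as [(x & k & X1 & X2 & X3) R9].
           destruct (Nat.eq_dec (lam Sf p q0) (sc s ve)) as [D|D].
           ++ destruct (EXP q0 Y2 Y1 (R9 D)) as (y & W1 & W2 & W3). exists y.
              destruct (C4 y W1) as [-> ->]. split; [lia|]. split; [exact W2|]. rewrite W3. symmetry. exact Y3.
           (* If the representative were ahead of [q0], the next letter of [S] would still continue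
              the period, whereas [c] breaks it. *)
           ++ assert (LQ : p <= q0) by (pose proof (lcs_le Sf Tf q0 j); lia). assert (K0 : k = 0).
              { destruct k as [|k]; [reflexivity|exfalso].
                destruct (R7 x X1) as (Z1 & Z2 & Z3 & Z4). rewrite X2 in *. rewrite X3 in Z2.
                pose proof (lam_bounds Sf p q0 LQ) as LBq.
                pose proof (lam_per Sf p (q0 + S k * p) (S k * p - 1) ltac:(lia) ltac:(lia)) as P. cbv beta in P.
                replace (q0 + S k * p - 1 - (S k * p - 1)) with q0 in P by lia.
                replace (q0 + S k * p - 1 - (S k * p - 1 + p)) with (q0 - p) in P by lia.
                pose proof (lcs_eq Sf Tf q0 j (p - 1) ltac:(lia)) as P2. cbv beta in P2.
                replace (q0 - 1 - (p - 1)) with (q0 - p) in P2 by lia. replace (j - 1 - (p - 1)) with (j - p) in P2 by lia.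
                congruence. }
              subst k. rewrite Nat.add_0_r in X2, X3.
              destruct (E5 x) as [Z1 Z2]. rewrite X2 in Z1. rewrite X3 in Z2.
              destruct (C6 x X1) as (y & W1 & W2 & W3). { lia. } { rewrite Z1. exact Y2. }
              exists y. split; [exact W1|]. rewrite W2, W3, Z1, Z2, Y3. split; [reflexivity|].
              destruct (lcs_periodic Sf Tf q0 j p ltac:(lia) ltac:(lia)) as [_ ND]. rewrite R5 in *. rewrite (ND D). reflexivity.
        -- intros p' Hp' H2'. exists j. split; [lia|]. rewrite (minper_unique _ _ _ _ _ Hp' R3). congruence.
Qed.

Lemma maxes_LI s B j sh : LI B j s -> B <= j -> sc s vnms = sh ->
  (exists q, q <= m /\ sh <= lcs Sf Tf q j) ->
  let s' := sem MAXES s in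
  (exists q, q <= m /\ sc s' vnms <= lcs Sf Tf q j) /\ sh <= sc s' vnms /\
  (forall q, q <= m -> g + (j - B) <= lcs Sf Tf q j -> lcs Sf Tf q j <= sc s' vnms) /\
  tk s' <= tk s + 8 * (4 * m / g) + 10.
Proof.
  intros [LE LC LR] HBj Hsh Hex s'. subst s'. pose proof Hsmall as RB.
  assert (RD : sc s vnE + sc s vnG <= 4 * m / g) by (apply Nat.div_le_lower_bound; lia).
  pose proof (RB _ LC) as LC'. destruct (maxes_ok s (fun v => exists q, q <= m /\ v <= lcs Sf Tf q j))
    as (A1 & A2 & A3 & A4 & A5); try lia.
  - rewrite Hsh. exact Hex.
  - eauto.
  - intros x Hx. destruct LR as [(R1 & R2 & _)|(R1 & p & R2 & R3 & R4 & R5 & R6 & R7 & R8)]; [lia|].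
    destruct (R7 x Hx) as (Z1 & Z2 & Z3 & Z4). exists (ar s aGQ x). split; [exact Z1|]. rewrite Z2, R5.
    apply lcs_periodic; [apply R3|lia].
  - split; [exact A1|]. split; [lia|]. split; [|lia].
    intros q Hq HL. destruct LR as [(R1 & R2 & R3 & R4)|(R1 & p & R2 & R3 & R4 & R5 & R6 & R7 & R8)].
    + destruct (R3 q Hq HL) as (x & X1 & X2 & X3). rewrite <- X3. auto.
    + destruct (R8 q Hq HL) as [(x & k & X1 & X2 & X3) R9]. destruct (Nat.eq_dec (lam Sf p q) (sc s ve)) as [D|D].
      * destruct (R9 D) as (y & Y1 & Y2 & Y3). rewrite <- Y3. auto.
      * specialize (A4 x X1).
        destruct R3 as (Hp & _). destruct (lcs_periodic Sf Tf q j p ltac:(lia) ltac:(lia)) as [_ ND]. lia.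
Qed.

(** * The main loop *)

Section Main.
Variables n sg pm t : nat.
Hypothesis Hn : length Tl = n.
Hypothesis HnM : 2 * n + 100 < M.
Hypothesis HSsg : forall i, i < m -> nth i Sl 0 < sg.
Hypothesis HTsg : forall i, i < n -> nth i Tl 0 < sg.
Hypothesis Hpm : forall i j, i < m -> j < m ->
  nth i Sl 0 mod pm = nth j Sl 0 mod pm -> nth i Sl 0 = nth j Sl 0.
Hypothesis Hpm0 : 1 <= pm <= (g + 1) ^ t.
Notation ms := (msf Sf Tf m).

Definition LPRE : cmd := (vc ::= aBUF.[!vhl + !i4] ;; vnms ::= aSH.[!vhl + !i4 + #1])%c.
Definition LPOST : cmd :=
  (CIf ((#0 <? !vms) && ~~ (!vms <? !vnms)) (COut (!vB + !i4 - !vms + #1)%e (!vB + !i4)%e) CSkip ;; vms ::= !vnms)%c.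
Definition LETTER : cmd := (LPRE ;; EUPD ;; RUNUPD ;; MAXES ;; LPOST)%c.

(** The order of commands matters for the report: the old statistic stays in [vms] until the new
    one, in [vnms], shows whether the match ending at [j] can be extended. *)
Lemma letter_ok s B j hl : consts sg pm t s -> LI B j s -> B <= j < B + g -> j < n ->
  sc s vB = B -> sc s i4 = j - B -> sc s vhl = hl -> (hl = 0 /\ B = 0 \/ hl = g /\ g <= B) ->
  (forall x, x < hl + (j - B) + 1 -> ar s aBUF x = Tf (B - hl + x)) ->
  (forall q, q <= m -> Nat.min (hl + (j - B) + 1) (lcs Sf Tf q (j + 1)) <= ar s aSH (hl + (j - B) + 1)) ->
  (exists q, q <= m /\ ar s aSH (hl + (j - B) + 1) <= lcs Sf Tf q (j + 1)) ->
  sc s vms = ms j -> outp s = outs Sf Tf m j ->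
  let s' := sem LETTER s in
  LI B (j + 1) s' /\ sc s' vms = ms (j + 1) /\ outp s' = outs Sf Tf m (j + 1) /\
  tk s' <= tk s + 28 * (4 * m / g) + 60.
Proof.
  intros Hc HL HBj Hjn EB Ei Eh Hhl HBUF HSH1 HSH2 Ems Eout s'. subst s'. unfold LETTER.
  rewrite (sem_seq LPRE), (sem_seq EUPD), (sem_seq RUNUPD), (sem_seq MAXES). pose proof (agree_sem LPRE s) as F1.
  assert (X1 : sc (sem LPRE s) vc = Tf j /\ sc (sem LPRE s) vnms = ar s aSH (hl + (j - B) + 1) /\ tk (sem LPRE s) = tk s + 2).
  { unfold LPRE. xs. rewrite Eh, Ei. ev. rewrite HBUF by lia. replace (B - hl + (hl + (j - B))) with j by lia.
    repeat split; lia. }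
  assert (L1 : LI B j (sem LPRE s)) by (eapply LI_agree; eauto).
  set (s1 := sem LPRE s) in *. destruct X1 as (X1 & X2 & X3). set (c := Tf j) in X1.
  assert (HB2 : g <= B -> sc s1 vhl = g /\ forall x, x < g + (j - B) -> ar s1 aBUF x = Tf (B - g + x)).
  { split; [frall; lia|]. intros x Hx. frall. rewrite HBUF by lia. f_equal. lia. }
  assert (E1 : sc s1 vm = m) by (frall; exact (c_m _ _ _ _ Hc)). assert (E2 : sc s1 vg = g) by (frall; exact (c_g _ _ _ _ Hc)).
  assert (E3 : sc s1 i4 = j - B) by (frall; exact Ei).
  destruct (longstep_ok s1 B j c L1 HBj ltac:(lia) eq_refl X1 E1 E2 E3 HB2) as [L2 T2].
  pose proof (agree_sem (EUPD ;; RUNUPD)%c s1) as F2. rewrite sem_seq in F2.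
  set (s2 := sem RUNUPD (sem EUPD s1)) in *.
  assert (Y1 : sc s2 vnms = ar s aSH (hl + (j - B) + 1)) by (frall; exact X2).
  destruct (maxes_LI s2 B (j + 1) _ L2 ltac:(lia) Y1 HSH2) as (A1 & A2 & A3 & A4).
  pose proof (agree_sem MAXES s2) as F3. assert (L3 : LI B (j + 1) (sem MAXES s2)) by (eapply LI_agree; eauto).
  (* Matches that reach [g] letters or more before the block are found by [MAXES]. All others fit in
     the window, which holds either [g] letters before the block or, in the first block, everything
     read so far, and [aSH] is exact for them. *)
  set (s3 := sem MAXES s2) in *. assert (NM : sc s3 vnms = ms (j + 1)).
  { apply msf_unique; [|exact A1]. intros q Hq. specialize (HSH1 q Hq). pose proof (lcs_le Sf Tf q (j + 1)) as [_ LL].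
    destruct (Nat.le_gt_cases (g + (j + 1 - B)) (lcs Sf Tf q (j + 1))) as [C|C]; [apply A3; auto|].
    destruct Hhl as [[H1 H2]|[H1 H2]]; lia. }
  assert (Z1 : sc s3 vB = B) by (frall; exact EB). assert (Z2 : sc s3 i4 = j - B) by (frall; exact Ei).
  assert (Z3 : sc s3 vms = ms j) by (frall; exact Ems). assert (Z4 : outp s3 = outs Sf Tf m j).
  { rewrite (proj2 (proj2 (proj2 F3)) eq_refl), (proj2 (proj2 (proj2 F2)) eq_refl), (proj2 (proj2 (proj2 F1)) eq_refl). exact Eout. }
  pose proof (msf_le Sf Tf m j) as ML.
  pose proof (agree_sem LPOST s3) as F4. assert (L4 : LI B (j + 1) (sem LPOST s3)) by (eapply LI_agree; eauto).
  split; [exact L4|]. unfold LPOST. cond_is ((0 <? ms j) && negb (ms j <? ms (j + 1))).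
  { xs. rewrite Z3, NM. reflexivity. }
  replace (outs Sf Tf m (j + 1)) with (if (0 <? ms j) && negb (ms j <? ms (j + 1)) then (j - ms j + 1, j) :: outs Sf Tf m j else outs Sf Tf m j)
    by (replace (j + 1) with (S j) by lia; cbn [outs]; replace (j + 1) with (S j) by lia; reflexivity).
  destruct ((0 <? ms j) && negb (ms j <? ms (j + 1))) eqn:C.
  - xs. rewrite Z1, Z2, Z3, NM, Z4. ev. split; [reflexivity|]. split; [|lia].
    replace (B + (j - B)) with j by lia. reflexivity.
  - xs. rewrite NM, Z4. split; [reflexivity|]. split; [reflexivity|lia].
Qed.

Definition READ : cmd := For i4 (!vbl) (CNext vc ;; CSto aBUF (!vhl + !i4) (!vc))%c.

Lemma read_ok s B hl bl : sc s vhl = hl -> hl <= g -> sc s vbl = bl -> bl <= g -> inp s = B -> sc s vrem = n - B -> B + bl <= n ->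
  (forall x, x < hl -> ar s aBUF x = Tf (B - hl + x)) -> hl <= B ->
  let s' := sem READ s in
  inp s' = B + bl /\ sc s' vrem = n - (B + bl) /\
  (forall x, x < hl + bl -> ar s' aBUF x = Tf (B - hl + x)) /\ tk s' <= tk s + 5 * g + 5.
Proof.
  intros Eh Hh Eb Hb Ein Er HBn HBUF HhB s'. subst s'. unfold READ.
  destruct (for_ind (fun k s' => inp s' = B + k /\ sc s' vrem = n - (B + k) /\
    (forall x, x < hl + k -> ar s' aBUF x = Tf (B - hl + x)) /\ tk s' <= tk s + 4 * k + 5) i4 (!vbl)%e
    (CNext vc ;; CSto aBUF (!vhl + !i4) (!vc))%c s bl) as [(R1 & R2 & R3 & R4) _]; auto.
  - lia.
  - xs. split; [lia|]. split; [rewrite Er; lia|]. split; [|lia]. intros x Hx. apply HBUF. lia.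
  - intros k s1 Hk F Hi (I1 & I2 & I3 & I4). assert (E1 : sc s1 vhl = hl) by (frall; exact Eh).
    cbn [sem]. rewrite sc_tick, I2.
    destruct (Nat.eqb_spec (n - (B + k)) 0) as [C|C]; [lia|]. xs. rewrite Hi, E1, I1. ev.
    do 2 (split; [lia|]). split; [|lia].
    intros x Hx. destruct (Nat.eqb_spec x (hl + k)) as [->|Hne]; [f_equal; lia|]. apply I3. lia.
  - split; [exact R1|]. split; [exact R2|]. split; [exact R3|lia].
Qed.

Definition LETTERS : cmd := For i4 (!vbl) LETTER.
Definition BLEN : cmd := (CIf (!vn - !vB <? !vg) (vbl ::= !vn - !vB) (vbl ::= !vg))%c.
Definition BLOCK : cmd :=
  (BLEN ;; READ ;; SHORT ;; LETTERS ;; CIf (!vbl =? !vg) BOUNDARY CSkip ;; vB ::= !vB + !vbl)%c.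
Definition MAIN : cmd :=
  (CRep (!vn / !vg + #1) BLOCK ;; CIf (#0 <? !vms) (COut (!vn - !vms + #1)%e (!vn)%e) CSkip)%c.

Lemma letters_ok s B hl bl : consts sg pm t s -> LI B B s -> sc s vbl = bl -> bl <= g -> B + bl <= n ->
  sc s vB = B -> sc s vhl = hl -> (hl = 0 /\ B = 0 \/ hl = g /\ g <= B) ->
  (forall x, x < hl + bl -> ar s aBUF x = Tf (B - hl + x)) ->
  (forall i q, i < bl -> q <= m -> Nat.min (hl + i + 1) (lcs Sf Tf q (B + i + 1)) <= ar s aSH (hl + i + 1)) ->
  (forall i, i < bl -> exists q, q <= m /\ ar s aSH (hl + i + 1) <= lcs Sf Tf q (B + i + 1)) ->
  sc s vms = ms B -> outp s = outs Sf Tf m B ->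
  let s' := sem LETTERS s in
  LI B (B + bl) s' /\ sc s' vms = ms (B + bl) /\ outp s' = outs Sf Tf m (B + bl) /\
  tk s' <= tk s + (28 * (4 * m / g) + 63) * g + 5.
Proof.
  intros Hc HL Eb Hb HBn EB Eh Hhl HBUF HSH1 HSH2 Ems Eout s'. subst s'. unfold LETTERS.
  destruct (for_ind (fun k s' => LI B (B + k) s' /\ sc s' vms = ms (B + k) /\
     outp s' = outs Sf Tf m (B + k) /\ tk s' <= tk s + (28 * (4 * m / g) + 63) * k + 5) i4 (!vbl)%e LETTER s bl) as [R _]; auto.
  - lia.
  - rewrite Nat.add_0_r. split; [|xs; repeat split; auto; lia].
    apply (LI_agree (i4 ::= #0)%c B B s); auto. apply (agree_sem (i4 ::= #0)%c s).
  - intros k s1 Hk F Hi (I1 & I2 & I3 & I4). assert (Hc1 : consts sg pm t (tick s1)).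
    { assert (consts sg pm t s1) as []; [eapply consts_agree; eauto|]. constructor; assumption. }
    assert (L1 : LI B (B + k) (tick s1)). { apply (LI_agree CSkip B (B + k) s1); auto. repeat split. }
    destruct (letter_ok (tick s1) B (B + k) hl Hc1 L1 ltac:(lia) ltac:(lia)) as (A1 & A2 & A3 & A4);
      try (replace (B + k - B) with k by lia); auto.
    { xs. frall. exact EB. } { xs. frall. exact Eh. }
    { intros x Hx. xs. frall. apply HBUF. lia. }
    { xs. frall. auto. } { xs. frall. auto. }
    set (s2 := sem LETTER (tick s1)) in *. replace (B + S k) with (B + k + 1) by lia.
    split; [|xs; repeat split; auto; cbn [tk tick] in A4; rewrite Nat.mul_succ_r; lia].
    apply (LI_agree (incr i4) B (B + k + 1) s2); auto. apply (agree_sem (incr i4) s2).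
  - destruct R as (R1 & R2 & R3 & R4). split; [exact R1|]. split; [exact R2|]. split; [exact R3|].
    assert ((28 * (4 * m / g) + 63) * bl <= (28 * (4 * m / g) + 63) * g) by (apply Nat.mul_le_mono_l; assumption). lia.
Qed.

Record BI (B : nat) (s : state) : Prop := {
  bi_n : sc s vn = n; bi_B : sc s vB = B; bi_c : consts sg pm t s;
  bi_ms : sc s vms = ms B; bi_out : outp s = outs Sf Tf m B }.
(** The part of the state that the next block relies on. A last block with fewer than [g] letters
    does not restore it. *)
Record BJ (B : nat) (s : state) : Prop := {
  bj_in : inp s = B; bj_rem : sc s vrem = n - B;
  bj_hl : sc s vhl = 0 /\ B = 0 \/ sc s vhl = g /\ g <= B;
  bj_buf : forall x, x < sc s vhl -> ar s aBUF x = Tf (B - sc s vhl + x);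
  bj_li : LI B B s }.

Definition TB := ((500 * g + 500) * t + 400 * Q + 100) * (m / (2 * g) + 1) + 712 * m + 400 * g + 150.

Lemma block_ok s B : BI B s -> BJ B s -> B <= n ->
  let s' := sem BLOCK s in let bl := Nat.min g (n - B) in
  BI (B + bl) s' /\ (bl = g -> BJ (B + bl) s') /\ tk s' <= tk s + TB.
Proof.
  intros [] [] HBn s' bl. subst s'. unfold BLOCK. rewrite !sem_seq. pose proof (agree_sem BLEN s) as F1.
  assert (X : sc (sem BLEN s) vbl = bl /\ tk (sem BLEN s) <= tk s + 3).
  { unfold BLEN. cond_is (n - B <? g).
    { xs. rewrite bi_n0, bi_B0, (c_g _ _ _ _ bi_c0). ev. reflexivity. }
    destruct (Nat.ltb_spec (n - B) g) as [C|C]; xs.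
    - rewrite bi_n0, bi_B0. ev. unfold bl. split; lia.
    - rewrite (c_g _ _ _ _ bi_c0). unfold bl. split; lia. }
  set (s1 := sem BLEN s) in *. clearbody s1. destruct X as (X1 & X2).
  assert (Hc1 : consts sg pm t s1) by (eapply consts_agree; eauto). set (hl := sc s vhl) in *.
  assert (Hbl : bl <= g /\ B + bl <= n) by (unfold bl; lia).
  assert (Hbg : bl < g -> B + bl = n) by (unfold bl; lia). assert (E1 : sc s1 vhl = hl) by (frall; reflexivity).
  assert (E1' : sc s1 vrem = n - B) by (frall; assumption).
  assert (E1'' : inp s1 = B) by (rewrite (proj1 (proj2 (proj2 F1)) eq_refl); assumption).
  destruct (read_ok s1 B hl bl E1 ltac:(lia) X1 ltac:(lia) E1'' E1' ltac:(lia)) as (R1 & R2 & R3 & R4); [|lia|].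
  { intros x Hx. frall. auto. }
  pose proof (agree_sem READ s1) as F2.
  assert (Hc2 : consts sg pm t (sem READ s1)) by (eapply consts_agree; eauto).
  set (s2 := sem READ s1) in *. clearbody s2.
  assert (E2 : sc s2 vhl + sc s2 vbl = hl + bl) by (frall; rewrite X1; reflexivity).
  destruct (short_ok sg pm t HSsg Hpm Hpm0 s2 (hl + bl) (fun x => Tf (B - hl + x)) Hc2 E2 ltac:(lia))
    as (S1 & S2).
  { intros i Hi. split; [apply R3; exact Hi|]. apply HTsg. lia. }
  pose proof (agree_sem SHORT s2) as F3.
  assert (Hc3 : consts sg pm t (sem SHORT s2)) by (eapply consts_agree; eauto).
  set (s3 := sem SHORT s2) in *. clearbody s3. assert (L3 : LI B B s3).
  { eapply LI_agree; [exact F3|reflexivity|]. eapply LI_agree; [exact F2|reflexivity|]. eapply LI_agree; [exact F1|reflexivity|exact bj_li0]. }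
  assert (WIN : forall i q, i < bl -> lcs Sf (fun x => Tf (B - hl + x)) q (hl + i + 1) = Nat.min (hl + i + 1) (lcs Sf Tf q (B + i + 1))).
  { intros i q Hi. apply lcs_window; [lia|]. intros x Hx. f_equal. lia. }
  assert (G1 : sc s3 vbl = bl) by (frall; exact X1). assert (G2 : sc s3 vB = B) by (frall; exact bi_B0).
  assert (G3 : sc s3 vhl = hl) by (frall; reflexivity).
  assert (G4 : forall x, x < hl + bl -> ar s3 aBUF x = Tf (B - hl + x)) by (intros x Hx; rewrite ((proj1 (proj2 F3)) aBUF x eq_refl); auto).
  assert (G5 : sc s3 vms = ms B) by (frall; exact bi_ms0). assert (G6 : outp s3 = outs Sf Tf m B).
  { rewrite (proj2 (proj2 (proj2 F3)) eq_refl), (proj2 (proj2 (proj2 F2)) eq_refl), (proj2 (proj2 (proj2 F1)) eq_refl). assumption. }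
  assert (G7 : inp s3 = B + bl) by (rewrite (proj1 (proj2 (proj2 F3)) eq_refl); exact R1).
  assert (G8 : sc s3 vrem = n - (B + bl)) by (rewrite (proj1 F3 vrem eq_refl); exact R2).
  assert (G9 : sc s3 vn = n) by (frall; exact bi_n0). clear F1 F2 F3.
  destruct (letters_ok s3 B hl bl Hc3 L3 G1 ltac:(lia) ltac:(lia) G2 G3 bj_hl0 G4) as (P1 & P2 & P3 & P4); auto.
  { intros i q Hi Hq. rewrite <- WIN by exact Hi. apply (S1 (hl + i + 1)); [lia|exact Hq]. }
  { intros i Hi. destruct (S1 (hl + i + 1) ltac:(lia)) as (_ & q & Hq & Z). exists q.
    rewrite WIN in Z by exact Hi. lia. }
  pose proof (agree_sem LETTERS s3) as F4.
  assert (Hc4 : consts sg pm t (sem LETTERS s3)) by (eapply consts_agree; eauto). set (s4 := sem LETTERS s3) in *.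
  assert (I1 : sc s4 vbl = bl) by (frall; assumption). assert (I2 : sc s4 vB = B) by (frall; assumption).
  assert (I3 : sc s4 vhl = hl) by (frall; assumption).
  assert (I4 : forall x, x < hl + bl -> ar s4 aBUF x = Tf (B - hl + x)) by (intros x Hx; rewrite ((proj1 (proj2 F4)) aBUF x eq_refl); auto).
  assert (I5 : inp s4 = B + bl) by (rewrite (proj1 (proj2 (proj2 F4)) eq_refl); assumption).
  assert (I6 : sc s4 vrem = n - (B + bl)) by (frall; assumption).
  assert (I7 : sc s4 vn = n) by (frall; assumption). assert (TT : (28 * (4 * m / g) + 63) * g <= 112 * m + 63 * g).
  { pose proof (Nat.Div0.mul_div_le (4 * m) g). lia. }
  assert (X : exists s5, sem (CIf (!vbl =? !vg) BOUNDARY CSkip)%c s4 = s5 /\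
     consts sg pm t s5 /\ sc s5 vbl = bl /\ sc s5 vB = B /\ inp s5 = B + bl /\ sc s5 vrem = n - (B + bl) /\ sc s5 vn = n /\
     sc s5 vms = ms (B + bl) /\ outp s5 = outs Sf Tf m (B + bl) /\
     (bl = g -> sc s5 vhl = g /\ (forall x, x < g -> ar s5 aBUF x = Tf (B + bl - g + x)) /\ LI (B + bl) (B + bl) s5) /\
     tk s5 <= tk s4 + 600 * m + 300 * g + 91).
  { eexists. split; [reflexivity|]. cond_is (bl =? g). { xs. rewrite I1, (c_g _ _ _ _ Hc4). reflexivity. }
    destruct (Nat.eqb_spec bl g) as [C|C].
    - assert (Lt : LI B (B + bl) (tick s4)). { apply (LI_agree CSkip B (B + bl) s4); auto. repeat split. }
      destruct (boundary_ok (tick s4) B (B + bl) hl) as (K1 & K2 & K3 & K4); auto.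
      { lia. } { exact (c_m _ _ _ _ Hc4). } { exact (c_g _ _ _ _ Hc4). }
      { intros x Hx. xs. rewrite I4 by lia. f_equal. lia. }
      pose proof (agree_sem BOUNDARY (tick s4)) as F5. assert (Hc5 : consts sg pm t (sem BOUNDARY (tick s4))).
      { eapply consts_agree; eauto. destruct Hc4; constructor; assumption. }
      cbn [tk tick] in K4. split; [exact Hc5|]. split; [frall; exact I1|]. split; [frall; exact I2|].
      split; [rewrite (proj1 (proj2 (proj2 F5)) eq_refl); exact I5|]. split; [frall; exact I6|]. split; [frall; exact I7|].
      split; [frall; exact P2|]. split; [rewrite (proj2 (proj2 (proj2 F5)) eq_refl); exact P3|]. split; [auto|lia].
    - cbn [sem sc inp outp ar tick tk]. split; [destruct Hc4; constructor; assumption|].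
      split; [exact I1|]. split; [exact I2|]. split; [exact I5|]. split; [exact I6|]. split; [exact I7|].
      split; [exact P2|]. split; [exact P3|]. split; [contradiction|lia]. }
  destruct X as (s5 & -> & K1 & K2 & K3 & K4 & K5 & K6 & K7 & K8 & K9 & K10).
  pose proof (agree_sem (vB ::= !vB + !vbl)%c s5) as F6.
  assert (Hc6 : consts sg pm t (sem (vB ::= !vB + !vbl)%c s5)) by (eapply consts_agree; eauto).
  assert (Y1 : sc (sem (vB ::= !vB + !vbl)%c s5) vB = B + bl) by (xs; rewrite K2, K3; ev; reflexivity).
  assert (Y2 : tk (sem (vB ::= !vB + !vbl)%c s5) = tk s5 + 1) by reflexivity.
  set (s6 := sem (vB ::= !vB + !vbl)%c s5) in *. clearbody s6. split; [|split].
  - constructor; auto; try (frall; assumption). rewrite (proj2 (proj2 (proj2 F6)) eq_refl). exact K8.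
  - intros C. destruct (K9 C) as (Z1 & Z2 & Z3). assert (W : sc s6 vhl = g) by (frall; exact Z1). constructor.
    + rewrite (proj1 (proj2 (proj2 F6)) eq_refl). exact K4.
    + frall. exact K5.
    + rewrite W. right. lia.
    + rewrite W. intros x Hx. frall. auto.
    + eapply LI_agree; [exact F6|reflexivity|exact Z3].
  - unfold TB. clear - X2 R4 S2 P4 TT K10 Y2 Hbl. lia.
Qed.

Lemma main_ok s : BI 0 s -> BJ 0 s ->
  let s' := sem MAIN s in
  outp s' = (if 0 <? ms n then (n - ms n + 1, n) :: outs Sf Tf m n else outs Sf Tf m n) /\
  tk s' <= tk s + (TB + 1) * (n / g + 1) + 5.
Proof.
  intros H1 H2 s'. subst s'. unfold MAIN. rewrite sem_seq. assert (EV : eval s (!vn / !vg + #1)%e = n / g + 1).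
  { xs. rewrite (bi_n _ _ H1), (c_g _ _ _ _ (bi_c _ _ H1)).
    assert (n / g <= n) by (apply Nat.Div0.div_le_upper_bound; nia). ev. reflexivity. }
  pose proof (Nat.Div0.mul_div_le n g) as D1. pose proof (Nat.mul_succ_div_gt n g ltac:(lia)) as D2.
  (* The last of the [n / g + 1] rounds gets the remaining letters, fewer than [g] and possibly
     none, hence the minimum. *)
  pose proof (rep_ind (fun k s' => BI (Nat.min (k * g) n) s' /\ (k * g <= n -> BJ (k * g) s') /\
    tk s' <= tk s + (TB + 1) * k + 1) (!vn / !vg + #1)%e BLOCK s) as R. rewrite EV in R.
  destruct R as (R1 & R2 & R3).
  - split; [|split; [intros _|cbn [tk tick]; lia]].
    + destruct H1 as [? ? [] ? ?]. constructor; auto. constructor; auto.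
    + destruct H2. constructor; auto. apply (LI_agree CSkip 0 0 s); auto. repeat split.
  - intros k s1 Hk F (I1 & I2 & I3).
    assert (Hkg : k * g <= n). { assert (k * g <= (n / g) * g) by (apply Nat.mul_le_mono_r; lia). lia. }
    specialize (I2 Hkg). replace (Nat.min (k * g) n) with (k * g) in I1 by lia.
    assert (J1 : BI (k * g) (tick s1)) by (destruct I1 as [? ? [] ? ?]; constructor; auto; constructor; auto).
    assert (J2 : BJ (k * g) (tick s1)).
    { destruct I2. constructor; auto. apply (LI_agree CSkip (k * g) (k * g) s1); auto. repeat split. }
    destruct (block_ok (tick s1) (k * g) J1 J2 Hkg) as (K1 & K2 & K3).
    cbn [tk tick] in K3. cbn [Nat.mul]. split; [|split].
    + replace (Nat.min (g + k * g) n) with (k * g + Nat.min g (n - k * g)) by lia. exact K1.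
    + intros C. replace (g + k * g) with (k * g + Nat.min g (n - k * g)) by lia. apply K2. lia.
    + lia.
  - set (s1 := sem (CRep _ BLOCK) s) in *.
    replace (Nat.min ((n / g + 1) * g) n) with n in R1 by (rewrite Nat.mul_add_distr_r; lia).
    destruct R1. pose proof (msf_le Sf Tf m n) as ML. cond_is (0 <? ms n). { xs. rewrite bi_ms0. reflexivity. }
    destruct (0 <? ms n); xs.
    + rewrite bi_n0, bi_ms0, bi_out0. ev. split; [reflexivity|lia].
    + split; [exact bi_out0|lia].
Qed.
End Main.

(** * Choice of the modulus *)

Section Pre.
Variables n sg k : nat.

(** The product [tries * n] must exceed the work of the search in [search_bound]: there [2 * n]
    bounds [m ^ 8] and [8 * ((k + 1) * (k + 1)) * n] bounds the square of the bit length of [sg]. *)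
Definition tries := 4 * (2 + 8 * ((k + 1) * (k + 1))).
(** If [m ^ capexp < sg <= (2 * n) ^ k], then [m ^ 8 < 2 * n], and testing every modulus on every
    pair of positions takes O(n). Otherwise [sg] has a bounded number of digits in base [g + 1] and
    serves as the modulus itself. *)
Definition capexp := 8 * k + 1.

Definition PROBE : cmd :=
  (CIf ((ES (!i5) %% (!i4 + #1) =? ES (!i6) %% (!i4 + #1)) && ~~ (ES (!i5) =? ES (!i6))) (vok ::= #0) CSkip)%c.
Definition CHECK : cmd := (vok ::= #1 ;; For i5 (!vm) (For i6 (!vm) PROBE))%c.
Definition SEARCH : cmd :=
  ((vfound ::= #0 ;; vpm ::= #1) ;;
   For i4 (EC tries * !vn) (CIf (!vfound =? #0)
     (CHECK ;; CIf (!vok =? #1) (vpm ::= !i4 + #1 ;; vfound ::= #1) CSkip) CSkip))%c.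
Definition TDIG : cmd :=
  ((vt ::= #0 ;; vpw ::= #1) ;;
   CRep (EC tries * !vn) (CIf (!vpw <? !vpm) (vpw ::= !vpw * !vbeta ;; incr vt) CSkip))%c.
Definition PRE : cmd :=
  ((vn ::= !vrem ;; vbeta ::= !vg + #1 ;; vcap ::= #1) ;; CRep (EC capexp) (vcap ::= !vcap * !vm) ;;
   CIf (!vcap <? !vsg) (SEARCH ;; TDIG) (vpm ::= !vsg ;; vt ::= EC (4 * capexp)))%c.

Hypothesis Hmn : m <= n.
Hypothesis Hmg : m <= 4 * g * g.
Hypothesis HM1 : m ^ capexp + capexp * 4 + 100 < M.
Hypothesis HM2 : (tries * n + 10) * (g + 10) < M.
Hypothesis HSsg : forall i, i < m -> nth i Sl 0 < sg.
Hypothesis Hsg : sg <= (2 * n) ^ k.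

Lemma check_ok s p : sc s vm = m -> sc s i4 + 1 = p -> p < M ->
  let s' := sem CHECK s in
  (sc s' vok = 1 /\ good Sf m p \/ sc s' vok = 0 /\ ~ good Sf m p) /\
  tk s' <= tk s + 14 * (m * m) + 10.
Proof.
  intros Em Ep HpM s'. subst s'. unfold CHECK. rewrite sem_seq. set (s1 := sem (vok ::= #1)%c s).
  assert (X : sc s1 vm = m /\ sc s1 i4 + 1 = p /\ sc s1 vok = 1 /\ tk s1 = tk s + 1) by (unfold s1; xs; auto).
  clear Em Ep. destruct X as (Em & Ep & Eok & Et).
  pose (bad := fun x y => Sf x mod p = Sf y mod p /\ Sf x <> Sf y).
  assert (R : (sc (sem (For i5 (!vm) (For i6 (!vm) PROBE)) s1) vok = 1 /\ (forall x y, x < m -> y < m -> ~ bad x y) \/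
     sc (sem (For i5 (!vm) (For i6 (!vm) PROBE)) s1) vok = 0 /\ exists x y, x < m /\ y < m /\ bad x y) /\
     tk (sem (For i5 (!vm) (For i6 (!vm) PROBE)) s1) <= tk s1 + (6 * m + 8) * m + 5).
  { destruct (for_ind (fun a s' =>
      (sc s' vok = 1 /\ (forall x y, x < a -> y < m -> ~ bad x y) \/
       sc s' vok = 0 /\ exists x y, x < m /\ y < m /\ bad x y) /\ tk s' <= tk s1 + (6 * m + 8) * a + 5)
      i5 (!vm)%e (For i6 (!vm) PROBE) s1 m) as [R _]; [xs; exact Em|reflexivity|lia| | |exact R].
    - xs. split; [left; split; [assumption|intros; lia]|lia].
    - intros a s2 Ha F Hi (I1 & I2).
      assert (E2 : sc s2 vm = m) by (frall; exact Em). assert (E3 : sc s2 i4 + 1 = p) by (frall; exact Ep).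
      destruct (for_ind (fun b s' =>
        (sc s' vok = 1 /\ (forall x y, x < a -> y < m -> ~ bad x y) /\ (forall y, y < b -> ~ bad a y) \/
         sc s' vok = 0 /\ exists x y, x < m /\ y < m /\ bad x y) /\ tk s' <= tk s2 + 1 + 6 * b + 5)
        i6 (!vm)%e PROBE (tick s2) m) as [[R1 R2] _]; [xs; exact E2|reflexivity|lia| | |].
      + xs. split; [|lia]. destruct I1 as [[I1 I1']|[I1 I1']]; [left|right; auto].
        split; [assumption|]. split; [assumption|intros; lia].
      + intros b s3 Hb F3 Hi3 (J1 & J2).
        assert (E5 : sc s3 i5 = a) by (frall; xs; exact Hi). assert (E6 : sc s3 i4 + 1 = p) by (frall; xs; exact E3).
        unfold PROBE. cond_is ((Sf a mod p =? Sf b mod p) && negb (Sf a =? Sf b)).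
        { xs. rewrite E5, Hi3. ev. rewrite E6. reflexivity. }
        destruct ((Sf a mod p =? Sf b mod p) && negb (Sf a =? Sf b)) eqn:C.
        * apply andb_true_iff in C as [capexp' C2']. apply Nat.eqb_eq in capexp'. apply negb_true_iff, Nat.eqb_neq in C2'.
          xs. split; [|lia]. right. split; [reflexivity|]. exists a, b. do 2 (split; [assumption|]). split; assumption.
        * xs. split; [|lia]. destruct J1 as [(J1 & J3 & J4)|J1]; [left|right; exact J1].
          do 2 (split; [assumption|]). intros y Hy. destruct (Nat.eq_dec y b) as [->|]; [|apply J4; lia].
          intros [B1 B2]. apply Nat.eqb_eq in B1. apply Nat.eqb_neq in B2. rewrite B1, B2 in C. discriminate.
      + set (s3 := sem (For i6 (!vm) PROBE) (tick s2)) in *. xs. split; [|lia].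
        destruct R1 as [(R1 & R3 & R4)|R1]; [left|right; exact R1]. split; [assumption|].
        intros x y Hx Hy. destruct (Nat.eq_dec x a) as [->|]; [apply R4; assumption|apply R3; lia]. }
  destruct R as [R1 R2]. split.
  - destruct R1 as [[R1 R3]|[R1 (x & y & Hx & Hy & B1 & B2)]]; [left|right]; (split; [assumption|]).
    + intros x y Hx Hy E. destruct (Nat.eq_dec (Sf x) (Sf y)) as [|C]; [assumption|]. exfalso. apply (R3 x y Hx Hy). split; assumption.
    + auto.
  - assert (m <= m * m) by (clear - Hm0; nia). lia.
Qed.

(** Rounds after the success are idle, so the checks are paid by the modulus found rather than by
    the number of rounds. *)
Lemma search_ok s p0 : sc s vm = m -> sc s vn = n -> 1 <= p0 <= tries * n -> good Sf m p0 ->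
  let s' := sem SEARCH s in
  1 <= sc s' vpm <= p0 /\ good Sf m (sc s' vpm) /\
  tk s' <= tk s + 10 * (tries * n) + (14 * (m * m) + 10) * p0 + 10.
Proof.
  intros Em En Hp0 Hgood s'. subst s'. unfold SEARCH. rewrite sem_seq.
  set (s1 := sem (vfound ::= #0 ;; vpm ::= #1)%c s).
  assert (X : sc s1 vm = m /\ sc s1 vn = n /\ sc s1 vfound = 0 /\ tk s1 = tk s + 2) by (unfold s1; xs; repeat split; auto; lia).
  destruct X as (Em1 & En1 & Ef & Et).
  set (c := (14 * (m * m) + 10)). set (N := tries * n) in *. destruct (for_ind (fun a s' =>
    (sc s' vfound = 0 /\ (forall p, 1 <= p <= a -> ~ good Sf m p) /\ tk s' <= tk s1 + 10 * a + c * a + 5 \/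
     sc s' vfound = 1 /\ 1 <= sc s' vpm <= p0 /\ good Sf m (sc s' vpm) /\ tk s' <= tk s1 + 10 * a + c * sc s' vpm + 5))
    i4 (EC tries * !vn)%e (CIf (!vfound =? #0)
     (CHECK ;; CIf (!vok =? #1) (vpm ::= !i4 + #1 ;; vfound ::= #1) CSkip) CSkip)%c s1 N) as [R _].
  - xs. rewrite En1. ev. reflexivity.
  - auto. - lia.
  - left. xs. split; [assumption|]. split; [intros; lia|lia].
  - intros a s2 Ha F Hi I. assert (E1 : sc s2 vm = m) by (frall; exact Em1). clear F.
    destruct I as [(I1 & I2 & I3)|(I1 & I2 & I3 & I4)].
    + cond_is true. { xs. rewrite I1. reflexivity. } destruct (check_ok (tick (tick s2)) (a + 1)) as [A1 A2].
      { exact E1. } { auto. } { lia. }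
      pose proof (agree_sem CHECK (tick (tick s2))) as F.
      assert (E2 : sc (sem CHECK (tick (tick s2))) i4 = a) by (frall; xs; exact Hi).
      assert (E3 : sc (sem CHECK (tick (tick s2))) vfound = 0) by (frall; xs; exact I1). cbn [tk tick] in A2.
      destruct A1 as [[A1 A3]|[A1 A3]].
      * cond_is true. { xs. rewrite A1. reflexivity. } right. xs. rewrite E2. ev. split; [reflexivity|]. split.
        { split; [lia|]. apply Nat.nlt_ge. intros C. apply (I2 p0); [lia|exact Hgood]. }
        split; [exact A3|]. lia.
      * cond_is false. { xs. rewrite A1. reflexivity. } left. xs. split; [exact E3|]. split.
        { intros p Hp. destruct (Nat.eq_dec p (a + 1)) as [->|]; [exact A3|apply I2; lia]. }
        lia.
    + cond_is false. { xs. rewrite I1. reflexivity. } right. xs.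
      split; [exact I1|]. split; [exact I2|]. split; [exact I3|]. lia.
  - set (s2 := sem (For i4 _ _) s1) in *. destruct R as [(R1 & R2 & R3)|(R1 & R2 & R3 & R4)].
    + exfalso. apply (R2 p0); [lia|exact Hgood].
    + split; [exact R2|]. split; [exact R3|].
      assert (c * sc s2 vpm <= c * p0) by (apply Nat.mul_le_mono_l; lia). lia.
Qed.

Lemma tdig_ok s pm : sc s vn = n -> sc s vpm = pm -> sc s vbeta = g + 1 -> 1 <= pm <= tries * n ->
  let s' := sem TDIG s in
  pm <= (g + 1) ^ sc s' vt /\ (forall u, pm <= (g + 1) ^ u -> sc s' vt <= u) /\
  tk s' <= tk s + 5 * (tries * n) + 10.
Proof.
  intros En Ep Eb Hpm s'. subst s'. unfold TDIG. rewrite sem_seq. set (s1 := sem (vt ::= #0 ;; vpw ::= #1)%c s).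
  assert (X : sc s1 vn = n /\ sc s1 vpm = pm /\ sc s1 vbeta = g + 1 /\ sc s1 vt = 0 /\ sc s1 vpw = 1 /\ tk s1 = tk s + 2)
    by (unfold s1; xs; repeat split; auto; lia).
  clear En Ep Eb. destruct X as (En & Ep & Eb & X1 & X2 & X3).
  assert (KB : pm * (g + 1) + tries * n < M). { clear - HM2 Hg Hpm. nia. }
  assert (EV : eval s1 (EC tries * !vn)%e = tries * n) by (xs; rewrite En; ev; reflexivity).
  set (N := tries * n) in *. pose proof (rep_ind (fun a s' => sc s' vpw = (g + 1) ^ sc s' vt /\ sc s' vt <= a /\
    (sc s' vt = a \/ pm <= sc s' vpw) /\ (forall u, pm <= (g + 1) ^ u -> sc s' vt <= u) /\
    tk s' <= tk s1 + 5 * a + 1) (EC tries * !vn)%e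
    (CIf (!vpw <? !vpm) (vpw ::= !vpw * !vbeta ;; incr vt) CSkip)%c s1) as R.
  rewrite EV in R. destruct R as (R1 & R2 & R3 & R4 & R5).
  - xs. rewrite X1, X2. split; [reflexivity|]. split; [lia|]. split; [left; reflexivity|]. split; [intros; lia|lia].
  - intros a s2 Ha F (I1 & I2 & I3 & I4 & I5).
    assert (E1 : sc s2 vpm = pm) by (frall; assumption). assert (E2 : sc s2 vbeta = g + 1) by (frall; assumption).
    set (t := sc s2 vt) in *. cond_is (sc s2 vpw <? pm). { xs. rewrite E1. reflexivity. }
    destruct (Nat.ltb_spec (sc s2 vpw) pm) as [C|C].
    + xs. rewrite E2. assert (sc s2 vpw * (g + 1) <= pm * (g + 1)) by (apply Nat.mul_le_mono_r; lia).
      ev. split; [rewrite I1, Nat.pow_add_r, Nat.pow_1_r; reflexivity|]. split; [lia|]. split; [left; lia|].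
      split; [|lia]. intros u Hu. destruct (Nat.le_gt_cases (t + 1) u) as [|D]; [assumption|exfalso].
      assert ((g + 1) ^ u <= (g + 1) ^ t) by (apply Nat.pow_le_mono_r; lia). lia.
    + xs. split; [exact I1|]. split; [lia|]. split; [right; exact C|]. split; [exact I4|lia].
  - split; [|split; [exact R4|lia]].
    destruct R3 as [R3|R3]; [|lia]. rewrite R3. assert (N < (g + 1) ^ N) by (apply Nat.pow_gt_lin_r; lia). lia.
Qed.

Lemma log_sq l : (l + 1) * (l + 1) <= 4 * 2 ^ l.
Proof.
  induction l as [|l IH]; [cbn; lia|]. cbn [Nat.pow].
  clear. induction l as [|l IH]; [cbn; lia|]. cbn [Nat.pow]. lia.
Qed.

Lemma beta_pow : m * m <= (g + 1) ^ 8.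
Proof.
  assert (4 * g * g <= (g + 1) ^ 4) by (cbn [Nat.pow]; nia).
  replace 8 with (4 + 4) by lia. rewrite Nat.pow_add_r. apply Nat.mul_le_mono; lia.
Qed.

(** The product [L * m ^ 4] is split as [L * b <= b * b + L * L] with [b = m ^ 4]. The first summand
    is below [2 * n] since [sg] exceeds [m ^ capexp]; the second is a squared logarithm, hence
    O(n). *)
Lemma search_bound : m ^ capexp < sg -> let L := Nat.log2 sg + 1 in
  (m * m) * (2 * (L * (m * m) + 1)) <= tries * n.
Proof.
  intros Hc L. assert (Hn : 1 <= n) by lia. assert (A : (m * m) * (m * m) * ((m * m) * (m * m)) < 2 * n).
  { apply Nat.nle_gt. intros C. assert (X : (2 * n) ^ k <= m ^ (8 * k)).
    { rewrite Nat.pow_mul_r. apply Nat.pow_le_mono_l. cbn [Nat.pow]. lia. }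
    assert (Y : m ^ (8 * k) <= m ^ capexp) by (apply Nat.pow_le_mono_r; unfold capexp; lia). lia. }
  assert (HL : L <= (k + 1) * (Nat.log2 (2 * n) + 1)).
  { pose proof (Nat.log2_spec (2 * n) ltac:(lia)) as [_ B]. set (l := Nat.log2 (2 * n)) in *.
    assert (X : (2 * n) ^ k <= 2 ^ (S l * k)) by (rewrite Nat.pow_mul_r; apply Nat.pow_le_mono_l; lia).
    assert (Y : Nat.log2 sg <= S l * k).
    { rewrite <- (Nat.log2_pow2 (S l * k)) by lia. apply Nat.log2_le_mono. lia. }
    nia. }
  assert (LL : L * L <= 8 * ((k + 1) * (k + 1)) * n).
  { pose proof (Nat.log2_spec (2 * n) ltac:(lia)) as [B _]. set (l := Nat.log2 (2 * n)) in *.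
    pose proof (log_sq l) as C.
    transitivity ((k + 1) * (l + 1) * ((k + 1) * (l + 1))); [apply Nat.mul_le_mono; exact HL|].
    replace ((k + 1) * (l + 1) * ((k + 1) * (l + 1))) with ((k + 1) * (k + 1) * ((l + 1) * (l + 1))) by ring.
    replace (8 * ((k + 1) * (k + 1)) * n) with ((k + 1) * (k + 1) * (8 * n)) by ring.
    apply Nat.mul_le_mono_l. lia. }
  assert (L1 : 1 <= L) by (unfold L; lia). set (a := m * m) in *. assert (a1 : 1 <= a) by (unfold a; nia).
  set (b := a * a) in *. assert (ab : a <= b) by (unfold b; nia).
  assert (bL : b <= L * b) by (clear - L1; nia). assert (AM : L * b <= b * b + L * L) by (clear; nia).
  unfold tries. nia.
Qed.

Lemma pre_ok s : sc s vm = m -> sc s vrem = n -> sc s vsg = sg -> sc s vg = g ->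
  let s' := sem PRE s in
  sc s' vn = n /\ exists pm t, consts sg pm t s' /\ 1 <= pm <= (g + 1) ^ t /\ good Sf m pm /\
  (t <= 4 * capexp \/ m ^ capexp < sg /\ t <= 12 + Nat.log2 (Nat.log2 sg + 1)) /\
  tk s' <= tk s + 200 * (tries * n) + 4 * capexp + 40.
Proof.
  intros Em Er Es Eg s'. subst s'. unfold PRE. rewrite sem_seq.
  set (s1 := sem (vn ::= !vrem ;; vbeta ::= !vg + #1 ;; vcap ::= #1)%c s).
  assert (X : sc s1 vm = m /\ sc s1 vn = n /\ sc s1 vsg = sg /\ sc s1 vg = g /\ sc s1 vbeta = g + 1 /\ sc s1 vcap = 1 /\ tk s1 = tk s + 3).
  { unfold s1. xs. ev. repeat split; auto; lia. }
  destruct X as (X1 & X2 & X3 & X4 & X5 & X6 & X7). rewrite sem_seq.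
  assert (CAP : sc (sem (CRep (EC capexp) (vcap ::= !vcap * !vm)) s1) vcap = m ^ capexp /\
     tk (sem (CRep (EC capexp) (vcap ::= !vcap * !vm)) s1) <= tk s1 + 2 * capexp + 1).
  { apply (rep_ind (fun a s' => sc s' vcap = m ^ a /\ tk s' <= tk s1 + 2 * a + 1) (EC capexp) (vcap ::= !vcap * !vm)%c s1).
    - xs. split; [assumption|lia].
    - intros a s2 Ha F (I1 & I2). cbn [eval] in Ha. xs. rewrite I1. frall. rewrite X1.
      assert (m ^ a * m <= m ^ capexp).
      { replace (m ^ a * m) with (m ^ (S a)) by (cbn; ring). apply Nat.pow_le_mono_r; lia. }
      ev. split; [cbn [Nat.pow]; ring|lia]. }
  pose proof (agree_sem (CRep (EC capexp) (vcap ::= !vcap * !vm))%c s1) as F.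
  set (s2 := sem (CRep _ _) s1) in *. destruct CAP as [CA CT].
  assert (Y1 : sc s2 vm = m) by (frall; assumption). assert (Y2 : sc s2 vn = n) by (frall; assumption).
  assert (Y3 : sc s2 vsg = sg) by (frall; assumption). assert (Y4 : sc s2 vg = g) by (frall; assumption).
  assert (Y5 : sc s2 vbeta = g + 1) by (frall; assumption). clear F.
  cond_is (m ^ capexp <? sg). { xs. rewrite CA, Y3. reflexivity. }
  destruct (Nat.ltb_spec (m ^ capexp) sg) as [C|C].
  - rewrite sem_seq. pose proof (search_bound C) as SB. cbv zeta in SB. set (L := Nat.log2 sg + 1) in *.
    assert (Hs0 : 0 < sg) by lia. destruct (good_modulus Sf m L) as (p0 & P1 & P2).
    { intros i Hi. pose proof (HSsg i Hi). pose proof (Nat.log2_spec sg Hs0) as [_ B].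
      unfold L. rewrite Nat.add_1_r. lia. }
    set (P := 2 * (L * (m * m) + 1)) in *. assert (mm : 1 <= m * m) by nia.
    assert (PK : P <= tries * n) by (clear - SB mm; nia).
    destruct (search_ok (tick s2) p0) as (A1 & A2 & A3); auto. { lia. }
    pose proof (agree_sem SEARCH (tick s2)) as F.
    assert (Z1 : sc (sem SEARCH (tick s2)) vm = m) by (frall; exact Y1). assert (Z2 : sc (sem SEARCH (tick s2)) vn = n) by (frall; exact Y2).
    assert (Z3 : sc (sem SEARCH (tick s2)) vsg = sg) by (frall; exact Y3). assert (Z4 : sc (sem SEARCH (tick s2)) vg = g) by (frall; exact Y4).
    assert (Z5 : sc (sem SEARCH (tick s2)) vbeta = g + 1) by (frall; exact Y5). clear F.
    set (s3 := sem SEARCH (tick s2)) in *. set (pm := sc s3 vpm) in *.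
    destruct (tdig_ok s3 pm Z2 eq_refl Z5 ltac:(lia)) as (B1 & B2 & B3). pose proof (agree_sem TDIG s3) as F.
    assert (W1 : sc (sem TDIG s3) vm = m) by (frall; exact Z1). assert (W2 : sc (sem TDIG s3) vn = n) by (frall; exact Z2).
    assert (W3 : sc (sem TDIG s3) vsg = sg) by (frall; exact Z3). assert (W4 : sc (sem TDIG s3) vg = g) by (frall; exact Z4).
    assert (W5 : sc (sem TDIG s3) vbeta = g + 1) by (frall; exact Z5). assert (W6 : sc (sem TDIG s3) vpm = pm) by (frall; reflexivity).
    set (s4 := sem TDIG s3) in *.
    split; [exact W2|]. exists pm, (sc s4 vt). split; [constructor; auto|]. split; [lia|]. split; [exact A2|]. split.
    (* The modulus is at most [8 * (m * m) * L], and the factors need 3, 8 and [log2 L + 1] digits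
       in base [g + 1 >= 2]. *)
    + right. split; [exact C|]. apply B2. pose proof beta_pow as BP. assert (LP : L <= (g + 1) ^ (Nat.log2 L + 1)).
      { pose proof (Nat.log2_spec L ltac:(lia)) as [_ B]. rewrite <- (Nat.add_1_r (Nat.log2 L)) in B.
        assert (2 ^ (Nat.log2 L + 1) <= (g + 1) ^ (Nat.log2 L + 1)) by (apply Nat.pow_le_mono_l; lia). lia. }
      replace (12 + Nat.log2 L) with (3 + 8 + (Nat.log2 L + 1)) by lia. rewrite (Nat.pow_add_r (g + 1) (3 + 8)), (Nat.pow_add_r (g + 1) 3).
      assert (B8 : 8 <= (g + 1) ^ 3) by (change 8 with (2 ^ 3) at 1; apply Nat.pow_le_mono_l; lia).
      transitivity (8 * (m * m) * L). { lia. } apply Nat.mul_le_mono; [apply Nat.mul_le_mono; assumption|exact LP].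
    + cbn [tk tick] in A3. assert ((14 * (m * m) + 10) * p0 <= 24 * (tries * n)).
      { transitivity (24 * ((m * m) * P)); [|lia]. transitivity (24 * (m * m) * p0); [apply Nat.mul_le_mono_r; lia|].
        rewrite <- Nat.mul_assoc. apply Nat.mul_le_mono_l. apply Nat.mul_le_mono_l. lia. }
      lia.
  - split; [xs; exact Y2|]. exists sg, (4 * capexp). xs. split; [constructor; xs; auto|]. split.
    (* Here [m <= 4 * g * g <= (g + 1) ^ 4], so [sg <= m ^ capexp] has at most [4 * capexp]
       digits. *)
    + specialize (HSsg 0 Hm0). split; [lia|]. transitivity (m ^ capexp); [exact C|].
      rewrite Nat.pow_mul_r. apply Nat.pow_le_mono_l. cbn [Nat.pow]. nia.
    + split; [|split; [left; lia|lia]].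
      intros x y Hx Hy E. rewrite !Nat.mod_small in E by (apply HSsg; assumption). exact E.
Qed.
End Pre.

End Semantics.

(** * Compilation to the word RAM *)

Definition opc (o : aop) : binop :=
  match o with AAdd => OAdd | ASub => OSub | AMul => OMul | ADiv => ODiv | AMod => OMod end.

(* Out-of-range indices are multiplied by the outcome of the range test, hence sent to 0. *)
Definition addrcode (k t : nat) : list instr :=
  [IOp OLt (t + 1) t 4; IOp OMul t t (t + 1); IConst (t + 1) NA; IOp OMul t t (t + 1);
   IConst (t + 1) (V0 + k); IOp OAdd t t (t + 1)].

(** The value goes to cell [t], and the cells above [t] serve as an evaluation stack. A bitwise or
    of a cell with itself is a copy. *)
Fixpoint compE (e : expr) (t : nat) : list instr :=
  match e with
  | EV x => [IOp OOr t x x]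
  | EC v => [IConst t v]
  | EO o a b => compE a t ++ compE b (t + 1) ++ [IOp (opc o) t t (t + 1)]
  | EA k e => compE e t ++ addrcode k t ++ [ILoad t t]
  | ES e => compE e t ++ [IOp OLt (t + 1) t 0; IOp OMul t t (t + 1); IRead t t]
  end.

Fixpoint compB (b : bexp) (t : nat) : list instr :=
  match b with
  | BLt x y => compE x t ++ compE y (t + 1) ++ [IOp OLt t t (t + 1)]
  | BEq x y => compE x t ++ compE y (t + 1) ++ [IOp OEq t t (t + 1)]
  | BAnd p q => compB p t ++ compB q (t + 1) ++ [IOp OMul t t (t + 1)]
  | BNot p => compB p t ++ [IConst (t + 1) 0; IOp OEq t t (t + 1)]
  end.

(** [pc] is the address of the code, needed for jump targets, and [d] the nesting depth of loops,
    which selects the counter cell [VN + d]. An unconditional jump is a test of a cell just set to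
    0. *)
Fixpoint comp (c : cmd) (pc d : nat) : list instr :=
  match c with
  | CSkip => []
  | CSet x e => compE e T0 ++ [IOp OOr x T0 T0]
  | CSto k i e => compE i T0 ++ addrcode k T0 ++ compE e (T0 + 1) ++ [IStore T0 (T0 + 1)]
  | CNext x => [IJz 1 (pc + 4); INext x; IConst T0 1; IOp OSub 1 1 T0]
  | COut a b => compE a T0 ++ compE b (T0 + 1) ++ [IReport T0 (T0 + 1)]
  | CSeq c1 c2 => let k1 := comp c1 pc d in k1 ++ comp c2 (pc + length k1) d
  | CIf b c1 c2 =>
      let kb := compB b T0 in
      let p1 := pc + length kb + 1 in
      let k1 := comp c1 p1 d in
      let p2 := p1 + length k1 + 2 in
      let k2 := comp c2 p2 d in
      kb ++ [IJz T0 p2] ++ k1 ++ [IConst T0 0; IJz T0 (p2 + length k2)] ++ k2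
  | CRep e c =>
      let ke := compE e T0 in
      let h := VN + d in
      let l := pc + length ke + 1 in
      let kc := comp c (l + 1) (d + 1) in
      ke ++ [IOp OOr h T0 T0; IJz h (l + length kc + 5)] ++ kc ++
      [IConst T0 1; IOp OSub h h T0; IConst T0 0; IJz T0 l]
  end.

Fixpoint tdep (e : expr) : nat :=
  match e with
  | EV _ | EC _ => 2
  | EO _ a b => Nat.max (tdep a) (tdep b + 1)
  | EA _ e | ES e => Nat.max 2 (tdep e)
  end.
Fixpoint tdepb (b : bexp) : nat :=
  match b with
  | BLt a b | BEq a b => Nat.max (tdep a) (tdep b + 1)
  | BAnd a b => Nat.max (tdepb a) (tdepb b + 1)
  | BNot b => Nat.max 2 (tdepb b)
  end.

Fixpoint wfE (v : nat) (e : expr) : bool :=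
  match e with
  | EV x => x <? VN
  | EC c => c <=? v
  | EO _ a b => wfE v a && wfE v b
  | EA k e => (k <? NA) && wfE v e
  | ES e => wfE v e
  end.
Fixpoint wfB (v : nat) (b : bexp) : bool :=
  match b with
  | BLt x y | BEq x y => wfE v x && wfE v y
  | BAnd p q => wfB v p && wfB v q
  | BNot p => wfB v p
  end.

Definition okE (v kx : nat) (e : expr) : bool :=
  wfE v e && (tdep e <=? 18) && (length (compE e T0) <=? kx).

(* [v] bounds the constants of the program and [kx] the length of the code of its
   expressions; cells 0 to 4 hold the arguments and the array size. *)
Fixpoint wfC (v kx : nat) (c : cmd) (d : nat) : bool :=
  match c with
  | CSkip => true
  | CSet x e => (4 <? x) && (x <? VN) && okE v kx e
  | CSto k i e => (k <? NA) && okE v kx i && okE v kx e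
  | CNext x => (4 <? x) && (x <? VN)
  | COut a b => okE v kx a && okE v kx b
  | CSeq c1 c2 => wfC v kx c1 d && wfC v kx c2 d
  | CIf b c1 c2 => wfB v b && (tdepb b <=? 18) && (length (compB b T0) <=? kx)
                   && wfC v kx c1 d && wfC v kx c2 d
  | CRep e c => (d <? HN) && okE v kx e && wfC v kx c (d + 1)
  end.

Lemma compE_length (e : expr) : forall t t', length (compE e t) = length (compE e t').
Proof.
  induction e; intros; simpl; rewrite ?length_app; simpl; auto.
Qed.

(** An update without option type, defined pointwise so that reads reduce by [nth_upn]; [upn_write]
    links it to the machine. *)
Definition upn (a v : nat) (l : list nat) : list nat :=
  map (fun b => if b =? a then v else nth b l 0) (seq 0 (length l)).

Lemma upn_length a v l : length (upn a v l) = length l.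
Proof. unfold upn. now rewrite length_map, length_seq. Qed.

Lemma nth_upn a v l b : a < length l -> nth b (upn a v l) 0 = if b =? a then v else nth b l 0.
Proof.
  destruct (Nat.lt_ge_cases b (length l)) as [C|C].
  - unfold upn. rewrite (nth_indep _ 0 (if 0 =? a then v else nth 0 l 0)) by now rewrite length_map, length_seq.
    rewrite (map_nth (fun b => if b =? a then v else nth b l 0)). now rewrite seq_nth.
  - rewrite !nth_overflow by now rewrite ?upn_length. destruct (Nat.eqb_spec b a); [lia|reflexivity].
Qed.

Lemma upn_write a v l : a < length l -> upn a v l = firstn a l ++ v :: skipn (a + 1) l.
Proof.
  intros H. assert (E : length (upn a v l) = length (firstn a l ++ v :: skipn (a + 1) l)).
  { rewrite upn_length, length_app, length_firstn. cbn [length]. rewrite length_skipn. lia. }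
  apply (nth_ext _ _ 0 0 E). intros b Hb. rewrite nth_upn by assumption.
  assert (F : length (firstn a l) = a) by (rewrite length_firstn; lia). destruct (Nat.eqb_spec b a) as [->|N].
  - rewrite app_nth2; rewrite F; [|lia]. now rewrite Nat.sub_diag.
  - destruct (Nat.lt_ge_cases b a).
    + rewrite app_nth1, nth_firstn by lia. destruct (Nat.ltb_spec b a); [reflexivity|lia].
    + rewrite app_nth2, F by lia. destruct (b - a) as [|x] eqn:D; [lia|].
      cbn [nth]. rewrite nth_skipn. f_equal. lia.
Qed.

Ltac rd := repeat (rewrite nth_upn by (rewrite ?upn_length; lia));
  repeat match goal with |- context [?a =? ?b] => first
    [ replace (a =? b) with true by (symmetry; apply Nat.eqb_eq; lia)
    | replace (a =? b) with false by (symmetry; apply Nat.eqb_neq; lia) ] end.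

(** * Simulation of the structured language by the word RAM *)

Definition codeat (P : program) (p : nat) (k : list instr) : Prop :=
  forall i, i < length k -> nth_error P (p + i) = nth_error k i.

Lemma codeat_app P p k1 k2 :
  codeat P p (k1 ++ k2) -> codeat P p k1 /\ codeat P (p + length k1) k2.
Proof.
  split; intros i Hi.
  - rewrite H by (rewrite length_app; lia). apply nth_error_app1. lia.
  - rewrite <- Nat.add_assoc, H by (rewrite length_app; lia). rewrite nth_error_app2 by lia. f_equal. lia.
Qed.

Lemma codeat_cons P p i k :
  codeat P p (i :: k) -> nth_error P p = Some i /\ codeat P (p + 1) k.
Proof.
  split.
  - specialize (H 0). rewrite Nat.add_0_r in H. apply H. simpl. lia.
  - intros j Hj. rewrite <- Nat.add_assoc. apply H. simpl. lia.
Qed.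

Section Simulation.
Variables (P : program) (w Q : nat) (Sl Tl : list nat).
Let M := 2 ^ w.

Hypothesis Hbig : V0 + NA * Q < M.
Hypothesis HS : Forall (fun a => a < M) Sl.
Hypothesis HT : Forall (fun a => a < M) Tl.
Hypothesis HS0 : 0 < length Sl.
Hypothesis HQ0 : 0 < Q.
Let HV : V0 = 110 := eq_refl.
Let HVN : VN = 80 := eq_refl.
Let HHN : HN = 10 := eq_refl.
Let HT0 : T0 = 90 := eq_refl.
Let HNA : NA = 32 := eq_refl.

Lemma steps_trans a b c c1 :
  steps P w Sl a c = Some c1 -> steps P w Sl (a + b) c = steps P w Sl b c1.
Proof.
  revert c. induction a as [|a IH]; intros c H; simpl in *.
  - injection H as ->. reflexivity.
  - destruct (step P w Sl c); simpl in *; [auto|discriminate].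
Qed.

Lemma steps_one c c1 i :
  nth_error P (pc c) = Some i -> exec w Sl i c = Some c1 -> steps P w Sl 1 c = Some c1.
Proof. intros H1 H2. simpl. unfold step. rewrite H1. simpl. rewrite H2. reflexivity. Qed.

Lemma assign_ok d v p mm st rp :
  d < length mm ->
  assign w d v (Config p mm st rp) = Some (Config (p + 1) (upn d (v mod M) mm) st rp).
Proof.
  unfold assign, write. simpl. destruct (Nat.ltb_spec d (length mm)); [|lia]. now rewrite upn_write.
Qed.

Lemma get_ok a (mm : list nat) : a < length mm -> nth_error mm a = Some (nth a mm 0).
Proof. intros. apply nth_error_nth'. assumption. Qed.

(** The arrays are interleaved because their length is an input while the program is fixed: the
    address [V0 + i * NA + k] has constant coefficients. Cells of loop counters and temporaries are
    left free. *)
Record Rel (s : state) (mm : list nat) (st : list nat) (rp : list (nat * nat)) : Prop := {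
  r_len : length mm = V0 + NA * Q;
  r_sc : forall x, x < VN -> nth x mm 0 = sc s x;
  r_ar : forall k i, k < NA -> i < Q -> nth (V0 + i * NA + k) mm 0 = ar s k i;
  r_scM : forall x, x < VN -> sc s x < M;
  r_arM : forall k i, k < NA -> i < Q -> ar s k i < M;
  r_st : st = skipn (inp s) Tl;
  r_inp : sc s 1 + inp s = length Tl;
  r_rp : rp = outp s;
  r_m : sc s 0 = length Sl;
  r_Q : sc s 4 = Q }.

Definition same_but (lo : nat) (mm mm' : list nat) : Prop :=
  length mm' = length mm /\ forall x, ~ (lo <= x < V0) -> nth x mm' 0 = nth x mm 0.

Lemma same_but_trans a b m1 m2 m3 :
  a <= b -> same_but a m1 m2 -> same_but b m2 m3 -> same_but a m1 m3.
Proof.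
  intros H [L1 H1] [L2 H2]. split; [lia|]. intros x Hx. rewrite H2 by lia. apply H1. lia.
Qed.

Lemma same_but_upn a b v mm :
  a <= b < V0 -> b < length mm -> same_but a mm (upn b v mm).
Proof.
  split; [apply upn_length|]. intros x Hx. rd. reflexivity.
Qed.

Lemma Rel_same s mm mm' st rp : Rel s mm st rp -> same_but T0 mm mm' -> Rel s mm' st rp.
Proof.
  intros [] [L H]. constructor; auto.
  - lia.
  - intros x Hx. rewrite H; auto. unfold T0, VN, HN in *; lia.
  - intros k i Hk Hi. rewrite H; auto. lia.
Qed.

Lemma same_but_mono a b mm mm' : a <= b -> same_but b mm mm' -> same_but a mm mm'.
Proof. intros H [L H1]. split; auto. intros x Hx. apply H1. lia. Qed.

Lemma M_pos : 0 < M.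
Proof. lia. Qed.

Lemma opsem_eq o x y : x < M -> y < M ->
  eval_binop w (opc o) x y mod M = opsem M o x y /\ opsem M o x y < M.
Proof.
  destruct o; simpl; split; try reflexivity;
    try (apply Nat.mod_upper_bound; lia).
  - apply Nat.mod_small. apply Nat.le_lt_trans with x; auto.
    destruct y; [simpl; lia|]. apply Nat.Div0.div_le_upper_bound. nia.
  - apply Nat.le_lt_trans with x; auto. destruct y; [simpl; lia|]. apply Nat.Div0.div_le_upper_bound. nia.
  - apply Nat.mod_small. apply Nat.le_lt_trans with x; auto. apply Nat.Div0.mod_le.
  - apply Nat.le_lt_trans with x; auto. apply Nat.Div0.mod_le.
Qed.

Lemma nth_lt_M l i : Forall (fun a => a < M) l -> nth i l 0 < M.
Proof.
  intros H. destruct (Nat.lt_ge_cases i (length l)).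
  - rewrite Forall_forall in H. apply H. apply nth_In. assumption.
  - rewrite nth_overflow by assumption. apply M_pos.
Qed.

Definition runs_to (k : nat) (p : nat) (mm : list nat) st rp (mm' : list nat) : Prop :=
  steps P w Sl k (Config p mm st rp) = Some (Config (p + k) mm' st rp).

Lemma runs_to_trans k1 k2 p mm st rp m1 m2 :
  runs_to k1 p mm st rp m1 -> runs_to k2 (p + k1) m1 st rp m2 ->
  runs_to (k1 + k2) p mm st rp m2.
Proof.
  unfold runs_to. intros H1 H2. rewrite (steps_trans _ _ _ _ H1), H2. do 2 f_equal. lia.
Qed.

Lemma run_const p d v mm st rp :
  nth_error P p = Some (IConst d v) -> d < length mm -> v < M ->
  runs_to 1 p mm st rp (upn d v mm).
Proof.
  intros H Hd Hv. eapply steps_one; [exact H|]. simpl.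
  rewrite assign_ok by assumption. rewrite Nat.mod_small by assumption. reflexivity.
Qed.

Lemma run_op p o d a b mm st rp :
  nth_error P p = Some (IOp o d a b) ->
  d < length mm -> a < length mm -> b < length mm ->
  runs_to 1 p mm st rp (upn d (eval_binop w o (nth a mm 0) (nth b mm 0) mod M) mm).
Proof.
  intros H Hd Ha Hb. eapply steps_one; [exact H|]. simpl.
  rewrite (get_ok a), (get_ok b) by assumption. simpl. rewrite assign_ok by assumption. reflexivity.
Qed.

Lemma run_copy p d a mm st rp :
  nth_error P p = Some (IOp OOr d a a) -> d < length mm -> a < length mm ->
  nth a mm 0 < M ->
  runs_to 1 p mm st rp (upn d (nth a mm 0) mm).
Proof.
  intros H Hd Ha HM. pose proof (run_op p _ _ _ _ mm st rp H Hd Ha Ha) as R.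
  rewrite Nat.lor_diag, Nat.mod_small in R by assumption. exact R.
Qed.

(** The effect of straight-line code, so that short instruction sequences are executed by
    computation. *)
Fixpoint line (k : list instr) (mm : list nat) : list nat :=
  match k with
  | IConst d v :: r => line r (upn d (v mod M) mm)
  | IOp o d a b :: r => line r (upn d (eval_binop w o (nth a mm 0) (nth b mm 0) mod M) mm)
  | _ => mm
  end.

Lemma line_ok k : forall p mm st rp, codeat P p k ->
  Forall (fun i => match i with
    | IConst d _ => d < length mm
    | IOp _ d a b => d < length mm /\ a < length mm /\ b < length mm
    | _ => False end) k ->
  runs_to (length k) p mm st rp (line k mm).
Proof.
  induction k as [|i k IH]; intros p mm st rp HC HF.
  - unfold runs_to. rewrite Nat.add_0_r. reflexivity.
  - apply codeat_cons in HC as [C1 C2]. inversion HF as [|? ? Hi HF']; subst.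
    destruct i as [d v|o d a b| | | | | | |]; try contradiction;
      (eapply (runs_to_trans 1); [|apply IH; [exact C2|rewrite upn_length; exact HF']]).
    + eapply steps_one; [exact C1|]. apply assign_ok, Hi.
    + apply run_op; tauto.
Qed.

Lemma line_length k mm : length (line k mm) = length mm.
Proof.
  revert mm. induction k as [|[] k IH]; intros mm; cbn [line]; auto; rewrite IH; apply upn_length.
Qed.

Lemma run_addr p k t mm st rp v :
  codeat P p (addrcode k t) -> length mm = V0 + NA * Q ->
  nth 4 mm 0 = Q -> nth t mm 0 = v -> v < M -> T0 <= t -> t + 2 <= V0 -> k < NA ->
  exists mm', runs_to 6 p mm st rp mm' /\ same_but t mm mm' /\
    nth t mm' 0 = V0 + clip Q v * NA + k.
Proof.
  intros HC HL H4 Hv HvM Ht1 Ht2 Hk. assert (Hc : clip Q v < Q) by (unfold clip; destruct (Nat.ltb_spec v Q); lia).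
  exists (line (addrcode k t) mm). split; [|split; [split; [apply line_length|]|]].
  - apply (line_ok (addrcode k t)); [exact HC|]. repeat constructor; lia.
  - intros x Hx. cbn [addrcode line]. rd. reflexivity.
  - cbn [addrcode line eval_binop]. rd. rewrite Hv, H4.
    replace ((v * ((if v <? Q then 1 else 0) mod M)) mod M) with (clip Q v).
    + rewrite (Nat.mod_small NA), (Nat.mod_small (V0 + k)), (Nat.mod_small (clip Q v * NA)) by nia.
      rewrite Nat.mod_small by nia. lia.
    + unfold clip in *. rewrite (Nat.mod_small (if v <? Q then 1 else 0)) by (destruct (v <? Q); lia).
      rewrite Nat.mod_small; destruct (v <? Q); lia.
Qed.

Lemma run_bin p o d mm st rp x y :
  nth_error P p = Some (IOp o d d (d + 1)) -> d + 1 < length mm ->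
  nth d mm 0 = x -> nth (d + 1) mm 0 = y ->
  runs_to 1 p mm st rp (upn d (eval_binop w o x y mod M) mm).
Proof.
  intros H L Hx Hy. pose proof (run_op _ _ _ _ _ mm st rp H ltac:(lia) ltac:(lia) ltac:(lia)) as R.
  rewrite Hx, Hy in R. exact R.
Qed.

Definition computes (code : list instr) (t p v : nat) mm st rp : Prop :=
  exists mm', runs_to (length code) p mm st rp mm' /\ same_but t mm mm' /\
    nth t mm' 0 = v /\ v < M.

Lemma computes_bin ca cb o t p x y v mm st rp :
  codeat P p (ca ++ cb ++ [IOp o t t (t + 1)]) ->
  length mm = V0 + NA * Q -> T0 <= t -> t + 2 <= V0 ->
  computes ca t p x mm st rp ->
  (forall mm1, same_but t mm mm1 -> computes cb (t + 1) (p + length ca) y mm1 st rp) ->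
  eval_binop w o x y mod M = v -> v < M ->
  computes (ca ++ cb ++ [IOp o t t (t + 1)]) t p v mm st rp.
Proof.
  intros HC HL Ht1 Ht2 (m1 & R1 & S1 & N1 & B1) Hb Hv HvM.
  apply codeat_app in HC as [_ HC]. apply codeat_app in HC as [_ HC]. apply codeat_cons in HC as [C _].
  destruct (Hb m1 S1) as (m2 & R2 & S2 & N2 & B2). assert (L2 : length m2 = V0 + NA * Q) by (destruct S1, S2; lia).
  exists (upn t v m2). split; [|split; [|split]].
  - rewrite !length_app, Nat.add_assoc. apply runs_to_trans with m2; [apply runs_to_trans with m1; assumption|].
    rewrite Nat.add_assoc, <- Hv. apply run_bin; auto; [lia|]. destruct S2 as [_ S2]. rewrite S2 by lia. exact N1.
  - apply same_but_trans with (t) m2; [lia| |apply same_but_upn; lia].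
    apply same_but_trans with (t + 1) m1; [lia|assumption|assumption].
  - rd. reflexivity.
  - assumption.
Qed.

Lemma evE_ok v : v < M -> forall e t p s mm st rp,
  codeat P p (compE e t) -> Rel s mm st rp -> wfE v e = true ->
  T0 <= t -> t + tdep e <= V0 ->
  computes (compE e t) t p (eval M Q Sl s e) mm st rp.
Proof.
  assert (Hd : forall e, 2 <= tdep e) by (induction e; cbn [tdep]; lia).
  induction e as [x|c|o a IHa b IHb|k e IH|e IH]; intros t p s mm st rp HC HR HW Ht1 Ht2;
    cbn [compE wfE tdep eval] in *; pose proof (r_len _ _ _ _ HR) as HL.
  - apply Nat.ltb_lt in HW. apply codeat_cons in HC as [C _].
    pose proof (r_sc _ _ _ _ HR x HW) as E. pose proof (r_scM _ _ _ _ HR x HW) as B.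
    exists (upn t (sc s x) mm). split; [|split; [|split]].
    + rewrite <- E. apply run_copy; [exact C|lia|lia|lia].
    + apply same_but_upn; lia.
    + rd. reflexivity.
    + assumption.
  - apply Nat.leb_le in HW. apply codeat_cons in HC as [C _]. exists (upn t c mm). split; [|split; [|split]].
    + apply run_const; [exact C|lia|lia].
    + apply same_but_upn; lia.
    + rd. reflexivity.
    + lia.
  - apply andb_prop in HW as [W1 W2].
    pose proof (codeat_app _ _ _ _ HC) as [C1 C2]. apply codeat_app in C2 as [C2 _].
    assert (Ga : computes (compE a t) t p (eval M Q Sl s a) mm st rp) by (apply IHa; auto; lia).
    assert (Gb : forall mm1, same_but t mm mm1 ->
       computes (compE b (t + 1)) (t + 1) (p + length (compE a t)) (eval M Q Sl s b) mm1 st rp).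
    { intros m1 S1. apply IHb; auto; try lia.
      eapply Rel_same; [exact HR|]. eapply same_but_mono; [|exact S1]. lia. }
    assert (Hx : eval M Q Sl s a < M) by (destruct Ga as (? & ? & ? & ? & ?); assumption).
    assert (Hy : eval M Q Sl s b < M). { destruct (Gb mm) as (? & ? & ? & ? & ?); [split; auto|assumption]. }
    destruct (opsem_eq o _ _ Hx Hy) as [E B]. eapply computes_bin; eauto. pose proof (Hd a). lia.
  - apply andb_prop in HW as [W1 W2]. apply Nat.ltb_lt in W1.
    pose proof (codeat_app _ _ _ _ HC) as [C1 C2]. apply codeat_app in C2 as [C2 C3].
    apply codeat_cons in C3 as [C3 _].
    destruct (IH t p s mm st rp C1 HR W2 Ht1 ltac:(lia)) as (m1 & R1 & S1 & N1 & B1). destruct S1 as [L1 S1].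
    destruct (run_addr _ k t m1 st rp _ C2 ltac:(lia)
       ltac:(rewrite S1 by lia; rewrite (r_sc _ _ _ _ HR) by lia; apply (r_Q _ _ _ _ HR))
       N1 B1 Ht1 ltac:(lia) W1) as (m2 & R2 & [L2 S2] & N2).
    set (i := clip Q (eval M Q Sl s e)) in *.
    assert (Hi : i < Q) by (unfold i, clip; destruct (Nat.ltb_spec (eval M Q Sl s e) Q); lia).
    pose proof (r_ar _ _ _ _ HR k i W1 Hi) as E. pose proof (r_arM _ _ _ _ HR k i W1 Hi) as B.
    exists (upn t (ar s k i) m2). split; [|split; [|split]].
    + rewrite !length_app, Nat.add_assoc. apply runs_to_trans with m2; [apply runs_to_trans with m1; assumption|].
      eapply steps_one; [cbn [pc]; rewrite Nat.add_assoc; exact C3|].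
      cbn [exec mem]. rewrite (get_ok t) by lia. cbn [bind]. rewrite N2, get_ok by nia. cbn [bind]. rewrite assign_ok by lia. rewrite S2 by lia. rewrite S1 by lia. rewrite E, Nat.mod_small by assumption. reflexivity.
    + apply same_but_trans with t m2; [lia| |apply same_but_upn; lia].
      apply same_but_trans with t m1; [lia|split; assumption|split; assumption].
    + rd. reflexivity.
    + assumption.
  - pose proof (codeat_app _ _ _ _ HC) as [C1 C2].
    apply (codeat_app _ _ [IOp OLt (t + 1) t 0; IOp OMul t t (t + 1)]) in C2 as [C2 C3].
    apply codeat_cons in C3 as [C3 _].
    destruct (IH t p s mm st rp C1 HR HW Ht1 ltac:(lia)) as (m1 & R1 & [L1 S1] & N1 & B1).
    set (x := eval M Q Sl s e) in *. set (i := clip (length Sl) x). assert (E0 : nth 0 m1 0 = length Sl).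
    { rewrite S1 by lia. rewrite (r_sc _ _ _ _ HR) by lia. apply (r_m _ _ _ _ HR). }
    assert (Hi : i < length Sl) by (unfold i, clip; destruct (Nat.ltb_spec x (length Sl)); lia).
    pose proof (nth_lt_M Sl i HS) as B. pose proof (line_ok _ _ m1 st rp C2 ltac:(repeat constructor; lia)) as R2.
    set (m2 := line _ m1) in R2. assert (L2 : length m2 = length m1) by apply line_length.
    assert (N2 : nth t m2 0 = i).
    { unfold m2. cbn [line eval_binop]. rd. rewrite N1, E0.
      rewrite (Nat.mod_small (if x <? length Sl then 1 else 0)) by (destruct (x <? length Sl); lia).
      unfold i, clip in *. rewrite Nat.mod_small; destruct (x <? length Sl); lia. }
    exists (upn t (nth i Sl 0) m2). split; [|split; [|split]].
    + rewrite length_app. apply runs_to_trans with m1; [assumption|].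
      apply (runs_to_trans 2 1 _ _ _ _ m2); [exact R2|]. eapply steps_one; [exact C3|]. cbn [exec mem].
      rewrite (get_ok t) by lia. cbn [bind]. rewrite N2, get_ok by assumption. cbn [bind].
      rewrite assign_ok, Nat.mod_small by lia. reflexivity.
    + split; [rewrite upn_length; lia|]. intros y Hy. unfold m2. cbn [line]. rd. apply S1. lia.
    + rd. reflexivity.
    + assumption.
Qed.

Definition b2n (b : bool) : nat := if b then 1 else 0.

Lemma evB_ok v : v < M -> forall b t p s mm st rp,
  codeat P p (compB b t) -> Rel s mm st rp -> wfB v b = true ->
  T0 <= t -> t + tdepb b <= V0 ->
  computes (compB b t) t p (b2n (evalb M Q Sl s b)) mm st rp.
Proof.
  assert (Hd : forall e, 2 <= tdep e) by (induction e; cbn [tdep]; lia).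
  assert (Hdb : forall e, 2 <= tdepb e) by (induction e; cbn [tdepb]; pose proof Hd as Hd1; try pose proof (Hd1 a); lia).
  induction b as [x y|x y|b1 IH1 b2 IH2|b IH]; intros t p s mm st rp HC HR HW Ht1 Ht2;
    cbn [compB wfB tdepb evalb] in *; pose proof (r_len _ _ _ _ HR) as HL.
  1,2: pose proof (Hd x); pose proof (Hd y);
    apply andb_prop in HW as [W1 W2];
    pose proof (codeat_app _ _ _ _ HC) as [C1 C2]; apply codeat_app in C2 as [C2 _];
    eapply computes_bin with (x := eval M Q Sl s x) (y := eval M Q Sl s y); eauto; try lia;
    [ apply (evE_ok v); auto; lia
    | intros m1 S1; apply (evE_ok v); auto; try lia;
      eapply Rel_same; [exact HR|]; eapply same_but_mono; [|exact S1]; lia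
    | cbn [eval_binop]; unfold b2n; apply Nat.mod_small;
      match goal with |- context [if ?b then _ else _] => destruct b end; lia
    | unfold b2n; match goal with |- context [if ?b then _ else _] => destruct b end; lia ].
  - pose proof (Hdb b1); pose proof (Hdb b2). apply andb_prop in HW as [W1 W2].
    pose proof (codeat_app _ _ _ _ HC) as [C1 C2]; apply codeat_app in C2 as [C2 _].
    eapply computes_bin with (x := b2n (evalb M Q Sl s b1)) (y := b2n (evalb M Q Sl s b2));
      eauto; try lia.
    + apply IH1; eauto. lia.
    + intros m1 S1. apply IH2; auto; try lia. eapply Rel_same; [exact HR|]; eapply same_but_mono; [|exact S1]; lia.
    + destruct (evalb M Q Sl s b1), (evalb M Q Sl s b2); simpl;
        apply Nat.mod_small; lia.
    + destruct (evalb M Q Sl s b1), (evalb M Q Sl s b2); simpl; lia.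
  - pose proof (codeat_app _ _ _ _ HC) as [C1 C2]. change [IConst (t + 1) 0; IOp OEq t t (t + 1)] with
      ([IConst (t + 1) 0] ++ [IOp OEq t t (t + 1)]).
    eapply computes_bin with (x := b2n (evalb M Q Sl s b)) (y := 0); eauto; try lia.
    + apply IH; eauto. lia.
    + intros m1 [L1 S1]. apply codeat_cons in C2 as [C2 _]. exists (upn (t + 1) 0 m1). split; [|split; [|split]].
      * apply run_const; [exact C2|lia|lia].
      * apply same_but_upn; lia.
      * rd. reflexivity.
      * lia.
    + destruct (evalb M Q Sl s b); simpl; apply Nat.mod_small; lia.
    + destruct (evalb M Q Sl s b); simpl; lia.
Qed.

Lemma Rel_tick s mm st rp : Rel s mm st rp -> Rel (tick s) mm st rp.
Proof. intros []. constructor; auto. Qed.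

Lemma Rel_upn_hidden s mm st rp a v :
  VN <= a < V0 -> Rel s mm st rp -> Rel s (upn a v mm) st rp.
Proof.
  intros Ha [L ? ? ? ? ? ? ? ? ?]. constructor; auto.
  - rewrite upn_length; lia.
  - intros x Hx. rd. auto.
  - intros k i Hk Hi. rd. auto.
Qed.

Lemma Rel_setsc s mm st rp x v :
  4 < x -> x < VN -> v < M -> Rel s mm st rp -> Rel (setsc x v s) (upn x v mm) st rp.
Proof.
  intros H4 Hx Hv [L ? ? ? ? ? ? ? ? ?]. constructor; cbn [setsc sc ar inp outp]; auto.
  - rewrite upn_length; lia.
  - intros y Hy. rewrite nth_upn by lia. destruct (Nat.eqb_spec y x); auto.
  - intros k i Hk Hi. rd. auto.
  - intros y Hy. destruct (Nat.eqb_spec y x); auto.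
  - destruct (Nat.eqb_spec 1 x); [lia|auto].
  - destruct (Nat.eqb_spec 0 x); [lia|auto].
  - destruct (Nat.eqb_spec 4 x); [lia|auto].
Qed.

Lemma Rel_setar s mm st rp k i v :
  k < NA -> i < Q -> v < M -> Rel s mm st rp ->
  Rel (setar k i v s) (upn (V0 + i * NA + k) v mm) st rp.
Proof.
  intros Hk Hi Hv [L ? ? ? ? ? ? ? ? ?].

  constructor; cbn [setar sc ar inp outp]; auto.
  - rewrite upn_length; lia.
  - intros y Hy. rd. auto.
  - intros k' i' Hk' Hi'. rewrite nth_upn by lia. destruct (Nat.eqb_spec k' k) as [->|Hn].
    + destruct (Nat.eqb_spec i' i) as [->|Hn].
      * rewrite Nat.eqb_refl. reflexivity.
      * destruct (Nat.eqb_spec (V0 + i' * NA + k) (V0 + i * NA + k)); [nia|auto].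
    + destruct (Nat.eqb_spec (V0 + i' * NA + k') (V0 + i * NA + k)) as [E|]; [|auto]. lia.
  - intros k' i' Hk' Hi'. destruct (Nat.eqb_spec k' k); [destruct (Nat.eqb_spec i' i)|]; auto.
Qed.

(** The semantics adds a round at the end, whereas the induction on the machine's counter peels off
    the first round. *)
Lemma iter_S {A} n (f : A -> A) x : iter (S n) f x = iter n f (f x).
Proof. induction n; simpl in *; congruence. Qed.

(** The counters of the [d] enclosing loops must survive the code inside them. *)
Definition hid (d : nat) (mm mm' : list nat) : Prop :=
  forall x, VN <= x < VN + d -> nth x mm' 0 = nth x mm 0.

Lemma hid_same d mm mm' : d <= HN -> same_but T0 mm mm' -> hid d mm mm'.
Proof.
  intros Hd [_ H] x Hx. apply H. lia.
Qed.

Lemma tk_tick s : tk (tick s) = tk s + 1. Proof. reflexivity. Qed.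

Variables (v kx : nat).
Hypothesis Hv : v < M.
Let KC := 2 * kx + 20.

Definition simulates (c : cmd) (d : nat) (p len : nat) : Prop :=
  forall s mm st rp, Rel s mm st rp ->
  exists t mm' st' rp',
    steps P w Sl t (Config p mm st rp) = Some (Config (p + len) mm' st' rp') /\
    Rel (sem M Q Sl Tl c s) mm' st' rp' /\ hid d mm mm' /\
    t + KC * tk s <= KC * tk (sem M Q Sl Tl c s).

Lemma okE_ok e p t s mm st rp :
  codeat P p (compE e t) -> okE v kx e = true -> T0 <= t <= T0 + 1 -> Rel s mm st rp ->
  computes (compE e t) t p (eval M Q Sl s e) mm st rp /\ length (compE e t) <= kx.
Proof.
  intros HC HO Ht HR. apply andb_prop in HO as [HO H3]. apply andb_prop in HO as [H1 H2].
  apply Nat.leb_le in H2, H3. split.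
  - apply (evE_ok v); auto; [lia|]. lia.
  - rewrite (compE_length e t T0). assumption.
Qed.

Lemma comp_ok c : forall p d,
  wfC v kx c d = true -> d <= HN -> codeat P p (comp c p d) ->
  simulates c d p (length (comp c p d)).
Proof.
  induction c as [|x e|k i e|x|a b|b c1 IH1 c2 IH2|e c IH|c1 IH1 c2 IH2];
    intros p d HW Hd HC s mm st rp HR; cbn [comp wfC] in *;
    pose proof (r_len _ _ _ _ HR) as HL.
  - exists 0, mm, st, rp. cbn [length steps sem]. rewrite Nat.add_0_r.
    split; [reflexivity|]. split; [assumption|]. split; [intros y Hy; reflexivity|]. lia.
  - apply andb_prop in HW as [HW W3]. apply andb_prop in HW as [W1 W2]. apply Nat.ltb_lt in W1, W2.
    apply codeat_app in HC as [C1 C2]. apply codeat_cons in C2 as [C2 _].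
    destruct (okE_ok e p T0 s mm st rp C1 W3 ltac:(lia) HR) as [(m1 & R1 & S1 & N1 & B1) LK].
    assert (HR1 : Rel s m1 st rp) by (eapply Rel_same; eauto). pose proof (r_len _ _ _ _ HR1) as L1.
    exists (length (compE e T0) + 1), (upn x (eval M Q Sl s e) m1), st, rp. split; [|split; [|split]].
    + rewrite length_app. apply runs_to_trans with m1; [assumption|].
      rewrite <- N1. apply run_copy; [exact C2|lia|lia|lia].
    + cbn [sem]. apply Rel_setsc; auto. apply Rel_tick; auto.
    + intros y Hy. rd. apply S1. lia.
    + cbn [sem setsc tk tick]. unfold KC. nia.
  - apply andb_prop in HW as [HW W3]. apply andb_prop in HW as [W1 W2]. apply Nat.ltb_lt in W1.
    apply codeat_app in HC as [C1 C2]. apply codeat_app in C2 as [C2 C3].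
    apply codeat_app in C3 as [C3 C4]. apply codeat_cons in C4 as [C4 _]. cbn [addrcode length] in C3, C4.
    destruct (okE_ok i p T0 s mm st rp C1 W2 ltac:(lia) HR) as [(m1 & R1 & S1 & N1 & B1) LK].
    assert (HR1 : Rel s m1 st rp) by (eapply Rel_same; eauto). pose proof (r_len _ _ _ _ HR1) as L1.
    destruct (run_addr _ k T0 m1 st rp _ C2 L1
       ltac:(rewrite (r_sc _ _ _ _ HR1) by lia; apply (r_Q _ _ _ _ HR1))
       N1 B1 ltac:(lia) ltac:(lia) W1) as (m2 & R2 & S2 & N2).
    assert (HR2 : Rel s m2 st rp) by (eapply Rel_same; eauto).
    destruct (okE_ok e _ (T0 + 1) s m2 st rp C3 W3 ltac:(lia) HR2)
      as [(m3 & R3 & S3 & N3 & B3) LK3].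
    set (i' := clip Q (eval M Q Sl s i)) in *.
    assert (Hi : i' < Q) by (unfold i', clip; destruct (Nat.ltb_spec (eval M Q Sl s i) Q); lia).
    assert (HR3 : Rel s m3 st rp). { eapply Rel_same; [exact HR2|]. eapply same_but_mono; [|exact S3]. lia. }
    pose proof (r_len _ _ _ _ HR3) as L3. assert (N2' : nth T0 m3 0 = V0 + i' * NA + k).
    { destruct S3 as [_ S3]. rewrite S3 by lia. exact N2. }
    exists (length (compE i T0) + (6 + (length (compE e (T0 + 1)) + 1))),
      (upn (V0 + i' * NA + k) (eval M Q Sl s e) m3), st, rp.
    split; [|split; [|split]].
    + rewrite !length_app. cbn [addrcode length]. apply runs_to_trans with m1; [assumption|].
      apply runs_to_trans with m2; [assumption|]. apply runs_to_trans with m3; [assumption|].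
      unfold runs_to. eapply steps_one; [exact C4|]. cbn [exec mem].
      rewrite (get_ok T0) by lia. rewrite (get_ok (T0 + 1)) by lia. cbn [bind].
      rewrite N2', N3. rewrite assign_ok by nia. rewrite Nat.mod_small by assumption. reflexivity.
    + cbn [sem]. apply Rel_setar; auto. apply Rel_tick; auto.
    + intros y Hy. rd. destruct S1 as [_ S1], S2 as [_ S2], S3 as [_ S3]. rewrite S3, S2, S1 by lia. reflexivity.
    + cbn [sem setar tk tick]. nia.
  - apply andb_prop in HW as [W1 W2]. apply Nat.ltb_lt in W1, W2.
    apply codeat_cons in HC as [C1 HC]. apply codeat_cons in HC as [C2 HC].
    pose proof (r_sc _ _ _ _ HR 1 ltac:(lia)) as E1.
    pose proof (r_inp _ _ _ _ HR) as EI. pose proof (r_st _ _ _ _ HR) as ES.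
    cbn [sem]. destruct (Nat.eqb_spec (sc s 1) 0) as [Z|Z].
    + exists 1, mm, st, rp. split; [|split; [|split]].
      * eapply steps_one; [exact C1|]. cbn [exec mem]. rewrite get_ok by lia. rewrite E1, Z. reflexivity.
      * apply Rel_tick; auto.
      * intros y Hy; reflexivity.
      * rewrite tk_tick. nia.
    + assert (HI : inp s < length Tl) by lia. set (a := nth (inp s) Tl 0).
      assert (Ha : a < M) by (apply nth_lt_M; auto). assert (Hst : st = a :: skipn (inp s + 1) Tl).
      { rewrite ES. unfold a. clear -HI. revert HI. generalize (inp s).
        induction Tl as [|y l IH]; intros [|j] Hj; simpl in *; try lia; auto. apply IH. lia. }
      set (m1 := upn x a mm). set (m3 := line [IConst T0 1; IOp OSub 1 1 T0] m1).
      assert (Hsc1 : sc s 1 < M) by (apply (r_scM _ _ _ _ HR); lia).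
      assert (E3 : m3 = upn 1 (sc s 1 - 1) (upn T0 1 m1)).
      { unfold m3. cbn [line eval_binop]. unfold m1. rd. rewrite E1, (Nat.mod_small 1) by lia. fold M.
        replace (sc s 1 + (M - 1)) with (sc s 1 - 1 + 1 * M) by lia.
        rewrite Nat.Div0.mod_add, Nat.mod_small by lia. reflexivity. }
      exists 4, m3, (skipn (inp s + 1) Tl), rp. split; [|split; [|split]].
      * erewrite (steps_trans 1 3).
        2:{ eapply steps_one; [exact C1|]. cbn [exec mem]. rewrite get_ok by lia.
            cbn [bind pc]. rewrite E1. destruct (Nat.eqb_spec (sc s 1) 0); [lia|]. reflexivity. }
        erewrite (steps_trans 1 2).
        2:{ eapply steps_one; [exact C2|]. cbn [exec stream reports mem pc]. rewrite Hst, assign_ok by lia. rewrite Nat.mod_small by assumption. reflexivity. }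
        etransitivity; [apply (line_ok _ _ m1 _ _ HC)|cbn [length]; do 2 f_equal; lia].
        unfold m1. rewrite upn_length. repeat constructor; lia.
      * assert (HR2 : Rel (setsc x a s) (upn T0 1 m1) st rp)
          by (apply Rel_upn_hidden; [lia|]; apply Rel_setsc; auto).
        rewrite E3. set (m2 := upn T0 1 m1) in *.
        destruct HR2 as [L ? ? ? ? ? ? ? ? ?]. constructor; cbn [setsc sc ar inp outp tick] in *; auto.
        -- rewrite upn_length; lia.
        -- intros y Hy. rewrite nth_upn by lia. destruct (Nat.eqb_spec y 1) as [->|]; auto.
        -- intros k i Hk Hi. rd. auto.
        -- intros y Hy. destruct (Nat.eqb_spec y 1); [|auto]. lia.
        -- cbn [Nat.eqb]. lia.
      * intros y Hy. rewrite E3. unfold m1. rd. reflexivity.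
      * cbn [setsc tk]. nia.
  - apply andb_prop in HW as [W1 W2]. apply codeat_app in HC as [C1 C2]. apply codeat_app in C2 as [C2 C3].
    apply codeat_cons in C3 as [C3 _].
    destruct (okE_ok a p T0 s mm st rp C1 W1 ltac:(lia) HR) as [(m1 & R1 & S1 & N1 & B1) LK].
    assert (HR1 : Rel s m1 st rp) by (eapply Rel_same; eauto).
    destruct (okE_ok b _ (T0 + 1) s m1 st rp C2 W2 ltac:(lia) HR1)
      as [(m2 & R2 & S2 & N2 & B2) LK2].
    assert (S2' : same_but T0 m1 m2) by (eapply same_but_mono; [|exact S2]; lia).
    assert (HR2 : Rel s m2 st rp) by (eapply Rel_same; eauto). pose proof (r_len _ _ _ _ HR2) as L2.
    exists (length (compE a T0) + (length (compE b (T0 + 1)) + 1)), m2, st,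
      ((eval M Q Sl s a, eval M Q Sl s b) :: rp).
    split; [|split; [|split]].
    + rewrite (steps_trans _ _ _ _ R1), (steps_trans _ _ _ _ R2). erewrite steps_one; [|exact C3|].
      2:{ cbn [exec mem]. rewrite (get_ok T0), (get_ok (T0 + 1)) by lia. reflexivity. }
      cbn [pc stream reports]. rewrite N2. destruct S2 as [_ S2]. rewrite S2 by lia.
      rewrite N1, !length_app. cbn [length]. do 2 f_equal. lia.
    + destruct HR2. constructor; cbn [sem sc ar inp outp]; auto. f_equal; auto.
    + apply hid_same; [lia|]. eapply same_but_trans; [|exact S1|exact S2']. lia.
    + cbn [sem tk]. nia.
  - apply andb_prop in HW as [HW W5]. apply andb_prop in HW as [HW W4].
    apply andb_prop in HW as [HW W3]. apply andb_prop in HW as [W1 W2]. apply Nat.leb_le in W2, W3.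
    set (kb := compB b T0) in *. set (p1 := p + length kb + 1) in *.
    set (k1 := comp c1 p1 d) in *. set (p2 := p1 + length k1 + 2) in *. set (k2 := comp c2 p2 d) in *.
    apply codeat_app in HC as [C1 C2]. apply codeat_cons in C2 as [C2 C3].
    apply codeat_app in C3 as [C3 C4]. apply codeat_cons in C4 as [C4 C5]. apply codeat_cons in C5 as [C5 C6].
    fold p1 in C3, C4, C5, C6. replace (p1 + length k1 + 1 + 1) with p2 in C6 by (unfold p2; lia).
    destruct (evB_ok v Hv b T0 p s mm st rp C1 HR W1 ltac:(lia) ltac:(lia))
      as (m1 & R1 & S1 & N1 & B1).
    assert (HR1 : Rel (tick s) m1 st rp) by (apply Rel_tick; eapply Rel_same; eauto).
    pose proof (r_len _ _ _ _ HR1) as L1. assert (J : steps P w Sl 1 (Config (p + length kb) m1 st rp) =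
      Some (Config (if evalb M Q Sl s b then p1 else p2) m1 st rp)).
    { eapply steps_one; [exact C2|]. cbn [exec mem]. rewrite get_ok by lia.
      rewrite N1. destruct (evalb M Q Sl s b); reflexivity. }
    cbn [sem]. destruct (evalb M Q Sl s b).
    + destruct (IH1 p1 d W4 Hd C3 _ _ _ _ HR1) as (t & m2 & st2 & rp2 & R2 & HR2 & H2 & T2).
      pose proof (r_len _ _ _ _ HR2) as L2. exists (length kb + (1 + (t + (1 + 1)))), (upn T0 0 m2), st2, rp2.
      split; [|split; [|split]].
      * rewrite (steps_trans _ _ _ _ R1), (steps_trans _ _ _ _ J), (steps_trans _ _ _ _ R2).
        assert (R3 : runs_to 1 (p1 + length k1) m2 st2 rp2 (upn T0 0 m2))
          by (apply run_const; [exact C4|lia|lia]).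
        rewrite (steps_trans _ _ _ _ R3).
        eapply steps_one; [exact C5|]. cbn [exec mem]. rewrite get_ok by (rewrite upn_length; lia).
        cbn [bind]. rewrite nth_upn by lia. rewrite Nat.eqb_refl.
        do 2 f_equal. cbn [length]; rewrite ?length_app; cbn [length]. lia.
      * apply Rel_upn_hidden; [lia|assumption].
      * intros y Hy. rd. rewrite (H2 y Hy). apply S1. lia.
      * rewrite tk_tick in T2. nia.
    + destruct (IH2 p2 d W5 Hd C6 _ _ _ _ HR1) as (t & m2 & st2 & rp2 & R2 & HR2 & H2 & T2).
      exists (length kb + (1 + t)), m2, st2, rp2. split; [|split; [|split]].
      * rewrite (steps_trans _ _ _ _ R1), (steps_trans _ _ _ _ J), R2.
        do 2 f_equal. cbn [length]; rewrite ?length_app; cbn [length]. fold k2. lia.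
      * assumption.
      * intros y Hy. rewrite (H2 y Hy). apply S1. lia.
      * rewrite tk_tick in T2. nia.
  - apply andb_prop in HW as [HW W3]. apply andb_prop in HW as [W1 W2]. apply Nat.ltb_lt in W1.
    set (ke := compE e T0) in *. set (h := VN + d) in *.
    set (l := p + length ke + 1) in *. set (kc := comp c (l + 1) (d + 1)) in *.
    apply codeat_app in HC as [C1 C2]. apply codeat_cons in C2 as [C2 C3].
    apply codeat_cons in C3 as [C3 C4]. apply codeat_app in C4 as [C4 C5].
    apply (codeat_app _ _ [IConst T0 1; IOp OSub h h T0; IConst T0 0]) in C5 as [C5 C8].
    apply codeat_cons in C8 as [C8 _].
    destruct (okE_ok e p T0 s mm st rp C1 W2 ltac:(lia) HR) as [(m1 & R1 & S1 & N1 & B1) LK].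
    assert (HR1 : Rel s m1 st rp) by (eapply Rel_same; eauto). pose proof (r_len _ _ _ _ HR1) as L1.
    set (body := fun s' => sem M Q Sl Tl c (tick s')).
    (* The counter cell runs down to 0 independently of [e], which is evaluated once. The additional
       step is the final test that leaves the loop. *)
    assert (LOOP : forall r s mm st rp, Rel s mm st rp -> nth h mm 0 = r -> r < M ->
      exists t mm' st' rp',
        steps P w Sl t (Config l mm st rp) = Some (Config (l + length kc + 5) mm' st' rp') /\
        Rel (iter r body s) mm' st' rp' /\ hid d mm mm' /\
        t + KC * tk s <= KC * tk (iter r body s) + 1).
    { clear - IH C3 C4 C5 C8 W1 W3 HV HVN HHN HT0 HNA Hbig HS HT HS0 HQ0 Hv.
      induction r as [|r IHr]; intros s mm st rp HR Hh HrM.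
      - exists 1, mm, st, rp. split; [|split; [|split]].
        + eapply steps_one; [exact C3|]. cbn [exec mem].
          rewrite get_ok by (rewrite (r_len _ _ _ _ HR); unfold h; lia). rewrite Hh. reflexivity.
        + assumption.
        + intros y Hy; reflexivity.
        + simpl. lia.
      - destruct (IH (l + 1) (d + 1) W3 ltac:(lia) C4 _ _ _ _ (Rel_tick _ _ _ _ HR))
          as (t & m2 & st2 & rp2 & R2 & HR2 & H2 & T2).
        pose proof (r_len _ _ _ _ HR) as L. pose proof (r_len _ _ _ _ HR2) as L2.
        assert (Hh2 : nth h m2 0 = S r) by (rewrite H2 by (unfold h; lia); exact Hh).
        set (m5 := line [IConst T0 1; IOp OSub h h T0; IConst T0 0] m2).
        assert (E5 : m5 = upn T0 0 (upn h r (upn T0 1 m2))).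
        { unfold m5. cbn [line eval_binop]. f_equal; [apply Nat.mod_small; lia|].
          rd. rewrite Hh2, (Nat.mod_small 1) by lia. fold M. replace (S r + (M - 1)) with (r + 1 * M) by lia.
          rewrite Nat.Div0.mod_add, Nat.mod_small by lia. reflexivity. }
        assert (HR5 : Rel (body s) m5 st2 rp2). { repeat apply Rel_upn_hidden; try (unfold h; lia). exact HR2. }
        assert (L5 : length m5 = length m2) by apply line_length.
        destruct (IHr (body s) m5 st2 rp2 HR5) as (t' & m6 & st6 & rp6 & R6 & HR6 & H6 & T6).
        { rewrite E5. rd. reflexivity. }
        { lia. }
        exists (1 + (t + (3 + (1 + t')))), m6, st6, rp6. split; [|split; [|split]].
        + erewrite steps_trans.
          2:{ eapply steps_one; [exact C3|]. cbn [exec mem].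
              rewrite get_ok by (unfold h; lia). rewrite Hh. reflexivity. }
          rewrite (steps_trans _ _ _ _ R2). erewrite (steps_trans 3).
          2:{ apply (line_ok _ _ m2 _ _ C5). repeat constructor; lia. } fold m5. erewrite steps_trans; [exact R6|].
          eapply steps_one; [exact C8|]. cbn [exec mem]. rewrite get_ok by lia. rewrite E5. rd. reflexivity.
        + rewrite iter_S. exact HR6.
        + intros y Hy. rewrite (H6 y Hy), E5. rd. apply H2. lia.
        + rewrite iter_S. rewrite tk_tick in T2. fold (body s) in T2. nia. }
    set (m2 := upn h (eval M Q Sl s e) m1). assert (HR2 : Rel (tick s) m2 st rp).
    { apply Rel_upn_hidden; [unfold h; lia|]. apply Rel_tick; auto. }
    destruct (LOOP (eval M Q Sl s e) (tick s) m2 st rp HR2) as (t & m3 & st3 & rp3 & R3 & HR3 & H3 & T3).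
    { unfold m2. rewrite nth_upn by (unfold h; lia). rewrite Nat.eqb_refl. reflexivity. }
    { lia. }
    exists (length ke + (1 + t)), m3, st3, rp3. split; [|split; [|split]].
    + rewrite (steps_trans _ _ _ _ R1). assert (X : runs_to 1 (p + length ke) m1 st rp m2).
      { unfold m2. rewrite <- N1. apply run_copy; [exact C2|unfold h; lia|lia|lia]. }
      rewrite (steps_trans _ _ _ _ X). fold l. rewrite R3.
      do 2 f_equal. cbn [length]; rewrite ?length_app; cbn [length]. lia.
    + exact HR3.
    + intros y Hy. rewrite (H3 y Hy). unfold m2. rewrite nth_upn by (unfold h; lia).
      destruct (Nat.eqb_spec y h); [unfold h in *; lia|]. apply S1. lia.
    + cbn [sem]. rewrite tk_tick in T3. fold body. fold ke in LK. nia.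
  - apply andb_prop in HW as [W1 W2]. set (k1 := comp c1 p d) in *. apply codeat_app in HC as [C1 C2].
    destruct (IH1 p d W1 Hd C1 _ _ _ _ HR) as (t1 & m1 & st1 & rp1 & R1 & HR1 & H1 & T1).
    destruct (IH2 _ d W2 Hd C2 _ _ _ _ HR1) as (t2 & m2 & st2 & rp2 & R2 & HR2 & H2 & T2).
    exists (t1 + t2), m2, st2, rp2. split; [|split; [|split]].
    + rewrite (steps_trans _ _ _ _ R1). fold k1. rewrite R2, length_app. do 2 f_equal. lia.
    + exact HR2.
    + intros y Hy. rewrite (H2 y Hy). apply H1. assumption.
    + cbn [sem]. lia.
Qed.

End Simulation.

(** * Correctness and complexity *)

Lemma fragment_nth T i j x : 1 <= i -> i <= j -> x < j - i + 1 -> nth x (fragment T i j) 0 = nth (i - 1 + x) T 0.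
Proof.
  intros H1 H2 Hx. unfold fragment. rewrite nth_firstn. destruct (Nat.ltb_spec x (j - i + 1)); [|lia].
  apply nth_skipn.
Qed.

Lemma fragment_length T i j : 1 <= i -> i <= j -> j <= length T -> length (fragment T i j) = j - i + 1.
Proof. unfold fragment. rewrite length_firstn, length_skipn. lia. Qed.

(** Fragments ending at [j] are suffixes of one another, and a suffix of an occurring word occurs;
    so those that occur are exactly the ones no longer than the longest. *)
Lemma occurs_iff Sl T i j : 1 <= i -> i <= j -> j <= length T ->
  (occurs (fragment T i j) Sl <-> j - i + 1 <= msf (fun x => nth x Sl 0) (fun x => nth x T 0) (length Sl) j).
Proof.
  intros H1 H2 H3. set (l := j - i + 1). assert (FL := fragment_length T i j H1 H2 H3). split.
  - intros (x & y & E). set (q := length x + l).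
    assert (HL : length Sl = length x + l + length y) by (rewrite E, !length_app, FL; lia).
    etransitivity; [|apply (msf_ge _ _ (length Sl) j q); unfold q; lia].
    apply lcs_spec. split; [unfold q; lia|]. split; [unfold l; lia|]. intros z Hz.
    rewrite E at 1. rewrite app_nth2 by (unfold q; lia). rewrite app_nth1 by (unfold q; lia).
    rewrite fragment_nth by (unfold l in *; lia). f_equal. lia.
  - intros H. destruct (msf_ex (fun x => nth x Sl 0) (fun x => nth x T 0) (length Sl) j) as (q & Hq & E).
    rewrite E in H. apply lcs_spec in H as (A & B & D). exists (firstn (q - l) Sl), (skipn q Sl).
    assert (F : fragment T i j = firstn l (skipn (q - l) Sl)).
    { apply (nth_ext _ _ 0 0).
      - rewrite FL, length_firstn, length_skipn. lia.
      - intros z Hz. rewrite fragment_nth by (unfold l in *; lia). rewrite nth_firstn.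
        destruct (Nat.ltb_spec z l); [|lia]. rewrite nth_skipn.
        specialize (D (l - 1 - z) ltac:(lia)). replace (q - 1 - (l - 1 - z)) with (q - l + z) in D by lia.
        rewrite D. f_equal. lia. }
    rewrite F. replace (skipn q Sl) with (skipn l (skipn (q - l) Sl)) by (rewrite skipn_skipn; f_equal; lia).
    rewrite firstn_skipn. symmetry. apply firstn_skipn.
Qed.

(** * The reported pairs are the maximal common substrings *)

Section Output.
Variables (Sl Tl : list nat).
Notation ms := (msf (fun i => nth i Sl 0) (fun i => nth i Tl 0) (length Sl)).
Notation os := (outs (fun i => nth i Sl 0) (fun i => nth i Tl 0) (length Sl)).
Definition report : list (nat * nat) :=
  let n := length Tl in if 0 <? ms n then (n - ms n + 1, n) :: os n else os n.

Lemma outs_in k a b : In (a, b) (os k) <-> b < k /\ 0 < ms b /\ ms (b + 1) <= ms b /\ a = b - ms b + 1.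
Proof.
  induction k as [|k IH]; cbn [outs]; [split; [intros []|lia]|].
  destruct ((0 <? ms k) && negb (ms k <? ms (k + 1))) eqn:C.
  - apply andb_true_iff in C as [C1 C2]. apply Nat.ltb_lt in C1. apply negb_true_iff, Nat.ltb_ge in C2.
    cbn [In]. rewrite IH. split.
    + intros [E|H]; [injection E as <- <-; repeat split; auto; lia|]. destruct H as (H & ?). split; [lia|assumption].
    + intros (H1 & H2 & H3 & ->). destruct (Nat.eq_dec b k) as [->|]; [left; reflexivity|right]. split; [lia|auto].
  - rewrite IH. split; [intros (H & ?); split; [lia|assumption]|]. intros (H1 & H2 & H3 & ->).
    destruct (Nat.eq_dec b k) as [->|]; [exfalso|split; [lia|auto]].
    apply andb_false_iff in C as [C|C]; [apply Nat.ltb_ge in C; lia|]. apply negb_false_iff, Nat.ltb_lt in C. lia.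
Qed.

Lemma outs_nodup k : NoDup (os k).
Proof.
  induction k as [|k IH]; cbn [outs]; [constructor|]. destruct (_ && _); [|assumption].
  constructor; [|assumption]. rewrite outs_in. lia.
Qed.

Lemma report_nodup : NoDup report.
Proof.
  unfold report. pose proof (outs_nodup (length Tl)). destruct (0 <? _); [|assumption].
  constructor; [|assumption]. rewrite outs_in. lia.
Qed.

Lemma report_spec i j : In (i, j) report <-> maximal_common_substring Sl Tl i j.
Proof.
  set (n := length Tl).
  assert (A : In (i, j) report <-> j <= n /\ 0 < ms j /\ (j < n -> ms (j + 1) <= ms j) /\ i = j - ms j + 1).
  { unfold report. fold n. destruct (Nat.ltb_spec 0 (ms n)) as [C|C].
    - cbn [In]. rewrite outs_in. split.
      + intros [E|(H1 & H2 & H3 & H4)]; [injection E as <- <-|]; repeat split; auto; lia.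
      + intros (H1 & H2 & H3 & ->). destruct (Nat.eq_dec j n) as [->|]; [left; reflexivity|right].
        split; [lia|]. split; [assumption|]. split; [apply H3; lia|reflexivity].
    - rewrite outs_in. split.
      + lia.
      + intros (H1 & H2 & H3 & ->). destruct (Nat.eq_dec j n) as [->|]; [lia|].
        split; [lia|]. split; [assumption|]. split; [apply H3; lia|reflexivity]. }
  rewrite A. pose proof (msf_le (fun i => nth i Sl 0) (fun i => nth i Tl 0) (length Sl) j) as ML. split.
  - intros (H1 & H2 & H3 & E). do 2 (split; [lia|]). split; [assumption|]. split; [apply occurs_iff; lia|]. split.
    + intros Hi O. apply occurs_iff in O; lia.
    + intros Hj O. apply occurs_iff in O; lia.
  (* Maximality to the left forces the length [ms j]: a shorter fragment could be extended by one
     letter. *)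
  - intros (H1 & H2 & H3 & O & H4 & H5). apply occurs_iff in O; try lia. assert (E : j - i + 1 = ms j).
    { destruct (Nat.eq_dec (j - i + 1) (ms j)) as [|Ne]; [assumption|exfalso].
      apply H4; [lia|]. apply occurs_iff; lia. }
    split; [assumption|]. split; [lia|]. split; [|lia].
    intros Hj. specialize (H5 Hj). apply Nat.nlt_ge. intros C. apply H5. apply occurs_iff; lia.
Qed.
End Output.

(** * The complete program and its running time *)

Lemma wf_main : wfC 100 200 MAIN 0 = true.
Proof. reflexivity. Qed.

Lemma wf_mono v v' kx c : v <= v' -> forall d, wfC v kx c d = true -> wfC v' kx c d = true.
Proof.
  intros Hv. assert (HE : forall e, wfE v e = true -> wfE v' e = true).
  { induction e as [x|a|o a IHa b IHb|k e IHe|e IHe]; cbn [wfE]; auto.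
    - rewrite !Nat.leb_le. lia.
    - rewrite !andb_true_iff. tauto.
    - rewrite !andb_true_iff. tauto. }
  assert (HB : forall b, wfB v b = true -> wfB v' b = true).
  { induction b as [x y|x y|a IHa b IHb|b IHb]; cbn [wfB]; rewrite ?andb_true_iff; intuition auto. }
  assert (HO : forall e, okE v kx e = true -> okE v' kx e = true).
  { intros e. unfold okE. rewrite !andb_true_iff. intuition auto. }
  induction c; intros d; cbn [wfC]; rewrite ?andb_true_iff; intuition auto.
Qed.

Lemma wf_prog k v : 100 + 4 * capexp k + tries k <= v -> wfC v 200 (PRE k ;; MAIN)%c 0 = true.
Proof.
  intros Hv. apply andb_true_iff. split; [|apply (wf_mono 100); [lia|exact wf_main]].
  unfold PRE, SEARCH, TDIG, CHECK, PROBE, For, incr.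
  (* The constants that depend on [k] stay symbolic; their comparisons with [v] are settled by [lia]
     and the rest by computation. *)
  cbn [wfC]. unfold okE. cbn [wfE wfB]. repeat match goal with |- context [?x <=? v] =>
    replace (x <=? v) with true by (symmetry; apply Nat.leb_le; lia) end.
  reflexivity.
Qed.

(* Cell 4 receives the array size [100 * g], where [g] is the last argument. *)
Definition compile (c : cmd) : program :=
  ([IConst T0 100; IOp OMul 4 T0 3] ++ comp c 2 0 ++ [IHalt])%list.

Lemma compile_ok c v w m n sg g (Sl Tl : list nat) :
  let M := 2 ^ w in let Q := 100 * g in
  length Sl = m -> length Tl = n -> 0 < m -> n < M -> 1 <= g -> sg < M -> m < M -> v < M ->
  V0 + NA * Q < M -> Forall (fun a => a < M) Sl -> Forall (fun a => a < M) Tl ->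
  wfC v 200 c 0 = true ->
  exists s0 time,
    sc s0 0 = m /\ sc s0 1 = n /\ sc s0 2 = sg /\ sc s0 3 = g /\
    (forall x, 4 < x -> x < VN -> sc s0 x = 0) /\ inp s0 = 0 /\ outp s0 = [] /\ tk s0 = 0 /\
    runs (compile c) w Sl Tl [m; n; sg; g] (V0 + NA * Q) time (rev (outp (sem M Q Sl Tl c s0))) /\
    time <= 2 + 420 * tk (sem M Q Sl Tl c s0).
Proof.
  intros M Q Hm Hn Hm0 HnM Hg HsM HmM Hv HQM HS HT HW.
  remember (V0 + NA * Q) as sp eqn:Hsp. assert (HV : V0 = 110) by reflexivity.
  assert (HNA : NA = 32) by reflexivity. assert (HT0 : T0 = 90) by reflexivity. assert (HVN : VN = 80) by reflexivity.
  set (mm0 := map (fun v => v mod 2 ^ w) [m; n; sg; g] ++ repeat 0 (sp - 4)).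
  assert (E0 : mm0 = [m; n; sg; g] ++ repeat 0 (sp - 4)).
  { unfold mm0. cbn [map]. rewrite !Nat.mod_small by lia. reflexivity. }
  assert (L0 : length mm0 = sp) by (rewrite E0, length_app, repeat_length; cbn [length]; lia).
  set (mm2 := upn 4 Q (upn T0 100 mm0)).
  assert (L2 : length mm2 = sp) by (unfold mm2; rewrite !upn_length; exact L0).
  assert (N2 : forall x, nth x mm2 0 = if x =? 4 then Q else if x =? T0 then 100 else nth x mm0 0).
  { intros x. unfold mm2. rewrite !nth_upn by (rewrite ?upn_length; lia). reflexivity. }
  assert (NZ : forall x, 4 <= x -> nth x mm0 0 = 0).
  { intros x Hx. rewrite E0, app_nth2 by exact Hx. apply nth_repeat. }
  assert (N03 : nth 0 mm0 0 = m /\ nth 1 mm0 0 = n /\ nth 2 mm0 0 = sg /\ nth 3 mm0 0 = g) by (rewrite E0; cbn; auto).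
  destruct N03 as (N00 & N01 & N02 & N03). assert (HBIG : V0 + NA * Q < 2 ^ w) by (rewrite <- Hsp; exact HQM).
  assert (HQ0 : 0 < Q) by (unfold Q; lia).
  assert (STEP : steps (compile c) w Sl 2 (init w sp [m; n; sg; g] Tl) = Some (Config 2 mm2 Tl [])).
  { pose proof (assign_ok w Q Sl HBIG ltac:(lia) HQ0) as ASG.
    unfold init. replace (sp - length [m; n; sg; g]) with (sp - 4) by reflexivity. fold mm0. unfold compile.
    cbn [steps]. unfold step at 1. cbn [pc app nth_error bind exec].
    rewrite ASG by lia. unfold step at 1. cbn [pc app Nat.add nth_error bind exec mem].
    rewrite !(get_ok) by (rewrite upn_length; lia). cbn [bind eval_binop stream reports].
    pose proof (get_ok 3 (upn T0 (100 mod 2 ^ w) mm0) ltac:(rewrite upn_length; lia)) as G3. cbn [nth_error] in G3.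
    rewrite G3. cbn [bind]. rewrite ASG by (rewrite upn_length; lia). fold M.
    rewrite !nth_upn by lia. rewrite N03, HT0. cbn [Nat.eqb].
    rewrite (Nat.mod_small 100 M) by lia. rewrite Nat.mod_small by (fold Q; lia). reflexivity. }
  set (s0 := St (fun x => nth x mm2 0) (fun k i => nth (V0 + i * NA + k) mm2 0) 0 [] 0).
  assert (S4 : forall x, 4 < x -> x < VN -> sc s0 x = 0).
  { intros x H1 H2. unfold s0. cbn [sc]. rewrite N2.
    destruct (Nat.eqb_spec x 4); [lia|]. destruct (Nat.eqb_spec x T0); [lia|]. apply NZ. lia. }
  assert (S03 : sc s0 0 = m /\ sc s0 1 = n /\ sc s0 2 = sg /\ sc s0 3 = g /\ sc s0 4 = Q).
  { unfold s0. cbn [sc]. auto. }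
  destruct S03 as (S0 & S1 & S2 & S3 & S4'). assert (R0 : Rel w Q Sl Tl s0 mm2 Tl []).
  { constructor.
    - lia. - auto. - auto.
    - intros x Hx. destruct (Nat.lt_ge_cases 4 x) as [C|C]; [rewrite S4 by assumption; lia|].
      destruct x as [|[|[|[|[|x]]]]]; lia.
    - intros a i Ha Hi. unfold s0. cbn [ar]. rewrite N2.
      destruct (Nat.eqb_spec (V0 + i * NA + a) 4); [lia|]. destruct (Nat.eqb_spec (V0 + i * NA + a) T0); [lia|].
      rewrite NZ by lia. lia.
    - auto. - rewrite S1, Hn. apply Nat.add_0_r. - auto. - lia. - exact S4'. }
  assert (CA : codeat (compile c) 2 (comp c 2 0)).
  { unfold compile. generalize (comp c 2 0). intros code i Hi. cbn [app Nat.add nth_error]. apply nth_error_app1. exact Hi. }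
  destruct (comp_ok (compile c) w Q Sl Tl HBIG HS HT ltac:(lia) HQ0 v 200 Hv c 2 0 HW ltac:(apply Nat.le_0_l) CA s0 mm2 Tl [] R0)
    as (tm & mm3 & st3 & rp3 & T1 & T2 & T3 & T4).
  fold M in T2, T4. exists s0, (2 + tm).
  split; [exact S0|]. split; [exact S1|]. split; [exact S2|]. split; [exact S3|]. split; [exact S4|].
  do 3 (split; [reflexivity|]). split.
  - split; [cbn [length]; lia|]. exists (Config (2 + length (comp c 2 0)) mm3 st3 rp3). split; [|split].
    + rewrite (steps_trans _ _ _ _ _ _ _ STEP). exact T1.
    + cbn [pc]. unfold compile. generalize (comp c 2 0). intros code. cbn [app Nat.add nth_error].
      rewrite nth_error_app2 by apply le_n. rewrite Nat.sub_diag. reflexivity.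
    + rewrite (r_rp _ _ _ _ _ _ _ _ T2). reflexivity.
  - lia.
Qed.

Definition prog (k : nat) : program := compile (PRE k ;; MAIN)%c.

Theorem runs_ok k w m n sg g (Sl Tl : list nat) :
  let M := 2 ^ w in let Q := 100 * g in
  length Sl = m -> length Tl = n -> 0 < m <= n -> 1 <= g -> m <= 4 * g * g ->
  Forall (fun a => a < sg) Sl -> Forall (fun a => a < sg) Tl -> sg <= (2 * n) ^ k ->
  (2 * n) ^ k < M -> V0 + NA * Q < M -> 20 * Q + 100 < M -> 2 * n + 100 < M ->
  m ^ capexp k + capexp k * 4 + 100 < M -> (tries k * n + 10) * (g + 10) < M -> 100 + 4 * capexp k + tries k < M ->
  exists t time : nat,
    runs (prog k) w Sl Tl [m; n; sg; g] (V0 + NA * Q) time (rev (report Sl Tl)) /\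
    (t <= 4 * capexp k \/ m ^ capexp k < sg /\ t <= 12 + Nat.log2 (Nat.log2 sg + 1)) /\
    time <= 420 * (200 * (tries k * n) + 4 * capexp k + 47 + (TB Q m g t + 1) * (n / g + 1)).
Proof.
  intros M Q Hm Hn Hmn Hg Hmg HS HT Hsg B1 B2 B3 B4 B5 B6 B7. assert (HSsg : forall i, i < m -> nth i Sl 0 < sg).
  { intros i Hi. rewrite Forall_forall in HS. apply HS. apply nth_In. lia. }
  assert (HTsg : forall i, i < n -> nth i Tl 0 < sg).
  { intros i Hi. rewrite Forall_forall in HT. apply HT. apply nth_In. lia. }
  assert (HSM : Forall (fun a => a < M) Sl) by (eapply Forall_impl; [|exact HS]; cbn; intros; lia).
  assert (HTM : Forall (fun a => a < M) Tl) by (eapply Forall_impl; [|exact HT]; cbn; intros; lia).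
  assert (HSMALL : forall z, g * z <= 4 * m -> z <= 16 * g).
  { clear - Hg Hmg. nia. }
  destruct (compile_ok (PRE k ;; MAIN)%c (100 + 4 * capexp k + tries k) w m n sg g Sl Tl Hm Hn ltac:(lia) ltac:(fold M; lia) Hg
    ltac:(fold M; lia) ltac:(fold M; lia) B7 B2 HSM HTM (wf_prog k _ (le_n _)))
    as (s0 & tm & S0 & S1 & S2 & S3 & S4 & I00 & O00 & T00 & RU & RT).
  fold M Q in RU, RT. rewrite sem_seq in RU, RT.
  destruct (pre_ok M Q Sl Tl B3 m g eq_refl Hg Hm ltac:(lia) ltac:(lia) n sg k ltac:(lia) Hmg B5 B6 HSsg Hsg s0 S0 S1 S2 S3)
    as (P1 & pm & t & P2 & P3 & P4 & P5 & P6).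
  pose proof (agree_sem M Q Sl Tl (PRE k) s0) as F. set (s1 := sem M Q Sl Tl (PRE k) s0) in *.
  assert (Z : forall x, wS x (PRE k) = false -> 4 < x -> x < VN -> sc s1 x = 0).
  { intros x H1 H2 H3. rewrite (proj1 F x H1). apply S4; assumption. }
  assert (HVN : VN = 80) by reflexivity.
  assert (O0 : outp s1 = []) by (rewrite (proj2 (proj2 (proj2 F)) eq_refl); exact O00).
  assert (I0 : inp s1 = 0) by (rewrite (proj1 (proj2 (proj2 F)) eq_refl); exact I00).
  assert (V1 : sc s1 vrem = n) by (rewrite (proj1 F vrem eq_refl); exact S1).
  assert (Z0 : sc s1 vB = 0 /\ sc s1 vms = 0 /\ sc s1 vhl = 0 /\ sc s1 vnE = 0 /\ sc s1 vnG = 0 /\ sc s1 vrun = 0)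
    by (repeat split; apply Z; try reflexivity; lia).
  destruct Z0 as (Z1 & Z2 & Z3 & Z4 & Z5 & Z6).
  pose proof (msf_le (fun i => nth i Sl 0) (fun i => nth i Tl 0) m 0) as M0.
  assert (BI0 : BI Sl Tl m g n sg pm t 0 s1). { constructor; auto. lia. } assert (BJ0 : BJ Sl Tl m g n 0 s1).
  { constructor.
    - exact I0. - lia. - auto. - lia.
    - constructor.
      + lia.
      + lia.
      + left. split; [exact Z6|]. split; [exact Z5|]. split.
        * intros q Hq HL. pose proof (lcs_le (fun i => nth i Sl 0) (fun i => nth i Tl 0) q 0). lia.
        * intros p (Hp & [HgB _] & _). lia. }
  destruct (main_ok M Q Sl Tl B3 m g eq_refl Hg Hm ltac:(lia) ltac:(lia) HSMALL n sg pm t Hn B4 HSsg HTsg P4 P3 s1 BI0 BJ0)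
    as [U1 U2].
  exists t, tm. split; [|split; [exact P5|]].
  - unfold report. rewrite Hm, Hn, <- U1. exact RU.
  - lia.
Qed.

Definition unit_cost : nat := 43 * 1000.

(** There are at most [m / (2 * g) + 1] chunks per block, each taking O(g) time for each of the [t]
    digit passes and for the suffix array; the work on long matches adds O(m). *)
Lemma TB_bound m g t : 1 <= g -> TB (100 * g) m g t + 1 <= unit_cost * (t + 1) * (m + g).
Proof.
  intros Hg. unfold TB. set (z := m / (2 * g) + 1).
  assert (D1 : g * z <= m + g) by (pose proof (Nat.Div0.mul_div_le m (2 * g)); unfold z; nia).
  assert (E1 : (500 * g + 500) * t + 400 * (100 * g) + 100 <= 41 * 1000 * ((t + 1) * g)) by nia.
  apply (Nat.mul_le_mono_r _ _ z) in E1. apply (Nat.mul_le_mono_l _ _ (t + 1)) in D1. unfold unit_cost. lia.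
Qed.

(** Both sides carry a factor [g], which avoids truncated quotients. The hypothesis [g <= N * m]
    absorbs the O(n) preprocessing into O(n m / g) and the blocks' [m + g] into O(m). *)
Lemma time_bound N k m n g t time : 1 <= g -> 0 < m <= n -> g <= N * m ->
  time <= 420 * (200 * (tries k * n) + 4 * capexp k + 47 + (TB (100 * g) m g t + 1) * (n / g + 1)) ->
  g * time <= 420 * ((200 * tries k + 4 * capexp k + 47) * N + unit_cost * (1 + N) * (1 + N)) * (t + 1) * (n * m).
Proof.
  intros Hg Hmn HN Ht. assert (D2 : g * (n / g + 1) <= (1 + N) * n). { pose proof (Nat.Div0.mul_div_le n g). nia. }
  pose proof (TB_bound m g t Hg) as D3.
  assert (D4 : unit_cost * (t + 1) * (m + g) <= unit_cost * (t + 1) * ((1 + N) * m)) by (apply Nat.mul_le_mono_l; lia).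
  generalize dependent unit_cost. intros D D3 D4. generalize dependent (TB (100 * g) m g t + 1). intros tb Ht D3.
  assert (E1 : g * (tb * (n / g + 1)) <= D * (t + 1) * ((1 + N) * m) * ((1 + N) * n)).
  { replace (g * (tb * (n / g + 1))) with (tb * (g * (n / g + 1))) by ring. apply Nat.mul_le_mono; lia. }
  assert (E2 : g * (200 * (tries k * n) + 4 * capexp k + 47) <= (200 * tries k + 4 * capexp k + 47) * N * (n * m)).
  { replace ((200 * tries k + 4 * capexp k + 47) * N * (n * m)) with (N * m * ((200 * tries k + 4 * capexp k + 47) * n)) by ring.
    apply Nat.mul_le_mono; [exact HN|]. nia. }
  apply (Nat.mul_le_mono_l _ _ g) in Ht. set (a := (200 * tries k + 4 * capexp k + 47) * N) in *.
  set (b := g * (200 * (tries k * n) + 4 * capexp k + 47)) in *.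
  replace (g * (420 * (200 * (tries k * n) + 4 * capexp k + 47 + tb * (n / g + 1))))
    with (420 * (b + g * (tb * (n / g + 1)))) in Ht by (unfold b; ring).
  generalize 420 Ht. intros q Hq. replace (q * (a + D * (1 + N) * (1 + N)) * (t + 1) * (n * m))
    with (q * (a * (t + 1) * (n * m) + D * (t + 1) * ((1 + N) * m) * ((1 + N) * n))) by ring.
  etransitivity; [exact Hq|]. apply Nat.mul_le_mono_l. lia.
Qed.

(** The polynomial [wordA N k * n ^ wordE k] dominates every word size requirement of [runs_ok]. *)
Definition wordA (N k : nat) : nat :=
  4000 * (N + 1) + 4 * capexp k + tries k + (tries k + 10) * (N + 10) + 2 ^ k + 1000.
Definition wordE (k : nat) : nat := capexp k + 2 + k.

Lemma word_ok N k m n g M : 0 < m <= n -> g <= N * m -> wordA N k * n ^ wordE k < M ->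
  (2 * n) ^ k < M /\ V0 + NA * (100 * g) < M /\ 20 * (100 * g) + 100 < M /\ 2 * n + 100 < M /\
  m ^ capexp k + capexp k * 4 + 100 < M /\ (tries k * n + 10) * (g + 10) < M /\ 100 + 4 * capexp k + tries k < M.
Proof.
  intros Hmn HN HM. set (X := n ^ wordE k) in *.
  assert (P : forall e, e <= wordE k -> n ^ e <= X) by (intros e He; apply Nat.pow_le_mono_r; lia).
  assert (X1 : 1 <= X) by (specialize (P 0 ltac:(lia)); exact P).
  assert (X2 : n * n <= X) by (specialize (P 2 ltac:(unfold wordE; lia)); rewrite Nat.pow_2_r in P; exact P).
  assert (X3 : m ^ capexp k <= X).
  { transitivity (n ^ capexp k); [apply Nat.pow_le_mono_l; lia|apply P; unfold wordE; lia]. }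
  assert (X4 : (2 * n) ^ k <= 2 ^ k * X).
  { rewrite Nat.pow_mul_l. apply Nat.mul_le_mono_l. apply P. unfold wordE. lia. }
  assert (Xn : n <= X) by nia. clearbody X. assert (X5 : g <= N * X) by nia.
  assert (X6 : (tries k * n + 10) * (g + 10) <= (tries k + 10) * (N + 10) * X).
  { transitivity ((tries k + 10) * n * ((N + 10) * n)); [apply Nat.mul_le_mono; nia|].
    replace ((tries k + 10) * n * ((N + 10) * n)) with ((tries k + 10) * (N + 10) * (n * n)) by ring.
    apply Nat.mul_le_mono_l. exact X2. }
  assert (E : wordA N k * X = 4000 * (N * X) + 4000 * X + 1000 * X + 4 * (capexp k * X) + tries k * X + (tries k + 10) * (N + 10) * X + 2 ^ k * X)
    by (unfold wordA; lia).
  rewrite E in HM. assert (X7 : capexp k <= capexp k * X) by (clear - X1; nia). assert (X8 : tries k <= tries k * X) by (clear - X1; nia).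
  change V0 with 110. change NA with 32.
  set (u := (tries k + 10) * (N + 10) * X) in *. set (v := (tries k * n + 10) * (g + 10)) in *. clearbody u v.
  repeat split; lia.
Qed.

(** * Logarithms and the asymptotic statement *)

Open Scope R_scope.

Lemma ln2_pos : 0 < ln 2.
Proof. rewrite <- ln_1. apply ln_increasing; lra. Qed.

Lemma lg_le x y : 0 < x -> x <= y -> lg x <= lg y.
Proof.
  intros Hx [H| ->]; [|lra]. unfold lg. pose proof ln2_pos. apply Rmult_le_compat_r.
  - left. apply Rinv_0_lt_compat. assumption.
  - left. apply ln_increasing; assumption.
Qed.

Lemma lg_pow k : lg (2 ^ k) = INR k.
Proof. unfold lg. pose proof ln2_pos. rewrite ln_pow by lra. field. lra. Qed.

Lemma lg1_ge x : 1 <= lg1 x /\ lg x <= lg1 x.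
Proof. unfold lg1. split; [apply Rmax_l|apply Rmax_r]. Qed.

Lemma log2_lg x : (1 <= x)%nat -> INR (Nat.log2 x) <= lg (INR x).
Proof.
  intros Hx. rewrite <- lg_pow. apply lg_le; [apply pow_lt; lra|].
  replace 2 with (INR 2) by (simpl; lra). rewrite <- pow_INR. apply le_INR. apply Nat.log2_spec. lia.
Qed.

Lemma word_size a e n w : (1 <= n)%nat -> INR (a + e) * lg1 (INR n) <= INR w -> (2 ^ a * n ^ e <= 2 ^ w)%nat.
Proof.
  intros Hn H. apply INR_le. rewrite mult_INR, !pow_INR. replace (INR 2) with 2 by (simpl; lra).
  assert (Hn' : 0 < INR n) by (apply lt_0_INR; lia). pose proof ln2_pos as L2.
  rewrite <- !(Rpower_pow _ 2) by lra. rewrite <- (Rpower_pow e (INR n)) by assumption.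
  replace (Rpower (INR n) (INR e)) with (Rpower 2 (INR e * lg (INR n))).
  2:{ unfold Rpower, lg. f_equal. field. lra. } rewrite <- Rpower_plus. apply Rle_Rpower; [lra|].
  destruct (lg1_ge (INR n)) as [A B]. rewrite plus_INR in H. pose proof (pos_INR a). pose proof (pos_INR e). nra.
Qed.

(** For [m > 4] all logarithmic factors are at least 1, so [tau] is at least the square root of [m].
    For [m <= 4], where the iterated logarithm may be negative, [1 <= tau] suffices; this is where
    the factor 4 comes from. *)
Lemma tau_lower m tau : (1 <= tau)%nat ->
  sqrt (INR m) * lg (INR m) * lg (lg (INR m)) ^ 3 <= INR tau -> (m <= 4 * tau * tau)%nat.
Proof.
  intros Ht H. destruct (Nat.le_gt_cases m 4) as [C|C]; [nia|]. assert (L1 : 2 <= lg (INR m)).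
  { replace 2 with (lg (2 ^ 2)) by (rewrite lg_pow; simpl; lra). apply lg_le; [lra|].
    replace (2 ^ 2) with (INR 4) by (simpl; lra). apply le_INR. lia. }
  assert (L2 : 1 <= lg (lg (INR m))).
  { replace 1 with (lg (2 ^ 1)) by (rewrite lg_pow; simpl; lra). apply lg_le; lra. }
  pose proof (sqrt_pos (INR m)) as SP. pose proof (sqrt_sqrt (INR m) (pos_INR m)) as SS.
  assert (L3 : 1 <= lg (lg (INR m)) ^ 3) by (apply pow_R1_Rle; assumption). assert (X : sqrt (INR m) <= INR tau).
  { assert (sqrt (INR m) * 1 * 1 <= sqrt (INR m) * lg (INR m) * lg (lg (INR m)) ^ 3).
    { apply Rmult_le_compat; [nra|lra| |assumption]. apply Rmult_le_compat_l; lra. } lra. }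
  assert (Y : INR m <= INR (tau * tau)). { rewrite mult_INR, <- SS. apply Rmult_le_compat; assumption. }
  apply INR_le in Y. nia.
Qed.

(** In the second case [t + 1] is at most 13 plus the logarithm of [l + 1 <= 2 * l], that is 14 plus
    an iterated logarithm, and [lg1] is at least 1. *)
Lemma digits_bound a sg t : (t <= a \/ (2 <= sg)%nat /\ (t <= 12 + Nat.log2 (Nat.log2 sg + 1))%nat)%nat ->
  INR (t + 1) <= INR (a + 15) * lg1 (lg1 (INR sg)).
Proof.
  destruct (lg1_ge (lg1 (INR sg))) as [A B]. pose proof (pos_INR a) as Pa. intros [H|[H1 H2]].
  - apply Rle_trans with (INR (a + 15) * 1); [rewrite Rmult_1_r; apply le_INR; lia|].
    apply Rmult_le_compat_l; [apply pos_INR|exact A].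
  - assert (G : INR (Nat.log2 sg) <= lg1 (INR sg)). { etransitivity; [apply log2_lg; lia|apply lg1_ge]. }
    set (l := Nat.log2 sg) in *.
    assert (Hl : (1 <= l)%nat) by (change 1%nat with (Nat.log2 2); apply Nat.log2_le_mono; exact H1).
    assert (D : INR (Nat.log2 (l + 1)) <= 1 + lg1 (lg1 (INR sg))).
    { assert (D1 : (Nat.log2 (l + 1) <= 1 + Nat.log2 l)%nat).
      { replace (1 + Nat.log2 l)%nat with (Nat.log2 (2 * l)) by (rewrite Nat.log2_double by lia; lia).
        apply Nat.log2_le_mono. lia. }
      apply le_INR in D1. rewrite plus_INR in D1. replace (INR 1) with 1 in D1 by reflexivity.
      assert (INR (Nat.log2 l) <= lg (lg1 (INR sg))).
      { etransitivity; [apply log2_lg; exact Hl|]. apply lg_le; [apply lt_0_INR; lia|exact G]. }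
      lra. }
    assert (H3 : INR (t + 1) <= INR (13 + Nat.log2 (l + 1))) by (apply le_INR; lia).
    rewrite (plus_INR 13) in H3. replace (INR 13) with 13 in H3 by (simpl; lra).
    rewrite (plus_INR a 15). replace (INR 15) with 15 by (simpl; lra).
    assert (0 <= INR a * lg1 (lg1 (INR sg))) by (apply Rmult_le_pos; lra). lra.
Qed.

Theorem theorem25 (c : R) (k : nat) :
  exists (P : program) (K C : R),
  forall (m n sigma tau w : nat) (S T : list nat),
    length S = m ->
    length T = n ->
    (0 < m <= n)%nat ->
    Forall (fun a => a < sigma)%nat S ->
    Forall (fun a => a < sigma)%nat T ->
    (sigma <= (n + m) ^ k)%nat ->
    (1 <= tau)%nat ->
    sqrt (INR m) * lg (INR m) * lg (lg (INR m)) ^ 3 <= INR tau ->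
    INR tau <= c * (INR m / lg1 (INR m) ^ 2) ->
    K * lg1 (INR n) <= INR w ->
    exists (space time : nat) (out : list (nat * nat)),
      runs P w S T [m; n; sigma; tau] space time out /\
      NoDup out /\
      (forall i j : nat,
         In (i, j) out <-> maximal_common_substring S T i j) /\
      INR space <= C * INR tau /\
      INR time <= C * (INR n * INR m / INR tau * lg1 (lg1 (INR sigma))).
Proof.
  destruct (INR_unbounded c) as [N HN].
  set (KT := (420 * ((200 * tries k + 4 * capexp k + 47) * N + unit_cost * (1 + N) * (1 + N)))%nat).
  (* [2 ^ a * n ^ e <= 2 ^ w] holds once [w] is [a + e] times the logarithm of [n]. The memory has
     [110 + 32 * 100 * g <= 3310 * g] cells, and the second summand of [C] pays for the time. *)
  exists (prog k), (INR (wordA N k + wordE k)), (3310 + INR KT * INR (4 * capexp k + 15)).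
  intros m n sg g w Sl Tl Hm Hn Hmn HS HT Hsg Hg Hlow Hup Hw. assert (HgN : (g <= N * m)%nat).
  { apply INR_le. rewrite mult_INR. destruct (lg1_ge (INR m)) as [A _].
    pose proof (pos_INR m) as Pm. pose proof (pos_INR N) as PN.
    assert (A2 : 1 <= lg1 (INR m) ^ 2) by (apply pow_R1_Rle; exact A).
    assert (Y : 0 <= INR m / lg1 (INR m) ^ 2 <= INR m).
    { split.
      - apply Rmult_le_pos; [assumption|]. left. apply Rinv_0_lt_compat. lra.
      - apply Rmult_le_reg_r with (lg1 (INR m) ^ 2); [lra|]. unfold Rdiv. rewrite Rmult_assoc, Rinv_l by lra. nra. }
    set (y := INR m / lg1 (INR m) ^ 2) in *. clearbody y. nra. }
  pose proof (tau_lower m g Hg Hlow) as Hmg. assert (HM : (wordA N k * n ^ wordE k < 2 ^ w)%nat).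
  { pose proof (word_size (wordA N k) (wordE k) n w ltac:(lia) Hw) as W.
    assert (W2 : (wordA N k < 2 ^ wordA N k)%nat) by (apply Nat.pow_gt_lin_r; lia).
    assert (W3 : (n ^ wordE k <> 0)%nat) by (apply Nat.pow_nonzero; lia).
    assert (W4 : (wordA N k * n ^ wordE k < 2 ^ wordA N k * n ^ wordE k)%nat)
      by (apply Nat.mul_lt_mono_pos_r; [lia|exact W2]). lia. }
  destruct (word_ok N k m n g (2 ^ w) Hmn HgN HM) as (B1 & B2 & B3 & B4 & B5 & B6 & B7).
  assert (Hsg' : (sg <= (2 * n) ^ k)%nat). { etransitivity; [exact Hsg|]. apply Nat.pow_le_mono_l. lia. }
  destruct (runs_ok k w m n sg g Sl Tl Hm Hn Hmn Hg Hmg HS HT Hsg' B1 B2 B3 B4 B5 B6 B7)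
    as (t & time & R1 & R2 & R3).
  exists (V0 + NA * (100 * g))%nat, time, (rev (report Sl Tl)).
  split; [exact R1|]. split; [apply NoDup_rev, report_nodup|]. split.
  { intros i j. rewrite <- in_rev. apply report_spec. }
  pose proof (time_bound N k m n g t time Hg Hmn HgN R3) as TM. fold KT in TM.
  assert (G1 : 1 <= INR g) by (apply (le_INR 1); exact Hg).
  pose proof (pos_INR KT) as PK. pose proof (pos_INR (4 * capexp k + 15)) as PC.
  assert (P0 : 0 <= INR KT * INR (4 * capexp k + 15)) by (apply Rmult_le_pos; assumption). split.
  - assert (S1 : (V0 + NA * (100 * g) <= 3310 * g)%nat) by (change V0 with 110%nat; change NA with 32%nat; lia).
    apply le_INR in S1. rewrite mult_INR in S1. replace (INR 3310) with 3310 in S1 by (rewrite INR_IZR_INZ; reflexivity).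
    assert (0 <= INR KT * INR (4 * capexp k + 15) * INR g) by (apply Rmult_le_pos; lra). lra.
  - assert (D : INR (t + 1) <= INR (4 * capexp k + 15) * lg1 (lg1 (INR sg))).
    { apply digits_bound. destruct R2 as [R2|[R2 R4]]; [left; exact R2|right].
      assert (m ^ capexp k <> 0)%nat by (apply Nat.pow_nonzero; lia). split; [lia|exact R4]. }
    apply le_INR in TM. rewrite !mult_INR in TM. set (q := lg1 (lg1 (INR sg))) in *. set (x := INR n * INR m) in *.
    assert (X0 : 0 <= x) by (apply Rmult_le_pos; apply pos_INR). assert (Q1 : 1 <= q) by apply lg1_ge.
    apply Rmult_le_reg_l with (INR g); [lra|].
    replace (INR g * ((3310 + INR KT * INR (4 * capexp k + 15)) * (x / INR g * q)))
      with ((3310 + INR KT * INR (4 * capexp k + 15)) * x * q) by (field; lra).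
    assert (Z1 : INR KT * INR (t + 1) * x <= INR KT * (INR (4 * capexp k + 15) * q) * x).
    { apply Rmult_le_compat_r; [assumption|]. apply Rmult_le_compat_l; assumption. }
    assert (Z2 : 0 <= 3310 * x * q) by (apply Rmult_le_pos; lra). lra.
Qed.
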